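(* Let $\Sigma$ be a coherent subanalytic germ at $0$ of a closed subset of $\mathbb{R}^n$ with $0\in\Sigma$, and let $\varphi:(\mathbb{R}^n,0)\to(\mathbb{R}^n,0)$ be a real analytic map-germ. The following are equivalent: (1) for each $r\in\mathbb{N}$, $\varphi$ is $\Sigma$-$C^r$-rigid; (2) $\varphi$ is finitely $\Sigma$-$SV$-determined; (3) $\varphi$ is finitely $\Sigma$-$V$-determined; (4) $I_K(\varphi)$ is $\Sigma$-elliptic; (5) $\mathfrak{m}_\Sigma^\infty\subset I_K(\varphi)$; (6) $\mathfrak{m}_\Sigma^\infty\subset I_T(\varphi)$.
   Context: $\mathcal{E}(n)$ is the ring of germs at $0$ of $C^\infty$ functions on $\mathbb{R}^n$; $\mathcal{E}(n)^p$ the set of $C^\infty$ map-germs $(\mathbb{R}^n,0)\to(\mathbb{R}^p,0)$; $\mathcal{E}_{[r]}(n)$ the ring of $C^r$ function-germs and $\mathcal{E}_{[r]}(n)(\varphi)$ the ideal of it generated by the components of $\varphi$. $\mathfrak{m}_\Sigma$ is the ideal of germs in $\mathcal{E}(n)$ vanishing on $\Sigma$; $\Sigma$ is coherent if $\mathfrak{m}_\Sigma$ is finitely generated; $\mathfrak{m}_\Sigma^\infty$ is the ideal of germs flat on $\Sigma$. $j^kf(\Sigma;0)=j^kg(\Sigma;0)$ means the $k$-jets agree at all points of $\Sigma\cap U$ for some neighbourhood $U$ of $0$. $\mathcal{R}^{\mathrm{fix}}_\Sigma$ is the group of germs of homeomorphisms of $(\mathbb{R}^n,0)$ fixing $\Sigma$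 pointwise. $\varphi$ is $\Sigma$-$C^r$-rigid if there is $k$ such that for every $\psi$ with $j^k\psi(\Sigma;0)=j^k\varphi(\Sigma;0)$ some $\tau\in\mathcal{R}^{\mathrm{fix}}_\Sigma$ gives $\mathcal{E}_{[r]}(n)(\varphi\circ\tau)=\mathcal{E}_{[r]}(n)(\psi)$. $\Sigma$-$SV$-equivalence: $\varphi(f^{-1}(0))=g^{-1}(0)$ for some $\varphi\in\mathcal{R}^{\mathrm{fix}}_\Sigma$; $\Sigma$-$V$-equivalence: zero-set germs homeomorphic by a homeomorphism fixing $f^{-1}(0)\cap\Sigma$ pointwise. Finitely $\Sigma$-$SV$- (resp. $V$-) determined: there is $k$ such that every $C^\infty$ $g$ with $j^kg(\Sigma;0)=j^k\varphi(\Sigma;0)$ is $\Sigma$-$SV$- (resp. $V$-) equivalent to $\varphi$. $I_K(\varphi)$ is the ideal generated by $\varphi_1,\dots,\varphi_n$ and the Jacobian determinant $\det D\varphi$; since $n=p$, $I_T(\varphi)$ is the ideal generated by $\varphi_1,\dots,\varphi_n$. An ideal is $\Sigma$-elliptic if it contains $f$ with $|f(x)|\ge C\,d(x,\Sigma)^\alpha$ near $0$ for some $C,\alpha>0$. *)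

(* Defs.v *)
(* classical reals.  Points of R^n are represented as
   [Rvec := nat -> R] whose coordinates of index >= n vanish ([inRn n]). *)
From Stdlib Require Import Reals List ClassicalEpsilon.
Open Scope R_scope.

Definition Rvec := nat -> R.
Definition fn := Rvec -> R.

Definition inRn (n : nat) (x : Rvec) : Prop := forall i, (n <= i)%nat -> x i = 0.
Definition zerov : Rvec := fun _ => 0.
Definition vadd (x h : Rvec) : Rvec := fun i => x i + h i.
Definition eqn (n : nat) (x y : Rvec) : Prop := forall i, (i < n)%nat -> x i = y i.

Fixpoint normv (n : nat) (x : Rvec) : R :=
  match n with O => 0 | S m => Rmax (normv m x) (Rabs (x m)) end.
Definition distv (n : nat) (x y : Rvec) : R := normv n (fun i => x i - y i).

Definition ballc (n : nat) (y : Rvec) (r : R) (x : Rvec) : Prop :=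
  inRn n x /\ distv n x y < r.
Definition ball (n : nat) (r : R) : Rvec -> Prop := ballc n zerov r.

Fixpoint sumn (m : nat) (g : nat -> R) : R :=
  match m with O => 0 | S k => sumn k g + g k end.

Definition shift (x : Rvec) (i : nat) (t : R) : Rvec :=
  fun j => if Nat.eqb j i then x j + t else x j.

(* the partial derivative d/dx_i (a value chosen classically; meaningful where it exists) *)
Definition pd (i : nat) (g : fn) (x : Rvec) : R :=
  epsilon (inhabits 0) (fun l => derivable_pt_lim (fun t => g (shift x i t)) 0 l).

Definition iterD (l : list nat) (g : fn) : fn := fold_right pd g l.

Definition idx_ok (n : nat) (l : list nat) : Prop := Forall (fun i => (i < n)%nat) l.

Definition contf (n : nat) (A : Rvec -> Prop) (g : fn) : Prop :=
  forall x, A x -> forall e, 0 < e -> exists d, 0 < d /\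
    forall y, A y -> distv n y x < d -> Rabs (g y - g x) < e.

Definition contv (n : nat) (A : Rvec -> Prop) (F : Rvec -> Rvec) : Prop :=
  forall x, A x -> forall e, 0 < e -> exists d, 0 < d /\
    forall y, A y -> distv n y x < d -> distv n (F y) (F x) < e.

Definition Cr_on (n r : nat) (U : Rvec -> Prop) (g : fn) : Prop :=
  forall l, idx_ok n l -> (length l <= r)%nat ->
    contf n U (iterD l g) /\
    ((length l < r)%nat -> forall i x, (i < n)%nat -> U x ->
        exists d, derivable_pt_lim (fun t => iterD l g (shift x i t)) 0 d).

Definition smooth_on (n : nat) (U : Rvec -> Prop) (g : fn) : Prop :=
  forall r, Cr_on n r U g.

Definition mono (h : Rvec) (l : list nat) : R := fold_right (fun i acc => h i * acc) 1 l.

Fixpoint sumlists (n k : nat) (F : list nat -> R) : R :=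
  match k with
  | O => F nil
  | S k' => sumn n (fun i => sumlists n k' (fun l => F (i :: l)))
  end.

(* f is given near y by an absolutely convergent power series in N variables
   (monomials indexed by ordered lists of coordinates, grouped by total degree) *)
Definition analytic_at (N : nat) (f : fn) (y : Rvec) : Prop :=
  exists d (c : list nat -> R), 0 < d /\
    forall h, ball N d h ->
      (exists s, infinite_sum
          (fun k => sumlists N k (fun l => Rabs (c l) * Rabs (mono h l))) s) /\
      infinite_sum (fun k => sumlists N k (fun l => c l * mono h l)) (f (vadd y h)).

Definition analytic_on (N : nat) (U : Rvec -> Prop) (f : fn) : Prop :=
  forall y, U y -> analytic_at N f y.

Definition semianalytic (N : nat) (X : Rvec -> Prop) : Prop :=
  forall y, inRn N y -> exists d, 0 < d /\
    exists L : list (fn * list fn),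
      (forall p, In p L -> analytic_on N (ballc N y d) (fst p) /\
                           forall g, In g (snd p) -> analytic_on N (ballc N y d) g) /\
      forall z, ballc N y d z ->
        (X z <-> exists p, In p L /\ fst p z = 0 /\ forall g, In g (snd p) -> 0 < g z).

(* the germ at 0 of S is subanalytic: near 0, S is the projection of a bounded
   (= relatively compact) semianalytic subset of R^(n+m) *)
Definition subanalytic_germ0 (n : nat) (S : Rvec -> Prop) : Prop :=
  exists e m (B : Rvec -> Prop), 0 < e /\
    (forall z, B z -> inRn (n + m) z) /\ semianalytic (n + m) B /\
    (exists M, forall z, B z -> normv (n + m) z <= M) /\
    forall x, ball n e x -> (S x <-> exists z, B z /\ forall i, (i < n)%nat -> z i = x i).

Definition closed_in_Rn (n : nat) (S : Rvec -> Prop) : Prop :=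
  (forall x, S x -> inRn n x) /\
  forall x, inRn n x -> (forall e, 0 < e -> exists y, S y /\ distv n y x < e) -> S x.

Definition openset (n : nat) (U : Rvec -> Prop) : Prop :=
  (forall x, U x -> inRn n x) /\
  forall x, U x -> exists r, 0 < r /\ forall y, ballc n x r y -> U y.

Definition inIdeal (n m : nat) (G : nat -> fn) (h : fn) : Prop :=
  exists e (a : nat -> fn), 0 < e /\
    (forall j, (j < m)%nat -> smooth_on n (ball n e) (a j)) /\
    forall x, ball n e x -> h x = sumn m (fun j => a j x * G j x).

Definition inCrIdeal (n r : nat) (F : nat -> fn) (h : fn) : Prop :=
  exists e (a : nat -> fn), 0 < e /\
    (forall i, (i < n)%nat -> Cr_on n r (ball n e) (a i)) /\
    forall x, ball n e x -> h x = sumn n (fun i => a i x * F i x).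

Definition Crideal_eq (n r : nat) (F G : nat -> fn) : Prop :=
  forall h, inCrIdeal n r F h <-> inCrIdeal n r G h.

Definition m_Sigma (n : nat) (S : Rvec -> Prop) (f : fn) : Prop :=
  exists e, 0 < e /\ smooth_on n (ball n e) f /\ forall x, S x -> ball n e x -> f x = 0.

Definition coherent (n : nat) (S : Rvec -> Prop) : Prop :=
  exists m (G : nat -> fn), (forall j, (j < m)%nat -> m_Sigma n S (G j)) /\
    forall f, m_Sigma n S f -> inIdeal n m G f.

Definition flat_on (n : nat) (S : Rvec -> Prop) (f : fn) : Prop :=
  exists e, 0 < e /\ smooth_on n (ball n e) f /\
    forall l x, idx_ok n l -> S x -> ball n e x -> iterD l f x = 0.

Definition coord (i : nat) (F : Rvec -> Rvec) : fn := fun x => F x i.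

Definition analytic_mapgerm (n : nat) (F : Rvec -> Rvec) : Prop :=
  (forall i, (i < n)%nat -> F zerov i = 0) /\
  forall i, (i < n)%nat -> analytic_at n (coord i F) zerov.

Definition smooth_mapgerm (n : nat) (F : Rvec -> Rvec) : Prop :=
  (forall i, (i < n)%nat -> F zerov i = 0) /\
  exists e, 0 < e /\ forall i, (i < n)%nat -> smooth_on n (ball n e) (coord i F).

Definition jet_eq (n : nat) (S : Rvec -> Prop) (k : nat) (F G : Rvec -> Rvec) : Prop :=
  exists e, 0 < e /\ forall x l i, S x -> ball n e x -> idx_ok n l -> (length l <= k)%nat ->
    (i < n)%nat -> iterD l (coord i F) x = iterD l (coord i G) x.

Fixpoint detm (n : nat) (M : nat -> nat -> R) : R :=
  match n with
  | O => 1
  | S m => sumn (S m) (fun j =>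
      (-1) ^ j * M O j * detm m (fun a b => M (S a) (if Nat.ltb b j then b else S b)))
  end.

Definition jacdet (n : nat) (F : Rvec -> Rvec) : fn :=
  fun x => detm n (fun i j => pd j (coord i F) x).

Definition IK_gen (n : nat) (F : Rvec -> Rvec) (j : nat) : fn :=
  if Nat.ltb j n then coord j F else jacdet n F.
Definition IT_gen (n : nat) (F : Rvec -> Rvec) (j : nat) : fn := coord j F.

Definition homeo_fix_on (n : nat) (S : Rvec -> Prop) (e : R) (tau : Rvec -> Rvec) : Prop :=
  let img := fun y => inRn n y /\ exists x, ball n e x /\ eqn n (tau x) y in
  0 < e /\ (forall x, ball n e x -> inRn n (tau x)) /\ eqn n (tau zerov) zerov /\
  (forall x, S x -> ball n e x -> eqn n (tau x) x) /\
  contv n (ball n e) tau /\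
  (forall x, ball n e x -> exists r, 0 < r /\ forall y, ballc n (tau x) r y -> img y) /\
  exists sigma : Rvec -> Rvec,
    (forall y, img y -> ball n e (sigma y) /\ eqn n (tau (sigma y)) y) /\
    (forall x, ball n e x -> eqn n (sigma (tau x)) x) /\
    contv n img sigma.

Definition zero (n : nat) (F : Rvec -> Rvec) (x : Rvec) : Prop :=
  forall i, (i < n)%nat -> F x i = 0.

Definition rigid (n : nat) (S : Rvec -> Prop) (r : nat) (phi : Rvec -> Rvec) : Prop :=
  exists k, forall psi, smooth_mapgerm n psi -> jet_eq n S k psi phi ->
    exists tau e, homeo_fix_on n S e tau /\
      Crideal_eq n r (fun i x => phi (tau x) i) (fun i x => psi x i).

Definition SVeq (n : nat) (S : Rvec -> Prop) (f g : Rvec -> Rvec) : Prop :=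
  exists tau e, homeo_fix_on n S e tau /\
    exists d, 0 < d /\ forall y, ball n d y ->
      (zero n g y <-> exists x, ball n e x /\ zero n f x /\ eqn n (tau x) y).

Definition Veq (n : nat) (S : Rvec -> Prop) (f g : Rvec -> Rvec) : Prop :=
  exists (U V : Rvec -> Prop) (h k : Rvec -> Rvec),
    openset n U /\ openset n V /\ U zerov /\ V zerov /\
    (forall x, U x -> zero n f x -> V (h x) /\ zero n g (h x)) /\
    (forall y, V y -> zero n g y -> U (k y) /\ zero n f (k y)) /\
    (forall x, U x -> zero n f x -> eqn n (k (h x)) x) /\
    (forall y, V y -> zero n g y -> eqn n (h (k y)) y) /\
    contv n (fun x => U x /\ zero n f x) h /\
    contv n (fun y => V y /\ zero n g y) k /\
    (forall x, U x -> zero n f x -> S x -> eqn n (h x) x).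

Definition finSV (n : nat) (S : Rvec -> Prop) (phi : Rvec -> Rvec) : Prop :=
  exists k, forall g, smooth_mapgerm n g -> jet_eq n S k g phi -> SVeq n S g phi.

Definition finV (n : nat) (S : Rvec -> Prop) (phi : Rvec -> Rvec) : Prop :=
  exists k, forall g, smooth_mapgerm n g -> jet_eq n S k g phi -> Veq n S g phi.

Definition is_inf_dist (n : nat) (S : Rvec -> Prop) (x : Rvec) (d : R) : Prop :=
  (forall y, S y -> d <= distv n x y) /\
  (forall b, (forall y, S y -> b <= distv n x y) -> b <= d).

Definition rpow (d a : R) : R := if Rle_dec d 0 then 0 else Rpower d a.

Definition elliptic (n m : nat) (G : nat -> fn) (S : Rvec -> Prop) : Prop :=
  exists f, inIdeal n m G f /\
    exists C a e, 0 < C /\ 0 < a /\ 0 < e /\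
      forall x, ball n e x -> forall d, is_inf_dist n S x d -> C * rpow d a <= Rabs (f x).

(* Main.v *)
From mathcomp Require all_boot all_algebra filter Rstruct.
From Coquelicot Require Import Coquelicot.
From Stdlib Require Import Reals List ClassicalEpsilon FunctionalExtensionality.
From Stdlib Require Import Lra Lia Psatz Cantor FinFun Ranalysis5.
Require Import Defs.
Open Scope R_scope.
Set Bullet Behavior "Strict Subproofs".

(* All six conditions are equivalent to [Ell]: [|phi|^2 >= C d^a] near 0, where [d] is the
   distance to [Sigma].

   [Ell] implies (1) with the identity as homeomorphism: if [h = psi - phi] vanishes to high
   order on [Sigma], then [h_i = sum_j (h_i phi_j / |phi|^2) phi_j] has coefficients of class C^r,
   and the same holds with [psi] in place of [phi].  It implies (6) in the same way.
   (1) => (2) => (3) compares zero sets and (6) => (5) is clear.  If (4) fails, there are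
   [x_m -> 0] at which the generators of [I_K] are smaller than every power of [d]; a sum of
   bumps at the [x_m] is then flat on [Sigma] and does not lie in [I_K], so (5) => (4).

   For (4) => [Ell] and (3) => [Ell], consider the analytic germs that are small along a
   sequence [x_m -> 0], in a sense given by an ultrafilter: they form a prime ideal [P], which is
   not maximal.  Weierstrass division shows by induction on the dimension that, up to a linear
   change of coordinates and a denominator outside [P], the ideal [P] is generated by polynomials
   that can be solved for one coordinate each, with at least one coordinate left free.  Hence
   there is a vector field tangent to [P] that is not small, and a zero of finitely many members
   of [P] at a general [x_m] is not isolated.
   - If [Ell] fails, take [x_m] with [phi(x_m)] smaller than every power of [d(x_m)].  The tangent
     field and Cramer's rule make [det D phi] small along [x_m], contradicting (4).
   - A flat perturbation of [phi] has nondegenerate, hence isolated, zeros at these [x_m].  Under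
     (3) the germ [phi] itself has isolated zeros [y_m -> 0], contradicting the last statement. *)

(** Everything is done with the values of germs at the points [x_m]. In the argument for (4) these
    points need not be zeros of anything, so no tangent space of a zero set is at hand: membership
    in [P] replaces vanishing, and a tangent field is a vector at each [x_m] along which the
    derivatives of members of [P] are again small. The ultrafilter makes [P] prime: if a product is
    small, one factor is small at each index, but which one may vary with the index, and the
    ultrafilter selects one. The structure theorem uses only the closure rules of [prime_ideal], so
    a single induction serves germs that are flat along [x_m] and germs that vanish along it.
    Solvability for a coordinate comes from minimality: a polynomial of least degree in [P] with
    leading coefficient outside [P] has its derivative outside [P], the analogue of separability in
    characteristic zero. [Ell] is stated with the square norm because the quotients
    [phi_j / |phi|^2] then give explicit coefficients that express a sufficiently flat germ through
    the components of [phi]. *)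

Record ultra (U : (nat -> Prop) -> Prop) : Prop := {
  ultra_mono : forall A B : nat -> Prop, (forall m, A m -> B m) -> U A -> U B;
  ultra_and : forall A B : nat -> Prop, U A -> U B -> U (fun m => A m /\ B m);
  ultra_ex : forall A : nat -> Prop, U A -> exists m, A m;
  ultra_or : forall A : nat -> Prop, U A \/ U (fun m => ~ A m);
  ultra_tail : forall N, U (fun m => (N <= m)%nat) }.

Module FilterLemmas.
Import mathcomp.boot.ssreflect mathcomp.boot.ssrfun mathcomp.boot.ssrbool.
Import mathcomp.classical.boolp mathcomp.classical.classical_sets mathcomp.classical.filter.

(** Extending the filter of tails makes the ultrafilter non-principal, which is [ultra_tail]. *)
Lemma ultra_exists : exists U, ultra U.
Proof.
have PF : ProperFilter (fun A : nat -> Prop => exists N, forall m, Peano.le N m -> A m).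
{ apply: Build_ProperFilter_ex.
    by move=> A [N HN]; exists N; apply: HN.
  split; first by exists 0%nat.
  - move=> A B [N HN] [N' HN']; exists (Nat.max N N') => m Hm; split; [apply: HN|apply: HN']; lia.
  - by move=> A B AB [N HN]; exists N => m Hm; apply: AB; apply: HN. }
have [G [UG sG]] := ultraFilterLemma PF.
have PG := @ultra_proper _ _ UG.
exists G; split.
- by move=> A B AB; apply: filterS.
- by move=> A B; apply: filterI.
- by move=> A /filter_ex [m Am]; exists m.
- move=> A; have [GA|GA] := in_ultra_setVsetC A UG; [by left|by right].
- by move=> N; apply: sG; exists N.
Qed.
End FilterLemmas.


(** * Finite sums, determinants and Cramer's rule *)

Lemma sumn_ext (n : nat) (f g : nat -> R) :
  (forall i, (i < n)%nat -> f i = g i) -> sumn n f = sumn n g.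
Proof.
  induction n as [|n IH]; simpl; intros H; auto. rewrite IH, H; auto.
Qed.

Lemma sumn_le (n : nat) (f g : nat -> R) :
  (forall i, (i < n)%nat -> f i <= g i) -> sumn n f <= sumn n g.
Proof.
  induction n as [|n IH]; simpl; intros H. lra.
  apply Rplus_le_compat; auto.
Qed.

Lemma sumn_scal (n : nat) (c : R) (f : nat -> R) : sumn n (fun i => c * f i) = c * sumn n f.
Proof. induction n as [|n IH]; simpl; rewrite ?IH; ring. Qed.

Lemma sumn_scal_r (n : nat) (c : R) (f : nat -> R) : sumn n (fun i => f i * c) = sumn n f * c.
Proof. induction n as [|n IH]; simpl; rewrite ?IH; ring. Qed.

Lemma sumn_plus (n : nat) (f g : nat -> R) :
  sumn n (fun i => f i + g i) = sumn n f + sumn n g.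
Proof. induction n as [|n IH]; simpl; rewrite ?IH; ring. Qed.

Lemma sumn_opp (n : nat) (f : nat -> R) : sumn n (fun i => - f i) = - sumn n f.
Proof. induction n as [|n IH]; simpl; rewrite ?IH; ring. Qed.

Lemma sumn_const (n : nat) (c : R) : sumn n (fun _ => c) = INR n * c.
Proof.
  induction n as [|n IH]. simpl; ring. rewrite S_INR; simpl sumn; rewrite IH; ring.
Qed.

Lemma sumn_zero (n : nat) (f : nat -> R) : (forall i, (i < n)%nat -> f i = 0) -> sumn n f = 0.
Proof. intros H. rewrite (sumn_ext n f (fun _ => 0) H), sumn_const; ring. Qed.

Lemma sumn_nonneg (n : nat) (f : nat -> R) : (forall i, (i < n)%nat -> 0 <= f i) -> 0 <= sumn n f.
Proof. intros H. rewrite <- (sumn_zero n (fun _ => 0)); auto. apply sumn_le; auto. Qed.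

Lemma sumn_Rabs (n : nat) (f : nat -> R) : Rabs (sumn n f) <= sumn n (fun i => Rabs (f i)).
Proof.
  induction n as [|n IH]; simpl. rewrite Rabs_R0; lra.
  eapply Rle_trans. apply Rabs_triang. lra.
Qed.

Lemma sumn_term_le (n : nat) (f : nat -> R) (j : nat) :
  (forall i, (i < n)%nat -> 0 <= f i) -> (j < n)%nat -> f j <= sumn n f.
Proof.
  induction n as [|n IH]; intros H Hj; [lia|simpl].
  destruct (Nat.eq_dec j n) as [->|].
  - pose proof (sumn_nonneg n f (fun i Hi => H i (Nat.lt_lt_succ_r _ _ Hi))). lra.
  - pose proof (H n (Nat.lt_succ_diag_r n)).
    assert (f j <= sumn n f) by (apply IH; [intros; apply H; lia | lia]). lra.
Qed.

Lemma detm_ext (n : nat) (M N : nat -> nat -> R) :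
  (forall i j, (i < n)%nat -> (j < n)%nat -> M i j = N i j) -> detm n M = detm n N.
Proof.
  revert M N; induction n as [|n IH]; intros M N H; auto.
  change (sumn (S n) (fun j => (-1) ^ j * M O j * detm n (fun a b => M (S a) (if Nat.ltb b j then b else S b)))
   = sumn (S n) (fun j => (-1) ^ j * N O j * detm n (fun a b => N (S a) (if Nat.ltb b j then b else S b)))).
  apply sumn_ext; intros j Hj. rewrite H by lia. f_equal. apply IH; intros a b Ha Hb.
  apply H; [lia|]. destruct (Nat.ltb b j); lia.
Qed.

Lemma detm_bounded (n : nat) (K : R) : 0 <= K -> exists K', 0 <= K' /\ forall M,
  (forall i j, (i < n)%nat -> (j < n)%nat -> Rabs (M i j) <= K) -> Rabs (detm n M) <= K'.
Proof.
  intros HK; induction n as [|n [K' [HK' IH]]].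
  - exists 1; split; [lra|]. intros M _; simpl. rewrite Rabs_R1; lra.
  - exists (INR (S n) * (K * K')); split.
    { apply Rmult_le_pos; [apply pos_INR | nra]. }
    intros M H. rewrite <- sumn_const.
    change (detm (S n) M) with (sumn (S n) (fun j => (-1) ^ j * M O j *
       detm n (fun a b => M (S a) (if Nat.ltb b j then b else S b)))).
    eapply Rle_trans; [apply sumn_Rabs | apply sumn_le]. intros j Hj.
    rewrite !Rabs_mult, pow_1_abs, Rmult_1_l.
    apply Rmult_le_compat; auto using Rabs_pos. { apply H; lia. }
    apply IH; intros a b Ha Hb. apply H; [lia|]. destruct (Nat.ltb b j); lia.
Qed.

Module DetLemmas.
Import mathcomp.boot.all_boot mathcomp.algebra.all_algebra.
Import mathcomp.reals_stdlib.Rstruct.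
Import GRing.Theory Num.Theory.
Local Open Scope ring_scope.

Definition mx_of (n : nat) (M : nat -> nat -> R) : 'M[R]_n := \matrix_(i < n, j < n) M i j.

Lemma sumn_big (n : nat) (f : nat -> R) : Defs.sumn n f = \sum_(i < n) f i.
Proof. by elim: n => [|n IH]; rewrite ?big_ord0 // big_ord_recr /= IH. Qed.

(** [detm] is the Laplace expansion along the row of index 0, and [if Nat.ltb b j then b else S b]
    is the map [bump j] that skips column [j]. *)
Lemma detm_det (n : nat) (M : nat -> nat -> R) : detm n M = \det (mx_of n M).
Proof.
elim: n M => [|n IH] M; first by rewrite det_mx00.
rewrite (expand_det_row _ ord0) /detm -/detm sumn_big; apply: eq_bigr => j _.
rewrite /cofactor IH mxE add0n.
have -> : row' ord0 (col' j (mx_of n.+1 M)) =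
   mx_of n (fun a b => M (S a) (if Nat.ltb b j then b else S b)).
  apply/matrixP => a b; rewrite !mxE /=; congr M.
  rewrite /bump; case: Nat.ltb_spec => [/ltP|/leP] h; last by rewrite h.
  by rewrite leqNgt h.
by rewrite RpowE !RealsE mulrA [_ * M _ _]mulrC.
Qed.

(** Coordinate [j] of [adj(M) M v = det(M) v], with the entries of the adjugate written as signed
    minors. *)
Lemma adjugate_identity (n : nat) (M : nat -> nat -> R) (v : nat -> R) (j : nat) :
  Peano.lt j n.+1 ->
  detm n.+1 M * v j = Defs.sumn n.+1 (fun i =>
    (-1) ^+ (i + j)%N * detm n (fun a b => M (bump i a) (bump j b)) *
       Defs.sumn n.+1 (fun l => M i l * v l)).
Proof.
move=> /ltP hj; rewrite detm_det sumn_big.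
pose w : 'cV[R]_n.+1 := \col_i v i.
have := congr1 (fun B => (B *m w) (Ordinal hj) ord0) (mul_adj_mx (mx_of n.+1 M)).
rewrite -mulmxA mul_scalar_mx [X in _ = X -> _]mxE [X in _ = _ * X -> _]mxE => <-.
rewrite mxE; apply: eq_bigr => i _; rewrite !mxE sumn_big /cofactor detm_det.
congr (_ * _); last by apply: eq_bigr => l _; rewrite !mxE.
by congr (_ * \det _); apply/matrixP => a b; rewrite !mxE.
Qed.

(** The signs are hidden in [s], so that outside the module only absolute values of minors and the
    standard real operations remain. *)
Lemma cramer_row (n : nat) (M : nat -> nat -> R) (v : nat -> R) (j : nat) :
  Peano.lt j n.+1 -> exists s : nat -> R, (forall i, Rabs (s i) = IZR 1) /\
  Rmult (detm n.+1 M) (v j) = Defs.sumn n.+1 (fun i =>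
    Rmult (Rmult (s i) (detm n (fun a b => M (bump i a) (bump j b))))
       (Defs.sumn n.+1 (fun l => Rmult (M i l) (v l)))).
Proof.
move=> hj; exists (fun i => (-1) ^+ (i + j)%N); split; last exact: adjugate_identity.
by move=> i; rewrite RabsE normrX normrN1 expr1n.
Qed.

Lemma bump_lt (n i a : nat) : Peano.lt a n -> Peano.lt (bump i a) n.+1.
Proof. by move=> /ltP h; apply/ltP; rewrite /bump; case: (i <= a)%N => //=; rewrite add0n ltnW. Qed.

(** As a function of [t], the determinant of [M + t I] is the characteristic polynomial of [- M],
    monic of degree [n]; it cannot vanish at [n + 1] distinct values of [s]. *)
Lemma detm_add_scalar_neq0 (n : nat) (M : nat -> nat -> R) (s : nat -> R) :
  injective s -> exists k, detm n (fun i j => Rplus (M i j) (if Nat.eqb i j then s k else 0)) <> 0.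
Proof.
move=> sI; pose p := char_poly (- mx_of n M).
have p0 : p != 0 by rewrite monic_neq0 // char_poly_monic.
have : ~~ all (root p) [seq s i | i <- iota 0 n.+1].
  apply/negP => H; have := max_poly_roots p0 H; rewrite map_inj_uniq ?iota_uniq // => /(_ isT).
  by rewrite size_map size_iota size_char_poly ltnn.
case/allPn => x /mapP[k _ ->] hk; exists k; move: hk.
rewrite /root /p /char_poly -horner_evalE -det_map_mx detm_det => /eqP hk h; apply: hk.
rewrite -[RHS]h; congr (\det _); apply/matrixP => i j; rewrite !mxE /= !horner_evalE.
rewrite !hornerE opprK; case: (i =P j) => [->|ij].
  by rewrite Nat.eqb_refl hornerX addrC.
case: Nat.eqb_spec => [/val_inj //|_]; by rewrite horner0 addrC.
Qed.

End DetLemmas.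

(** Nothing is divided by the determinant, so singular matrices are allowed. It is read in two ways:
    if [M v] is small and [v] is not, then [det M] is small; if [det M] is not 0, then [v] is
    controlled by [M v]. *)
Lemma cramer_bound (n : nat) (K : R) : 0 <= K -> exists K', 0 <= K' /\ forall M v j,
  (forall a b, (a < n)%nat -> (b < n)%nat -> Rabs (M a b) <= K) -> (j < n)%nat ->
  Rabs (detm n M) * Rabs (v j) <= K' * sumn n (fun i => Rabs (sumn n (fun l => M i l * v l))).
Proof.
  intros HK. destruct n as [|n]. { exists 0; split; [lra|]. intros; lia. }
  destruct (detm_bounded n K HK) as [K' [HK' H]]. exists K'; split; auto.
  intros M v j HM Hj. rewrite <- Rabs_mult.
  destruct (DetLemmas.cramer_row n M v j Hj) as [s [Hs ->]].
  rewrite <- sumn_scal. eapply Rle_trans; [apply sumn_Rabs | apply sumn_le]. intros i Hi.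
  rewrite !Rabs_mult, Hs, Rmult_1_l. apply Rmult_le_compat_r; [apply Rabs_pos|].
  apply H; intros a b Ha Hb. apply HM; apply DetLemmas.bump_lt; auto.
Qed.

Lemma detm_perturb_neq0 (n : nat) (M : nat -> nat -> R) (d : R) : 0 < d ->
  exists e, 0 < e < d /\ detm n (fun i j => M i j + (if Nat.eqb i j then e else 0)) <> 0.
Proof.
  (* The numbers [d / (k + 2)] are pairwise distinct and lie strictly between 0 and [d]. *)
  intros Hd. destruct (DetLemmas.detm_add_scalar_neq0 n M (fun k => d * / (INR k + 2))) as [k Hk].
  - intros a b H. pose proof (pos_INR a); pose proof (pos_INR b).
    apply INR_eq. apply Rmult_eq_reg_l in H; [|lra].
    apply (f_equal Rinv) in H. rewrite !Rinv_inv in H. lra.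
  - exists (d * / (INR k + 2)); split; auto. pose proof (pos_INR k).
    split. { apply Rmult_lt_0_compat; auto. apply Rinv_0_lt_compat; lra. }
    rewrite <- (Rmult_1_r d) at 2. apply Rmult_lt_compat_l; auto.
    rewrite <- Rinv_1. apply Rinv_lt_contravar; lra.
Qed.

(** * Convergence of real series *)

(** [sumn n] omits the term of index [n] while the partial sums of the library include it, hence the
    shift by one. *)
Lemma is_series_of_limsum (a : nat -> R) (l : R) :
  is_series a l <-> forall e, 0 < e -> exists N, forall n, (N <= n)%nat -> Rabs (sumn n a - l) < e.
Proof.
  assert (Hs : forall n, sumn (S n) a = sum_n a n).
  { induction n as [|n IH]. simpl; rewrite sum_O; ring.
    rewrite sum_Sn, <- IH. reflexivity. }
  rewrite is_series_Reals. unfold infinite_sum, Rdist. split; intros H e He.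
  - destruct (H e He) as [N HN]. exists (S N). intros n Hn. destruct n; [lia|].
    rewrite Hs, sum_n_Reals. apply HN; lia.
  - destruct (H e He) as [N HN]. exists N. intros n Hn.
    rewrite <- sum_n_Reals, <- Hs. apply HN; lia.
Qed.

Lemma is_series_uniq (a : nat -> R) (l l' : R) : is_series a l -> is_series a l' -> l = l'.
Proof. intros H H'. rewrite <- (is_series_unique _ _ H). apply is_series_unique; auto. Qed.

Lemma nonneg_series_ex (a : nat -> R) (M : R) :
  (forall n, 0 <= a n) -> (forall n, sumn n a <= M) -> exists l, is_series a l /\ l <= M.
Proof.
  intros Ha HM.
  assert (Hmon : forall n p, sumn n a <= sumn (n + p) a).
  { intros n p; induction p. rewrite Nat.add_0_r; lra. rewrite Nat.add_succ_r; simpl.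
    pose proof (Ha (n + p)%nat); lra. }
  destruct (completeness (fun y => exists n, y = sumn n a)) as [l [Hl1 Hl2]].
  - exists M. intros y [n ->]; auto.
  - exists 0, 0%nat; reflexivity.
  - exists l; split.
    + apply is_series_of_limsum. intros e He.
      destruct (classic (exists n, l - e < sumn n a)) as [[N HN]|Hn].
      * exists N; intros n Hn. replace n with (N + (n - N))%nat by lia.
        pose proof (Hmon N (n - N)%nat).
        assert (sumn (N + (n - N)) a <= l) by (apply Hl1; eexists; eauto).
        rewrite Rabs_left1; lra.
      * exfalso. assert (l <= l - e); [|lra]. apply Hl2. intros y [n ->].
        apply Rnot_lt_le. intros H; apply Hn; eauto.
    + apply Hl2. intros y [n ->]; auto.
Qed.

Lemma nonneg_series_ge (a : nat -> R) (l : R) :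
  (forall n, 0 <= a n) -> is_series a l -> forall n, sumn n a <= l.
Proof.
  intros Ha H n. apply Rnot_lt_le; intros Hlt.
  rewrite is_series_of_limsum in H. destruct (H (sumn n a - l)) as [N HN]; [lra|].
  specialize (HN (n + N)%nat ltac:(lia)).
  assert (sumn n a <= sumn (n + N) a).
  { clear -Ha. induction N. rewrite Nat.add_0_r; lra. rewrite Nat.add_succ_r; simpl.
    pose proof (Ha (n + N)%nat); lra. }
  apply Rabs_def2 in HN. lra.
Qed.

Lemma series_le_bound (a : nat -> R) (l M : R) :
  is_series a l -> (forall n, sumn n a <= M) -> l <= M.
Proof.
  intros H HM. apply Rnot_lt_le; intros Hlt.
  rewrite is_series_of_limsum in H. destruct (H (l - M)) as [N HN]; [lra|].
  specialize (HN N ltac:(lia)). specialize (HM N). apply Rabs_def2 in HN. lra.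
Qed.

Lemma series_abs_bound (a : nat -> R) (l M : R) :
  is_series a l -> (forall n, sumn n (fun i => Rabs (a i)) <= M) -> Rabs l <= M.
Proof.
  intros H HM.
  assert (Hb : forall n, Rabs (sumn n a) <= M).
  { intros n. eapply Rle_trans; [apply sumn_Rabs | apply HM]. }
  apply Rabs_le; split.
  - assert (- l <= M); [|lra]. apply series_le_bound with (fun i => - a i).
    + apply (is_series_opp a l H).
    + intros n. rewrite sumn_opp. specialize (Hb n). apply Rabs_le_between in Hb; lra.
  - apply series_le_bound with a; auto. intros n. specialize (Hb n). apply Rabs_le_between in Hb; lra.
Qed.

Lemma abs_series_ex (a b : nat -> R) (M : R) :
  (forall n, Rabs (a n) <= b n) -> (forall n, sumn n b <= M) ->
  exists l, is_series a l /\ Rabs l <= M.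
Proof.
  intros Hab HM.
  assert (HaM : forall n, sumn n (fun i => Rabs (a i)) <= M).
  { intros n. eapply Rle_trans; [apply sumn_le; intros; apply Hab | apply HM]. }
  destruct (nonneg_series_ex (fun i => Rabs (a i)) M (fun i => Rabs_pos _) HaM) as [l [Hl _]].
  destruct (ex_series_Rabs a (ex_intro _ l Hl)) as [s Hs].
  exists s; split; auto. apply series_abs_bound with a; auto.
Qed.

Lemma sumn_swap (I J : nat) (u : nat -> nat -> R) :
  sumn J (fun j => sumn I (fun i => u i j)) = sumn I (fun i => sumn J (fun j => u i j)).
Proof. induction I as [|I IH]; simpl. rewrite sumn_const; ring. rewrite sumn_plus, IH; auto. Qed.

Lemma is_series_zero : is_series (fun _ : nat => 0) 0.
Proof.
  apply is_series_of_limsum. intros e He; exists 0%nat; intros n _.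
  rewrite sumn_const, Rmult_0_r, Rminus_0_r, Rabs_R0; auto.
Qed.

Lemma is_series_sumn (u : nat -> nat -> R) (r : nat -> R) (I : nat) :
  (forall i, (i < I)%nat -> is_series (u i) (r i)) ->
  is_series (fun j => sumn I (fun i => u i j)) (sumn I r).
Proof.
  induction I as [|I IH]; intros Hr; simpl. apply is_series_zero.
  apply (is_series_plus (fun j => sumn I (fun i => u i j)) (u I)); auto.
Qed.

(** * Summation of double series along the Cantor pairing *)

(** An initial segment of the Cantor enumeration and a rectangle both become lists of index pairs,
    so that their partial sums are compared by inclusion of lists. *)
Definition sumL (f : nat * nat -> R) (l : list (nat * nat)) : R :=
  fold_right (fun p acc => f p + acc) 0 l.

Lemma sumL_app f l l' : sumL f (l ++ l') = sumL f l + sumL f l'.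
Proof. induction l as [|p l IH]; simpl; rewrite ?IH; ring. Qed.

Lemma sumL_incl (f : nat * nat -> R) (l l' : list (nat * nat)) :
  (forall p, 0 <= f p) -> NoDup l -> incl l l' -> sumL f l <= sumL f l'.
Proof.
  intros Hf; revert l'; induction l as [|p l IH]; intros l' Hnd Hin; simpl.
  - clear -Hf. induction l' as [|p l' IH]; simpl; [lra|]. specialize (Hf p); lra.
  - inversion Hnd as [|? ? Hp Hnd']; subst.
    destruct (in_split p l') as [l1 [l2 ->]]. { apply Hin; left; auto. }
    rewrite sumL_app; simpl.
    assert (sumL f l <= sumL f (l1 ++ l2)).
    { apply IH; auto. intros q Hq. specialize (Hin q (or_intror Hq)).
      apply in_app_or in Hin. apply in_or_app. destruct Hin as [|[|]]; auto.
      subst; contradiction. }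
    rewrite sumL_app in H. lra.
Qed.

Lemma sumL_map_seq (u : nat * nat -> R) (K : nat) :
  sumL u (map of_nat (seq 0 K)) = sumn K (fun n => u (of_nat n)).
Proof.
  induction K as [|K IH]; auto. rewrite seq_S, map_app, sumL_app, IH; simpl. ring.
Qed.

Lemma sumL_prod (u : nat * nat -> R) (I J : nat) :
  sumL u (list_prod (seq 0 I) (seq 0 J)) = sumn I (fun i => sumn J (fun j => u (i, j))).
Proof.
  induction I as [|I IH]; auto.
  assert (Ha : forall l l' r : list nat, list_prod (l ++ l') r = list_prod l r ++ list_prod l' r).
  { intros l l' r; induction l as [|a l IHl]; simpl; rewrite ?IHl, ?app_assoc; auto. }
  rewrite seq_S, Ha, sumL_app, IH.
  simpl. rewrite app_nil_r. f_equal. clear.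
  induction J as [|J IH]; auto. rewrite seq_S, map_app, sumL_app, IH; simpl; ring.
Qed.

(** Both coordinates of a pair are at most its Cantor code, so the first [K] pairs lie in the square
    of side [K]. *)
Lemma flat_le_rect (u : nat * nat -> R) (K : nat) : (forall p, 0 <= u p) ->
  sumn K (fun n => u (of_nat n)) <= sumn K (fun i => sumn K (fun j => u (i, j))).
Proof.
  intros Hu. rewrite <- sumL_map_seq, <- sumL_prod. apply sumL_incl; auto.
  - apply Injective_map_NoDup; [|apply seq_NoDup].
    intros a b H. rewrite <- (cancel_to_of a), <- (cancel_to_of b), H; auto.
  - intros [i j] H. apply in_map_iff in H. destruct H as [n [Hn Hin]].
    apply in_seq in Hin.
    assert (n = to_nat (i, j)) by (rewrite <- Hn, cancel_to_of; auto).
    pose proof (to_nat_non_decreasing i j).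
    apply in_prod; apply in_seq; lia.
Qed.

(** A rectangle has finitely many codes, and [K] is taken above all of them. *)
Lemma rect_le_flat (u : nat * nat -> R) (I J : nat) : (forall p, 0 <= u p) ->
  exists K, sumn I (fun i => sumn J (fun j => u (i, j))) <= sumn K (fun n => u (of_nat n)).
Proof.
  intros Hu.
  assert (HK : exists K, forall i j, (i < I)%nat -> (j < J)%nat -> (to_nat (i, j) < K)%nat).
  { induction I as [|I [K HK]]. exists 0%nat; intros; lia.
    assert (HJ : exists K', forall j, (j < J)%nat -> (to_nat (I, j) < K')%nat).
    { clear. induction J as [|J [K' H]]. exists 0%nat; intros; lia.
      exists (S (Nat.max K' (to_nat (I, J)))). intros j Hj.
      destruct (Nat.eq_dec j J) as [->|]; [lia|]. specialize (H j ltac:(lia)); lia. }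
    destruct HJ as [K' HK']. exists (Nat.max K K'). intros i j Hi Hj.
    destruct (Nat.eq_dec i I) as [->|]; [specialize (HK' j Hj) | specialize (HK i j ltac:(lia) Hj)]; lia. }
  destruct HK as [K HK]. exists K. rewrite <- sumL_map_seq, <- sumL_prod. apply sumL_incl; auto.
  - assert (HP : forall (l l' : list nat), NoDup l -> NoDup l' -> NoDup (list_prod l l')).
    { induction l as [|a l IH]; intros l' Hl Hl'; simpl; [constructor|].
      inversion Hl as [|? ? Ha Hl2]; subst. apply NoDup_app; auto.
      - apply Injective_map_NoDup; auto. intros x y E; injection E; auto.
      - intros [x y] Hx Hy. apply in_map_iff in Hx. destruct Hx as [z [Hz _]].
        injection Hz as <- <-. apply in_prod_iff in Hy. tauto. }
    apply HP; apply seq_NoDup.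
  - intros [i j] H. apply in_prod_iff in H. destruct H as [Hi Hj].
    apply in_seq in Hi; apply in_seq in Hj. apply in_map_iff.
    exists (to_nat (i, j)); split; [apply cancel_of_to|]. apply in_seq.
    specialize (HK i j); lia.
Qed.

(** The sum along the enumeration is at most [S] since initial segments lie in squares, and at least
    [S] since rectangles lie in initial segments. *)
Lemma double_series_nonneg (u : nat * nat -> R) (r : nat -> R) (S : R) :
  (forall p, 0 <= u p) -> (forall i, is_series (fun j => u (i, j)) (r i)) -> is_series r S ->
  is_series (fun n => u (of_nat n)) S.
Proof.
  intros Hu Hr HS.
  assert (Hr0 : forall i, 0 <= r i).
  { intros i. apply (nonneg_series_ge _ _ (fun j => Hu (i, j)) (Hr i) 0%nat). }
  destruct (nonneg_series_ex (fun n => u (of_nat n)) S) as [T [HT HTS]]; auto.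
  { intros K. eapply Rle_trans; [apply flat_le_rect; auto|].
    apply Rle_trans with (sumn K r); [|apply nonneg_series_ge; auto].
    apply sumn_le. intros i _. apply nonneg_series_ge with (l := r i); auto. }
  replace S with T; auto. apply Rle_antisym; auto.
  apply series_le_bound with r; auto. intros I.
  pose proof (is_series_sumn (fun i j => u (i, j)) r I (fun i _ => Hr i)) as H.
  apply series_le_bound with (1 := H). intros J.
  rewrite sumn_swap. destruct (rect_le_flat u I J Hu) as [K' HK'].
  eapply Rle_trans; [apply HK'|]. apply (nonneg_series_ge _ _ (fun n => Hu (of_nat n)) HT).
Qed.

(** Reduced to the nonnegative case by splitting [u] into [(|u| + u) / 2] and [(|u| - u) / 2], both
    dominated by [|u|]. The bound on the squares makes the rows, and the series of the row sums,
    converge for either part. *)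
Lemma double_series (u : nat * nat -> R) (r : nat -> R) (S M : R) :
  (forall N, sumn N (fun i => sumn N (fun j => Rabs (u (i, j)))) <= M) ->
  (forall i, is_series (fun j => u (i, j)) (r i)) -> is_series r S ->
  is_series (fun n => u (of_nat n)) S.
Proof.
  intros HM Hr HS.
  assert (HIJ : forall I J, sumn I (fun i => sumn J (fun j => Rabs (u (i, j)))) <= M).
  { intros I J. set (N := Nat.max I J).
    assert (Hinc : forall (f : nat -> R) a b, (forall i, 0 <= f i) -> (a <= b)%nat -> sumn a f <= sumn b f).
    { intros f a b Hf Hab. induction Hab; simpl; [lra|]. specialize (Hf m). lra. }
    apply Rle_trans with (2 := HM N).
    apply Rle_trans with (sumn I (fun i => sumn N (fun j => Rabs (u (i, j))))).
    - apply sumn_le. intros i _. apply Hinc; [intros; apply Rabs_pos | lia].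
    - apply Hinc; [|lia]. intros i. apply sumn_nonneg; intros; apply Rabs_pos. }
  assert (Hpart : forall v : nat * nat -> R, (forall p, 0 <= v p <= Rabs (u p)) ->
     exists rv Sv, (forall i, is_series (fun j => v (i, j)) (rv i)) /\ is_series rv Sv).
  { intros v Hv.
    assert (H1 : forall i, exists l, is_series (fun j => v (i, j)) l).
    { intros i. destruct (nonneg_series_ex (fun j => v (i, j)) M) as [l [Hl _]].
      - intros; apply Hv.
      - intros J. apply Rle_trans with (2 := HIJ (Datatypes.S i) J). simpl.
        assert (0 <= sumn i (fun a => sumn J (fun j => Rabs (u (a, j))))).
        { apply sumn_nonneg; intros; apply sumn_nonneg; intros; apply Rabs_pos. }
        assert (sumn J (fun j => v (i, j)) <= sumn J (fun j => Rabs (u (i, j)))).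
        { apply sumn_le; intros; apply Hv. }
        lra.
      - eauto. }
    exists (fun i => proj1_sig (constructive_indefinite_description _ (H1 i))).
    set (rv := fun i => proj1_sig (constructive_indefinite_description _ (H1 i))).
    assert (Hrv : forall i, is_series (fun j => v (i, j)) (rv i)).
    { intros i; unfold rv. destruct constructive_indefinite_description; auto. }
    assert (H0 : forall i, 0 <= rv i).
    { intros i. apply (nonneg_series_ge _ _ (fun j => proj1 (Hv (i, j))) (Hrv i) 0%nat). }
    destruct (nonneg_series_ex rv M) as [Sv [HSv _]]; auto.
    - intros I.
      pose proof (is_series_sumn (fun i j => v (i, j)) rv I (fun i _ => Hrv i)) as H.
      apply series_le_bound with (1 := H). intros J.
      rewrite sumn_swap. apply Rle_trans with (2 := HIJ I J).
      apply sumn_le; intros; apply sumn_le; intros; apply Hv.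
    - eauto. }
  assert (Hp : forall p, 0 <= (Rabs (u p) + u p) / 2 <= Rabs (u p)).
  { intros p. pose proof (Rle_abs (u p)). pose proof (Rle_abs (- u p)). rewrite Rabs_Ropp in H0. lra. }
  assert (Hm : forall p, 0 <= (Rabs (u p) - u p) / 2 <= Rabs (u p)).
  { intros p. pose proof (Rle_abs (u p)). pose proof (Rle_abs (- u p)). rewrite Rabs_Ropp in H0. lra. }
  destruct (Hpart _ Hp) as [rp [Sp [Hrp HSp]]]. destruct (Hpart _ Hm) as [rm [Sm [Hrm HSm]]].
  assert (Hpm : forall i, r i = rp i - rm i).
  { intros i. apply is_series_uniq with (1 := Hr i).
    eapply is_series_ext; [|apply (is_series_minus _ _ _ _ (Hrp i) (Hrm i))].
    intros j; simpl. unfold minus, plus, opp; simpl. lra. }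
  assert (HSpm : S = Sp - Sm).
  { apply is_series_uniq with (1 := HS).
    eapply is_series_ext; [|apply (is_series_minus _ _ _ _ HSp HSm)].
    intros j; simpl. rewrite Hpm. reflexivity. }
  rewrite HSpm.
  eapply is_series_ext; [|apply (is_series_minus _ _ _ _
     (double_series_nonneg _ _ _ (fun p => proj1 (Hp p)) Hrp HSp)
     (double_series_nonneg _ _ _ (fun p => proj1 (Hm p)) Hrm HSm))].
  intros n. unfold minus, plus, opp; simpl. lra.
Qed.

(** * Absolutely convergent power series on polydiscs *)

Definition polyd (k : nat) (rho x : Rvec) : Prop := forall i, (i < k)%nat -> Rabs (x i) <= rho i.
Definition posr (k : nat) (rho : Rvec) : Prop := forall i, (i < k)%nat -> 0 < rho i.

(* [f] is a sum of monomials in the first [k] variables, in any order and possibly with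
   repetitions, whose absolute values at [rho] add up to at most [M]. *)
Definition PS (k : nat) (rho : Rvec) (M : R) (f : fn) : Prop :=
  exists (c : nat -> R) (l : nat -> list nat), (forall j, idx_ok k (l j)) /\
    (forall N, sumn N (fun j => Rabs (c j) * mono rho (l j)) <= M) /\
    forall x, polyd k rho x -> is_series (fun j => c j * mono x (l j)) (f x).

Lemma mono_app x l l' : mono x (l ++ l') = mono x l * mono x l'.
Proof. induction l as [|i l IH]; simpl; rewrite ?IH; ring. Qed.

Lemma mono_ext k x y l : (forall i, (i < k)%nat -> x i = y i) -> idx_ok k l -> mono x l = mono y l.
Proof. intros H; induction 1 as [|i l Hi Hl IH]; simpl; auto. rewrite H, IH; auto. Qed.

Lemma mono_nonneg k rho l : posr k rho -> idx_ok k l -> 0 <= mono rho l.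
Proof.
  intros Hr; induction 1 as [|i l Hi Hl IH]; simpl; [lra|].
  apply Rmult_le_pos; auto. apply Rlt_le, Hr; auto.
Qed.

Lemma mono_le k rho x l : polyd k rho x -> idx_ok k l -> Rabs (mono x l) <= mono rho l.
Proof.
  intros Hr; induction 1 as [|i l Hi Hl IH]; simpl. rewrite Rabs_R1; lra.
  rewrite Rabs_mult. apply Rmult_le_compat; auto using Rabs_pos.
Qed.

Lemma polyd_self k rho : posr k rho -> polyd k rho rho.
Proof. intros H i Hi. rewrite Rabs_pos_eq; [lra | apply Rlt_le; auto]. Qed.

Lemma polyd_zero k rho : posr k rho -> polyd k rho zerov.
Proof. intros H i Hi. unfold zerov. rewrite Rabs_R0. apply Rlt_le; auto. Qed.

Lemma mono_dom k rho x l a : polyd k rho x -> idx_ok k l -> Rabs (a * mono x l) <= Rabs a * mono rho l.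
Proof. intros. rewrite Rabs_mult. apply Rmult_le_compat_l; [apply Rabs_pos | eapply mono_le; eauto]. Qed.

Lemma PS_bound k rho M f x : PS k rho M f -> polyd k rho x -> Rabs (f x) <= M.
Proof.
  intros [c [l [Hl [HM Hs]]]] Hx. apply series_abs_bound with (1 := Hs x Hx).
  intros n. eapply Rle_trans; [apply sumn_le | apply HM]. intros j _.
  eapply mono_dom; eauto.
Qed.

Lemma PS_nonneg k rho M f : PS k rho M f -> 0 <= M.
Proof. intros [c [l [Hl [HM Hs]]]]. apply (HM 0%nat). Qed.

Lemma PS_ext k rho M f g : (forall x, polyd k rho x -> f x = g x) -> PS k rho M f -> PS k rho M g.
Proof.
  intros H [c [l [Hl [HM Hs]]]]. exists c, l. repeat split; auto.
  intros x Hx. rewrite <- H; auto.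
Qed.

Lemma PS_le k rho M M' f : M <= M' -> PS k rho M f -> PS k rho M' f.
Proof.
  intros H [c [l [Hl [HM Hs]]]]. exists c, l. repeat split; auto.
  intros N. eapply Rle_trans; [apply HM | auto].
Qed.

Lemma PS_shrink k rho rho' M f :
  (forall i, (i < k)%nat -> 0 < rho' i <= rho i) -> PS k rho M f -> PS k rho' M f.
Proof.
  intros H [c [l [Hl [HM Hs]]]]. exists c, l. split; auto. split.
  - intros N. eapply Rle_trans; [apply sumn_le | apply (HM N)]. intros j _.
    apply Rmult_le_compat_l; [apply Rabs_pos|].
    eapply Rle_trans; [apply Rle_abs|]. apply mono_le with k; auto.
    intros i Hi. specialize (H i Hi). rewrite Rabs_pos_eq; lra.
  - intros x Hx. apply Hs. intros i Hi. specialize (H i Hi). specialize (Hx i Hi). lra.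
Qed.

Lemma PS_widen k k' rho M f : (k <= k')%nat -> PS k rho M f -> PS k' rho M f.
Proof.
  intros H [c [l [Hl [HM Hs]]]]. exists c, l. repeat split; auto.
  - intros j. eapply Forall_impl; [|apply Hl]. simpl; intros; lia.
  - intros x Hx. apply Hs. intros i Hi. apply Hx; lia.
Qed.

Lemma sumn_S_l n (f : nat -> R) : sumn (S n) f = f 0%nat + sumn n (fun i => f (S i)).
Proof.
  induction n as [|n IH]; [simpl; ring|].
  change (sumn (S n) f + f (S n) = f 0%nat + (sumn n (fun i => f (S i)) + f (S n))). rewrite IH; ring.
Qed.

Lemma is_series_single (a : R) : is_series (fun j => match j with O => a | _ => 0 end) a.
Proof.
  apply is_series_of_limsum. intros e He. exists 1%nat. intros n Hn.
  destruct n; [lia|]. rewrite sumn_S_l, sumn_zero by auto.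
  rewrite Rminus_diag_eq, Rabs_R0; auto. ring.
Qed.

Lemma PS_monomial k rho a l : posr k rho -> idx_ok k l ->
  PS k rho (Rabs a * mono rho l) (fun x => a * mono x l).
Proof.
  intros Hr Hl.
  exists (fun j => match j with O => a | _ => 0 end), (fun _ => l). split; auto. split.
  - intros N. apply nonneg_series_ge.
    + intros n. apply Rmult_le_pos; [apply Rabs_pos | eapply mono_nonneg; eauto].
    + eapply is_series_ext; [|apply (is_series_single (Rabs a * mono rho l))].
      intros [|n]; simpl; rewrite ?Rabs_R0; ring.
  - intros x Hx. eapply is_series_ext; [|apply (is_series_single (a * mono x l))].
    intros [|n]; simpl; ring.
Qed.

Lemma PS_const k rho a : posr k rho -> PS k rho (Rabs a) (fun _ => a).
Proof.
  intros H. pose proof (PS_monomial k rho a nil H (Forall_nil _)) as P; simpl in P.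
  rewrite Rmult_1_r in P. eapply PS_ext; [|apply P]. intros; simpl; ring.
Qed.

Lemma PS_zero k rho : posr k rho -> PS k rho 0 (fun _ => 0).
Proof. intros H. eapply PS_le; [|apply PS_const; auto]. rewrite Rabs_R0; lra. Qed.

Lemma PS_one k rho : posr k rho -> PS k rho 1 (fun _ => 1).
Proof. intros H. eapply PS_le; [|apply PS_const; auto]. rewrite Rabs_R1; lra. Qed.

Lemma PS_coord k rho i : posr k rho -> (i < k)%nat -> PS k rho (rho i) (fun x => x i).
Proof.
  intros H Hi. pose proof (PS_monomial k rho 1 (i :: nil) H) as P; simpl in P.
  rewrite Rabs_R1, !Rmult_1_l, Rmult_1_r in P.
  eapply PS_ext; [|apply P]. intros; simpl; ring. constructor; auto.
Qed.

(** The double family of monomials is only re-enumerated along the Cantor pairing; no coefficients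
    have to be collected, because [PS] allows repeated monomials. Products, substitutions and the
    limits in the division theorem all come from here. *)
Lemma PS_series k rho (M : nat -> R) (f : nat -> fn) (B : R) (F : fn) :
  posr k rho -> (forall i, PS k rho (M i) (f i)) -> (forall N, sumn N M <= B) ->
  (forall x, polyd k rho x -> is_series (fun i => f i x) (F x)) -> PS k rho B F.
Proof.
  intros Hr Hf HB HF.
  assert (H : forall i, exists cl : (nat -> R) * (nat -> list nat), (forall j, idx_ok k (snd cl j)) /\
    (forall N, sumn N (fun j => Rabs (fst cl j) * mono rho (snd cl j)) <= M i) /\
    forall x, polyd k rho x -> is_series (fun j => fst cl j * mono x (snd cl j)) (f i x)).
  { intros i. destruct (Hf i) as [c [l Hcl]]. exists (c, l); auto. }
  set (cl := fun i => proj1_sig (constructive_indefinite_description _ (H i))).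
  assert (Hcl : forall i, (forall j, idx_ok k (snd (cl i) j)) /\
    (forall N, sumn N (fun j => Rabs (fst (cl i) j) * mono rho (snd (cl i) j)) <= M i) /\
    forall x, polyd k rho x -> is_series (fun j => fst (cl i) j * mono x (snd (cl i) j)) (f i x)).
  { intros i; unfold cl; destruct constructive_indefinite_description; auto. }
  exists (fun n => fst (cl (fst (of_nat n))) (snd (of_nat n))),
         (fun n => snd (cl (fst (of_nat n))) (snd (of_nat n))).
  split; [intros j; apply Hcl|].
  assert (Hrect : forall N, sumn N (fun i => sumn N (fun j =>
      Rabs (fst (cl i) j) * mono rho (snd (cl i) j))) <= B).
  { intros N. apply Rle_trans with (2 := HB N). apply sumn_le. intros i _. apply Hcl. }
  split.
  - intros N. apply Rle_trans with (2 := Hrect N).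
    apply (flat_le_rect (fun p => Rabs (fst (cl (fst p)) (snd p)) * mono rho (snd (cl (fst p)) (snd p)))).
    intros p. apply Rmult_le_pos; [apply Rabs_pos | apply mono_nonneg with k; auto; apply Hcl].
  - intros x Hx.
    apply (double_series (fun p => fst (cl (fst p)) (snd p) * mono x (snd (cl (fst p)) (snd p)))
       (fun i => f i x) (F x) B); auto.
    + intros N. apply Rle_trans with (2 := Hrect N). apply sumn_le; intros i _. apply sumn_le; intros j _.
      apply mono_dom with k; auto. apply Hcl.
    + intros i. simpl. apply Hcl; auto.
Qed.

Lemma PS_plus k rho M N f g : posr k rho -> PS k rho M f -> PS k rho N g ->
  PS k rho (M + N) (fun x => f x + g x).
Proof.
  intros Hr Hf Hg.
  apply (PS_series k rho (fun i => match i with O => M | 1%nat => N | _ => 0 end)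
    (fun i => match i with O => f | 1%nat => g | _ => fun _ => 0 end)); auto.
  - intros [|[|i]]; auto. apply PS_zero; auto.
  - intros [|[|n]]; simpl. 1: pose proof (PS_nonneg _ _ _ _ Hf); pose proof (PS_nonneg _ _ _ _ Hg); lra.
    1: pose proof (PS_nonneg _ _ _ _ Hg); lra.
    induction n as [|n IH]; simpl in *; lra.
  - intros x _. apply is_series_of_limsum. intros e He. exists 2%nat. intros [|[|n]] Hn; try lia.
    rewrite 2!sumn_S_l, sumn_zero by auto. rewrite Rminus_diag_eq, Rabs_R0; auto. ring.
Qed.

Lemma PS_scal k rho M f a : PS k rho M f -> PS k rho (Rabs a * M) (fun x => a * f x).
Proof.
  intros [c [l [Hl [HM Hs]]]]. exists (fun j => a * c j), l. split; auto. split.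
  - intros N. rewrite (sumn_ext _ _ (fun j => Rabs a * (Rabs (c j) * mono rho (l j)))).
    + rewrite sumn_scal. apply Rmult_le_compat_l; [apply Rabs_pos | auto].
    + intros; rewrite Rabs_mult; ring.
  - intros x Hx. eapply is_series_ext; [|apply (is_series_scal a _ _ (Hs x Hx))].
    intros n; unfold scal; simpl; unfold mult; simpl; ring.
Qed.

Lemma PS_monomial_mult k rho M f a l : posr k rho -> idx_ok k l -> PS k rho M f ->
  PS k rho (Rabs a * mono rho l * M) (fun x => a * mono x l * f x).
Proof.
  intros Hr Hl0 [c [l' [Hl [HM Hs]]]]. exists (fun j => a * c j), (fun j => l ++ l' j). split; [|split].
  - intros j. apply Forall_app; split; auto. apply Hl.
  - intros N. rewrite (sumn_ext _ _ (fun j => (Rabs a * mono rho l) * (Rabs (c j) * mono rho (l' j)))).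
    + rewrite sumn_scal. apply Rmult_le_compat_l; auto.
      apply Rmult_le_pos; [apply Rabs_pos | eapply mono_nonneg; eauto].
    + intros; rewrite Rabs_mult, mono_app; ring.
  - intros x Hx. eapply is_series_ext; [|apply (is_series_scal (a * mono x l) _ _ (Hs x Hx))].
    intros n; unfold scal; simpl; unfold mult; simpl; rewrite mono_app; ring.
Qed.

Lemma PS_mult k rho M N f g : posr k rho -> PS k rho M f -> PS k rho N g ->
  PS k rho (M * N) (fun x => f x * g x).
Proof.
  intros Hr [c [l [Hl [HM Hs]]]] Hg.
  apply (PS_series k rho (fun i => Rabs (c i) * mono rho (l i) * N) (fun i x => c i * mono x (l i) * g x)); auto.
  - intros i. apply PS_monomial_mult; auto.
  - intros n. rewrite sumn_scal_r. apply Rmult_le_compat_r; auto. eapply PS_nonneg; eauto.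
  - intros x Hx. rewrite Rmult_comm.
    eapply is_series_ext; [|apply (is_series_scal (g x) _ _ (Hs x Hx))].
    intros n; unfold scal; simpl; unfold mult; simpl; ring.
Qed.

Lemma PS_sumn k rho n (M : nat -> R) (f : nat -> fn) : posr k rho ->
  (forall i, (i < n)%nat -> PS k rho (M i) (f i)) ->
  PS k rho (sumn n M) (fun x => sumn n (fun i => f i x)).
Proof.
  intros Hr; induction n as [|n IH]; intros H; simpl.
  - apply PS_zero; auto.
  - apply PS_plus; auto.
Qed.

(** The bounds are submultiplicative, so a monomial in the [G i] is bounded by the same monomial in
    the radii [rho i], and the total bound [M] does not grow. *)
Lemma PS_subst k k' rho rho' M f (G : nat -> fn) : posr k' rho' -> posr k rho ->
  (forall i, (i < k)%nat -> PS k' rho' (rho i) (G i)) -> PS k rho M f ->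
  PS k' rho' M (fun x => f (fun i => G i x)).
Proof.
  intros Hr' Hr HG [c [l [Hl [HM Hs]]]].
  assert (Hm : forall l, idx_ok k l -> PS k' rho' (mono rho l) (fun x => mono (fun i => G i x) l)).
  { induction 1 as [|i l0 Hi Hl0 IH]; simpl.
    - apply PS_one; auto.
    - apply PS_mult; auto. }
  apply (PS_series k' rho' (fun i => Rabs (c i) * mono rho (l i)) (fun i x => c i * mono (fun i => G i x) (l i))); auto.
  - intros i. apply PS_scal. apply Hm, Hl.
  - intros x Hx. apply Hs. intros i Hi. apply PS_bound with (1 := HG i Hi); auto.
Qed.

Lemma coef_series k rho M (c : nat -> R) (l : nat -> list nat) x : (forall j, idx_ok k (l j)) ->
  (forall N, sumn N (fun j => Rabs (c j) * mono rho (l j)) <= M) -> polyd k rho x ->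
  is_series (fun j => c j * mono x (l j)) (Series (fun j => c j * mono x (l j))).
Proof.
  intros Hl HM Hx. apply Series_correct.
  destruct (abs_series_ex (fun j => c j * mono x (l j)) (fun j => Rabs (c j) * mono rho (l j)) M) as [s [Hs _]]; auto.
  - intros n. apply mono_dom with k; auto.
  - exists s; auto.
Qed.

(** Division of a monomial by the variable of index [k], when that variable occurs in it. *)
Fixpoint rem1 (k : nat) (l : list nat) : list nat :=
  match l with nil => nil | i :: l' => if Nat.eqb i k then l' else i :: rem1 k l' end.

Lemma mono_rem1 x k l : In k l -> mono x l = x k * mono x (rem1 k l).
Proof.
  induction l as [|i l IH]; simpl; [tauto|]. intros H.
  destruct (Nat.eqb_spec i k) as [->|Hn]; auto. simpl. rewrite IH; [ring|]. destruct H; congruence.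
Qed.

Lemma rem1_ok n k l : idx_ok n l -> idx_ok n (rem1 k l).
Proof.
  induction 1 as [|i l Hi Hl IH]; simpl; [constructor|].
  destruct (Nat.eqb i k); auto. constructor; auto.
Qed.

Lemma idx_ok_pred k l : idx_ok (S k) l -> ~ In k l -> idx_ok k l.
Proof.
  induction 1 as [|i l Hi Hl IH]; simpl; intros H; constructor.
  - destruct (Nat.eq_dec i k); [exfalso; auto | lia].
  - apply IH; auto.
Qed.

(** Monomials containing [x k] go to [t], the others to [r]. Dropping one factor [x k] divides the
    bound by [rho k]; this is the estimate behind the division theorem. *)
Lemma PS_split1 k rho M f : posr (S k) rho -> PS (S k) rho M f ->
  exists t r, PS (S k) rho (M / rho k) t /\ PS k rho M r /\
    forall x, polyd (S k) rho x -> f x = x k * t x + r x.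
Proof.
  intros Hr [c [l [Hl [HM Hs]]]].
  pose proof (Hr k (Nat.lt_succ_diag_r k)) as Hk.
  set (d := fun j => in_dec Nat.eq_dec k (l j)).
  set (ct := fun j => if d j then c j else 0). set (lt := fun j => if d j then rem1 k (l j) else nil).
  set (cr := fun j => if d j then 0 else c j). set (lr := fun j => if d j then nil else l j).
  assert (Hlt : forall j, idx_ok (S k) (lt j)).
  { intros j; unfold lt. destruct (d j); [apply rem1_ok; apply Hl | constructor]. }
  assert (Hlr : forall j, idx_ok k (lr j)).
  { intros j; unfold lr. destruct (d j); [constructor | apply idx_ok_pred; auto; apply Hl]. }
  assert (Hpos : forall j, 0 <= Rabs (c j) * mono rho (l j)).
  { intros j. apply Rmult_le_pos; [apply Rabs_pos | apply mono_nonneg with (S k); auto; apply Hl]. }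
  assert (Bt : forall N, sumn N (fun j => Rabs (ct j) * mono rho (lt j)) <= M / rho k).
  { intros N. apply Rmult_le_reg_l with (rho k); auto.
    rewrite <- sumn_scal. replace (rho k * (M / rho k)) with M by (field; lra).
    apply Rle_trans with (2 := HM N). apply sumn_le; intros j _. unfold ct, lt. specialize (Hpos j).
    destruct (d j) as [Hin|]. rewrite (mono_rem1 rho k (l j)); auto; lra.
    rewrite Rabs_R0; lra. }
  assert (Br : forall N, sumn N (fun j => Rabs (cr j) * mono rho (lr j)) <= M).
  { intros N. apply Rle_trans with (2 := HM N). apply sumn_le; intros j _. unfold cr, lr.
    specialize (Hpos j). destruct (d j) as [Hin|]; [|lra]. rewrite Rabs_R0; lra. }
  exists (fun x => Series (fun j => ct j * mono x (lt j))), (fun x => Series (fun j => cr j * mono x (lr j))).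
  split; [|split].
  - exists ct, lt; repeat split; auto. intros x Hx. eapply coef_series; eauto.
  - exists cr, lr; repeat split; auto. intros x Hx. eapply coef_series; eauto.
  - intros x Hx. apply is_series_uniq with (1 := Hs x Hx).
    assert (Hx' : polyd k rho x) by (intros i Hi; apply Hx; lia).
    eapply is_series_ext; [|apply (is_series_plus _ _ _ _
      (is_series_scal (x k) _ _ (coef_series (S k) rho _ ct lt x Hlt Bt Hx)) (coef_series k rho _ cr lr x Hlr Br Hx'))].
    intros j. unfold plus, scal; simpl; unfold mult; simpl. unfold ct, lt, cr, lr.
    destruct (d j) as [Hin|]; [rewrite (mono_rem1 x k (l j)) by auto|]; simpl; ring.
Qed.

(** Without constant terms every monomial has at least one factor that shrinks by [th]. *)
Lemma PS_vanish k rho rho' M f th : posr k rho -> 0 < th <= 1 ->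
  (forall i, (i < k)%nat -> 0 < rho' i <= th * rho i) -> PS k rho M f -> f zerov = 0 ->
  PS k rho' (th * M) f.
Proof.
  intros Hr Hth Hrho [c [l [Hl [HM Hs]]]] H0.
  assert (Hle : forall i, (i < k)%nat -> 0 < rho' i <= rho i).
  { intros i Hi. specialize (Hrho i Hi). specialize (Hr i Hi). nra. }
  (* The list may contain several constant monomials; their coefficients add up to [f zerov = 0], so
     all of them can be deleted. *)
  set (c' := fun j => match l j with nil => 0 | _ => c j end).
  exists c', l. split; auto. split.
  - intros N. apply Rle_trans with (th * sumn N (fun j => Rabs (c j) * mono rho (l j))).
    2: apply Rmult_le_compat_l; [lra | auto].
    rewrite <- sumn_scal. apply sumn_le; intros j _. unfold c'.
    specialize (Hl j). destruct (l j) as [|i l0]; simpl.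
    + rewrite Rabs_R0. pose proof (Rabs_pos (c j)). nra.
    + inversion Hl as [|? ? Hi Hl0]; subst.
      assert (mono rho' l0 <= mono rho l0).
      { eapply Rle_trans; [apply Rle_abs|]. apply mono_le with k; auto.
        intros a Ha. specialize (Hle a Ha). rewrite Rabs_pos_eq; lra. }
      assert (0 <= mono rho' l0). { apply mono_nonneg with k; auto. intros a Ha; apply Hle; auto. }
      assert (rho' i * mono rho' l0 <= (th * rho i) * mono rho l0).
      { apply Rmult_le_compat; auto. apply Rlt_le, Hrho; auto. apply Hrho; auto. }
      pose proof (Rabs_pos (c j)). nra.
  - intros x Hx.
    assert (Hx' : polyd k rho x).
    { intros i Hi. specialize (Hx i Hi). specialize (Hle i Hi). lra. }
    pose proof (Hs x Hx') as E1. pose proof (Hs zerov (polyd_zero k rho Hr)) as E2. rewrite H0 in E2.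
    replace (f x) with (f x - 0) by ring.
    eapply is_series_ext; [|apply (is_series_minus _ _ _ _ E1 E2)].
    intros j. unfold minus, plus, opp; simpl. unfold c'. destruct (l j) as [|i l0]; simpl.
    ring. unfold zerov. ring.
Qed.

Lemma PS_xpow k rho i b : posr k rho -> (i < k)%nat -> PS k rho (rho i ^ b) (fun x => x i ^ b).
Proof.
  intros Hr Hi; induction b as [|b IH]; simpl.
  - apply PS_one; auto.
  - apply PS_mult; auto. apply PS_coord; auto.
Qed.

Lemma PS_split k rho M f b : posr (S k) rho -> PS (S k) rho M f ->
  exists t r, PS (S k) rho (M / rho k ^ b) t /\ (forall i, (i < b)%nat -> PS k rho (M / rho k ^ i) (r i)) /\
    forall x, polyd (S k) rho x -> f x = x k ^ b * t x + sumn b (fun i => r i x * x k ^ i).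
Proof.
  intros Hr Hf. pose proof (Hr k (Nat.lt_succ_diag_r k)) as Hk.
  induction b as [|b [t [r [Ht [Hrr E]]]]].
  - exists f, (fun _ => f). simpl. split; [|split].
    + unfold Rdiv. rewrite Rinv_1, Rmult_1_r; auto.
    + intros; lia.
    + intros; ring.
  - destruct (PS_split1 k rho _ t Hr Ht) as [t' [r' [Ht' [Hr' E']]]].
    exists t', (fun i => if Nat.eqb i b then r' else r i). split; [|split].
    + eapply PS_le; [|apply Ht']. right. simpl. field. split; [apply pow_nonzero|]; lra.
    + intros i Hi. destruct (Nat.eqb_spec i b) as [->|]; auto. apply Hrr; lia.
    + intros x Hx. rewrite E, E' by auto. simpl. rewrite Nat.eqb_refl.
      rewrite (sumn_ext b (fun i => (if Nat.eqb i b then r' else r i) x * x k ^ i) (fun i => r i x * x k ^ i)).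
      ring. intros i Hi. destruct (Nat.eqb_spec i b); [lia | auto].
Qed.

Lemma PS_dep k rho M f x y : PS k rho M f -> polyd k rho x -> (forall i, (i < k)%nat -> y i = x i) -> f y = f x.
Proof.
  intros [c [l [Hl [HM Hs]]]] Px Hy.
  assert (Py : polyd k rho y) by (intros i Hi; rewrite Hy; auto).
  apply is_series_uniq with (1 := Hs y Py). eapply is_series_ext; [|apply (Hs x Px)].
  intros n; simpl. f_equal. symmetry; apply mono_ext with k; auto.
Qed.

(** * Germs of analytic functions of the first [k] variables *)

Definition cst (r : R) : Rvec := fun _ => r.

(** Only the first [k] coordinates are restricted, so a germ in [k] variables stays the same
    function when it is regarded as a germ in more variables. *)
Definition near (k : nat) (Q : Rvec -> Prop) : Prop :=
  exists e, 0 < e /\ forall x, (forall i, (i < k)%nat -> Rabs (x i) < e) -> Q x.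

Definition Og (k : nat) (f : fn) : Prop := exists r M, 0 < r /\ PS k (cst r) M f.

Lemma near_and k (P Q : Rvec -> Prop) : near k P -> near k Q -> near k (fun x => P x /\ Q x).
Proof.
  intros [e [He H]] [e' [He' H']]. exists (Rmin e e'). split; [apply Rmin_pos; auto|].
  intros x Hx. split; [apply H | apply H']; intros i Hi; specialize (Hx i Hi);
    pose proof (Rmin_l e e'); pose proof (Rmin_r e e'); lra.
Qed.

Lemma near_mono k (P Q : Rvec -> Prop) : (forall x, P x -> Q x) -> near k P -> near k Q.
Proof. intros H [e [He HP]]. exists e; split; auto. Qed.

Lemma posr_cst k r : 0 < r -> posr k (cst r).
Proof. intros H i _; auto. Qed.

Lemma PS_cst_shrink k r r' M f : 0 < r' <= r -> PS k (cst r) M f -> PS k (cst r') M f.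
Proof. intros H; apply PS_shrink; auto. Qed.

Lemma Og_common k f g : Og k f -> Og k g -> exists r M N, 0 < r /\ PS k (cst r) M f /\ PS k (cst r) N g.
Proof.
  intros [r [M [Hr Hf]]] [r' [N [Hr' Hg]]]. exists (Rmin r r'), M, N.
  assert (0 < Rmin r r') by (apply Rmin_pos; auto).
  pose proof (Rmin_l r r'); pose proof (Rmin_r r r').
  split; auto. split; [apply PS_cst_shrink with r | apply PS_cst_shrink with r']; auto; lra.
Qed.

Lemma Og_const k a : Og k (fun _ => a).
Proof. exists 1, (Rabs a). split; [lra|]. apply PS_const. apply posr_cst; lra. Qed.

Lemma Og_coord k i : (i < k)%nat -> Og k (fun x => x i).
Proof. intros H. exists 1, 1. split; [lra|]. apply (PS_coord k (cst 1)); auto. apply posr_cst; lra. Qed.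

Lemma Og_plus k f g : Og k f -> Og k g -> Og k (fun x => f x + g x).
Proof.
  intros Hf Hg. destruct (Og_common k f g Hf Hg) as [r [M [N [Hr [H1 H2]]]]].
  exists r, (M + N); split; auto. apply PS_plus; auto. apply posr_cst; auto.
Qed.

Lemma Og_mult k f g : Og k f -> Og k g -> Og k (fun x => f x * g x).
Proof.
  intros Hf Hg. destruct (Og_common k f g Hf Hg) as [r [M [N [Hr [H1 H2]]]]].
  exists r, (M * N); split; auto. apply PS_mult; auto. apply posr_cst; auto.
Qed.

Lemma Og_scal k a f : Og k f -> Og k (fun x => a * f x).
Proof. intros Hf. apply Og_mult; auto. apply Og_const. Qed.

Lemma Og_minus k f g : Og k f -> Og k g -> Og k (fun x => f x - g x).
Proof.
  intros Hf Hg. replace (fun x => f x - g x) with (fun x => f x + (-1) * g x).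
  - apply Og_plus; auto. apply Og_scal; auto.
  - apply functional_extensionality; intros; ring.
Qed.

Lemma Og_pow k f n : Og k f -> Og k (fun x => f x ^ n).
Proof. intros Hf; induction n as [|n IH]; simpl. apply Og_const. apply Og_mult; auto. Qed.

Lemma Og_sumn k n (f : nat -> fn) : (forall i, (i < n)%nat -> Og k (f i)) -> Og k (fun x => sumn n (fun i => f i x)).
Proof.
  induction n as [|n IH]; intros H; simpl. apply Og_const. apply Og_plus; auto.
Qed.

Lemma Og_widen k k' f : (k <= k')%nat -> Og k f -> Og k' f.
Proof. intros H [r [M [Hr Hf]]]. exists r, M; split; auto. apply PS_widen with k; auto. Qed.

Lemma Og_ext k f g : near k (fun x => f x = g x) -> Og k f -> Og k g.
Proof.
  intros [e [He H]] [r [M [Hr Hf]]]. exists (Rmin r (e / 2)), M.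
  assert (0 < Rmin r (e / 2)) by (apply Rmin_pos; lra).
  pose proof (Rmin_l r (e/2)); pose proof (Rmin_r r (e/2)). split; auto.
  eapply PS_ext; [|apply PS_cst_shrink with r; [|apply Hf]; lra].
  intros x Hx. apply H. intros i Hi. specialize (Hx i Hi). unfold cst in Hx. lra.
Qed.

Lemma Og_bounded k f : Og k f -> exists B, near k (fun x => Rabs (f x) <= B).
Proof.
  intros [r [M [Hr Hf]]]. exists M, r; split; auto. intros x Hx. eapply PS_bound; eauto.
  intros i Hi. apply Rlt_le, Hx; auto.
Qed.

Lemma Og_dep k f : Og k f -> near k (fun x => forall y, (forall i, (i < k)%nat -> y i = x i) -> f y = f x).
Proof.
  intros [r [M [Hr Hf]]]. exists r; split; auto. intros x Hx y Hy.
  apply PS_dep with (1 := Hf); auto. intros i Hi; apply Rlt_le, Hx; auto.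
Qed.

Lemma mono_cst r l : mono (cst r) l = r ^ length l.
Proof. induction l as [|i l IH]; simpl; rewrite ?IH; auto. Qed.

(** The components [G i] vanish at 0, so on a small polydisc [PS_vanish] brings their bounds below
    the radius [r] of [f]. *)
Lemma Og_subst k k' f (G : nat -> fn) :
  (forall i, (i < k)%nat -> Og k' (G i)) -> (forall i, (i < k)%nat -> G i zerov = 0) ->
  Og k f -> Og k' (fun x => f (fun i => G i x)).
Proof.
  intros HG H0 [r [M [Hr Hf]]].
  assert (H : exists s, 0 < s /\ forall i, (i < k)%nat -> PS k' (cst s) r (G i)).
  { clear Hf. induction k as [|k IH].
    - exists 1; split; [lra|]. intros; lia.
    - destruct IH as [s [Hs IH]]; auto.
      destruct (HG k) as [s' [M' [Hs' HGk]]]; [lia|].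
      set (th := Rmin 1 (r / (M' + 1))).
      pose proof (PS_nonneg _ _ _ _ HGk) as HM'.
      assert (Hth : 0 < th <= 1).
      { split; [|apply Rmin_l]. apply Rmin_pos; [lra|]. apply Rdiv_lt_0_compat; lra. }
      assert (Hv : PS k' (cst (th * s')) r (G k)).
      { eapply PS_le; [|apply (PS_vanish k' (cst s') _ M' (G k) th)]; auto.
        - apply Rle_trans with (r / (M' + 1) * M').
          + apply Rmult_le_compat_r; auto. apply Rmin_r.
          + unfold Rdiv. rewrite Rmult_assoc. rewrite <- (Rmult_1_r r) at 2.
            apply Rmult_le_compat_l; [lra|]. apply Rmult_le_reg_l with (M' + 1); [lra|].
            rewrite <- Rmult_assoc, Rinv_r by lra. lra.
        - apply posr_cst; auto.
        - intros i _. unfold cst. split; [apply Rmult_lt_0_compat; lra | lra]. }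
      exists (Rmin s (th * s')). assert (0 < th * s') by (apply Rmult_lt_0_compat; lra).
      assert (0 < Rmin s (th * s')) by (apply Rmin_pos; auto).
      pose proof (Rmin_l s (th * s')); pose proof (Rmin_r s (th * s')).
      split; auto. intros i Hi. destruct (Nat.eq_dec i k) as [->|].
      + apply PS_cst_shrink with (th * s'); auto.
      + apply PS_cst_shrink with s; auto. apply IH; lia. }
  destruct H as [s [Hs H]]. exists s, M; split; auto.
  apply (PS_subst k k' (cst r) (cst s)); auto; apply posr_cst; auto.
Qed.

(** Derivative of the monomial [l] at [x] in the direction [w], by Leibniz' rule along the list. *)
Fixpoint dmono (x w : Rvec) (l : list nat) : R :=
  match l with nil => 0 | i :: l' => w i * mono x l' + x i * dmono x w l' end.

Definition unitv (j : nat) : Rvec := fun i => if Nat.eqb i j then 1 else 0.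

Lemma sumn_delta n j (f : nat -> R) : (j < n)%nat -> sumn n (fun i => unitv i j * f i) = f j.
Proof.
  induction n as [|n IH]; intros H; [lia|]. simpl. unfold unitv at 2.
  destruct (Nat.eqb_spec j n) as [->|Hn].
  - rewrite sumn_zero; [ring|]. intros i Hi. unfold unitv. rewrite (proj2 (Nat.eqb_neq n i)) by lia. ring.
  - rewrite IH by lia. ring.
Qed.

Lemma dmono_lin k x w l : idx_ok k l -> dmono x w l = sumn k (fun j => dmono x (unitv j) l * w j).
Proof.
  induction 1 as [|i l Hi Hl IH]; simpl.
  - rewrite sumn_zero; auto. intros; ring.
  - rewrite IH.
    rewrite (sumn_ext k (fun j => (unitv j i * mono x l + x i * dmono x (unitv j) l) * w j)
      (fun j => unitv j i * (mono x l * w j) + x i * (dmono x (unitv j) l * w j))).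
    + rewrite sumn_plus, sumn_scal, (sumn_delta k i (fun j => mono x l * w j)) by auto. ring.
    + intros; ring.
Qed.

(** Changing one factor at a time gives [length l] terms; the factor [2 ^ length l] absorbs their
    number and keeps the bound geometric. *)
Lemma mono_diff_bound k R0 W x w l : 0 < R0 -> 0 <= W -> idx_ok k l ->
  (forall i, (i < k)%nat -> Rabs (x i) <= R0) -> (forall i, (i < k)%nat -> Rabs (x i + w i) <= R0) ->
  (forall i, (i < k)%nat -> Rabs (w i) <= W) ->
  Rabs (mono (vadd x w) l - mono x l) <= (2 * R0) ^ length l * (W / R0).
Proof.
  intros HR HW Hl Hx Hxw Hw. induction Hl as [|i l Hi Hl IH]; simpl.
  - rewrite Rminus_diag_eq, Rabs_R0 by auto. assert (0 <= W / R0) by (apply Rdiv_le_0_compat; lra). lra.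
  - replace (vadd x w i * mono (vadd x w) l - x i * mono x l) with
      (vadd x w i * (mono (vadd x w) l - mono x l) + w i * mono x l) by (unfold vadd; ring).
    eapply Rle_trans; [apply Rabs_triang|]. rewrite !Rabs_mult.
    assert (H1 : Rabs (mono x l) <= R0 ^ length l).
    { rewrite <- mono_cst. apply mono_le with k; auto. }
    assert (H2 : R0 ^ length l <= (2 * R0) ^ length l) by (apply pow_incr; lra).
    assert (H3 : Rabs (vadd x w i) * Rabs (mono (vadd x w) l - mono x l) <= R0 * ((2 * R0) ^ length l * (W / R0))).
    { apply Rmult_le_compat; auto using Rabs_pos. apply Hxw; auto. }
    assert (H4 : Rabs (w i) * Rabs (mono x l) <= W * (2 * R0) ^ length l).
    { apply Rmult_le_compat; auto using Rabs_pos. lra. }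
    replace (2 * R0 * (2 * R0) ^ length l * (W / R0)) with
      (R0 * ((2 * R0) ^ length l * (W / R0)) + W * (2 * R0) ^ length l) by (field; lra). lra.
Qed.

(** The quadratic terms are counted by pairs of factors, and [4 ^ length l] exceeds their number. *)
Lemma mono_rem_bound k R0 W x w l : 0 < R0 -> 0 <= W -> idx_ok k l ->
  (forall i, (i < k)%nat -> Rabs (x i) <= R0) -> (forall i, (i < k)%nat -> Rabs (x i + w i) <= R0) ->
  (forall i, (i < k)%nat -> Rabs (w i) <= W) ->
  Rabs (mono (vadd x w) l - mono x l - dmono x w l) <= (4 * R0) ^ length l * (W / R0 * (W / R0)).
Proof.
  intros HR HW Hl Hx Hxw Hw.
  assert (H0 : 0 <= W / R0) by (apply Rdiv_le_0_compat; lra).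
  induction Hl as [|i l Hi Hl IH]; simpl.
  - replace (1 - 1 - 0) with 0 by ring. rewrite Rabs_R0. nra.
  - replace (vadd x w i * mono (vadd x w) l - x i * mono x l - (w i * mono x l + x i * dmono x w l)) with
      (x i * (mono (vadd x w) l - mono x l - dmono x w l) + w i * (mono (vadd x w) l - mono x l))
      by (unfold vadd; ring).
    eapply Rle_trans; [apply Rabs_triang|]. rewrite !Rabs_mult.
    pose proof (mono_diff_bound k R0 W x w l HR HW Hl Hx Hxw Hw) as H1.
    assert (H2 : (2 * R0) ^ length l <= (4 * R0) ^ length l) by (apply pow_incr; lra).
    assert (H3 : Rabs (x i) * Rabs (mono (vadd x w) l - mono x l - dmono x w l)
       <= R0 * ((4 * R0) ^ length l * (W / R0 * (W / R0)))).
    { apply Rmult_le_compat; auto using Rabs_pos. }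
    assert (H4 : Rabs (w i) * Rabs (mono (vadd x w) l - mono x l) <= W * ((4 * R0) ^ length l * (W / R0))).
    { apply Rmult_le_compat; auto using Rabs_pos. eapply Rle_trans; [apply H1|]. apply Rmult_le_compat_r; auto. }
    assert (0 <= (4 * R0) ^ length l) by (apply pow_le; lra).
    replace (4 * R0 * (4 * R0) ^ length l * (W / R0 * (W / R0))) with
      (4 * (W * ((4 * R0) ^ length l * (W / R0)))) by (field; lra).
    replace (R0 * ((4 * R0) ^ length l * (W / R0 * (W / R0)))) with
      (W * ((4 * R0) ^ length l * (W / R0))) in H3 by (field; lra).
    assert (0 <= W * ((4 * R0) ^ length l * (W / R0))) by (apply Rmult_le_pos; [auto | apply Rmult_le_pos; auto]). lra.
Qed.

(** First-order expansion with gradient [g] and quadratic remainder, uniform for base points near 0;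
    directional derivatives and Lipschitz bounds both follow from it. *)
Definition Tot (k : nat) (f : fn) (g : nat -> fn) : Prop :=
  exists C e, 0 <= C /\ 0 < e /\ forall x w W, (forall i, (i < k)%nat -> Rabs (x i) < e) ->
    (forall i, (i < k)%nat -> Rabs (w i) <= W) -> 0 <= W < e ->
    Rabs (f (vadd x w) - f x - sumn k (fun j => g j x * w j)) <= C * W * W.

Lemma PS_dmono k R0 j l : 0 < R0 -> idx_ok k l ->
  PS k (cst R0) ((2 * R0) ^ length l * / R0) (fun x => dmono x (unitv j) l).
Proof.
  intros HR Hl. assert (Hp := posr_cst k R0 HR).
  induction Hl as [|i l Hi Hl IH]; simpl.
  - eapply PS_le; [|apply PS_zero; auto]. assert (0 < / R0) by (apply Rinv_0_lt_compat; auto). lra.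
  - eapply PS_le; [|apply PS_plus; [auto|apply PS_scal|apply PS_mult; [auto|apply PS_coord; auto|apply IH]]].
    2:{ pose proof (PS_monomial k (cst R0) 1 l Hp Hl) as P. eapply PS_ext; [|apply P]. intros; simpl; ring. }
    rewrite mono_cst, Rabs_R1, Rmult_1_l.
    assert (H2 : R0 ^ length l <= (2 * R0) ^ length l) by (apply pow_incr; lra).
    assert (0 <= R0 ^ length l) by (apply pow_le; lra).
    assert (Rabs (unitv j i) <= 1).
    { unfold unitv; destruct (Nat.eqb i j); rewrite ?Rabs_R1, ?Rabs_R0; lra. }
    unfold cst.
    replace (R0 * ((2 * R0) ^ length l * / R0)) with ((2 * R0) ^ length l) by (field; lra).
    replace (2 * R0 * (2 * R0) ^ length l * / R0) with (2 * (2 * R0) ^ length l) by (field; lra).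
    pose proof (Rabs_pos (unitv j i)). nra.
Qed.

Lemma Og_Tot k f : Og k f -> exists g, (forall j, Og k (g j)) /\ Tot k f g.
Proof.
  intros [r [M [Hr [c [l [Hl [HM Hs]]]]]]].
  (* [mono_rem_bound] costs a factor [4 ^ length l], so the expansion is available on a quarter of
     the radius. *)
  set (R0 := r / 4). assert (HR : 0 < R0) by (unfold R0; lra).
  assert (HM' : forall N, sumn N (fun j => Rabs (c j) * (4 * R0) ^ length (l j)) <= M).
  { intros N. apply Rle_trans with (2 := HM N). apply Req_le, sumn_ext; intros i _.
    rewrite mono_cst. do 2 f_equal. unfold R0; field. }
  assert (H24 : forall i, (2 * R0) ^ length (l i) <= (4 * R0) ^ length (l i)).
  { intros; apply pow_incr; lra. }
  assert (Hg : forall j, exists gj, PS k (cst R0) (M * / R0) gj /\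
      forall x, polyd k (cst R0) x -> is_series (fun i => c i * dmono x (unitv j) (l i)) (gj x)).
  { intros j. exists (fun x => Series (fun i => c i * dmono x (unitv j) (l i))).
    assert (HB : forall N, sumn N (fun i => Rabs (c i) * ((2 * R0) ^ length (l i) * / R0)) <= M * / R0).
    { intros N. rewrite (sumn_ext _ _ (fun i => (Rabs (c i) * (2 * R0) ^ length (l i)) * / R0)) by (intros; ring).
      rewrite sumn_scal_r. apply Rmult_le_compat_r. apply Rlt_le, Rinv_0_lt_compat; auto.
      apply Rle_trans with (2 := HM' N). apply sumn_le; intros i _.
      apply Rmult_le_compat_l; auto using Rabs_pos. }
    assert (HS : forall x, polyd k (cst R0) x -> is_series (fun i => c i * dmono x (unitv j) (l i))
                 (Series (fun i => c i * dmono x (unitv j) (l i)))).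
    { intros x Hx. apply Series_correct.
      destruct (abs_series_ex (fun i => c i * dmono x (unitv j) (l i))
         (fun i => Rabs (c i) * ((2 * R0) ^ length (l i) * / R0)) (M * / R0)) as [s [E _]]; auto.
      - intros n. rewrite Rabs_mult. apply Rmult_le_compat_l; [apply Rabs_pos|].
        apply PS_bound with (1 := PS_dmono k R0 j (l n) HR (Hl n)); auto.
      - exists s; auto. }
    split; auto.
    apply (PS_series k (cst R0) (fun i => Rabs (c i) * ((2 * R0) ^ length (l i) * / R0))
       (fun i x => c i * dmono x (unitv j) (l i))); auto.
    { apply posr_cst; auto. }
    intros i. apply PS_scal. apply PS_dmono; auto. }
  set (g := fun j => proj1_sig (constructive_indefinite_description _ (Hg j))).
  assert (Hg' : forall j, PS k (cst R0) (M * / R0) (g j) /\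
      forall x, polyd k (cst R0) x -> is_series (fun i => c i * dmono x (unitv j) (l i)) (g j x)).
  { intros j; unfold g; destruct constructive_indefinite_description; auto. }
  exists g. split. { intros j. exists R0, (M * / R0); split; auto. apply Hg'. }
  exists (M * / R0 * / R0), (R0 / 2). split; [|split; [lra|]].
  { assert (0 <= M) by apply (HM 0%nat). assert (0 < / R0) by (apply Rinv_0_lt_compat; auto).
    repeat apply Rmult_le_pos; lra. }
  intros x w W Hx Hw [HW0 HW].
  assert (Hx1 : forall i, (i < k)%nat -> Rabs (x i) <= R0). { intros i Hi; specialize (Hx i Hi); lra. }
  assert (Hx2 : forall i, (i < k)%nat -> Rabs (x i + w i) <= R0).
  { intros i Hi; specialize (Hx i Hi); specialize (Hw i Hi). pose proof (Rabs_triang (x i) (w i)). lra. }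
  assert (HRr : R0 <= r) by (unfold R0; lra).
  assert (E : is_series (fun i => c i * (mono (vadd x w) (l i) - mono x (l i) - dmono x w (l i)))
       (f (vadd x w) - f x - sumn k (fun j => g j x * w j))).
  { assert (E1 : is_series (fun i => c i * mono (vadd x w) (l i)) (f (vadd x w))).
    { apply Hs. intros i Hi. unfold cst. specialize (Hx2 i Hi). unfold vadd; lra. }
    assert (E2 : is_series (fun i => c i * mono x (l i)) (f x)).
    { apply Hs. intros i Hi. unfold cst. specialize (Hx1 i Hi). lra. }
    assert (E3 : is_series (fun i => sumn k (fun j => c i * dmono x (unitv j) (l i) * w j)) (sumn k (fun j => g j x * w j))).
    { apply (is_series_sumn (fun j i => c i * dmono x (unitv j) (l i) * w j)). intros j _.
      rewrite Rmult_comm. eapply is_series_ext; [|apply (is_series_scal (w j) _ _ (proj2 (Hg' j) x Hx1))].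
      intros n; unfold scal; simpl; unfold mult; simpl; ring. }
    eapply is_series_ext; [|apply (is_series_minus _ _ _ _ (is_series_minus _ _ _ _ E1 E2) E3)].
    intros i. unfold minus, plus, opp; simpl. rewrite (dmono_lin k x w (l i)) by auto.
    rewrite (sumn_ext k (fun j => c i * dmono x (unitv j) (l i) * w j)
       (fun j => c i * (dmono x (unitv j) (l i) * w j))) by (intros; ring).
    rewrite sumn_scal. ring. }
  apply series_abs_bound with (1 := E). intros N.
  replace (M * / R0 * / R0 * W * W) with (M * (W / R0 * (W / R0))) by (field; lra).
  assert (0 <= W / R0) by (apply Rdiv_le_0_compat; lra).
  apply Rle_trans with (sumn N (fun i => (Rabs (c i) * (4 * R0) ^ length (l i)) * (W / R0 * (W / R0)))).
  - apply sumn_le; intros i _. rewrite Rabs_mult, Rmult_assoc. apply Rmult_le_compat_l; [apply Rabs_pos|].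
    apply mono_rem_bound with k; auto.
  - rewrite sumn_scal_r. apply Rmult_le_compat_r; auto. apply Rmult_le_pos; auto.
Qed.

(** * Weierstrass division *)

Definition axis (k : nat) (t : R) : Rvec := fun i => if Nat.eqb i k then t else 0.

Lemma pow_half_le n : 0 < (/ 2) ^ n <= 1.
Proof.
  split; [apply pow_lt; lra|]. induction n as [|n IH]; simpl; [lra|].
  assert (0 < (/ 2) ^ n) by (apply pow_lt; lra). lra.
Qed.

Lemma pow_small (y e : R) : 0 <= y < 1 -> 0 < e -> exists N, forall n, (N <= n)%nat -> y ^ n < e.
Proof.
  intros Hy He. destruct (pow_lt_1_zero y) with (y := e) as [N HN]; auto.
  - rewrite Rabs_pos_eq; lra.
  - exists N. intros n Hn. specialize (HN n Hn). rewrite Rabs_pos_eq in HN; auto. apply pow_le; lra.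
Qed.

(** Regularity of order [b] in the last variable: the [c i] vanish on the axis of [x k], where [f]
    is therefore [x k ^ b] times a unit. *)
Definition regular (k b : nat) (f : fn) : Prop :=
  exists r t (c : nat -> fn), 0 < r /\ (exists M, PS (S k) (cst r) M t) /\ t zerov <> 0 /\
    (forall i, (i < b)%nat -> (exists M, PS k (cst r) M (c i)) /\ c i zerov = 0) /\
    forall x, polyd (S k) (cst r) x -> f x = x k ^ b * t x + sumn b (fun i => c i x * x k ^ i).

(** If no order is regular, splitting off [x k] never meets a nonzero constant term. Then [f] at the
    axis point is bounded by [M * (|s| / rho k) ^ b] for every [b] and has to vanish. *)
Lemma regular_exists k rho M f r s : PS (S k) rho M f -> 0 < r ->
  (forall i, (i < S k)%nat -> r <= rho i) -> Rabs s < rho k -> f (axis k s) <> 0 ->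
  exists b, regular k b f.
Proof.
  intros Hf Hr Hrho Hs Hfs. apply NNPP; intros Hno.
  assert (Hp : posr (S k) rho). { intros i Hi. specialize (Hrho i Hi). lra. }
  assert (Hk : 0 < rho k) by (apply Hp; lia).
  assert (Hall : forall b, exists t c, PS (S k) rho (M / rho k ^ b) t /\
    (forall i, (i < b)%nat -> (exists M, PS k rho M (c i)) /\ c i zerov = 0) /\
    forall x, polyd (S k) rho x -> f x = x k ^ b * t x + sumn b (fun i => c i x * x k ^ i)).
  { induction b as [|b [t [c [Ht [Hc E]]]]].
    - exists f, (fun _ => f). split; [|split].
      + eapply PS_le; [|apply Hf]. simpl; lra.
      + intros; lia.
      + intros; simpl; ring.
    - destruct (PS_split1 k rho _ t Hp Ht) as [t' [r' [Ht' [Hr' E']]]].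
      exists t', (fun i => if Nat.eqb i b then r' else c i). split; [|split].
      + eapply PS_le; [|apply Ht']. right. simpl. field. split; [apply pow_nonzero|]; lra.
      + intros i Hi. destruct (Nat.eqb_spec i b) as [->|]; [|apply Hc; lia].
        split; [eauto|]. specialize (E' zerov (polyd_zero _ _ Hp)).
        unfold zerov at 2 in E'. rewrite Rmult_0_l, Rplus_0_l in E'. rewrite <- E'.
        apply NNPP; intros Hne. apply Hno. exists b, r, t, c. split; [auto|split; [|split; [auto|split]]].
        * eexists. apply PS_shrink with rho; eauto.
        * intros j Hj. destruct (Hc j Hj) as [[Mj HMj] Hj0]. split; auto.
          exists Mj. apply PS_shrink with rho; auto.
        * intros x Hx. apply E. intros j Hj. specialize (Hx j Hj). specialize (Hrho j Hj). unfold cst in Hx. lra.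
      + intros x Hx. rewrite E, E' by auto. simpl. rewrite Nat.eqb_refl.
        rewrite (sumn_ext b (fun i => (if Nat.eqb i b then r' else c i) x * x k ^ i) (fun i => c i x * x k ^ i)).
        ring. intros i Hi. rewrite (proj2 (Nat.eqb_neq i b)); auto; lia. }
  apply Hfs.
  assert (Hx : polyd (S k) rho (axis k s)).
  { intros i Hi. unfold axis. destruct (Nat.eqb_spec i k) as [->|]; [lra | rewrite Rabs_R0]. apply Rlt_le, Hp; auto. }
  assert (Hb : forall b, Rabs (f (axis k s)) <= M * (Rabs s / rho k) ^ b).
  { intros b. destruct (Hall b) as [t [c [Ht [Hc E]]]]. rewrite E by auto.
    rewrite sumn_zero.
    2:{ intros i Hi. destruct (Hc i Hi) as [[Mi Hci] H0].
        rewrite (PS_dep k rho Mi (c i) zerov (axis k s)); auto.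
        - rewrite H0; ring.
        - apply polyd_zero. intros j Hj; apply Hp; lia.
        - intros j Hj. unfold axis, zerov. rewrite (proj2 (Nat.eqb_neq j k)); auto; lia. }
    rewrite Rplus_0_r. replace (axis k s k) with s by (unfold axis; rewrite Nat.eqb_refl; auto).
    rewrite Rabs_mult, <- RPow_abs.
    pose proof (PS_bound _ _ _ _ _ Ht Hx) as Hbt.
    apply Rle_trans with (Rabs s ^ b * (M / rho k ^ b)).
    - apply Rmult_le_compat_l; auto. apply pow_le, Rabs_pos.
    - right. unfold Rdiv. rewrite Rpow_mult_distr, pow_inv. ring. }
  apply NNPP; intros Hne. assert (Hpos : 0 < Rabs (f (axis k s))) by (apply Rabs_pos_lt; auto).
  pose proof (PS_nonneg _ _ _ _ Hf) as HM.
  assert (Hy : 0 <= Rabs s / rho k < 1).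
  { split. apply Rdiv_le_0_compat; [apply Rabs_pos | auto]. apply Rlt_div_l; lra. }
  destruct (pow_small (Rabs s / rho k) (Rabs (f (axis k s)) / (M + 1)) Hy) as [N HN].
  { apply Rdiv_lt_0_compat; lra. }
  specialize (HN N (Nat.le_refl N)). specialize (Hb N).
  assert ((Rabs s / rho k) ^ N * (M + 1) < Rabs (f (axis k s))).
  { apply Rlt_div_r in HN; lra. }
  assert (0 <= (Rabs s / rho k) ^ N) by (apply pow_le; lra). nra.
Qed.

Lemma geom_sum_le C N : 0 <= C -> sumn N (fun j => C * (/ 2) ^ j) <= 2 * C.
Proof.
  intros HC. assert (H : sumn N (fun j => C * (/ 2) ^ j) = 2 * C * (1 - (/ 2) ^ N)).
  { induction N as [|N IH]; simpl; [ring|]. rewrite IH. field. }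
  rewrite H. pose proof (pow_half_le N). nra.
Qed.

(* One step of the division algorithm leaves a rest of half the norm; iterating gives
   the quotient and the remainder as geometrically convergent series. *)
Lemma division_by_contraction k rho b f g0 p Mp : posr (S k) rho -> g0 <> 0 ->
  PS (S k) rho (Rabs g0 * rho k ^ b / 2) (fun x => f x - g0 * x k ^ b) -> PS (S k) rho Mp p ->
  exists q (c : nat -> fn), (exists M, PS (S k) rho M q) /\ (forall i, (i < b)%nat -> exists M, PS k rho M (c i)) /\
    forall x, polyd (S k) rho x -> p x = q x * f x + sumn b (fun i => c i x * x k ^ i).
Proof.
  intros Hr Hg0 Hu Hp.
  assert (Hk : 0 < rho k) by (apply Hr; lia).
  assert (Hkb : 0 < rho k ^ b) by (apply pow_lt; auto).
  assert (Hg : 0 < Rabs g0) by (apply Rabs_pos_lt; auto).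
  assert (HMp := PS_nonneg _ _ _ _ Hp).
  set (D := / (Rabs g0 * rho k ^ b)).
  assert (HD : 0 < D) by (apply Rinv_0_lt_compat, Rmult_lt_0_compat; auto).
  assert (Hrk : posr k rho) by (intros i Hi; apply Hr; lia).
  (* In [P = x_k^b T + sum c_i x_k^i] the power [x_k^b] is replaced by [f / g0] at the cost of
     [T (f - g0 x_k^b) / g0], which has bound [m / 2] by the hypothesis on [f - g0 x_k^b]. *)
  assert (Hstep : forall m P, PS (S k) rho m P -> exists T : fn * (nat -> fn) * fn,
     PS (S k) rho (D * m) (fst (fst T)) /\ (forall i, (i < b)%nat -> PS k rho (m / rho k ^ i) (snd (fst T) i)) /\
     PS (S k) rho (m * / 2) (snd T) /\
     forall x, polyd (S k) rho x -> P x = fst (fst T) x * f x + sumn b (fun i => snd (fst T) i x * x k ^ i) + snd T x).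
  { intros m P HP. destruct (PS_split k rho m P b Hr HP) as [T [c [HT [Hc E]]]].
    assert (HQ : PS (S k) rho (D * m) (fun x => / g0 * T x)).
    { eapply PS_le; [|apply PS_scal, HT]. right. unfold D. rewrite Rabs_inv. field. lra. }
    exists ((fun x => / g0 * T x), c, (fun x => (-1) * ((/ g0 * T x) * (f x - g0 * x k ^ b)))).
    simpl. split; [auto|split; [auto|split]].
    - eapply PS_le; [|apply PS_scal, PS_mult; [auto|apply HQ|apply Hu]].
      right. replace (Rabs (-1)) with 1 by (rewrite Rabs_left; lra). unfold D. field. lra.
    - intros x Hx. rewrite E by auto. field. auto. }
  set (step := fun m (P : {P | PS (S k) rho m P}) =>
     constructive_indefinite_description _ (Hstep m (proj1_sig P) (proj2_sig P))).
  set (m := fun j => Mp * (/ 2) ^ j).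
  assert (Hm : forall j, m j * / 2 = m (S j)) by (intros j; unfold m; simpl; ring).
  assert (Hm0 : forall j, 0 <= m j). { intros j; unfold m. apply Rmult_le_pos; auto. apply pow_le; lra. }
  assert (Hp0 : PS (S k) rho (m 0%nat) p). { unfold m; simpl. rewrite Rmult_1_r; auto. }
  (* The iterates carry their bound in the type, because a step can be taken only from a series with
     a known bound; [eq_rect] rewrites [m j / 2] as [m (S j)]. *)
  set (sq := fix sq j : {P | PS (S k) rho (m j) P} :=
    match j with
    | O => exist _ p Hp0
    | S j' => exist _ (snd (proj1_sig (step (m j') (sq j'))))
        (eq_rect _ (fun y => PS (S k) rho y (snd (proj1_sig (step (m j') (sq j')))))
          (proj1 (proj2 (proj2 (proj2_sig (step (m j') (sq j')))))) _ (Hm j'))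
    end).
  set (Pj := fun j => proj1_sig (sq j)).
  set (Q := fun j => fst (fst (proj1_sig (step (m j) (sq j))))).
  set (c := fun j => snd (fst (proj1_sig (step (m j) (sq j))))).
  assert (HPj : forall j, PS (S k) rho (m j) (Pj j)) by (intros j; apply (proj2_sig (sq j))).
  assert (HQ : forall j, PS (S k) rho (D * m j) (Q j)).
  { intros j. apply (proj2_sig (step (m j) (sq j))). }
  assert (Hc : forall j i, (i < b)%nat -> PS k rho (m j / rho k ^ i) (c j i)).
  { intros j. apply (proj2_sig (step (m j) (sq j))). }
  assert (HE : forall j x, polyd (S k) rho x ->
     Pj j x = Q j x * f x + sumn b (fun i => c j i x * x k ^ i) + Pj (S j) x).
  { intros j. apply (proj2_sig (step (m j) (sq j))). }
  assert (Hsum : forall C, 0 <= C -> forall N, sumn N (fun j => C * m j) <= 2 * (C * Mp)).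
  { intros C HC N. rewrite (sumn_ext _ _ (fun j => (C * Mp) * (/ 2) ^ j)) by (intros; unfold m; ring).
    apply geom_sum_le. apply Rmult_le_pos; auto. }
  assert (HQs : forall x, polyd (S k) rho x -> is_series (fun j => Q j x) (Series (fun j => Q j x))).
  { intros x Hx. apply Series_correct.
    destruct (abs_series_ex (fun j => Q j x) (fun j => D * m j) (2 * (D * Mp))) as [s [E _]].
    - intros n. apply PS_bound with (1 := HQ n); auto.
    - apply Hsum; lra.
    - exists s; auto. }
  assert (Hcs : forall i x, (i < b)%nat -> polyd k rho x -> is_series (fun j => c j i x) (Series (fun j => c j i x))).
  { intros i x Hi Hx. apply Series_correct.
    destruct (abs_series_ex (fun j => c j i x) (fun j => / rho k ^ i * m j) (2 * (/ rho k ^ i * Mp))) as [s [E _]].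
    - intros n. rewrite Rmult_comm. apply PS_bound with (1 := Hc n i Hi); auto.
    - apply Hsum. apply Rlt_le, Rinv_0_lt_compat, pow_lt; auto.
    - exists s; auto. }
  exists (fun x => Series (fun j => Q j x)), (fun i x => Series (fun j => c j i x)).
  split; [|split].
  - exists (2 * (D * Mp)). apply (PS_series (S k) rho (fun j => D * m j) Q); auto. apply Hsum; lra.
  - intros i Hi. exists (2 * (/ rho k ^ i * Mp)).
    apply (PS_series k rho (fun j => / rho k ^ i * m j) (fun j => c j i)); auto.
    + intros j. rewrite Rmult_comm. apply Hc; auto.
    + apply Hsum. apply Rlt_le, Rinv_0_lt_compat, pow_lt; auto.
  - intros x Hx. assert (Hx' : polyd k rho x) by (intros i Hi; apply Hx; lia).
    apply is_series_uniq with (fun j => Q j x * f x + sumn b (fun i => c j i x * x k ^ i)).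
    + assert (Hpart : forall N, sumn N (fun j => Q j x * f x + sumn b (fun i => c j i x * x k ^ i)) = p x - Pj N x).
      { induction N as [|N IH]; simpl.
        - unfold Pj; simpl. ring.
        - rewrite IH. pose proof (HE N x Hx). lra. }
      apply is_series_of_limsum. intros e He.
      destruct (pow_small (/ 2) (e / (Mp + 1))) as [N HN]; [lra|apply Rdiv_lt_0_compat; lra|].
      exists N. intros n Hn. rewrite Hpart. replace (p x - Pj n x - p x) with (- Pj n x) by ring.
      rewrite Rabs_Ropp. eapply Rle_lt_trans; [apply PS_bound with (1 := HPj n); auto|].
      specialize (HN n Hn). apply Rlt_div_r in HN; [|lra]. unfold m. pose proof (pow_half_le n). nra.
    + assert (E1 : is_series (fun j => Q j x * f x) (Series (fun j => Q j x) * f x)).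
      { rewrite Rmult_comm. eapply is_series_ext; [|apply (is_series_scal (f x) _ _ (HQs x Hx))].
        intros n; unfold scal; simpl; unfold mult; simpl; ring. }
      apply (is_series_plus _ _ _ _ E1).
      apply (is_series_sumn (fun i j => c j i x * x k ^ i)). intros i Hi.
      rewrite Rmult_comm. eapply is_series_ext; [|apply (is_series_scal (x k ^ i) _ _ (Hcs i x Hi Hx'))].
      intros n; unfold scal; simpl; unfold mult; simpl; ring.
Qed.

Lemma PS_common_radius k b (c : nat -> fn) : (forall i, (i < b)%nat -> Og k (c i)) ->
  exists r, 0 < r /\ forall i, (i < b)%nat -> exists M, PS k (cst r) M (c i).
Proof.
  induction b as [|b IH]; intros H.
  - exists 1; split; [lra|]. intros; lia.
  - destruct IH as [r [Hr IH]]; auto. destruct (H b) as [r' [M [Hr' HM]]]; [lia|].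
    exists (Rmin r r'). assert (0 < Rmin r r') by (apply Rmin_pos; auto).
    pose proof (Rmin_l r r'); pose proof (Rmin_r r r'). split; auto.
    intros i Hi. destruct (Nat.eq_dec i b) as [->|].
    + exists M. apply PS_cst_shrink with r'; auto.
    + destruct (IH i) as [M' HM']; [lia|]. exists M'. apply PS_cst_shrink with r; auto.
Qed.

(** The radius [s] in the last variable is fixed first, so small that [t] is close to [t zerov]. The
    other radii [dl] are then taken so small that the coefficients [c i], which vanish at 0, are
    small against [s ^ b]. Each of the two errors is at most [|g0| s^b / 4], and together they
    satisfy the hypothesis of the contraction. *)
Theorem weierstrass_division k b f p : regular k b f -> Og (S k) p ->
  exists q (c : nat -> fn), Og (S k) q /\ (forall i, (i < b)%nat -> Og k (c i)) /\
    near (S k) (fun x => p x = q x * f x + sumn b (fun i => c i x * x k ^ i)).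
Proof.
  intros [r [t [c [Hr [[M Ht] [Ht0 [Hc E]]]]]]] [rp [Mp [Hrp Hp]]].
  set (g0 := t zerov) in *.
  assert (Hg : 0 < Rabs g0) by (apply Rabs_pos_lt; auto).
  assert (HM := PS_nonneg _ _ _ _ Ht).
  assert (Htm : PS (S k) (cst r) (M + Rabs (- g0)) (fun x => t x + - g0)).
  { apply PS_plus; auto using posr_cst. apply PS_const, posr_cst; auto. }
  rewrite Rabs_Ropp in Htm. set (M1 := M + Rabs g0) in *.
  assert (HM1 : 0 < M1) by (unfold M1; lra).
  set (th := Rmin 1 (Rabs g0 / (4 * M1))).
  assert (Hth : 0 < th <= 1).
  { split; [|apply Rmin_l]. apply Rmin_pos; [lra|]. apply Rdiv_lt_0_compat; lra. }
  assert (HthM : th * M1 <= Rabs g0 / 4).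
  { apply Rle_trans with (Rabs g0 / (4 * M1) * M1). apply Rmult_le_compat_r; [lra|apply Rmin_r].
    right; field; lra. }
  set (s := Rmin (th * r) rp).
  assert (Hs : 0 < s). { apply Rmin_pos; auto. apply Rmult_lt_0_compat; lra. }
  assert (Hsr : s <= th * r) by apply Rmin_l. assert (Hsp : s <= rp) by apply Rmin_r.
  assert (Hsb : 0 < s ^ b) by (apply pow_lt; auto).
  assert (Hex : exists Mi : nat -> R, forall i, (i < b)%nat -> PS k (cst r) (Mi i) (c i)).
  { exists (fun i => epsilon (inhabits 0) (fun M => PS k (cst r) M (c i))).
    intros i Hi. apply (epsilon_spec (inhabits 0) (fun M => PS k (cst r) M (c i))). apply Hc; auto. }
  destruct Hex as [Mi HMi].
  set (T := sumn b (fun i => Mi i * s ^ i)).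
  assert (HT : 0 <= T).
  { apply sumn_nonneg. intros i Hi. apply Rmult_le_pos; [|apply pow_le; lra].
    eapply PS_nonneg, HMi; auto. }
  set (th2 := Rmin 1 (Rabs g0 * s ^ b / (4 * (T + 1)))).
  assert (Hgs : 0 < Rabs g0 * s ^ b) by (apply Rmult_lt_0_compat; auto).
  assert (Hth2 : 0 < th2 <= 1).
  { split; [|apply Rmin_l]. apply Rmin_pos; [lra|]. apply Rdiv_lt_0_compat; lra. }
  assert (HthT : th2 * T <= Rabs g0 * s ^ b / 4).
  { apply Rle_trans with (Rabs g0 * s ^ b / (4 * (T + 1)) * (T + 1)).
    - apply Rmult_le_compat; try lra. apply Rmin_r.
    - right; field; lra. }
  set (dl := Rmin (th2 * r) s).
  assert (Hdl : 0 < dl). { apply Rmin_pos; auto. apply Rmult_lt_0_compat; lra. }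
  assert (Hdr : dl <= th2 * r) by apply Rmin_l. assert (Hds : dl <= s) by apply Rmin_r.
  set (rho := fun i => if Nat.eqb i k then s else dl).
  assert (Hrk : rho k = s) by (unfold rho; rewrite Nat.eqb_refl; auto).
  assert (Hpr : posr (S k) rho). { intros i _; unfold rho; destruct (Nat.eqb i k); auto. }
  assert (Hle : forall i, rho i <= s). { intros i; unfold rho; destruct (Nat.eqb i k); lra. }
  assert (Hthr : th * r <= r) by nra.
  assert (Hu : PS (S k) rho (Rabs g0 * rho k ^ b / 2) (fun x => f x - g0 * x k ^ b)).
  { rewrite Hrk.
    assert (H1 : PS (S k) rho (s ^ b * (th * M1)) (fun x => x k ^ b * (t x + - g0))).
    { apply PS_mult; auto.
      - rewrite <- Hrk. apply PS_xpow; auto.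
      - apply PS_vanish with (cst r); auto using posr_cst.
        + intros i Hi. split; [apply Hpr; auto|]. unfold cst. specialize (Hle i); lra.
        + unfold g0; ring. }
    assert (H2 : PS (S k) rho (sumn b (fun i => th2 * Mi i * s ^ i)) (fun x => sumn b (fun i => c i x * x k ^ i))).
    { apply PS_sumn; auto. intros i Hi. apply PS_mult; auto.
      - apply PS_widen with k; [lia|]. apply PS_vanish with (cst r); auto using posr_cst.
        + intros j Hj. unfold rho. rewrite (proj2 (Nat.eqb_neq j k)) by lia. unfold cst; lra.
        + apply Hc; auto.
      - rewrite <- Hrk. apply PS_xpow; auto. }
    eapply PS_ext; [|eapply PS_le; [|apply PS_plus; [auto|apply H1|apply H2]]].
    - intros x Hx. rewrite E; [ring|]. intros i Hi. specialize (Hx i Hi). specialize (Hle i). unfold cst. lra.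
    - rewrite (sumn_ext b _ (fun i => th2 * (Mi i * s ^ i))) by (intros; ring).
      rewrite sumn_scal. fold T. assert (s ^ b * (th * M1) <= s ^ b * (Rabs g0 / 4)).
      { apply Rmult_le_compat_l; lra. } lra. }
  assert (Hp' : PS (S k) rho Mp p).
  { apply PS_shrink with (cst rp); auto. intros i Hi. unfold cst. split; [apply Hpr; auto|]. specialize (Hle i); lra. }
  destruct (division_by_contraction k rho b f g0 p Mp Hpr Ht0 Hu Hp') as [q [cc [[Mq Hq] [Hcc Eq]]]].
  assert (Hmin : forall i, dl <= rho i). { intros i; unfold rho; destruct (Nat.eqb i k); lra. }
  exists q, cc. split; [|split].
  - exists dl, Mq; split; auto. apply PS_shrink with rho; auto.
  - intros i Hi. destruct (Hcc i Hi) as [Mc HMc]. exists dl, Mc; split; auto. apply PS_shrink with rho; auto.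
  - exists dl; split; auto. intros x Hx. apply Eq. intros i Hi. specialize (Hx i Hi). specialize (Hmin i). lra.
Qed.

(** The constant term is [O(t)] and hence zero; dividing by [t] lowers degree and order together. *)
Lemma poly_order_vanish b (a : nat -> R) B e : 0 < e ->
  (forall t, 0 < t < e -> Rabs (sumn b (fun i => a i * t ^ i)) <= B * t ^ b) ->
  forall i, (i < b)%nat -> a i = 0.
Proof.
  revert a; induction b as [|b IH]; intros a He H; [intros; lia|].
  assert (HS : forall t, sumn (S b) (fun i => a i * t ^ i) = a 0%nat + t * sumn b (fun i => a (S i) * t ^ i)).
  { intros t. rewrite sumn_S_l, <- sumn_scal. simpl. rewrite Rmult_1_r. f_equal.
    apply sumn_ext; intros; ring. }
  assert (H0 : a 0%nat = 0).
  { apply NNPP; intros Hne. assert (Hpos : 0 < Rabs (a 0%nat)) by (apply Rabs_pos_lt; auto).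
    set (K := Rabs B + sumn b (fun i => Rabs (a (S i)))).
    assert (HK : 0 <= K).
    { apply Rplus_le_le_0_compat; [apply Rabs_pos | apply sumn_nonneg; intros; apply Rabs_pos]. }
    set (t := Rmin (e / 2) (Rmin 1 (Rabs (a 0%nat) / (2 * (K + 1))))).
    assert (Hq : 0 < Rabs (a 0%nat) / (2 * (K + 1))) by (apply Rdiv_lt_0_compat; lra).
    assert (Ht : 0 < t) by (repeat apply Rmin_pos; lra).
    assert (Ht1 : t <= e / 2) by apply Rmin_l.
    assert (Ht2 : t <= 1). { eapply Rle_trans; [apply Rmin_r | apply Rmin_l]. }
    assert (Ht3 : t <= Rabs (a 0%nat) / (2 * (K + 1))). { eapply Rle_trans; [apply Rmin_r | apply Rmin_r]. }
    specialize (H t ltac:(lra)). rewrite HS in H.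
    assert (Hpw : forall i, 0 <= t ^ i <= 1).
    { intros i; split; [apply pow_le; lra|]. rewrite <- (pow1 i). apply pow_incr; lra. }
    assert (H1 : Rabs (t * sumn b (fun i => a (S i) * t ^ i)) <= t * sumn b (fun i => Rabs (a (S i)))).
    { rewrite Rabs_mult, (Rabs_pos_eq t) by lra. apply Rmult_le_compat_l; [lra|].
      eapply Rle_trans; [apply sumn_Rabs|]. apply sumn_le; intros i _.
      rewrite Rabs_mult, (Rabs_pos_eq (t ^ i)) by apply Hpw. pose proof (Hpw i). pose proof (Rabs_pos (a (S i))). nra. }
    assert (H2 : B * t ^ S b <= t * Rabs B).
    { simpl. pose proof (Hpw b). pose proof (Rle_abs B). pose proof (Rabs_pos B).
      apply Rle_trans with (Rabs B * (t * t ^ b)). apply Rmult_le_compat_r; [nra|lra].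
      rewrite (Rmult_comm t (Rabs B)). apply Rmult_le_compat_l; auto.
      rewrite <- (Rmult_1_r t) at 3. apply Rmult_le_compat_l; lra. }
    assert (H3 : Rabs (a 0%nat) <= t * K).
    { replace (a 0%nat) with ((a 0%nat + t * sumn b (fun i => a (S i) * t ^ i)) + - (t * sumn b (fun i => a (S i) * t ^ i))) by ring.
      eapply Rle_trans; [apply Rabs_triang|]. rewrite Rabs_Ropp. unfold K. lra. }
    assert (t * (2 * (K + 1)) <= Rabs (a 0%nat)).
    { apply Rle_div_r in Ht3; lra. } nra. }
  intros [|i] Hi; auto. apply (IH (fun i => a (S i)) He); [|lia].
  intros t Ht. specialize (H t Ht). rewrite HS, H0, Rplus_0_l, Rabs_mult, (Rabs_pos_eq t) in H by lra.
  simpl in H. apply Rmult_le_reg_l with t; [lra|]. lra.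
Qed.

(** Obtained by dividing [x k ^ b] by [f]. On the axis [f] is of order [b], so the remainder, of
    degree below [b], is [O(s^b)] there and its coefficients vanish at 0. *)
Lemma weierstrass_polynomial k b f : regular k b f ->
  exists q (c : nat -> fn), Og (S k) q /\ (forall i, (i < b)%nat -> Og k (c i) /\ c i zerov = 0) /\
    near (S k) (fun x => x k ^ b + sumn b (fun i => c i x * x k ^ i) = q x * f x).
Proof.
  intros Hreg. destruct (weierstrass_division k b f (fun x => x k ^ b) Hreg) as [q [c [Hq [Hc E]]]].
  { apply Og_pow, Og_coord; lia. }
  assert (H0 : forall i, (i < b)%nat -> c i zerov = 0).
  { destruct Hreg as [r [t [c' [Hr [[M Ht] [Ht0 [Hc' Ef]]]]]]].
    assert (HcS : forall i, (i < b)%nat -> Og k (c i)) by auto.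
    destruct (PS_common_radius k b c HcS) as [rc [Hrc Hcc]].
    destruct (Og_bounded _ _ Hq) as [Bq HBq].
    destruct (near_and _ _ _ E HBq) as [e [He HEB]].
    set (d := Rmin e (Rmin r rc)).
    assert (Hd : 0 < d) by (repeat apply Rmin_pos; auto).
    assert (Hd1 : d <= e) by apply Rmin_l.
    assert (Hd2 : d <= r). { eapply Rle_trans; [apply Rmin_r | apply Rmin_l]. }
    assert (Hd3 : d <= rc). { eapply Rle_trans; [apply Rmin_r | apply Rmin_r]. }
    assert (Hdep : forall rr M' g s, PS k (cst rr) M' g -> 0 < rr -> g (axis k s) = g zerov).
    { intros rr M' g s Hg Hrr. apply PS_dep with (1 := Hg).
      - apply polyd_zero, posr_cst; auto.
      - intros j Hj. unfold axis, zerov. rewrite (proj2 (Nat.eqb_neq j k)); auto; lia. }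
    apply (poly_order_vanish b (fun i => c i zerov) (1 + Bq * M) d Hd).
    intros s Hs.
    assert (Hax : forall i, Rabs (axis k s i) <= s).
    { intros i; unfold axis. destruct (Nat.eqb i k); [rewrite Rabs_pos_eq|rewrite Rabs_R0]; lra. }
    assert (Hxk : axis k s k = s) by (unfold axis; rewrite Nat.eqb_refl; auto).
    destruct (HEB (axis k s)) as [E1 B1]. { intros i _. specialize (Hax i). lra. }
    rewrite Hxk in E1.
    rewrite (sumn_ext b (fun i => c i zerov * s ^ i) (fun i => c i (axis k s) * s ^ i)).
    2:{ intros i Hi. destruct (Hcc i Hi) as [Mi HMi]. rewrite (Hdep rc Mi (c i) s); auto. }
    assert (Hpx : polyd (S k) (cst r) (axis k s)). { intros i _. unfold cst. specialize (Hax i). lra. }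
    assert (Ef1 := Ef _ Hpx). rewrite Hxk in Ef1.
    rewrite (sumn_zero b (fun i => c' i (axis k s) * s ^ i)) in Ef1.
    2:{ intros i Hi. destruct (Hc' i Hi) as [[Mi HMi] Hz]. rewrite (Hdep r Mi (c' i) s); auto.
        rewrite Hz; ring. }
    replace (sumn b (fun i => c i (axis k s) * s ^ i)) with (s ^ b * (1 - q (axis k s) * t (axis k s))).
    2:{ rewrite Ef1 in E1. lra. }
    assert (Hsb : 0 < s ^ b) by (apply pow_lt; lra).
    rewrite Rabs_mult, (Rabs_pos_eq (s ^ b)), (Rmult_comm (s ^ b)) by lra.
    apply Rmult_le_compat_r; [lra|].
    pose proof (PS_bound _ _ _ _ _ Ht Hpx) as Bt.
    replace (1 - q (axis k s) * t (axis k s)) with (1 + - (q (axis k s) * t (axis k s))) by ring.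
    eapply Rle_trans; [apply Rabs_triang|]. rewrite Rabs_Ropp, Rabs_R1, Rabs_mult.
    apply Rplus_le_compat_l. apply Rmult_le_compat; auto using Rabs_pos. }
  exists q, (fun i x => - 1 * c i x). split; [auto|split].
  - intros i Hi. split. apply Og_scal; auto. rewrite H0; auto; ring.
  - eapply near_mono; [|apply E]. intros x Hx; cbv beta in Hx.
    rewrite (sumn_ext b (fun i => -1 * c i x * x k ^ i) (fun i => -1 * (c i x * x k ^ i))) by (intros; ring).
    rewrite sumn_scal. lra.
Qed.

Lemma regular_monic k b (c : nat -> fn) : (forall i, (i < b)%nat -> Og k (c i) /\ c i zerov = 0) ->
  regular k b (fun x => x k ^ b + sumn b (fun i => c i x * x k ^ i)).
Proof.
  intros Hc. destruct (PS_common_radius k b c) as [r [Hr H]]. { intros i Hi; apply Hc; auto. }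
  exists r, (fun _ => 1), c. split; auto. split; [|split; [lra|split]].
  - exists 1. apply PS_one, posr_cst; auto.
  - intros i Hi; split; auto. apply Hc; auto.
  - intros; ring.
Qed.

(** * Analytic germs along a sequence *)

Definition bdd (u : nat -> R) : Prop := exists B N, forall m, (N <= m)%nat -> Rabs (u m) <= B.

(* The instances are the sequences that vanish along an ultrafilter, and those that are smaller
   along it than every power of a given null sequence. *)
Record prime_ideal (small : (nat -> R) -> Prop) : Prop := {
  sm_ev : forall u v, (exists N, forall m, (N <= m)%nat -> u m = v m) -> small u -> small v;
  sm_zero : small (fun _ => 0);
  sm_add : forall u v, small u -> small v -> small (fun m => u m + v m);
  sm_mul : forall u v, bdd v -> small u -> small (fun m => v m * u m);
  sm_prime : forall u v, bdd u -> bdd v -> small (fun m => u m * v m) -> small u \/ small v;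
  sm_one : ~ small (fun _ => 1) }.

Definition tend0 (k : nat) (x : nat -> Rvec) : Prop :=
  forall i, (i < k)%nat -> forall e, 0 < e -> exists N, forall m, (N <= m)%nat -> Rabs (x m i) < e.

Definition scalv (t : R) (V : Rvec) : Rvec := fun i => t * V i.

Definition ddir (f : fn) (x V : Rvec) (l : R) : Prop :=
  derivable_pt_lim (fun t => f (vadd x (scalv t V))) 0 l.

Lemma near_ev k x Q : near k Q -> tend0 k x -> exists N, forall m, (N <= m)%nat -> Q (x m).
Proof.
  intros [e [He H]] Hx.
  assert (HN : exists N, forall m, (N <= m)%nat -> forall i, (i < k)%nat -> Rabs (x m i) < e).
  { clear H. induction k as [|k IH].
    - exists 0%nat; intros; lia.
    - destruct IH as [N HN]. { intros i Hi; apply Hx; lia. }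
      destruct (Hx k (Nat.lt_succ_diag_r k) e He) as [N' HN'].
      exists (Nat.max N N'). intros m Hm i Hi.
      destruct (Nat.eq_dec i k) as [->|]; [apply HN' | apply HN]; lia. }
  destruct HN as [N HN]. exists N. auto.
Qed.

Lemma Og_bdd k x f : Og k f -> tend0 k x -> bdd (fun m => f (x m)).
Proof.
  intros Hf Hx. destruct (Og_bounded k f Hf) as [B HB].
  destruct (near_ev k x _ HB Hx) as [N HN]. exists B, N; auto.
Qed.

Lemma bdd_mul u v : bdd u -> bdd v -> bdd (fun m => u m * v m).
Proof.
  intros [B [N H]] [B' [N' H']]. exists (B * B'), (Nat.max N N'). intros m Hm. rewrite Rabs_mult.
  apply Rmult_le_compat; auto using Rabs_pos; [apply H | apply H']; lia.
Qed.

Lemma bdd_const c : bdd (fun _ => c).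
Proof. exists (Rabs c), 0%nat. intros; lra. Qed.

Lemma bdd_add u v : bdd u -> bdd v -> bdd (fun m => u m + v m).
Proof.
  intros [B [N H]] [B' [N' H']]. exists (B + B'), (Nat.max N N'). intros m Hm.
  eapply Rle_trans; [apply Rabs_triang|]. apply Rplus_le_compat; [apply H | apply H']; lia.
Qed.

Lemma bdd_sumn n (u : nat -> nat -> R) : (forall j, (j < n)%nat -> bdd (u j)) -> bdd (fun m => sumn n (fun j => u j m)).
Proof.
  induction n as [|n IH]; intros H; simpl. apply bdd_const. apply bdd_add; auto.
Qed.

Lemma sm_eq small u v : prime_ideal small -> (forall m, u m = v m) -> small u -> small v.
Proof. intros HS H. apply (sm_ev _ HS). exists 0%nat; auto. Qed.

Lemma Tot_ddir k f g : Tot k f g -> near k (fun x => forall V, ddir f x V (sumn k (fun j => g j x * V j))).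
Proof.
  intros [C [e [HC [He H]]]]. exists e; split; auto. intros x Hx V. unfold ddir.
  set (W := 1 + sumn k (fun j => Rabs (V j))).
  assert (HV : forall i, (i < k)%nat -> Rabs (V i) <= W).
  { intros i Hi. pose proof (sumn_term_le k (fun j => Rabs (V j)) i (fun j _ => Rabs_pos _) Hi). unfold W; lra. }
  assert (HW : 1 <= W).
  { pose proof (sumn_nonneg k (fun j => Rabs (V j)) (fun j _ => Rabs_pos _)). unfold W; lra. }
  intros eps Heps.
  assert (HCW : 0 < C * W * W + 1) by nra.
  assert (Hd : 0 < Rmin (e / W) (eps / (C * W * W + 1))).
  { apply Rmin_pos; apply Rdiv_lt_0_compat; lra. }
  exists (mkposreal _ Hd). simpl. intros h Hh Hhd.
  assert (Hh1 : Rabs h < e / W) by (pose proof (Rmin_l (e / W) (eps / (C * W * W + 1))); lra).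
  assert (Hh2 : Rabs h < eps / (C * W * W + 1)) by (pose proof (Rmin_r (e / W) (eps / (C * W * W + 1))); lra).
  assert (Hpos : 0 < Rabs h) by (apply Rabs_pos_lt; auto).
  apply Rlt_div_r in Hh1; [|lra]. apply Rlt_div_r in Hh2; [|lra].
  assert (E0 : vadd x (scalv 0 V) = x).
  { apply functional_extensionality; intros i; unfold vadd, scalv; ring. }
  rewrite Rplus_0_l, E0.
  specialize (H x (scalv h V) (Rabs h * W) Hx).
  assert (Hb : Rabs (f (vadd x (scalv h V)) - f x - h * sumn k (fun j => g j x * V j)) <= C * (Rabs h * W) * (Rabs h * W)).
  { rewrite <- sumn_scal. rewrite (sumn_ext k (fun j => h * (g j x * V j)) (fun j => g j x * scalv h V j)).
    - apply H; [|split; [nra|lra]]. intros i Hi. unfold scalv. rewrite Rabs_mult.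
      apply Rmult_le_compat_l; auto using Rabs_pos.
    - intros; unfold scalv; ring. }
  replace ((f (vadd x (scalv h V)) - f x) / h - sumn k (fun j => g j x * V j)) with
    ((f (vadd x (scalv h V)) - f x - h * sumn k (fun j => g j x * V j)) / h) by (field; auto).
  unfold Rdiv. rewrite Rabs_mult, Rabs_inv. apply Rmult_lt_reg_r with (Rabs h); auto.
  rewrite Rmult_assoc, Rinv_l by lra. rewrite Rmult_1_r.
  eapply Rle_lt_trans; [apply Hb|]. nra.
Qed.

Lemma Og_lip k f : Og k f -> exists L e, 0 <= L /\ 0 < e /\ forall x y W,
  (forall i, (i < k)%nat -> Rabs (x i) < e) -> (forall i, (i < k)%nat -> Rabs (y i - x i) <= W) -> 0 <= W < e ->
  Rabs (f y - f x) <= L * W.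
Proof.
  intros Hf. destruct (Og_Tot k f Hf) as [g [Hg [C [e [HC [He H]]]]]].
  assert (HB : exists B, 0 <= B /\ near k (fun x => forall j, (j < k)%nat -> Rabs (g j x) <= B)).
  { clear -Hg. assert (Hgen : forall n, exists B, 0 <= B /\ near k (fun x => forall j, (j < n)%nat -> Rabs (g j x) <= B)).
    { induction n as [|n [B [HB0 HB]]].
      - exists 0; split; [lra|]. exists 1; split; [lra|]. intros x Hx j Hj; lia.
      - destruct (Og_bounded k (g n) (Hg n)) as [B' HB'].
        exists (Rmax B B'). split. { eapply Rle_trans; [apply HB0 | apply Rmax_l]. }
        eapply near_mono; [|apply (near_and _ _ _ HB HB')]. intros x [H1 H2] j Hj.
        destruct (Nat.eq_dec j n) as [->|].
        + eapply Rle_trans; [apply H2 | apply Rmax_r].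
        + eapply Rle_trans; [apply H1; lia | apply Rmax_l]. }
    apply Hgen. }
  destruct HB as [B [HB0 [e' [He' HB]]]].
  exists (C * e + INR k * B), (Rmin e e').
  split; [|split; [apply Rmin_pos; auto|]].
  { apply Rplus_le_le_0_compat; apply Rmult_le_pos; auto using pos_INR; lra. }
  pose proof (Rmin_l e e'); pose proof (Rmin_r e e').
  intros x y W Hx Hy HW.
  assert (Hx1 : forall i, (i < k)%nat -> Rabs (x i) < e) by (intros i Hi; specialize (Hx i Hi); lra).
  assert (Hx2 : forall i, (i < k)%nat -> Rabs (x i) < e') by (intros i Hi; specialize (Hx i Hi); lra).
  set (w := fun i => y i - x i).
  assert (Ey : y = vadd x w) by (apply functional_extensionality; intros; unfold vadd, w; ring).
  specialize (H x w W Hx1 Hy ltac:(lra)). rewrite <- Ey in H.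
  assert (Hs : Rabs (sumn k (fun j => g j x * w j)) <= INR k * B * W).
  { rewrite Rmult_assoc, <- sumn_const. eapply Rle_trans; [apply sumn_Rabs | apply sumn_le].
    intros j Hj. rewrite Rabs_mult. apply Rmult_le_compat; auto using Rabs_pos. apply Hy; auto. }
  replace (f y - f x) with ((f y - f x - sumn k (fun j => g j x * w j)) + sumn k (fun j => g j x * w j)) by ring.
  eapply Rle_trans; [apply Rabs_triang|].
  assert (C * W * W <= C * e * W) by (apply Rmult_le_compat_r; [lra|]; apply Rmult_le_compat_l; lra). lra.
Qed.

(** The vectors are given only at the points [x m]; they define a derivation from germs to sequences
    that sends [P] to small sequences. The second clause excludes a field that is itself small. *)
Definition tangent_field (k : nat) (x : nat -> Rvec) (small : (nat -> R) -> Prop) (V : nat -> Rvec) : Prop :=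
  (forall j, (j < k)%nat -> bdd (fun m => V m j)) /\ (exists j, (j < k)%nat /\ ~ small (fun m => V m j)) /\
  forall p, Og k p -> small (fun m => p (x m)) ->
    exists u, small u /\ exists N, forall m, (N <= m)%nat -> ddir p (x m) (V m) (u m).

Definition not_isolated (k : nat) (ps : list fn) (y : Rvec) : Prop :=
  forall e, 0 < e -> exists z, (forall i, (i < k)%nat -> Rabs (z i - y i) < e) /\
    (exists i, (i < k)%nat /\ z i <> y i) /\ forall p, In p ps -> p z = 0.

(** Vanishing of the [qs] is asked for explicitly, since a member of [P] may be small at the points
    [x m] without being 0 there. The denominator [c] and the list [qs] collect the genericity
    conditions met in the induction. *)
Definition generically_not_isolated (k : nat) (x : nat -> Rvec) (small : (nat -> R) -> Prop) : Prop :=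
  forall ps : list fn, (forall p, In p ps -> Og k p /\ small (fun m => p (x m))) ->
  exists c qs, Og k c /\ ~ small (fun m => c (x m)) /\
    (forall q, In q qs -> Og k q /\ small (fun m => q (x m))) /\
    exists N, forall m, (N <= m)%nat -> c (x m) <> 0 -> (forall q, In q qs -> q (x m) = 0) ->
      not_isolated k ps (x m).

(* With [P] the germs that are small along [x]: the ideal generated by [h] and by the members
   of [P] that do not involve the last variable, saturated with respect to the functions of the first [k] variables outside [P]. *)
Inductive Tid (k : nat) (x : nat -> Rvec) (small : (nat -> R) -> Prop) (h : fn) : fn -> Prop :=
  | Tid_gen : Tid k x small h h
  | Tid_low s : Og k s -> small (fun m => s (x m)) -> Tid k x small h s
  | Tid_add f g : Tid k x small h f -> Tid k x small h g -> Tid k x small h (fun y => f y + g y)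
  | Tid_mul q f : Og (S k) q -> Tid k x small h f -> Tid k x small h (fun y => q y * f y)
  | Tid_sat c f : Og k c -> ~ small (fun m => c (x m)) -> Og (S k) f ->
      Tid k x small h (fun y => c y * f y) -> Tid k x small h f
  | Tid_ext f g : near (S k) (fun y => f y = g y) -> Tid k x small h f -> Tid k x small h g.

Lemma tend0_pred k x : tend0 (S k) x -> tend0 k x.
Proof. intros H i Hi; apply H; lia. Qed.

Lemma sm_near k x small f g : prime_ideal small -> tend0 k x -> near k (fun y => f y = g y) ->
  small (fun m => f (x m)) -> small (fun m => g (x m)).
Proof.
  intros HS Hx Hn. apply (sm_ev _ HS). apply (near_ev k x _ Hn Hx).
Qed.

Lemma sm_sumn small n (u : nat -> nat -> R) : prime_ideal small -> (forall j, (j < n)%nat -> small (u j)) ->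
  small (fun m => sumn n (fun j => u j m)).
Proof.
  intros HS; induction n as [|n IH]; intros H; simpl. apply (sm_zero _ HS). apply (sm_add _ HS); auto.
Qed.

Lemma sm_sub small u v : prime_ideal small -> small u -> small v -> small (fun m => u m - v m).
Proof.
  intros HS Hu Hv. apply sm_eq with (fun m => u m + (-1) * v m); auto. { intros; ring. }
  apply (sm_add _ HS); auto. apply (sm_mul _ HS); auto. apply bdd_const.
Qed.

(** Saturation does not lead out of [P] because [P] is prime. *)
Lemma Tid_spec k x small h f : prime_ideal small -> tend0 (S k) x ->
  Og (S k) h -> small (fun m => h (x m)) -> Tid k x small h f -> Og (S k) f /\ small (fun m => f (x m)).
Proof.
  intros HS Hx Hh Hhs. induction 1 as [|s Hs Hss|f g _ [Hf Hfs] _ [Hg Hgs]|q f Hq _ [Hf Hfs]|c f Hc Hcn Hf _ [Hcf Hcfs]|f g E _ [Hf Hfs]].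
  - auto.
  - split; auto. apply Og_widen with k; auto.
  - split. apply Og_plus; auto. apply (sm_add _ HS); auto.
  - split. apply Og_mult; auto. apply (sm_mul _ HS); auto. apply Og_bdd with (S k); auto.
  - split; auto. destruct (sm_prime _ HS (fun m => c (x m)) (fun m => f (x m))) as [H|H]; auto; try tauto.
    + apply Og_bdd with k; auto using tend0_pred.
    + apply Og_bdd with (S k); auto.
  - split. apply Og_ext with f; auto. apply sm_near with (S k) f; auto.
Qed.

(** [D] counts the coefficients, so the degree is less than [D]; a polynomial of degree [e] is
    [polyk k (S e)]. *)
Definition polyk (k D : nat) (r : nat -> fn) : fn := fun y => sumn D (fun i => r i y * y k ^ i).

Lemma Og_polyk k D r : (forall i, (i < D)%nat -> Og k (r i)) -> Og (S k) (polyk k D r).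
Proof.
  intros H. apply (Og_sumn (S k) D (fun i y => r i y * y k ^ i)). intros i Hi.
  apply Og_mult; [apply Og_widen with k; auto | apply Og_pow, Og_coord; lia].
Qed.

Lemma sumn_add_index n m (f : nat -> R) : sumn (n + m) f = sumn n f + sumn m (fun j => f (n + j)%nat).
Proof.
  induction m as [|m IH]. rewrite Nat.add_0_r; simpl; ring. rewrite Nat.add_succ_r; simpl. rewrite IH; ring.
Qed.

(** A member of [P] that is a polynomial in the last variable and whose leading coefficient survives
    modulo [P]. *)
Definition lowdeg (k : nat) (x : nat -> Rvec) (small : (nat -> R) -> Prop) (e : nat) (a : nat -> fn) : Prop :=
  (forall i, (i <= e)%nat -> Og k (a i)) /\ small (fun m => polyk k (S e) a (x m)) /\ ~ small (fun m => a e (x m)).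

(** A leading coefficient outside [P] would contradict the minimality of [e]; so it lies in [P], its
    term can be removed, and the degree drops. *)
Lemma lowdeg_coeffs k x small e D r : prime_ideal small -> tend0 (S k) x ->
  (forall e' a, (e' < e)%nat -> ~ lowdeg k x small e' a) -> (D <= e)%nat ->
  (forall i, (i < D)%nat -> Og k (r i)) -> small (fun m => polyk k D r (x m)) ->
  forall i, (i < D)%nat -> small (fun m => r i (x m)).
Proof.
  intros HS Hx Hmin. induction D as [|D IH]; intros HD Hr Hs i Hi; [lia|].
  assert (Htop : small (fun m => r D (x m))).
  { apply NNPP; intros Hn. apply (Hmin D r); [lia|]. split; [intros; apply Hr; lia|]. split; auto. }
  destruct (Nat.eq_dec i D) as [->|]; auto. apply IH; auto; [lia| |lia].
  apply sm_eq with (fun m => polyk k (S D) r (x m) - x m k ^ D * r D (x m)); auto.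
  { intros m; unfold polyk; simpl. ring. }
  apply sm_sub; auto. apply (sm_mul _ HS); auto.
  apply (Og_bdd (S k) x (fun y => y k ^ D)); auto. apply Og_pow, Og_coord; lia.
Qed.

Lemma Tid_polyk_low k x small h D r : (forall i, (i < D)%nat -> Og k (r i) /\ small (fun m => r i (x m))) ->
  prime_ideal small -> Tid k x small h (polyk k D r).
Proof.
  intros H HS. induction D as [|D IH].
  - apply Tid_low. apply Og_const. apply (sm_zero _ HS).
  - apply (Tid_add k x small h (polyk k D r) (fun y => r D y * y k ^ D)); auto.
    apply Tid_ext with (fun y => y k ^ D * r D y).
    + exists 1; split; [lra|]. intros; ring.
    + apply Tid_mul. apply Og_pow, Og_coord; lia. apply Tid_low; apply H; lia.
Qed.

(** Pseudo-division by the minimal polynomial: after multiplication by its leading coefficient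
    [a e], which is outside [P], the top term can be cancelled, and saturation in [Tid] takes the
    factor away again. *)
Lemma Tid_polyk k x small e a D r : prime_ideal small -> tend0 (S k) x -> lowdeg k x small e a ->
  (forall e' a, (e' < e)%nat -> ~ lowdeg k x small e' a) ->
  (forall i, (i < D)%nat -> Og k (r i)) -> small (fun m => polyk k D r (x m)) ->
  Tid k x small (polyk k (S e) a) (polyk k D r).
Proof.
  intros HS Hx [Ha [Has Hae]] Hmin. revert r.
  assert (Hlow : forall D r, (D <= e)%nat -> (forall i, (i < D)%nat -> Og k (r i)) -> small (fun m => polyk k D r (x m)) ->
    Tid k x small (polyk k (S e) a) (polyk k D r)).
  { intros D' r HD Hr Hs. apply Tid_polyk_low; auto. intros i Hi; split; auto.
    apply lowdeg_coeffs with k e D'; auto. }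
  induction D as [|D IH]; intros r Hr Hs; [apply Hlow; auto; lia|].
  destruct (Nat.le_gt_cases (S D) e) as [HD|HD]; [apply Hlow; auto|].
  set (d := (D - e)%nat).
  (* Coefficients of the minimal polynomial times [y k ^ d], aligned with the top degree [D]. *)
  set (b := fun i => if Nat.ltb i d then (fun _ => 0) else a (i - d)%nat).
  set (r' := fun i y => a e y * r i y - r D y * b i y).
  assert (Hb : forall i, (i <= D)%nat -> Og k (b i)).
  { intros i Hi; unfold b. destruct (Nat.ltb_spec i d). apply Og_const. apply Ha. lia. }
  assert (Eb : forall y, sumn (S D) (fun i => b i y * y k ^ i) = y k ^ d * polyk k (S e) a y).
  { intros y. replace (S D) with (d + S e)%nat by lia. rewrite sumn_add_index.
    rewrite sumn_zero.
    - unfold polyk. rewrite <- sumn_scal, Rplus_0_l. apply sumn_ext; intros i Hi. unfold b.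
      replace (Nat.ltb (d + i) d) with false by (symmetry; apply Nat.ltb_ge; lia).
      replace (d + i - d)%nat with i by lia. rewrite pow_add; ring.
    - intros i Hi. unfold b. replace (Nat.ltb i d) with true by (symmetry; apply Nat.ltb_lt; lia). ring. }
  assert (HbD : b D = a e).
  { unfold b. replace (Nat.ltb D d) with false by (symmetry; apply Nat.ltb_ge; lia). f_equal; lia. }
  assert (Er : forall y, a e y * polyk k (S D) r y = polyk k D r' y + (r D y * y k ^ d) * polyk k (S e) a y).
  { intros y. rewrite Rmult_assoc, <- Eb. unfold polyk, r'. simpl. rewrite HbD.
    rewrite (sumn_ext D (fun i => (a e y * r i y - r D y * b i y) * y k ^ i)
       (fun i => a e y * (r i y * y k ^ i) + - r D y * (b i y * y k ^ i))) by (intros; ring).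
    rewrite sumn_plus, !sumn_scal. ring. }
  assert (Hae' : Og k (a e)) by (apply Ha; lia).
  assert (HrD : Og (S k) (fun y => r D y * y k ^ d)).
  { apply Og_mult. apply Og_widen with k; auto. apply Og_pow, Og_coord; lia. }
  apply Tid_sat with (a e); auto.
  { apply Og_polyk; auto. }
  apply Tid_ext with (fun y => polyk k D r' y + (r D y * y k ^ d) * polyk k (S e) a y).
  { exists 1; split; [lra|]. intros y _; rewrite Er; auto. }
  apply (Tid_add k x small _ (polyk k D r')).
  - apply IH.
    + intros i Hi. apply Og_minus; apply Og_mult; auto. apply Hb; lia.
    + apply sm_eq with (fun m => a e (x m) * polyk k (S D) r (x m) - (r D (x m) * x m k ^ d) * polyk k (S e) a (x m)); auto.
      { intros m. rewrite Er. ring. }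
      apply sm_sub; auto; apply (sm_mul _ HS); auto.
      * apply Og_bdd with k; auto using tend0_pred.
      * apply (Og_bdd (S k) x (fun y => r D y * y k ^ d)); auto.
  - apply (Tid_mul k x small (polyk k (S e) a) (fun y => r D y * y k ^ d)); auto. apply Tid_gen.
Qed.

(** Splitting off one variable at a time writes [f] as a combination of the coordinates with
    analytic, hence bounded, coefficients. *)
Lemma sm_vanishing_germ k x small f : prime_ideal small -> tend0 k x -> Og k f -> f zerov = 0 ->
  (forall i, (i < k)%nat -> small (fun m => x m i)) -> small (fun m => f (x m)).
Proof.
  intros HS. revert f; induction k as [|k IH]; intros f Hx Hf H0 Hsm.
  - destruct (Og_dep 0 f Hf) as [e [He Hd]].
    apply sm_eq with (fun _ => 0); auto; [|apply (sm_zero _ HS)].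
    intros m. rewrite (Hd zerov); auto; intros; lia.
  - destruct Hf as [r [M [Hr Hf]]].
    destruct (PS_split1 k (cst r) M f (posr_cst _ r Hr) Hf) as [t [c [Ht [Hc E]]]].
    assert (En : near (S k) (fun y => t y * y k + c y = f y)).
    { exists r; split; auto. intros y Hy. rewrite E; [ring|]. intros i Hi; apply Rlt_le, Hy; auto. }
    apply sm_near with (S k) (fun y => t y * y k + c y); auto.
    apply (sm_add _ HS).
    + apply (sm_mul _ HS). 2: apply Hsm; lia. apply Og_bdd with (S k); auto. exists r, (M / cst r k); auto.
    + apply IH; auto using tend0_pred. exists r, M; auto.
      pose proof (E zerov (polyd_zero _ _ (posr_cst (S k) r Hr))) as E0. unfold zerov at 2 in E0. lra.
Qed.

Lemma sm_pow small u n : prime_ideal small -> bdd u -> small (fun m => u m ^ n) -> small u.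
Proof.
  intros HS Hu; induction n as [|n IH]; simpl; intros H.
  - exfalso; apply (sm_one _ HS); auto.
  - destruct (sm_prime _ HS u (fun m => u m ^ n)) as [|]; auto.
    clear -Hu. induction n as [|n IH]; simpl. apply bdd_const. apply bdd_mul; auto.
Qed.

Lemma lowdeg_minimal k x small e a : lowdeg k x small e a ->
  exists e a, lowdeg k x small e a /\ forall e' a', (e' < e)%nat -> ~ lowdeg k x small e' a'.
Proof.
  revert a. induction e as [e IH] using (well_founded_induction Wf_nat.lt_wf). intros a Ha.
  destruct (classic (exists e' a', (e' < e)%nat /\ lowdeg k x small e' a')) as [[e' [a' [Hlt Ha']]]|Hn].
  - apply (IH e' Hlt a' Ha').
  - exists e, a; split; auto. intros e' a' Hlt Ha'. apply Hn; eauto.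
Qed.

Definition dpoly (a : nat -> fn) : nat -> fn := fun i y => INR (S i) * a (S i) y.

Lemma derivable_polyk k e a : (forall i, (i <= e)%nat -> Og k (a i)) ->
  near k (fun y => ddir (polyk k (S e) a) y (unitv k) (polyk k e (dpoly a) y)).
Proof.
  intros Ha.
  assert (Hdep : forall D, (D <= S e)%nat -> near k (fun y => forall i, (i < D)%nat -> forall z, (forall j, (j < k)%nat -> z j = y j) -> a i z = a i y)).
  { induction D as [|D IH]; intros HD.
    - exists 1; split; [lra|]. intros; lia.
    - eapply near_mono; [|apply (near_and _ _ _ (IH ltac:(lia)) (Og_dep k (a D) (Ha D ltac:(lia))))].
      intros y [H1 H2] i Hi z Hz. destruct (Nat.eq_dec i D) as [->|]; auto. apply H1; auto; lia. }
  eapply near_mono; [|apply (Hdep (S e)); lia]. intros y Hy. unfold ddir.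
  apply (is_derive_Reals (fun t => polyk k (S e) a (vadd y (scalv t (unitv k)))) 0).
  apply is_derive_ext with (fun t => sumn (S e) (fun i => a i y * (y k + t) ^ i)).
  { intros t. unfold polyk. apply sumn_ext; intros i Hi. unfold vadd at 2, scalv at 2, unitv at 2.
    rewrite Nat.eqb_refl, Rmult_1_r. rewrite <- (Hy i Hi (vadd y (scalv t (unitv k)))); auto.
    intros j Hj. unfold vadd, scalv, unitv. rewrite (proj2 (Nat.eqb_neq j k)) by lia. ring. }
  clear Hdep Hy Ha. unfold polyk, dpoly. induction e as [|e IH].
  - apply is_derive_ext with (fun t => a 0%nat y). { intros; simpl; ring. } apply (is_derive_const (a 0%nat y)).
  - apply (is_derive_plus (fun t => sumn (S e) (fun i => a i y * (y k + t) ^ i)) (fun t => a (S e) y * (y k + t) ^ S e)); auto.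
    replace (INR (S e) * a (S e) y * y k ^ e) with (a (S e) y * (INR (S e) * 1 * (y k + 0) ^ e)) by (rewrite Rplus_0_r; ring).
    auto_derive; auto. change (match e with 0%nat => 1 | S _ => INR e + 1 end) with (INR (S e)). ring.
Qed.

(** The Weierstrass polynomial of [f] is monic and lies in [P]. If the first [k] coordinates were
    small, it would make a power of the last one small too, and [P] would be maximal. It also shows
    that a polynomial of minimal degree [e] exists; the derivative of that one has leading
    coefficient [e * a e], outside [P], and so is outside [P] by minimality. Finally, division by
    the Weierstrass polynomial reduces any member of [P] to a polynomial, to which [Tid_polyk]
    applies. *)
Lemma ideal_generically_generated k b f x small : prime_ideal small -> tend0 (S k) x ->
  (exists i, (i < S k)%nat /\ ~ small (fun m => x m i)) ->
  regular k b f -> small (fun m => f (x m)) ->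
  (exists i, (i < k)%nat /\ ~ small (fun m => x m i)) /\
  exists e a, lowdeg k x small e a /\ (0 < e)%nat /\
    ~ small (fun m => polyk k e (dpoly a) (x m)) /\
    forall p, Og (S k) p -> small (fun m => p (x m)) -> Tid k x small (polyk k (S e) a) p.
Proof.
  intros HS Hx Hns Hreg Hf.
  destruct (weierstrass_polynomial k b f Hreg) as [q [c [Hq [Hc E]]]].
  set (cw := fun i => if Nat.eqb i b then (fun _ => 1) else c i).
  assert (Ew : forall y, polyk k (S b) cw y = y k ^ b + sumn b (fun i => c i y * y k ^ i)).
  { intros y. unfold polyk; simpl. unfold cw at 2. rewrite Nat.eqb_refl.
    rewrite (sumn_ext b (fun i => cw i y * y k ^ i) (fun i => c i y * y k ^ i)); [ring|].
    intros i Hi. unfold cw. rewrite (proj2 (Nat.eqb_neq i b)); auto; lia. }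
  assert (Hcw : forall i, (i <= b)%nat -> Og k (cw i)).
  { intros i Hi; unfold cw. destruct (Nat.eqb_spec i b); [apply Og_const | apply Hc; lia]. }
  assert (Hw : small (fun m => polyk k (S b) cw (x m))).
  { apply sm_near with (S k) (fun y => q y * f y); auto.
    - eapply near_mono; [|apply E]. intros y Hy. rewrite Ew. auto.
    - apply (sm_mul _ HS); auto. apply Og_bdd with (S k); auto. }
  assert (HwO : Og (S k) (polyk k (S b) cw)) by (apply Og_polyk; intros; apply Hcw; lia).
  split.
  - apply NNPP; intros Hn.
    assert (Hall : forall i, (i < k)%nat -> small (fun m => x m i)).
    { intros i Hi. apply NNPP; intros H; apply Hn; eauto. }
    assert (Hk : small (fun m => x m k)).
    { apply sm_pow with b; auto.
      - apply (Og_bdd (S k) x (fun y => y k)); auto. apply Og_coord; lia.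
      - apply sm_eq with (fun m => polyk k (S b) cw (x m) - sumn b (fun i => x m k ^ i * c i (x m))); auto.
        { intros m. rewrite Ew. rewrite (sumn_ext b (fun i => c i (x m) * x m k ^ i) (fun i => x m k ^ i * c i (x m))) by (intros; ring). ring. }
        apply sm_sub; auto. apply (sm_sumn small b (fun i m => x m k ^ i * c i (x m))); auto.
        intros i Hi. apply (sm_mul _ HS).
        + apply (Og_bdd (S k) x (fun y => y k ^ i)); auto. apply Og_pow, Og_coord; lia.
        + apply sm_vanishing_germ with k; auto using tend0_pred; apply Hc; auto. }
    destruct Hns as [i [Hi Hin]]. apply Hin. destruct (Nat.eq_dec i k) as [->|]; auto. apply Hall; lia.
  - destruct (lowdeg_minimal k x small b cw) as [e [a [Hla Hmin]]].
    { split; [auto|split; auto]. unfold cw. rewrite Nat.eqb_refl. apply (sm_one _ HS). }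
    assert (Hla' := Hla). destruct Hla' as [Ha [Has Hae]].
    assert (He : (0 < e)%nat).
    { destruct e; [|lia]. exfalso; apply Hae. eapply sm_eq; [auto| |apply Has].
      intros m; unfold polyk; simpl; ring. }
    exists e, a. split; auto. split; auto. split.
    + intros Hs. destruct e as [|e']; [lia|]. apply (Hmin e' (dpoly a)); [lia|].
      split; [|split; auto].
      * intros i Hi. apply Og_scal. apply Ha; lia.
      * intros H. apply Hae. apply sm_eq with (fun m => / INR (S e') * (INR (S e') * a (S e') (x m))); auto.
        { intros m. field. apply not_0_INR; lia. }
        apply (sm_mul _ HS); auto. apply bdd_const.
    + intros p Hp Hps.
      destruct (weierstrass_division k b _ p (regular_monic k b c Hc) Hp) as [q' [r [Hq' [Hr Ep]]]].
      assert (Ep' : near (S k) (fun y => q' y * polyk k (S b) cw y + polyk k b r y = p y)).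
      { eapply near_mono; [|apply Ep]. intros y Hy; cbv beta in Hy. rewrite Ew. unfold polyk. auto. }
      assert (Hrs : small (fun m => polyk k b r (x m))).
      { apply sm_near with (S k) (fun y => p y - q' y * polyk k (S b) cw y); auto.
        - eapply near_mono; [|apply Ep']. intros y Hy; cbv beta in Hy |- *. lra.
        - apply sm_sub; auto. apply (sm_mul _ HS); auto. apply Og_bdd with (S k); auto. }
      apply Tid_ext with (1 := Ep'). apply (Tid_add k x small _ (fun y => q' y * polyk k (S b) cw y)).
      * apply Tid_mul; auto. apply Tid_polyk; auto. intros; apply Hcw; lia.
      * apply Tid_polyk; auto.
Qed.

(** * Lifting tangent fields and zeros through one variable *)

Lemma ddir_uniq f x V l l' : ddir f x V l -> ddir f x V l' -> l = l'.
Proof. intros H H'. eapply uniqueness_limite; eauto. Qed.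

Lemma ddir_plus f g x V l l' : ddir f x V l -> ddir g x V l' -> ddir (fun y => f y + g y) x V (l + l').
Proof. intros H H'. apply (derivable_pt_lim_plus _ _ _ _ _ H H'). Qed.

Lemma ddir_mult f g x V l l' : ddir f x V l -> ddir g x V l' ->
  ddir (fun y => f y * g y) x V (l * g x + f x * l').
Proof.
  intros H H'. pose proof (derivable_pt_lim_mult _ _ _ _ _ H H') as P. cbv beta in P.
  assert (E0 : vadd x (scalv 0 V) = x).
  { apply functional_extensionality; intros i; unfold vadd, scalv; ring. }
  rewrite E0 in P. apply P.
Qed.

Lemma ddir_ext_near k f g : near k (fun y => f y = g y) ->
  near k (fun x => forall V l, ddir f x V l -> ddir g x V l).
Proof.
  intros Hn. assert (Hn' := Hn). destruct Hn' as [e0 [He0 H0]]. exists e0; split; auto.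
  intros x Hx V l Hd eps Heps.
  destruct (Hd eps Heps) as [d Hd'].
  assert (Hk : exists d', 0 < d' /\ forall i, (i < k)%nat -> forall h, Rabs h < d' -> Rabs (x i + h * V i) < e0).
  { clear -Hx He0. induction k as [|k IH].
    - exists 1; split; [lra|]. intros; lia.
    - destruct IH as [d1 [Hd1 IH]]. { intros i Hi; apply Hx; lia. }
      specialize (Hx k (Nat.lt_succ_diag_r k)).
      set (q := (e0 - Rabs (x k)) / (1 + Rabs (V k))). pose proof (Rabs_pos (V k)).
      assert (0 < q) by (apply Rdiv_lt_0_compat; lra).
      exists (Rmin d1 q). split; [apply Rmin_pos; auto|].
      pose proof (Rmin_l d1 q); pose proof (Rmin_r d1 q).
      intros i Hi h Hh. destruct (Nat.eq_dec i k) as [->|]; [|apply IH; [lia|lra]].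
      eapply Rle_lt_trans; [apply Rabs_triang|]. rewrite Rabs_mult.
      assert (Hq : Rabs h < q) by lra. apply Rlt_div_r in Hq; [|lra]. pose proof (Rabs_pos h). nra. }
  destruct Hk as [d' [Hd1 Hk]].
  assert (Hm : 0 < Rmin d d') by (apply Rmin_pos; [apply cond_pos | auto]).
  exists (mkposreal _ Hm). simpl. intros h Hh0 Hh.
  pose proof (Rmin_l d d'); pose proof (Rmin_r d d').
  rewrite <- !H0.
  - apply Hd'; auto; lra.
  - intros i Hi. unfold vadd, scalv. apply Hk; auto. rewrite Rabs_R0; auto.
  - intros i Hi. unfold vadd, scalv. apply Hk; auto. rewrite Rplus_0_l; lra.
Qed.

Lemma ev_and (P Q : nat -> Prop) : (exists N, forall m, (N <= m)%nat -> P m) ->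
  (exists N, forall m, (N <= m)%nat -> Q m) -> exists N, forall m, (N <= m)%nat -> P m /\ Q m.
Proof.
  intros [N H] [N' H']. exists (Nat.max N N'). intros m Hm; split; [apply H | apply H']; lia.
Qed.

Lemma Og_ddir k x f V : Og k f -> tend0 k x -> (forall j, (j < k)%nat -> bdd (fun m => V m j)) ->
  exists u, bdd u /\ exists N, forall m, (N <= m)%nat -> ddir f (x m) (V m) (u m).
Proof.
  intros Hf Hx HV. destruct (Og_Tot k f Hf) as [g [Hg HT]].
  exists (fun m => sumn k (fun j => g j (x m) * V m j)). split.
  - apply (bdd_sumn k (fun j m => g j (x m) * V m j)). intros j Hj. apply bdd_mul; auto.
    apply Og_bdd with k; auto.
  - destruct (near_ev k x _ (Tot_ddir k f g HT) Hx) as [N HN]. exists N; intros m Hm; apply HN; auto.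
Qed.

(** Let [kap] be the derivative of the generating polynomial [h] in the last variable and [eta] its
    derivative along [V']. The field [(kap V', - eta)] kills [h], and it is not small since neither
    [kap] nor [V'] is. That it respects [P] follows by induction on the generation of [P] in
    [Tid]. *)
Lemma tangent_field_step k x small e a V' : prime_ideal small -> tend0 (S k) x ->
  lowdeg k x small e a -> ~ small (fun m => polyk k e (dpoly a) (x m)) ->
  (forall p, Og (S k) p -> small (fun m => p (x m)) -> Tid k x small (polyk k (S e) a) p) ->
  tangent_field k x small V' -> exists V, tangent_field (S k) x small V.
Proof.
  intros HS Hx [Ha [Has Hae]] Hkap HT [HVb [[j0 [Hj0 Hj0n]] HV]].
  assert (Hx' := tend0_pred _ _ Hx).
  set (h := polyk k (S e) a). set (kap := polyk k e (dpoly a)).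
  assert (HhO : Og (S k) h) by (apply Og_polyk; intros; apply Ha; lia).
  assert (HkO : Og (S k) kap).
  { apply Og_polyk. intros i Hi. apply Og_scal. apply Ha; lia. }
  assert (Hkb : bdd (fun m => kap (x m))) by (apply Og_bdd with (S k); auto).
  destruct (Og_Tot (S k) h HhO) as [g [Hg HTh]].
  set (eta := fun m => sumn k (fun j => g j (x m) * V' m j)).
  assert (Heb : bdd eta).
  { apply (bdd_sumn k (fun j m => g j (x m) * V' m j)). intros j Hj. apply bdd_mul; auto. apply Og_bdd with (S k); auto. }
  set (V := fun m i => if Nat.eqb i k then - 1 * eta m else kap (x m) * V' m i).
  assert (HVk : forall m, V m k = - 1 * eta m) by (intros; unfold V; rewrite Nat.eqb_refl; auto).
  assert (HVj : forall m j, (j < k)%nat -> V m j = kap (x m) * V' m j).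
  { intros m j Hj; unfold V. rewrite (proj2 (Nat.eqb_neq j k)); auto; lia. }
  assert (HVbd : forall j, (j < S k)%nat -> bdd (fun m => V m j)).
  { intros j Hj. destruct (Nat.eq_dec j k) as [->|].
    - destruct (bdd_mul _ _ (bdd_const (-1)) Heb) as [B [N HB]]. exists B, N. intros m Hm. rewrite HVk; auto.
    - destruct (bdd_mul _ _ Hkb (HVb j ltac:(lia))) as [B [N HB]]. exists B, N. intros m Hm. rewrite HVj; auto; lia. }
  exists V. split; auto. split.
  { exists j0. split; [lia|]. intros Hs.
    destruct (sm_prime _ HS (fun m => kap (x m)) (fun m => V' m j0)) as [H|H]; [auto | auto | | auto | auto].
    apply sm_eq with (fun m => V m j0); auto. }
  assert (Hhdir : exists N, forall m, (N <= m)%nat -> ddir h (x m) (V m) 0).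
  { destruct (ev_and _ _ (near_ev (S k) x _ (Tot_ddir (S k) h g HTh) Hx)
       (near_ev k x _ (derivable_polyk k e a Ha) Hx')) as [N HN].
    exists N. intros m Hm. destruct (HN m Hm) as [H1 H2].
    assert (Hgk : g k (x m) = kap (x m)).
    { pose proof (ddir_uniq _ _ _ _ _ H2 (H1 (unitv k))) as Eu. unfold kap; rewrite Eu.
      rewrite (sumn_ext (S k) _ (fun j => unitv j k * g j (x m))).
      - rewrite sumn_delta; auto.
      - intros j Hj. unfold unitv. rewrite (Nat.eqb_sym k j). ring. }
    replace 0 with (sumn (S k) (fun j => g j (x m) * V m j)); [apply H1|].
    simpl. rewrite HVk, Hgk.
    rewrite (sumn_ext k _ (fun j => kap (x m) * (g j (x m) * V' m j))).
    - rewrite sumn_scal. fold (eta m). ring.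
    - intros j Hj. rewrite HVj by auto. ring. }
  intros p Hp Hps. specialize (HT p Hp Hps). clear Hp Hps.
  assert (Hspec : forall f, Tid k x small h f -> Og (S k) f /\ small (fun m => f (x m))).
  { intros f Hf. exact (Tid_spec k x small h f HS Hx HhO Has Hf). }
  fold h in HT.
  induction HT as [|s Hs Hss|f f' Hf IHf Hf' IHf'|q f Hq Hf IHf|c f Hc Hcn HfO Hf IHf|f f' E Hf IHf].
  - exists (fun _ => 0). split; auto. apply (sm_zero _ HS).
  - destruct (HV s Hs Hss) as [u [Hu [N HN]]].
    exists (fun m => kap (x m) * u m). split; [apply (sm_mul _ HS); auto|].
    destruct (Og_Tot k s Hs) as [gs [Hgs HTs]].
    destruct (ev_and _ _ (ex_intro (fun N => forall m, (N <= m)%nat -> ddir s (x m) (V' m) (u m)) N HN)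
       (near_ev k x _ (Tot_ddir k s gs HTs) Hx')) as [N' HN'].
    exists N'. intros m Hm. destruct (HN' m Hm) as [H1 H2].
    rewrite (ddir_uniq _ _ _ _ _ H1 (H2 (V' m))).
    rewrite <- sumn_scal. rewrite (sumn_ext k _ (fun j => gs j (x m) * V m j)); auto.
    intros j Hj. rewrite HVj by auto. ring.
  - destruct IHf as [u [Hu H1]]. destruct IHf' as [u' [Hu' H2]].
    exists (fun m => u m + u' m). split; [apply (sm_add _ HS); auto|].
    destruct (ev_and _ _ H1 H2) as [N HN]. exists N. intros m Hm. destruct (HN m Hm). apply ddir_plus; auto.
  - destruct IHf as [u [Hu H1]]. destruct (Og_ddir (S k) x q V Hq Hx HVbd) as [uq [Huq H2]].
    destruct (Hspec f Hf) as [HfO Hfs].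
    exists (fun m => uq m * f (x m) + q (x m) * u m). split.
    + apply (sm_add _ HS); apply (sm_mul _ HS); auto. apply Og_bdd with (S k); auto.
    + destruct (ev_and _ _ H1 H2) as [N HN]. exists N. intros m Hm. destruct (HN m Hm). apply ddir_mult; auto.
  (* The derivative of [c f] is small and so is [f], hence [c] times the derivative of [f] is small;
     primality removes [c]. *)
  - destruct IHf as [u [Hu H1]].
    assert (HcO : Og (S k) c) by (apply Og_widen with k; auto).
    destruct (Og_ddir (S k) x c V HcO Hx HVbd) as [uc [Huc H2]].
    destruct (Og_ddir (S k) x f V HfO Hx HVbd) as [uf [Huf H3]].
    assert (Hfs : small (fun m => f (x m))).
    { apply (Hspec f). apply Tid_sat with c; auto. }
    exists uf. split; auto.
    destruct (ev_and _ _ H1 (ev_and _ _ H2 H3)) as [N HN].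
    destruct (sm_prime _ HS (fun m => c (x m)) uf) as [H|H]; auto; try tauto.
    { apply Og_bdd with (S k); auto. }
    apply (sm_ev _ HS) with (fun m => u m - uc m * f (x m)).
    + exists N. intros m Hm. destruct (HN m Hm) as [K1 [K2 K3]].
      rewrite (ddir_uniq _ _ _ _ _ K1 (ddir_mult _ _ _ _ _ _ K2 K3)). ring.
    + apply sm_sub; auto. apply (sm_mul _ HS); auto.
  - destruct IHf as [u [Hu H1]]. exists u; split; auto.
    destruct (ev_and _ _ H1 (near_ev (S k) x _ (ddir_ext_near (S k) f f' E) Hx)) as [N HN].
    exists N. intros m Hm. destruct (HN m Hm) as [K1 K2]. auto.
Qed.

(** Each saturation contributes a denominator and each low generator an equation; where the product
    [c] of the denominators is not 0, the equations and [h = 0] force [f = 0]. *)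
Lemma Tid_zero_set k x small h f : prime_ideal small -> tend0 (S k) x -> Tid k x small h f ->
  exists c ss, Og k c /\ ~ small (fun m => c (x m)) /\ (forall s, In s ss -> Og k s /\ small (fun m => s (x m))) /\
    near (S k) (fun z => c z <> 0 -> (forall s, In s ss -> s z = 0) -> h z = 0 -> f z = 0).
Proof.
  intros HS Hx.
  assert (Htriv : forall Q : Rvec -> Prop, (forall z, Q z) -> near (S k) Q).
  { intros Q HQ. exists 1; split; [lra|]. auto. }
  assert (Hprod : forall c c', Og k c -> Og k c' -> ~ small (fun m => c (x m)) -> ~ small (fun m => c' (x m)) ->
     ~ small (fun m => c (x m) * c' (x m))).
  { intros c c' Hc Hc' Hn Hn' H.
    destruct (sm_prime _ HS (fun m => c (x m)) (fun m => c' (x m))); auto; apply Og_bdd with k; auto using tend0_pred. }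
  induction 1 as [|s Hs Hss|f f' Hf [c [ss [Hc [Hcn [Hss Hz]]]]] Hf' [c' [ss' [Hc' [Hcn' [Hss' Hz']]]]]
     |q f Hq Hf [c [ss [Hc [Hcn [Hss Hz]]]]]|c0 f Hc0 Hcn0 HfO Hf [c [ss [Hc [Hcn [Hss Hz]]]]]
     |f f' E Hf [c [ss [Hc [Hcn [Hss Hz]]]]]].
  - exists (fun _ => 1), nil. split; [apply Og_const|]. split; [apply (sm_one _ HS)|]. split; [intros s []|].
    apply Htriv; auto.
  - exists (fun _ => 1), (s :: nil). split; [apply Og_const|]. split; [apply (sm_one _ HS)|]. split.
    { intros s' [<-|[]]; auto. }
    apply Htriv. intros z _ Hz _. apply Hz; left; auto.
  - exists (fun z => c z * c' z), (ss ++ ss'). split; [apply Og_mult; auto|]. split; [apply Hprod; auto|]. split.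
    { intros s Hs. apply in_app_or in Hs. destruct Hs; auto. }
    eapply near_mono; [|apply (near_and _ _ _ Hz Hz')]. intros z [H1 H2] Hne Hs Hh.
    rewrite H1, H2; auto; try ring.
    + intros E; apply Hne; rewrite E; ring.
    + intros s Hin; apply Hs, in_or_app; auto.
    + intros E; apply Hne; rewrite E; ring.
    + intros s Hin; apply Hs, in_or_app; auto.
  - exists c, ss. split; [auto|split; [auto|split; [auto|]]].
    eapply near_mono; [|apply Hz]. intros z H1 Hne Hs Hh. rewrite H1; auto; ring.
  - exists (fun z => c0 z * c z), ss. split; [apply Og_mult; auto|]. split; [apply Hprod; auto|]. split; auto.
    eapply near_mono; [|apply Hz]. intros z H1 Hne Hs Hh.
    destruct (Rmult_integral _ _ (H1 (fun E => Hne ltac:(rewrite E; ring)) Hs Hh)); auto.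
    exfalso; apply Hne. rewrite H; ring.
  - exists c, ss. split; [auto|split; [auto|split; [auto|]]].
    eapply near_mono; [|apply (near_and _ _ _ Hz E)]. intros z [H1 H2] Hne Hs Hh. rewrite <- H2; auto.
Qed.

Lemma Tid_zero_set_list k x small h ps : prime_ideal small -> tend0 (S k) x ->
  (forall p, In p ps -> Tid k x small h p) ->
  exists c ss, Og k c /\ ~ small (fun m => c (x m)) /\ (forall s, In s ss -> Og k s /\ small (fun m => s (x m))) /\
    near (S k) (fun z => c z <> 0 -> (forall s, In s ss -> s z = 0) -> h z = 0 -> forall p, In p ps -> p z = 0).
Proof.
  intros HS Hx. induction ps as [|p ps IH]; intros H.
  - exists (fun _ => 1), nil. split; [apply Og_const|]. split; [apply (sm_one _ HS)|]. split; [intros s []|].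
    exists 1; split; [lra|]. intros z _ _ _ _ p [].
  - destruct IH as [c [ss [Hc [Hcn [Hss Hz]]]]]. { intros q Hq; apply H; right; auto. }
    destruct (Tid_zero_set k x small h p HS Hx (H p (or_introl eq_refl))) as [c' [ss' [Hc' [Hcn' [Hss' Hz']]]]].
    exists (fun z => c z * c' z), (ss ++ ss'). split; [apply Og_mult; auto|]. split; [|split].
    + intros Hs. destruct (sm_prime _ HS (fun m => c (x m)) (fun m => c' (x m))); auto;
        apply Og_bdd with k; auto using tend0_pred.
    + intros s Hs. apply in_app_or in Hs. destruct Hs; auto.
    + eapply near_mono; [|apply (near_and _ _ _ Hz Hz')]. intros z [H1 H2] Hne Hs Hh q [<-|Hq].
      * apply H2; auto. intros E; apply Hne; rewrite E; ring. intros s Hin; apply Hs, in_or_app; auto.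
      * apply H1; auto. intros E; apply Hne; rewrite E; ring. intros s Hin; apply Hs, in_or_app; auto.
Qed.

Lemma near_list k (ss : list fn) (Q : fn -> Rvec -> Prop) : (forall s, In s ss -> near k (Q s)) ->
  near k (fun z => forall s, In s ss -> Q s z).
Proof.
  induction ss as [|s ss IH]; intros H.
  - exists 1; split; [lra|]. intros z _ s [].
  - eapply near_mono; [|apply (near_and _ _ _ (H s (or_introl eq_refl)) (IH (fun s' Hs' => H s' (or_intror Hs'))))].
    intros z [H1 H2] s' [<-|Hs']; auto.
Qed.

Lemma lip_continuity (F : R -> R) (a L d : R) : 0 <= L -> 0 < d ->
  (forall t, Rabs (t - a) < d -> Rabs (F t - F a) <= L * Rabs (t - a)) -> continuity_pt F a.
Proof.
  intros HL Hd H e He. exists (Rmin d (e / (L + 1))).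
  assert (0 < e / (L + 1)) by (apply Rdiv_lt_0_compat; lra).
  split; [apply Rmin_pos; auto|]. intros t [_ Ht]. simpl in *. unfold Rdist in *.
  pose proof (Rmin_l d (e / (L + 1))); pose proof (Rmin_r d (e / (L + 1))).
  assert (Ht' : Rabs (t - a) < e / (L + 1)) by lra. apply Rlt_div_r in Ht'; [|lra].
  eapply Rle_lt_trans; [apply H; lra|]. pose proof (Rabs_pos (t - a)). nra.
Qed.

(* Where the derivative [kap] of [h] in the last variable does not vanish, a zero of the low-dimensional
   problem lifts to a nearby zero of [h] by the intermediate value theorem. *)
Lemma not_isolated_step k x small e a : prime_ideal small -> tend0 (S k) x ->
  lowdeg k x small e a -> ~ small (fun m => polyk k e (dpoly a) (x m)) ->
  (forall p, Og (S k) p -> small (fun m => p (x m)) -> Tid k x small (polyk k (S e) a) p) ->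
  generically_not_isolated k x small -> generically_not_isolated (S k) x small.
Proof.
  intros HS Hx [Ha [Has Hae]] Hkap HT IH ps Hps.
  assert (Hx' := tend0_pred _ _ Hx).
  set (h := polyk k (S e) a) in *. set (kap := polyk k e (dpoly a)) in *.
  assert (HhO : Og (S k) h) by (apply Og_polyk; intros; apply Ha; lia).
  assert (HkO : Og (S k) kap).
  { apply Og_polyk. intros i Hi. apply Og_scal. apply Ha; lia. }
  destruct (Tid_zero_set_list k x small h ps HS Hx) as [C [ss [HC [HCn [Hss HZ]]]]].
  { intros p Hp. apply HT; apply Hps; auto. }
  destruct (IH ss Hss) as [c' [qs [Hc' [Hcn' [Hqs [N HN]]]]]].
  assert (HCO : Og (S k) C) by (apply Og_widen with k; auto).
  assert (Hc'O : Og (S k) c') by (apply Og_widen with k; auto).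
  exists (fun z => c' z * (C z * kap z)), (h :: qs).
  split; [repeat apply Og_mult; auto|]. split; [|split].
  { intros Hs.
    assert (bdd (fun m => C (x m))) by (apply Og_bdd with (S k); auto).
    assert (bdd (fun m => kap (x m))) by (apply Og_bdd with (S k); auto).
    assert (bdd (fun m => c' (x m))) by (apply Og_bdd with (S k); auto).
    destruct (sm_prime _ HS (fun m => c' (x m)) (fun m => C (x m) * kap (x m))) as [H'|H']; auto using bdd_mul.
    destruct (sm_prime _ HS (fun m => C (x m)) (fun m => kap (x m))) as [H''|H'']; auto. }
  { intros q [<-|Hq]; auto. destruct (Hqs q Hq). split; auto. apply Og_widen with k; auto. }
  destruct (Og_lip (S k) h HhO) as [L [eL [HL [HeL Hlip]]]].
  destruct (Og_lip k C HC) as [Lc [eC [HLc [HeC HlipC]]]].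
  destruct HZ as [eZ [HeZ HZ]].
  destruct (near_list k ss (fun s z => forall y, (forall i, (i < k)%nat -> y i = z i) -> s y = s z)) as [eD [HeD Hdep]].
  { intros s Hs. apply Og_dep. apply Hss; auto. }
  set (E := Rmin (Rmin eL eC) (Rmin eZ eD)).
  assert (HE : 0 < E) by (repeat apply Rmin_pos; auto).
  assert (HE1 : E <= eL) by (eapply Rle_trans; [apply Rmin_l | apply Rmin_l]).
  assert (HE2 : E <= eC) by (eapply Rle_trans; [apply Rmin_l | apply Rmin_r]).
  assert (HE3 : E <= eZ) by (eapply Rle_trans; [apply Rmin_r | apply Rmin_l]).
  assert (HE4 : E <= eD) by (eapply Rle_trans; [apply Rmin_r | apply Rmin_r]).
  assert (Hin : exists N, forall m, (N <= m)%nat -> forall i, (i < S k)%nat -> Rabs (x m i) < E / 2).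
  { apply (near_ev (S k) x (fun y => forall i, (i < S k)%nat -> Rabs (y i) < E / 2)); auto.
    exists (E / 2); split; [lra|]; auto. }
  destruct (ev_and _ _ Hin (near_ev k x _ (derivable_polyk k e a Ha) Hx')) as [N' HN'].
  exists (Nat.max N N'). intros m Hm Hne Hq0 eps Heps.
  destruct (HN' m ltac:(lia)) as [Hy Hder]. fold h in Hder. fold kap in Hder.
  specialize (HN m ltac:(lia)). set (y := x m) in *.
  assert (Hhy : h y = 0) by (apply Hq0; left; auto).
  assert (Hcy : c' y <> 0) by (intros K; apply Hne; rewrite K; ring).
  assert (HCy : C y <> 0) by (intros K; apply Hne; rewrite K; ring).
  assert (Hky : kap y <> 0) by (intros K; apply Hne; rewrite K; ring).
  specialize (HN Hcy (fun q Hq => Hq0 q (or_intror Hq))).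
  assert (Hk0 : 0 < Rabs (kap y)) by (apply Rabs_pos_lt; auto).
  assert (HC0 : 0 < Rabs (C y)) by (apply Rabs_pos_lt; auto).
  destruct (Hder (Rabs (kap y) / 2) ltac:(lra)) as [[d1 Hd1] Hd]. simpl in Hd.
  (* Half-length of the interval in the last variable: below [eps], inside the region of the
     estimates, and within the range [d1] in which the difference quotient of [h] differs from
     [kap y] by less than half of it. *)
  set (eta := Rmin (Rmin eps (E / 4)) d1 / 2).
  assert (Heta : 0 < eta) by (unfold eta; assert (0 < Rmin (Rmin eps (E / 4)) d1) by (repeat apply Rmin_pos; lra); lra).
  assert (He1 : eta < eps).
  { unfold eta in *. pose proof (Rmin_l (Rmin eps (E/4)) d1). pose proof (Rmin_l eps (E/4)). lra. }
  assert (He2 : eta < E / 4).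
  { unfold eta in *. pose proof (Rmin_l (Rmin eps (E/4)) d1). pose proof (Rmin_r eps (E/4)). lra. }
  assert (He3 : eta < d1).
  { unfold eta in *. pose proof (Rmin_r (Rmin eps (E/4)) d1). lra. }
  set (mu := Rabs (kap y) * eta / 2). assert (Hmu : 0 < mu) by (unfold mu; nra).
  (* Displacement allowed in the first [k] coordinates: it changes [h] by less than [mu] and cannot
     make [C] vanish. *)
  set (dl := Rmin (Rmin eps (E / 4)) (Rmin (mu / (2 * (L + 1))) (Rabs (C y) / (2 * (Lc + 1))))).
  assert (Hdl : 0 < dl) by (repeat apply Rmin_pos; try lra; apply Rdiv_lt_0_compat; lra).
  assert (Hl1 : dl <= eps) by (eapply Rle_trans; [apply Rmin_l | apply Rmin_l]).
  assert (Hl2 : dl <= E / 4) by (eapply Rle_trans; [apply Rmin_l | apply Rmin_r]).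
  assert (Hl3 : dl <= mu / (2 * (L + 1))) by (eapply Rle_trans; [apply Rmin_r | apply Rmin_l]).
  assert (Hl4 : dl <= Rabs (C y) / (2 * (Lc + 1))) by (eapply Rle_trans; [apply Rmin_r | apply Rmin_r]).
  apply Rle_div_r in Hl3; [|lra]. apply Rle_div_r in Hl4; [|lra].
  assert (HLd : L * dl < mu) by nra.
  assert (HLcd : Lc * dl < Rabs (C y)) by nra.
  destruct (HN dl Hdl) as [z' [Hz' [Hz'n Hz's]]].
  set (Z := fun t i => if Nat.ltb i k then z' i else if Nat.eqb i k then t else 0).
  assert (HZi : forall t i, (i < k)%nat -> Z t i = z' i).
  { intros t i Hi. unfold Z. replace (Nat.ltb i k) with true by (symmetry; apply Nat.ltb_lt; auto). auto. }
  assert (HZk : forall t, Z t k = t).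
  { intros t. unfold Z. rewrite Nat.ltb_irrefl, Nat.eqb_refl. auto. }
  assert (Hz'E : forall i, (i < k)%nat -> Rabs (z' i) < E).
  { intros i Hi. specialize (Hz' i Hi). specialize (Hy i ltac:(lia)).
    replace (z' i) with (y i + (z' i - y i)) by ring. eapply Rle_lt_trans; [apply Rabs_triang|]. lra. }
  assert (HZE : forall t, Rabs (t - y k) <= eta -> forall i, (i < S k)%nat -> Rabs (Z t i) < E).
  { intros t Ht i Hi. destruct (Nat.eq_dec i k) as [->|].
    - rewrite HZk. specialize (Hy k ltac:(lia)). replace t with (y k + (t - y k)) by ring.
      eapply Rle_lt_trans; [apply Rabs_triang|]. lra.
    - rewrite HZi by lia. apply Hz'E; lia. }
  (* Since [2 mu] equals [|kap y| eta], the value of [h] at each end of the interval has the sign of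
     [s * kap y]. *)
  assert (Hsign : forall s, Rabs s = eta -> Rabs (h (Z (y k + s)) - s * kap y) < 2 * mu).
  { intros s Hs.
    assert (Hs0 : s <> 0) by (intros ->; rewrite Rabs_R0 in Hs; lra).
    set (Y := vadd y (scalv s (unitv k))).
    assert (HYk : Y k = y k + s). { unfold Y, vadd, scalv, unitv. rewrite Nat.eqb_refl. ring. }
    assert (HYi : forall i, (i < k)%nat -> Y i = y i).
    { intros i Hi. unfold Y, vadd, scalv, unitv. rewrite (proj2 (Nat.eqb_neq i k)) by lia. ring. }
    specialize (Hd s Hs0 ltac:(lra)). rewrite Rplus_0_l in Hd. fold Y in Hd.
    assert (E0 : vadd y (scalv 0 (unitv k)) = y).
    { apply functional_extensionality; intros i; unfold vadd, scalv; ring. }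
    rewrite E0, Hhy, Rminus_0_r in Hd.
    assert (H1 : Rabs (h Y - s * kap y) < mu).
    { replace (h Y - s * kap y) with (s * (h Y / s - kap y)) by (field; auto).
      rewrite Rabs_mult, Hs. unfold mu. nra. }
    assert (H2 : Rabs (h (Z (y k + s)) - h Y) <= L * dl).
    { apply Hlip; [| |lra].
      - intros i Hi. destruct (Nat.eq_dec i k) as [->|].
        + rewrite HYk. specialize (Hy k ltac:(lia)). eapply Rle_lt_trans; [apply Rabs_triang|]. lra.
        + rewrite HYi by lia. specialize (Hy i Hi). lra.
      - intros i Hi. destruct (Nat.eq_dec i k) as [->|].
        + rewrite HYk, HZk. rewrite Rminus_diag_eq, Rabs_R0 by auto. lra.
        + rewrite HYi, HZi by lia. apply Rlt_le, Hz'; lia. }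
    replace (h (Z (y k + s)) - s * kap y) with ((h (Z (y k + s)) - h Y) + (h Y - s * kap y)) by ring.
    eapply Rle_lt_trans; [apply Rabs_triang|]. lra. }
  assert (Hkk : kap y * kap y = Rabs (kap y) * Rabs (kap y)).
  { rewrite <- Rabs_mult, Rabs_pos_eq; auto. apply Rle_0_sqr. }
  assert (Hmul : forall u v, Rabs (u - v) < 2 * mu -> Rabs (kap y * u - kap y * v) < Rabs (kap y) * (2 * mu)).
  { intros u v H. replace (kap y * u - kap y * v) with (kap y * (u - v)) by ring. rewrite Rabs_mult.
    apply Rmult_lt_compat_l; auto. }
  (* The factor [kap y] makes the function negative on the left and positive on the right, whatever
     the sign of [kap y]. *)
  destruct (IVT_interv (fun t => kap y * h (Z t)) (y k - eta) (y k + eta)) as [t [Ht Ht0]].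
  - intros t Ht. apply lip_continuity with (L := Rabs (kap y) * L) (d := E).
    + apply Rmult_le_pos; lra.
    + auto.
    + intros t' Ht'. replace (kap y * h (Z t') - kap y * h (Z t)) with (kap y * (h (Z t') - h (Z t))) by ring.
      rewrite Rabs_mult, Rmult_assoc. apply Rmult_le_compat_l; [lra|].
      apply Hlip.
      * intros i Hi. specialize (HZE t ltac:(apply Rabs_le; lra) i Hi). lra.
      * intros i Hi. destruct (Nat.eq_dec i k) as [->|]; [rewrite !HZk; lra|].
        rewrite !HZi by lia. rewrite Rminus_diag_eq, Rabs_R0 by auto. apply Rabs_pos.
      * split; [apply Rabs_pos | lra].
  - lra.
  - specialize (Hmul _ _ (Hsign (- eta) ltac:(rewrite Rabs_Ropp, Rabs_pos_eq; lra))).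
    apply Rabs_def2 in Hmul. replace (y k + - eta) with (y k - eta) in Hmul by ring. unfold mu in Hmul. nra.
  - specialize (Hmul _ _ (Hsign eta ltac:(rewrite Rabs_pos_eq; lra))).
    apply Rabs_def2 in Hmul. unfold mu in Hmul. nra.
  - assert (Hh0 : h (Z t) = 0).
    { destruct (Rmult_integral _ _ Ht0); auto. contradiction. }
    assert (Htk : Rabs (t - y k) <= eta) by (apply Rabs_le; lra).
    exists (Z t). split; [|split].
    + intros i Hi. destruct (Nat.eq_dec i k) as [->|]; [rewrite HZk; lra|].
      rewrite HZi by lia. specialize (Hz' i ltac:(lia)). lra.
    + destruct Hz'n as [i [Hi Hi']]. exists i. split; [lia|]. rewrite HZi; auto.
    + apply HZ; auto.
      * intros i Hi. specialize (HZE t Htk i Hi). lra.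
      * intros HC1. assert (H1 : Rabs (C (Z t) - C y) <= Lc * dl).
        { apply HlipC; [| |lra].
          - intros i Hi. specialize (Hy i ltac:(lia)). lra.
          - intros i Hi. rewrite HZi by auto. apply Rlt_le, Hz'; auto. }
        rewrite HC1 in H1. replace (0 - C y) with (- C y) in H1 by ring. rewrite Rabs_Ropp in H1. lra.
      * intros s Hs. rewrite (Hdep z' ltac:(intros i Hi; specialize (Hz'E i Hi); lra) s Hs (Z t)); auto.
Qed.

(** * Linear changes of coordinates and the structure theorem *)

(** Carries the axis of the variable [k] to the line spanned by [(lam, 1)] and fixes the hyperplane
    where that variable is 0; the inverse is the shear by [- lam]. *)
Definition shear (k : nat) (lam y : Rvec) : Rvec :=
  fun i => if Nat.ltb i k then y i + lam i * y k else y i.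

Lemma shear_lt k lam y i : (i < k)%nat -> shear k lam y i = y i + lam i * y k.
Proof. intros H. unfold shear. replace (Nat.ltb i k) with true; auto. symmetry; apply Nat.ltb_lt; auto. Qed.

Lemma shear_ge k lam y i : (k <= i)%nat -> shear k lam y i = y i.
Proof. intros H. unfold shear. replace (Nat.ltb i k) with false; auto. symmetry; apply Nat.ltb_ge; auto. Qed.

Lemma shear_inv k lam mu y : (forall i, mu i = - lam i) -> shear k lam (shear k mu y) = y.
Proof.
  intros H. apply functional_extensionality; intros i. destruct (Nat.lt_ge_cases i k) as [Hi|Hi].
  - rewrite !shear_lt by auto. rewrite (shear_ge k mu y k), H by lia. ring.
  - rewrite !shear_ge by auto. auto.
Qed.

Lemma shear_lin k lam y V t : shear k lam (vadd y (scalv t V)) = vadd (shear k lam y) (scalv t (shear k lam V)).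
Proof.
  apply functional_extensionality; intros i. unfold vadd, scalv, shear.
  destruct (Nat.ltb i k); ring.
Qed.

Lemma Og_shear k lam f : Og (S k) f -> Og (S k) (fun y => f (shear k lam y)).
Proof.
  intros Hf. apply (Og_subst (S k) (S k) f (fun i y => shear k lam y i)); auto.
  - intros i Hi. unfold shear. destruct (Nat.ltb i k).
    + apply Og_plus; [apply Og_coord; auto | apply Og_scal, Og_coord; lia].
    + apply Og_coord; auto.
  - intros i Hi. unfold shear, zerov. destruct (Nat.ltb i k); ring.
Qed.

Lemma sm_shear k lam x small : prime_ideal small ->
  (forall j, (j < S k)%nat -> small (fun m => shear k lam (x m) j)) ->
  forall j, (j < S k)%nat -> small (fun m => x m j).
Proof.
  intros HS H.
  assert (Hk : small (fun m => x m k)).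
  { eapply sm_eq; [auto| |apply (H k); lia]. intros m; simpl. rewrite shear_ge; auto. }
  intros j Hj. destruct (Nat.eq_dec j k) as [->|]; auto.
  apply sm_eq with (fun m => shear k lam (x m) j - lam j * x m k); auto.
  { intros m. rewrite shear_lt by lia. ring. }
  apply sm_sub; auto. apply (sm_mul _ HS); auto. apply bdd_const.
Qed.

Lemma tend0_shear k lam x : tend0 (S k) x -> tend0 (S k) (fun m => shear k lam (x m)).
Proof.
  intros Hx i Hi e He.
  assert (Hn : near (S k) (fun y => Rabs (shear k lam y i) < e)).
  { pose proof (Rabs_pos (lam i)). exists (e / (1 + Rabs (lam i))).
    split; [apply Rdiv_lt_0_compat; lra|]. intros y Hy.
    assert (Hle : e / (1 + Rabs (lam i)) <= e).
    { apply Rle_div_l; [lra|]. nra. }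
    destruct (Nat.lt_ge_cases i k) as [Hk|Hk].
    - rewrite shear_lt by auto. eapply Rle_lt_trans; [apply Rabs_triang|]. rewrite Rabs_mult.
      pose proof (Hy i Hi) as H1. pose proof (Hy k ltac:(lia)) as H2.
      apply Rlt_div_r in H1; [|lra]. apply Rlt_div_r in H2; [|lra].
      pose proof (Rabs_pos (y i)). pose proof (Rabs_pos (y k)).
      set (q := e / (1 + Rabs (lam i))) in *.
      assert (Hq : q * (1 + Rabs (lam i)) = e) by (unfold q; field; lra).
      pose proof (Hy i Hi). pose proof (Hy k ltac:(lia)). nra.
    - rewrite shear_ge by auto. specialize (Hy i Hi). lra. }
  apply (near_ev (S k) x _ Hn Hx).
Qed.

(** A point [a] near 0 with [f a <> 0] and [a k <> 0] lies on the image of the axis under the shear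
    by [lam i = a i / a k], so the sheared germ does not vanish identically on the axis. *)
Lemma regular_after_shear k f : Og (S k) f -> ~ near (S k) (fun y => f y = 0) ->
  exists lam b, regular k b (fun y => f (shear k lam y)).
Proof.
  intros Hf Hnz. assert (Hf' := Hf). destruct Hf' as [r [M [Hr HP]]].
  destruct (Og_lip (S k) f Hf) as [L [eL [HL [HeL Hlip]]]].
  set (E := Rmin (r / 4) (eL / 2)). assert (HE : 0 < E) by (apply Rmin_pos; lra).
  assert (HE1 : E <= r / 4) by apply Rmin_l. assert (HE2 : E <= eL / 2) by apply Rmin_r.
  assert (Ha0 : exists a0, (forall i, (i < S k)%nat -> Rabs (a0 i) < E) /\ f a0 <> 0).
  { apply NNPP; intros Hn. apply Hnz. exists E; split; auto. intros y Hy. apply NNPP; intros H; apply Hn; eauto. }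
  destruct Ha0 as [a0 [Ha0 Hfa0]].
  (* If [a0 k] is 0, this coordinate is moved by a [t] so small that the Lipschitz bound keeps [f]
     nonzero. *)
  assert (Ha : exists a, (forall i, (i < S k)%nat -> Rabs (a i) < 2 * E) /\ f a <> 0 /\ a k <> 0).
  { destruct (Req_dec (a0 k) 0) as [Hz|Hz].
    - assert (Hpos : 0 < Rabs (f a0)) by (apply Rabs_pos_lt; auto).
      set (t := Rmin (E / 2) (Rabs (f a0) / (2 * (L + 1)))).
      assert (Ht : 0 < t) by (apply Rmin_pos; [lra | apply Rdiv_lt_0_compat; lra]).
      assert (Ht1 : t <= E / 2) by apply Rmin_l.
      assert (Ht2 : t <= Rabs (f a0) / (2 * (L + 1))) by apply Rmin_r. apply Rle_div_r in Ht2; [|lra].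
      set (a := fun i => if Nat.eqb i k then t else a0 i).
      exists a. split; [|split].
      + intros i Hi. unfold a. destruct (Nat.eqb i k). rewrite Rabs_pos_eq; lra. specialize (Ha0 i Hi); lra.
      + intros H0. assert (H1 : Rabs (f a - f a0) <= L * t).
        { apply Hlip; [| |lra].
          - intros i Hi; specialize (Ha0 i Hi); lra.
          - intros i Hi. unfold a. destruct (Nat.eqb_spec i k) as [->|].
            rewrite Hz, Rminus_0_r, Rabs_pos_eq; lra. rewrite Rminus_diag_eq, Rabs_R0; auto; lra. }
        rewrite H0 in H1. replace (0 - f a0) with (- f a0) in H1 by ring. rewrite Rabs_Ropp in H1. nra.
      + unfold a. rewrite Nat.eqb_refl. lra.
    - exists a0. split; auto. intros i Hi; specialize (Ha0 i Hi); lra. }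
  destruct Ha as [a [Ha [Hfa Hak]]].
  set (lam := fun i => a i / a k). exists lam.
  assert (Hak' : 0 < Rabs (a k)) by (apply Rabs_pos_lt; auto).
  (* The radius in the last variable has to exceed [|a k|], and the sheared coordinates must stay
     within [r]: from [|a i| < 2 E <= r / 2] one gets [r / 4 + 3 / 2 |a i| <= r]. *)
  set (s := 3 / 2 * Rabs (a k)).
  set (rho := fun i => if Nat.eqb i k then s else r / 4).
  assert (Hrk : rho k = s) by (unfold rho; rewrite Nat.eqb_refl; auto).
  assert (Hpr : posr (S k) rho). { intros i Hi; unfold rho, s. destruct (Nat.eqb i k); lra. }
  apply (regular_exists k rho M (fun y => f (shear k lam y)) (Rmin s (r / 4)) (a k)).
  - apply (PS_subst (S k) (S k) (cst r) rho M f (fun i y => shear k lam y i)); auto.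
    + apply posr_cst; auto.
    + intros i Hi. unfold cst. destruct (Nat.eq_dec i k) as [->|].
      * eapply PS_ext; [|eapply PS_le; [|apply (PS_coord (S k) rho k); auto]].
        { intros y _. rewrite shear_ge; auto. }
        rewrite Hrk. unfold s. specialize (Ha k ltac:(lia)). lra.
      * eapply PS_ext; [|eapply PS_le; [|apply PS_plus; [auto|apply (PS_coord (S k) rho i); auto|
           apply (PS_scal (S k) rho (rho k) (fun y => y k) (lam i)), (PS_coord (S k) rho k); auto]]].
        { intros y _. cbv beta. rewrite shear_lt by lia. ring. }
        rewrite Hrk. unfold rho. rewrite (proj2 (Nat.eqb_neq i k)) by auto. unfold lam, s, Rdiv.
        rewrite Rabs_mult, Rabs_inv.
        replace (Rabs (a i) * / Rabs (a k) * (3 * / 2 * Rabs (a k))) with (3 / 2 * Rabs (a i)) by (field; lra).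
        specialize (Ha i Hi). lra.
  - apply Rmin_pos; unfold s; lra.
  - intros i Hi. unfold rho. destruct (Nat.eqb i k). apply Rmin_l. apply Rmin_r.
  - rewrite Hrk. unfold s. lra.
  - destruct HP as [c [l [Hl [HM Hs]]]]. intros H0. apply Hfa. rewrite <- H0.
    apply PS_dep with (S k) (cst r) M.
    + exists c, l; auto.
    + intros i Hi. unfold cst. destruct (Nat.eq_dec i k) as [->|].
      * rewrite shear_ge by lia. unfold axis. rewrite Nat.eqb_refl. specialize (Ha k Hi). lra.
      * rewrite shear_lt by lia. unfold axis. rewrite Nat.eqb_refl, (proj2 (Nat.eqb_neq i k)) by auto.
        unfold lam. replace (0 + a i / a k * a k) with (a i) by (field; auto). specialize (Ha i Hi). lra.
    + intros i Hi. destruct (Nat.eq_dec i k) as [->|].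
      * rewrite shear_ge by lia. unfold axis. rewrite Nat.eqb_refl. auto.
      * rewrite shear_lt by lia. unfold axis. rewrite Nat.eqb_refl, (proj2 (Nat.eqb_neq i k)) by auto.
        unfold lam. field. auto.
Qed.

Lemma structure_of_shear k lam x small : prime_ideal small ->
  (exists V, tangent_field (S k) (fun m => shear k (fun i => - lam i) (x m)) small V) ->
  generically_not_isolated (S k) (fun m => shear k (fun i => - lam i) (x m)) small ->
  (exists V, tangent_field (S k) x small V) /\ generically_not_isolated (S k) x small.
Proof.
  intros HS [V [HVb [HVn HV]]] HA.
  set (mu := fun i => - lam i) in *.
  assert (Einv : forall y, shear k lam (shear k mu y) = y) by (intros; apply shear_inv; auto).
  assert (Einv' : forall y, shear k mu (shear k lam y) = y).
  { intros; apply shear_inv. intros; unfold mu; ring. }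
  split.
  - exists (fun m => shear k lam (V m)). split; [|split].
    + intros j Hj. destruct (Nat.lt_ge_cases j k) as [Hk|Hk].
      * destruct (bdd_add _ _ (HVb j Hj) (bdd_mul _ _ (bdd_const (lam j)) (HVb k ltac:(lia)))) as [B [N HB]].
        exists B, N. intros m Hm. rewrite shear_lt; auto.
      * destruct (HVb j Hj) as [B [N HB]]. exists B, N. intros m Hm. rewrite shear_ge; auto.
    + apply NNPP; intros Hn. destruct HVn as [j [Hj Hjn]]. apply Hjn.
      apply sm_shear with k lam; auto. intros i Hi. apply NNPP; intros Hi'. apply Hn; eauto.
    + intros p Hp Hps. destruct (HV (fun y => p (shear k lam y))) as [u [Hu [N HN]]].
      * apply Og_shear; auto.
      * eapply sm_eq; [auto| |apply Hps]. intros m; simpl. rewrite Einv; auto.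
      * exists u; split; auto. exists N. intros m Hm. specialize (HN m Hm). unfold ddir in *.
        replace (fun t => p (vadd (x m) (scalv t (shear k lam (V m))))) with
          (fun t => p (shear k lam (vadd (shear k mu (x m)) (scalv t (V m))))); auto.
        apply functional_extensionality; intros t. rewrite shear_lin, Einv; auto.
  - intros ps Hps. destruct (HA (map (fun p y => p (shear k lam y)) ps)) as [c [qs [Hc [Hcn [Hqs [N HN]]]]]].
    { intros p Hp. apply in_map_iff in Hp. destruct Hp as [p0 [<- Hp0]]. destruct (Hps p0 Hp0) as [H1 H2]. split.
      - apply Og_shear; auto.
      - eapply sm_eq; [auto| |apply H2]. intros m; simpl. rewrite Einv; auto. }
    exists (fun y => c (shear k mu y)), (map (fun q y => q (shear k mu y)) qs).
    split; [apply Og_shear; auto|]. split; auto. split.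
    { intros q Hq. apply in_map_iff in Hq. destruct Hq as [q0 [<- Hq0]]. destruct (Hqs q0 Hq0).
      split; [apply Og_shear; auto | auto]. }
    exists N. intros m Hm Hcm Hqm e He.
    set (B := 1 + sumn (S k) (fun i => Rabs (lam i))).
    assert (HB : forall i, (i < S k)%nat -> Rabs (lam i) <= B - 1).
    { intros i Hi. pose proof (sumn_term_le (S k) (fun j => Rabs (lam j)) i (fun j _ => Rabs_pos _) Hi). unfold B. lra. }
    assert (HB1 : 1 <= B). { pose proof (HB k ltac:(lia)). pose proof (Rabs_pos (lam k)). lra. }
    destruct (HN m Hm Hcm) with (e := e / B) as [z [Hz [[i [Hi Hzi]] Hpz]]].
    { intros q Hq. apply (Hqm (fun y => q (shear k mu y))). apply in_map_iff. exists q; auto. }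
    { apply Rdiv_lt_0_compat; lra. }
    exists (shear k lam z). split; [|split].
    + intros j Hj. rewrite <- (Einv (x m)). set (y := shear k mu (x m)) in *.
      assert (Hq : e / B * B = e) by (field; lra).
      pose proof (Hz j Hj) as Hzj. pose proof (Hz k ltac:(lia)) as Hzk.
      assert (0 < e / B) by (apply Rdiv_lt_0_compat; lra).
      destruct (Nat.lt_ge_cases j k) as [Hk|Hk].
      * rewrite !shear_lt by auto.
        replace (z j + lam j * z k - (y j + lam j * y k)) with ((z j - y j) + lam j * (z k - y k)) by ring.
        eapply Rle_lt_trans; [apply Rabs_triang|]. rewrite Rabs_mult.
        pose proof (HB j Hj). pose proof (Rabs_pos (lam j)). pose proof (Rabs_pos (z k - y k)). nra.
      * rewrite !shear_ge by auto. nra.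
    + apply NNPP; intros Hn. apply Hzi. rewrite <- (Einv' z).
      assert (Heq : forall j, (j < S k)%nat -> shear k lam z j = x m j).
      { intros j Hj. apply NNPP; intros H; apply Hn; eauto. }
      unfold shear at 1 3. rewrite !Heq by lia. auto.
    + intros p Hp. apply (Hpz (fun y => p (shear k lam y))). apply in_map_iff. exists p; auto.
Qed.

(* A prime ideal of analytic germs other than the maximal ideal is, generically and after a linear
   change of coordinates, generated by polynomials solvable for one coordinate each, and at least
   one coordinate remains free. *)
Theorem structure_theorem k x small : prime_ideal small -> tend0 k x ->
  (exists i, (i < k)%nat /\ ~ small (fun m => x m i)) ->
  (exists V, tangent_field k x small V) /\ generically_not_isolated k x small.
Proof.
  intros HS. revert x. induction k as [|k IH]; intros x Hx Hns; [destruct Hns as [i [Hi _]]; lia|].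
  destruct (classic (exists f, Og (S k) f /\ small (fun m => f (x m)) /\ ~ near (S k) (fun y => f y = 0)))
    as [[f [Hf [Hfs Hfn]]]|Hall].
  - destruct (regular_after_shear k f Hf Hfn) as [lam [b Hreg]].
    set (mu := fun i => - lam i). set (x' := fun m => shear k mu (x m)).
    assert (Hx' : tend0 (S k) x') by (apply tend0_shear; auto).
    assert (Hns' : exists i, (i < S k)%nat /\ ~ small (fun m => x' m i)).
    { apply NNPP; intros Hn. destruct Hns as [i [Hi Hin]]. apply Hin. apply sm_shear with k mu; auto.
      intros j Hj. apply NNPP; intros H; apply Hn; eauto. }
    destruct (ideal_generically_generated k b _ x' small HS Hx' Hns' Hreg) as [Hns'' [e [a [Hla [He [Hkap HT]]]]]].
    { eapply sm_eq; [auto| |apply Hfs]. intros m; simpl. unfold x'. rewrite shear_inv; auto. }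
    destruct (IH x' (tend0_pred _ _ Hx') Hns'') as [[V' HV'] HA'].
    apply structure_of_shear with lam; auto.
    + apply tangent_field_step with e a V'; auto.
    + apply not_isolated_step with e a; auto.
  (* Here [P] contains only the zero germ: a constant unit vector is tangent, and no point near 0 is
     an isolated zero. *)
  - assert (Hz : forall p, Og (S k) p -> small (fun m => p (x m)) -> near (S k) (fun y => p y = 0)).
    { intros p Hp Hps. apply NNPP; intros H; apply Hall; eauto. }
    split.
    + exists (fun _ => unitv 0). split; [|split].
      * intros j _. apply bdd_const.
      * exists 0%nat. split; [lia|]. unfold unitv; simpl. apply (sm_one _ HS).
      * intros p Hp Hps. exists (fun _ => 0). split; [apply (sm_zero _ HS)|].
        assert (Hn : near (S k) (fun y => 0 = p y)) by (eapply near_mono; [|apply (Hz p Hp Hps)]; intros; symmetry; auto).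
        destruct (near_ev (S k) x _ (ddir_ext_near (S k) (fun _ => 0) p Hn) Hx) as [N HN].
        exists N. intros m Hm. apply HN; auto. apply derivable_pt_lim_const.
    + intros ps Hps. exists (fun _ => 1), nil. split; [apply Og_const|]. split; [apply (sm_one _ HS)|].
      split; [intros q []|].
      destruct (near_list (S k) ps (fun p y => p y = 0)) as [E [HE HzE]].
      { intros p Hp. apply Hz; apply Hps; auto. }
      assert (Hin : exists N, forall m, (N <= m)%nat -> forall i, (i < S k)%nat -> Rabs (x m i) < E / 2).
      { apply (near_ev (S k) x (fun y => forall i, (i < S k)%nat -> Rabs (y i) < E / 2)); auto.
        exists (E / 2); split; [lra|]; auto. }
      destruct Hin as [N HN]. exists N. intros m Hm _ _ e He.
      set (d := Rmin e E / 2). assert (0 < Rmin e E) by (apply Rmin_pos; auto).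
      pose proof (Rmin_l e E); pose proof (Rmin_r e E).
      set (z := fun i => x m i + (if Nat.eqb i 0 then d else 0)). exists z.
      assert (Hd : forall i, Rabs (z i - x m i) <= d).
      { intros i; unfold z. replace (x m i + _ - x m i) with (if Nat.eqb i 0 then d else 0) by ring.
        destruct (Nat.eqb i 0); [rewrite Rabs_pos_eq|rewrite Rabs_R0]; unfold d; lra. }
      split; [|split].
      * intros i Hi. specialize (Hd i). unfold d in *; lra.
      * exists 0%nat. split; [lia|]. unfold z, d; simpl. lra.
      * apply HzE. intros i Hi. specialize (HN m Hm i Hi). specialize (Hd i).
        replace (z i) with (x m i + (z i - x m i)) by ring. eapply Rle_lt_trans; [apply Rabs_triang|].
        unfold d in *; lra.
Qed.

(** * Functions of class C^r *)

Lemma normv_nonneg n x : 0 <= normv n x.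
Proof. induction n as [|n IH]; simpl; [lra|]. eapply Rle_trans; [apply IH | apply Rmax_l]. Qed.

Lemma normv_ge n x i : (i < n)%nat -> Rabs (x i) <= normv n x.
Proof.
  induction n as [|n IH]; intros Hi; [lia|]. simpl. destruct (Nat.eq_dec i n) as [->|].
  - apply Rmax_r.
  - eapply Rle_trans; [apply IH; lia | apply Rmax_l].
Qed.

Lemma normv_le n x M : 0 <= M -> (forall i, (i < n)%nat -> Rabs (x i) <= M) -> normv n x <= M.
Proof. intros HM; induction n as [|n IH]; intros H; simpl; auto. apply Rmax_lub; auto. Qed.

Lemma normv_lt n x M : 0 < M -> (forall i, (i < n)%nat -> Rabs (x i) < M) -> normv n x < M.
Proof. intros HM; induction n as [|n IH]; intros H; simpl; auto. apply Rmax_lub_lt; auto. Qed.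

Lemma distv_nonneg n x y : 0 <= distv n x y.
Proof. apply normv_nonneg. Qed.

Lemma distv_ge n x y i : (i < n)%nat -> Rabs (x i - y i) <= distv n x y.
Proof. apply (normv_ge n (fun i => x i - y i)). Qed.

Lemma distv_le n x y M : 0 <= M -> (forall i, (i < n)%nat -> Rabs (x i - y i) <= M) -> distv n x y <= M.
Proof. apply (normv_le n (fun i => x i - y i)). Qed.

Lemma distv_lt n x y M : 0 < M -> (forall i, (i < n)%nat -> Rabs (x i - y i) < M) -> distv n x y < M.
Proof. apply (normv_lt n (fun i => x i - y i)). Qed.

Lemma distv_refl n x : distv n x x = 0.
Proof.
  apply Rle_antisym; [|apply distv_nonneg]. apply distv_le; [lra|].
  intros; rewrite Rminus_diag_eq, Rabs_R0; auto; lra.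
Qed.

Lemma distv_sym n x y : distv n x y = distv n y x.
Proof.
  assert (H : forall x y, distv n x y <= distv n y x).
  { intros u v. apply distv_le; [apply distv_nonneg|]. intros i Hi. rewrite Rabs_minus_sym. apply distv_ge; auto. }
  apply Rle_antisym; auto.
Qed.

Lemma distv_triang n x y z : distv n x z <= distv n x y + distv n y z.
Proof.
  apply distv_le. { pose proof (distv_nonneg n x y); pose proof (distv_nonneg n y z); lra. }
  intros i Hi. replace (x i - z i) with ((x i - y i) + (y i - z i)) by ring.
  eapply Rle_trans; [apply Rabs_triang|]. apply Rplus_le_compat; apply distv_ge; auto.
Qed.

Lemma distv_zero n x : distv n x zerov = normv n x.
Proof. unfold distv, zerov. f_equal. apply functional_extensionality; intros; ring. Qed.

Lemma inRn_ext n x y : inRn n x -> inRn n y -> eqn n x y -> x = y.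
Proof.
  intros Hx Hy H. apply functional_extensionality; intros i.
  destruct (Nat.lt_ge_cases i n); [apply H; auto | rewrite Hx, Hy; auto].
Qed.

Lemma distv_eq0 n x y : inRn n x -> inRn n y -> distv n x y <= 0 -> x = y.
Proof.
  intros Hx Hy H. apply inRn_ext with n; auto. intros i Hi.
  pose proof (distv_ge n x y i Hi). pose proof (Rabs_pos (x i - y i)).
  apply Rminus_diag_uniq, Rabs_eq_0. lra.
Qed.

Lemma shift_same x i t : shift x i t i = x i + t.
Proof. unfold shift; rewrite Nat.eqb_refl; auto. Qed.

Lemma shift_other x i t j : j <> i -> shift x i t j = x j.
Proof. intros H. unfold shift. rewrite (proj2 (Nat.eqb_neq j i)); auto. Qed.

Lemma shift_zero x i : shift x i 0 = x.
Proof.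
  apply functional_extensionality; intros j. destruct (Nat.eq_dec j i) as [->|].
  rewrite shift_same; ring. rewrite shift_other; auto.
Qed.

Lemma shift_shift x i s t : shift (shift x i s) i t = shift x i (s + t).
Proof.
  apply functional_extensionality; intros j. destruct (Nat.eq_dec j i) as [->|].
  rewrite !shift_same; ring. rewrite !shift_other; auto.
Qed.

Lemma shift_inRn n x i t : (i < n)%nat -> inRn n x -> inRn n (shift x i t).
Proof. intros Hi Hx j Hj. rewrite shift_other by lia. auto. Qed.

Lemma distv_shift n x i t : distv n (shift x i t) x <= Rabs t.
Proof.
  apply distv_le; [apply Rabs_pos|]. intros j Hj. destruct (Nat.eq_dec j i) as [->|].
  - rewrite shift_same. replace (x i + t - x i) with t by ring. lra.
  - rewrite shift_other by auto. rewrite Rminus_diag_eq, Rabs_R0; auto. apply Rabs_pos.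
Qed.

Lemma ball_open n e : openset n (ball n e).
Proof.
  split; [intros x Hx; apply Hx|]. intros x [Hx Hd]. exists (e - distv n x zerov). split; [lra|].
  intros y [Hy Hyd]. split; auto. pose proof (distv_triang n y x zerov). lra.
Qed.

Lemma ball_mono n e e' x : e <= e' -> ball n e x -> ball n e' x.
Proof. intros H [Hx Hd]. split; auto. lra. Qed.

Lemma ball_zero n e : 0 < e -> ball n e zerov.
Proof. intros H. split. intros i _; auto. rewrite distv_refl; auto. Qed.

Lemma shift_open n U x i : openset n U -> U x -> (i < n)%nat -> exists d, 0 < d /\ forall t, Rabs t < d -> U (shift x i t).
Proof.
  intros [HU1 HU2] Hx Hi. destruct (HU2 x Hx) as [r [Hr H]]. exists r; split; auto. intros t Ht.
  apply H. split. apply shift_inRn; auto. eapply Rle_lt_trans; [apply distv_shift | auto].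
Qed.

(** [Cr_on] quantifies over iterated values of [pd]; here the partial derivatives are exhibited one
    order at a time, which makes closure under sums and products a plain induction. *)
Fixpoint CC (n r : nat) (U : Rvec -> Prop) (g : fn) : Prop :=
  contf n U g /\
  match r with
  | O => True
  | S r' => exists D : nat -> fn, forall i, (i < n)%nat ->
      (forall x, U x -> derivable_pt_lim (fun t => g (shift x i t)) 0 (D i x)) /\ CC n r' U (D i)
  end.

Lemma CC_cont n r U g : CC n r U g -> contf n U g.
Proof. destruct r; simpl; tauto. Qed.

Lemma derivable_pt_lim_local (f g : R -> R) (l d : R) : 0 < d -> (forall t, Rabs t < d -> f t = g t) ->
  derivable_pt_lim f 0 l -> derivable_pt_lim g 0 l.
Proof.
  intros Hd H Hf e He. destruct (Hf e He) as [[d' Hd'] H']. simpl in H'.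
  assert (Hm : 0 < Rmin d d') by (apply Rmin_pos; auto). exists (mkposreal _ Hm). simpl.
  pose proof (Rmin_l d d'); pose proof (Rmin_r d d').
  intros h Hh Hhd. rewrite <- !H. apply H'; auto; lra. rewrite Rabs_R0; auto. rewrite Rplus_0_l; lra.
Qed.

Lemma contf_ext n U g g' : (forall x, U x -> g x = g' x) -> contf n U g -> contf n U g'.
Proof.
  intros H Hg x Hx e He. destruct (Hg x Hx e He) as [d [Hd Hd']]. exists d; split; auto.
  intros y Hy Hyd. rewrite <- !H; auto.
Qed.

Lemma CC_ext n r U g g' : openset n U -> (forall x, U x -> g x = g' x) -> CC n r U g -> CC n r U g'.
Proof.
  intros HU H Hg. destruct r as [|r]; simpl in *; destruct Hg as [Hc Hg]; (split; [eapply contf_ext; eauto|auto]).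
  destruct Hg as [D HD]. exists D. intros i Hi. destruct (HD i Hi) as [H1 H2]. split; auto.
  intros x Hx. destruct (shift_open n U x i HU Hx Hi) as [d [Hd Hs]].
  apply derivable_pt_lim_local with (2 := fun t Ht => H _ (Hs t Ht)); auto.
Qed.

Lemma pd_spec i g x l : derivable_pt_lim (fun t => g (shift x i t)) 0 l -> pd i g x = l.
Proof.
  intros H. apply (uniqueness_limite (fun t => g (shift x i t)) 0); auto.
  unfold pd. apply (epsilon_spec (inhabits 0) (fun l => derivable_pt_lim (fun t => g (shift x i t)) 0 l)).
  exists l; auto.
Qed.

(** The last index of the list is differentiated first, so inductions on [r] take lists apart at
    their end. *)
Lemma iterD_snoc l i g : iterD (l ++ i :: nil) g = iterD l (pd i g).
Proof. unfold iterD. rewrite fold_right_app. auto. Qed.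

Lemma Cr_on_CC n r U g : Cr_on n r U g -> CC n r U g.
Proof.
  revert g; induction r as [|r IH]; intros g H; simpl.
  - split; auto. apply (H nil); auto. constructor.
  - destruct (H nil ltac:(constructor) ltac:(simpl; lia)) as [H1 H2]. split; auto.
    exists (fun i => pd i g). intros i Hi. split.
    + intros x Hx. destruct (H2 ltac:(simpl; lia) i x Hi Hx) as [d Hd]. simpl in Hd.
      rewrite (pd_spec i g x d Hd). auto.
    + apply IH. intros l Hl Hlen.
      assert (Hl' : idx_ok n (l ++ i :: nil)) by (apply Forall_app; split; auto; constructor; auto).
      destruct (H (l ++ i :: nil) Hl') as [K1 K2]. { rewrite length_app; simpl; lia. }
      rewrite iterD_snoc in K1, K2. split; auto. intros Hlt. apply K2. rewrite length_app; simpl; lia.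
Qed.

Lemma list_nil_or_snoc {A} (l : list A) : l = nil \/ exists l' a, l = l' ++ a :: nil.
Proof.
  destruct l as [|a l]; auto. right. destruct (@exists_last A (a :: l)) as [l' [b E]]; [discriminate|]. eauto.
Qed.

Lemma CC_Cr_on n r U g : openset n U -> CC n r U g -> Cr_on n r U g.
Proof.
  intros HU. revert g; induction r as [|r IH]; intros g H l Hl Hlen.
  - destruct l; [|simpl in Hlen; lia]. simpl in *. split; [tauto|]. intros; lia.
  - destruct H as [H1 [D HD]]. destruct (list_nil_or_snoc l) as [->|[l' [i ->]]].
    + simpl. split; auto. intros _ i x Hi Hx. exists (D i x). apply HD; auto.
    + apply Forall_app in Hl. destruct Hl as [Hl' Hi]. inversion Hi as [|? ? Hi' _]; subst.
      rewrite length_app in *; simpl in *. rewrite iterD_snoc.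
      destruct (HD i Hi') as [K1 K2].
      assert (K3 : Cr_on n r U (pd i g)).
      { apply IH. apply CC_ext with (D i); auto. intros x Hx. symmetry; apply pd_spec; auto. }
      destruct (K3 l' Hl' ltac:(lia)) as [M1 M2]. split; auto. intros Hlt. apply M2; lia.
Qed.

Lemma contf_const n U a : contf n U (fun _ => a).
Proof. intros x _ e He. exists 1; split; [lra|]. intros; rewrite Rminus_diag_eq, Rabs_R0; auto. Qed.

Lemma contf_plus n U f g : contf n U f -> contf n U g -> contf n U (fun x => f x + g x).
Proof.
  intros Hf Hg x Hx e He. destruct (Hf x Hx (e / 2) ltac:(lra)) as [d [Hd Hd']].
  destruct (Hg x Hx (e / 2) ltac:(lra)) as [d1 [Hd1 Hd1']].
  exists (Rmin d d1). split; [apply Rmin_pos; auto|]. pose proof (Rmin_l d d1); pose proof (Rmin_r d d1).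
  intros y Hy Hyd. replace (f y + g y - (f x + g x)) with ((f y - f x) + (g y - g x)) by ring.
  eapply Rle_lt_trans; [apply Rabs_triang|].
  specialize (Hd' y Hy ltac:(lra)). specialize (Hd1' y Hy ltac:(lra)). lra.
Qed.

Lemma contf_mult n U f g : contf n U f -> contf n U g -> contf n U (fun x => f x * g x).
Proof.
  intros Hf Hg x Hx e He.
  set (A := Rabs (f x) + 1). set (B := Rabs (g x) + 1).
  assert (HA : 0 < A) by (unfold A; pose proof (Rabs_pos (f x)); lra).
  assert (HB : 0 < B) by (unfold B; pose proof (Rabs_pos (g x)); lra).
  assert (H1 : 0 < Rmin 1 (e / (2 * B))) by (apply Rmin_pos; [lra | apply Rdiv_lt_0_compat; lra]).
  assert (H2 : 0 < e / (2 * A)) by (apply Rdiv_lt_0_compat; lra).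
  destruct (Hf x Hx _ H1) as [d [Hd Hd']]. destruct (Hg x Hx _ H2) as [d1 [Hd1 Hd1']].
  exists (Rmin d d1). split; [apply Rmin_pos; auto|]. pose proof (Rmin_l d d1); pose proof (Rmin_r d d1).
  intros y Hy Hyd. specialize (Hd' y Hy ltac:(lra)). specialize (Hd1' y Hy ltac:(lra)).
  pose proof (Rmin_l 1 (e / (2 * B))); pose proof (Rmin_r 1 (e / (2 * B))).
  replace (f y * g y - f x * g x) with (f y * (g y - g x) + (f y - f x) * g x) by ring.
  eapply Rle_lt_trans; [apply Rabs_triang|]. rewrite !Rabs_mult.
  assert (Hfy : Rabs (f y) <= A).
  { unfold A. replace (f y) with (f x + (f y - f x)) by ring. eapply Rle_trans; [apply Rabs_triang|]. lra. }
  assert (K1 : Rabs (f y - f x) < e / (2 * B)) by lra. apply Rlt_div_r in K1; [|lra].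
  apply Rlt_div_r in Hd1'; [|lra].
  pose proof (Rabs_pos (f y)). pose proof (Rabs_pos (g y - g x)). pose proof (Rabs_pos (f y - f x)).
  assert (Rabs (g x) <= B) by (unfold B; lra). pose proof (Rabs_pos (g x)).
  assert (Rabs (f y) * Rabs (g y - g x) <= A * Rabs (g y - g x)) by (apply Rmult_le_compat_r; auto).
  assert (Rabs (f y - f x) * Rabs (g x) <= Rabs (f y - f x) * B) by (apply Rmult_le_compat_l; auto). lra.
Qed.

Lemma contf_inv n U g : contf n U g -> (forall x, U x -> g x <> 0) -> contf n U (fun x => / g x).
Proof.
  intros Hg Hn x Hx e He. pose proof (Rabs_pos_lt _ (Hn x Hx)) as Hp. set (a := Rabs (g x)) in *.
  assert (H1 : 0 < Rmin (a / 2) (e * (a * a) / 2)) by (apply Rmin_pos; [lra|]; assert (0 < a * a) by nra; nra).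
  destruct (Hg x Hx _ H1) as [d [Hd Hd']]. exists d; split; auto. intros y Hy Hyd.
  specialize (Hd' y Hy Hyd). pose proof (Rmin_l (a / 2) (e * (a * a) / 2)); pose proof (Rmin_r (a / 2) (e * (a * a) / 2)).
  assert (Hgy : a / 2 < Rabs (g y)).
  { assert (a <= Rabs (g y) + Rabs (g y - g x)); [|lra]. unfold a.
    replace (g x) with (g y + - (g y - g x)) at 1 by ring. eapply Rle_trans; [apply Rabs_triang|]. rewrite Rabs_Ropp. lra. }
  replace (/ g y - / g x) with (- (g y - g x) * / (g y * g x)) by (field; split; auto).
  rewrite Rabs_mult, Rabs_Ropp, Rabs_inv, Rabs_mult. fold a.
  apply Rmult_lt_reg_r with (Rabs (g y) * a); [nra|].
  rewrite Rmult_assoc, Rinv_l by nra. rewrite Rmult_1_r.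
  assert (e * (a / 2 * a) < e * (Rabs (g y) * a)) by (apply Rmult_lt_compat_l; auto; nra). lra.
Qed.

Lemma contf_sub n (U U' : Rvec -> Prop) g : (forall x, U' x -> U x) -> contf n U g -> contf n U' g.
Proof.
  intros H Hg x Hx e He. destruct (Hg x (H x Hx) e He) as [d [Hd Hd']]. exists d; split; auto.
Qed.

Lemma CC_sub n r (U U' : Rvec -> Prop) g : (forall x, U' x -> U x) -> CC n r U g -> CC n r U' g.
Proof.
  intros H. revert g; induction r as [|r IH]; intros g [Hc Hg]; (split; [eapply contf_sub; eauto|auto]).
  destruct Hg as [D HD]. exists D. intros i Hi. destruct (HD i Hi). split; auto.
Qed.

Lemma CC_pred n r U g : CC n (S r) U g -> CC n r U g.
Proof.
  revert g; induction r as [|r IH]; intros g [Hc Hg]; split; auto.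
  destruct Hg as [D HD]. exists D. intros i Hi. destruct (HD i Hi). split; auto.
Qed.

Lemma CC_const n r U a : CC n r U (fun _ => a).
Proof.
  revert a; induction r as [|r IH]; intros a; split; try apply contf_const; auto.
  exists (fun _ _ => 0). intros i Hi; split; auto. intros x _. apply derivable_pt_lim_const.
Qed.

Lemma CC_plus n r U f g : CC n r U f -> CC n r U g -> CC n r U (fun x => f x + g x).
Proof.
  revert f g; induction r as [|r IH]; intros f g [Hf1 Hf2] [Hg1 Hg2]; split; try (apply contf_plus; auto); auto.
  destruct Hf2 as [D HD], Hg2 as [D' HD']. exists (fun i x => D i x + D' i x). intros i Hi.
  destruct (HD i Hi), (HD' i Hi). split; auto. intros x Hx.
  apply (derivable_pt_lim_plus (fun t => f (shift x i t)) (fun t => g (shift x i t))); auto.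
Qed.

Lemma derivable_pt_lim_mult_shift (f g : fn) x i lf lg :
  derivable_pt_lim (fun t => f (shift x i t)) 0 lf -> derivable_pt_lim (fun t => g (shift x i t)) 0 lg ->
  derivable_pt_lim (fun t => f (shift x i t) * g (shift x i t)) 0 (lf * g x + f x * lg).
Proof.
  intros Hf Hg. pose proof (derivable_pt_lim_mult _ _ _ _ _ Hf Hg) as P. cbv beta in P.
  rewrite shift_zero in P. apply P.
Qed.

Lemma CC_mult n r U f g : CC n r U f -> CC n r U g -> CC n r U (fun x => f x * g x).
Proof.
  revert f g; induction r as [|r IH]; intros f g Hf Hg.
  - destruct Hf as [Hf _], Hg as [Hg _]. split; auto. apply contf_mult; auto.
  - assert (Hf' := CC_pred _ _ _ _ Hf). assert (Hg' := CC_pred _ _ _ _ Hg).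
    destruct Hf as [Hf1 [D HD]], Hg as [Hg1 [D' HD']]. split; [apply contf_mult; auto|].
    exists (fun i x => D i x * g x + f x * D' i x). intros i Hi.
    destruct (HD i Hi), (HD' i Hi). split.
    + intros x Hx. apply derivable_pt_lim_mult_shift; auto.
    + apply CC_plus; apply IH; auto.
Qed.

Lemma CC_scal n r U a f : CC n r U f -> CC n r U (fun x => a * f x).
Proof. intros H. apply CC_mult; auto. apply CC_const. Qed.

Lemma CC_minus n r U f g : CC n r U f -> CC n r U g -> CC n r U (fun x => f x - g x).
Proof.
  intros Hf Hg. replace (fun x => f x - g x) with (fun x => f x + (-1) * g x).
  - apply CC_plus; auto. apply CC_scal; auto.
  - apply functional_extensionality; intros; ring.
Qed.

Lemma CC_sumn n r U m (f : nat -> fn) : (forall j, (j < m)%nat -> CC n r U (f j)) ->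
  CC n r U (fun x => sumn m (fun j => f j x)).
Proof.
  induction m as [|m IH]; intros H; simpl. apply CC_const. apply CC_plus; auto.
Qed.

Lemma CC_detm n r U m (M : Rvec -> nat -> nat -> R) :
  (forall i j, (i < m)%nat -> (j < m)%nat -> CC n r U (fun x => M x i j)) -> CC n r U (fun x => detm m (M x)).
Proof.
  revert M; induction m as [|m IH]; intros M H; [apply (CC_const n r U 1)|].
  apply (CC_sumn n r U (S m) (fun j x => (-1) ^ j * M x O j * detm m (fun a b => M x (S a) (if Nat.ltb b j then b else S b)))).
  intros j Hj. apply CC_mult.
  - apply CC_scal. apply H; lia.
  - apply IH. intros a b Ha Hb. apply H; [lia|]. destruct (Nat.ltb b j); lia.
Qed.

Definition smoothC (n : nat) (U : Rvec -> Prop) (g : fn) : Prop := forall r, CC n r U g.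

Lemma smooth_on_iff n U g : openset n U -> smooth_on n U g <-> smoothC n U g.
Proof.
  intros HU; split; intros H r; [apply Cr_on_CC; auto | apply CC_Cr_on; auto].
Qed.

Lemma smooth_pd n U g i : openset n U -> (i < n)%nat -> smoothC n U g -> smoothC n U (pd i g).
Proof.
  intros HU Hi H r. specialize (H (S r)). destruct H as [_ [D HD]]. destruct (HD i Hi) as [H1 H2].
  apply CC_ext with (D i); auto. intros x Hx. symmetry; apply pd_spec; auto.
Qed.

Lemma pd_deriv n U g i x : (i < n)%nat -> U x -> CC n 1 U g ->
  derivable_pt_lim (fun t => g (shift x i t)) 0 (pd i g x).
Proof.
  intros Hi Hx [_ [D HD]]. destruct (HD i Hi) as [H1 _]. rewrite (pd_spec i g x (D i x)); auto.
Qed.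

Lemma iterD_ext n U l f g : openset n U -> idx_ok n l -> (forall x, U x -> f x = g x) ->
  CC n (length l) U f -> forall x, U x -> iterD l f x = iterD l g x.
Proof.
  intros HU. revert f g. induction l as [|i l IH] using rev_ind; intros f g Hl Hfg Hf x Hx; [apply Hfg; auto|].
  apply Forall_app in Hl. destruct Hl as [Hl Hi]. inversion Hi as [|? ? Hi' _]; subst.
  rewrite length_app, Nat.add_1_r in Hf. assert (Hf' := CC_ext _ _ _ _ _ HU Hfg Hf).
  destruct Hf as [_ [D HD]]. destruct Hf' as [_ [D' HD']].
  destruct (HD i Hi') as [H1 H2]. destruct (HD' i Hi') as [H3 H4].
  rewrite !iterD_snoc. apply IH; auto.
  - intros y Hy. rewrite (pd_spec i f y (D i y)) by auto. symmetry; apply pd_spec.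
    destruct (shift_open n U y i HU Hy Hi') as [d [Hd Hs]].
    apply derivable_pt_lim_local with (2 := fun t Ht => Hfg _ (Hs t Ht)); auto.
  - apply CC_ext with (D i); auto. intros y Hy. symmetry; apply pd_spec; auto.
Qed.

Lemma iterD_plus n U l f g : openset n U -> idx_ok n l -> CC n (length l) U f -> CC n (length l) U g ->
  forall x, U x -> iterD l (fun y => f y + g y) x = iterD l f x + iterD l g x.
Proof.
  intros HU. revert f g. induction l as [|i l IH] using rev_ind; intros f g Hl Hf Hg x Hx; auto.
  apply Forall_app in Hl. destruct Hl as [Hl Hi]. inversion Hi as [|? ? Hi' _]; subst.
  rewrite length_app, Nat.add_1_r in *. rewrite !iterD_snoc.
  assert (Hfg := CC_plus _ _ _ _ _ Hf Hg).
  destruct Hf as [_ [D HD]], Hg as [_ [D' HD']]. destruct (HD i Hi') as [H1 H2]. destruct (HD' i Hi') as [H3 H4].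
  assert (Ef : forall y, U y -> D i y = pd i f y) by (intros; symmetry; apply pd_spec; auto).
  assert (Eg : forall y, U y -> D' i y = pd i g y) by (intros; symmetry; apply pd_spec; auto).
  assert (Cf : CC n (length l) U (pd i f)) by (apply CC_ext with (D i); auto).
  assert (Cg : CC n (length l) U (pd i g)) by (apply CC_ext with (D' i); auto).
  rewrite <- IH; auto. symmetry. apply iterD_ext with n U; auto.
  - intros y Hy. symmetry. apply pd_spec. rewrite <- Ef, <- Eg by auto.
    apply (derivable_pt_lim_plus (fun t => f (shift y i t)) (fun t => g (shift y i t))); auto.
  - apply CC_plus; auto.
Qed.

(** * Functions with controlled vanishing along a closed set *)

Definition distS (n : nat) (S : Rvec -> Prop) (x : Rvec) : R := epsilon (inhabits 0) (is_inf_dist n S x).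

Lemma is_inf_dist_uniq n S x d d' : is_inf_dist n S x d -> is_inf_dist n S x d' -> d = d'.
Proof. intros [H1 H2] [H3 H4]. apply Rle_antisym; auto. Qed.

Lemma distS_spec n S x : S zerov -> is_inf_dist n S x (distS n S x).
Proof.
  intros H0. unfold distS. apply epsilon_spec.
  destruct (completeness (fun b => exists y, S y /\ b = - distv n x y)) as [m [Hm1 Hm2]].
  - exists 0. intros b [y [_ ->]]. pose proof (distv_nonneg n x y); lra.
  - exists (- distv n x zerov), zerov; auto.
  - exists (- m). split.
    + intros y Hy. assert (- distv n x y <= m) by (apply Hm1; eauto). lra.
    + intros b Hb. assert (m <= - b); [|lra]. apply Hm2. intros c [y [Hy ->]]. specialize (Hb y Hy). lra.
Qed.

Lemma distS_nonneg n S x : S zerov -> 0 <= distS n S x.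
Proof. intros H0. apply (distS_spec n S x H0). intros; apply distv_nonneg. Qed.

Lemma distS_le n S x y : S zerov -> S y -> distS n S x <= distv n x y.
Proof. intros H0 Hy. apply (distS_spec n S x H0); auto. Qed.

Lemma distS_approx n S x e : S zerov -> 0 < e -> exists y, S y /\ distv n x y < distS n S x + e.
Proof.
  intros H0 He. apply NNPP; intros Hn.
  assert (distS n S x + e <= distS n S x); [|lra]. apply (distS_spec n S x H0).
  intros y Hy. apply Rnot_lt_le. intros H; apply Hn; eauto.
Qed.

Lemma distS_in n S x : S zerov -> S x -> distS n S x = 0.
Proof.
  intros H0 Hx. apply Rle_antisym; [|apply distS_nonneg; auto].
  rewrite <- (distv_refl n x). apply distS_le; auto.
Qed.

Lemma distS_pos n S x : closed_in_Rn n S -> S zerov -> inRn n x -> ~ S x -> 0 < distS n S x.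
Proof.
  intros Hc H0 Hx Hn. destruct (distS_nonneg n S x H0) as [|He]; auto. exfalso; apply Hn.
  apply Hc; auto. intros e Hpos. destruct (distS_approx n S x e H0 Hpos) as [y [Hy Hd]].
  exists y; split; auto. rewrite distv_sym. lra.
Qed.

Lemma distS_lip n S x y : S zerov -> distS n S x <= distS n S y + distv n x y.
Proof.
  intros H0. apply Rle_plus_epsilon. intros e He. destruct (distS_approx n S y e H0 He) as [z [Hz Hd]].
  pose proof (distS_le n S x z H0 Hz). pose proof (distv_triang n x y z). lra.
Qed.

Lemma distS_ball n S e x : S zerov -> ball n e x -> 0 <= distS n S x < e.
Proof.
  intros H0 [_ Hx]. split; [apply distS_nonneg; auto|].
  eapply Rle_lt_trans; [apply (distS_le n S x zerov); auto | auto].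
Qed.

Lemma open_minus n U S : openset n U -> closed_in_Rn n S -> openset n (fun x => U x /\ ~ S x).
Proof.
  intros [HU1 HU2] [_ HS]. split; [intros x [Hx _]; auto|]. intros x [Hx Hxn].
  destruct (HU2 x Hx) as [r [Hr H]].
  destruct (classic (exists e, 0 < e /\ forall y, S y -> e <= distv n y x)) as [[e [He Hey]]|Hn].
  - exists (Rmin r e). split; [apply Rmin_pos; auto|]. pose proof (Rmin_l r e); pose proof (Rmin_r r e).
    intros y [Hy Hyd]. split.
    + apply H. split; auto; lra.
    + intros Hs. specialize (Hey y Hs). lra.
  - exfalso; apply Hxn. apply HS; auto. intros e He. apply NNPP; intros H'. apply Hn. exists e; split; auto.
    intros y Hy. apply Rnot_lt_le. intros Hlt; apply H'; eauto.
Qed.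

(* The subtraction [p - 1] is truncated: [Fl r 0] asks for bounded derivatives off [Sg]. *)
Fixpoint Fl (n : nat) (Sg U : Rvec -> Prop) (r p : nat) (u : fn) : Prop :=
  (exists C, 0 <= C /\ forall x, U x -> Rabs (u x) <= C * distS n Sg x ^ p) /\
  contf n (fun x => U x /\ ~ Sg x) u /\
  match r with
  | O => True
  | S r' => exists D : nat -> fn, forall i, (i < n)%nat ->
      (forall x, U x -> ~ Sg x -> derivable_pt_lim (fun t => u (shift x i t)) 0 (D i x)) /\ Fl n Sg U r' (p - 1) (D i)
  end.

Lemma Fl_bound n Sg U r p u : Fl n Sg U r p u -> exists C, 0 <= C /\ forall x, U x -> Rabs (u x) <= C * distS n Sg x ^ p.
Proof. destruct r; intros H; apply H. Qed.

Lemma Fl_zero n Sg U r p u x : Sg zerov -> Fl n Sg U r p u -> (0 < p)%nat -> U x -> Sg x -> u x = 0.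
Proof.
  intros H0 Hf Hp Hx Hs. destruct (Fl_bound _ _ _ _ _ _ Hf) as [C [HC H]]. specialize (H x Hx).
  rewrite (distS_in n Sg x H0 Hs), pow_i, Rmult_0_r in H by auto.
  apply Rabs_eq_0. pose proof (Rabs_pos (u x)). lra.
Qed.

Lemma Fl_contf n Sg U r p u : openset n U -> closed_in_Rn n Sg -> Sg zerov ->
  Fl n Sg U r p u -> (0 < p)%nat -> contf n U u.
Proof.
  intros HU Hcl H0 Hf Hp. destruct (Fl_bound _ _ _ _ _ _ Hf) as [C [HC Hb]].
  assert (Hc : contf n (fun x => U x /\ ~ Sg x) u) by (destruct r; apply Hf).
  intros x Hx e He. destruct (classic (Sg x)) as [Hs|Hs].
  - assert (Hux : u x = 0) by (apply (Fl_zero n Sg U r p); auto).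
    set (d := Rmin 1 (e / (C + 1))).
    assert (Hd : 0 < d) by (apply Rmin_pos; [lra | apply Rdiv_lt_0_compat; lra]).
    exists d; split; auto. intros y Hy Hyd.
    assert (K1 : d <= 1) by apply Rmin_l. assert (K2 : d <= e / (C + 1)) by apply Rmin_r.
    rewrite Hux, Rminus_0_r. eapply Rle_lt_trans; [apply Hb; auto|].
    pose proof (distS_nonneg n Sg y H0) as Hn. pose proof (distS_le n Sg y x H0 Hs) as Hle.
    assert (Hpw : distS n Sg y ^ p <= distS n Sg y).
    { destruct p as [|p]; [lia|]. simpl. rewrite <- (Rmult_1_r (distS n Sg y)) at 3.
      apply Rmult_le_compat_l; auto. rewrite <- (pow1 p). apply pow_incr. lra. }
    assert (Hlt : distS n Sg y < e / (C + 1)) by lra. apply Rlt_div_r in Hlt; [|lra]. nra.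
  - destruct (Hc x (conj Hx Hs) e He) as [d [Hd Hd']].
    destruct (open_minus n U Sg HU Hcl) as [_ Ho]. destruct (Ho x (conj Hx Hs)) as [r' [Hr Hball]].
    exists (Rmin d r'). split; [apply Rmin_pos; auto|]. pose proof (Rmin_l d r'); pose proof (Rmin_r d r').
    intros y Hy Hyd. apply Hd'; [|lra]. apply Hball. split; [apply HU; auto | lra].
Qed.

Lemma Fl_pred_r n Sg U r p u : Fl n Sg U (S r) p u -> Fl n Sg U r p u.
Proof.
  revert p u; induction r as [|r IH]; intros p u [Hb [Hc [D HD]]]; split; auto; split; auto.
  exists D. intros i Hi. destruct (HD i Hi). split; auto.
Qed.

(** At a point of [Sg] the bound with [2 <= p] makes [u] of size [h^2] along the axis, so the
    derivative exists and is 0, which is also the value of [D] there. *)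
Lemma Fl_derivable n Sg U r p q u i (D : fn) : openset n U -> Sg zerov -> (i < n)%nat ->
  Fl n Sg U r p u -> (2 <= p)%nat -> Fl n Sg U r q D -> (0 < q)%nat ->
  (forall x, U x -> ~ Sg x -> derivable_pt_lim (fun t => u (shift x i t)) 0 (D x)) ->
  forall x, U x -> derivable_pt_lim (fun t => u (shift x i t)) 0 (D x).
Proof.
  intros HU H0 Hi Hf Hp HD Hq Hder x Hx. destruct (Fl_bound _ _ _ _ _ _ Hf) as [C [HC Hb]].
  destruct (classic (Sg x)) as [Hs|Hs]; [|apply Hder; auto].
  rewrite (Fl_zero n Sg U r q D x); auto.
  assert (Hux : u x = 0) by (apply (Fl_zero n Sg U r p); auto; lia).
  destruct (shift_open n U x i HU Hx Hi) as [d0 [Hd0 Hsh]].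
  intros e He. set (d := Rmin d0 (Rmin 1 (e / (C + 1)))).
  assert (Hd : 0 < d) by (repeat apply Rmin_pos; try lra; apply Rdiv_lt_0_compat; lra).
  exists (mkposreal d Hd). simpl. intros h Hh Hhd.
  assert (K1 : d <= d0) by apply Rmin_l.
  assert (K2 : d <= 1) by (eapply Rle_trans; [apply Rmin_r | apply Rmin_l]).
  assert (K3 : d <= e / (C + 1)) by (eapply Rle_trans; [apply Rmin_r | apply Rmin_r]).
  rewrite Rplus_0_l, shift_zero, Hux, !Rminus_0_r.
  assert (Hb' : Rabs (u (shift x i h)) <= C * (Rabs h * Rabs h)).
  { eapply Rle_trans; [apply Hb, Hsh; lra|]. apply Rmult_le_compat_l; auto.
    pose proof (distS_nonneg n Sg (shift x i h) H0) as Hn.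
    assert (Hle : distS n Sg (shift x i h) <= Rabs h).
    { eapply Rle_trans; [apply (distS_le n Sg _ x); auto | apply distv_shift]. }
    apply Rle_trans with (Rabs h ^ p). { apply pow_incr; auto. }
    destruct p as [|[|p]]; [lia|lia|]. simpl.
    assert (Rabs h ^ p <= 1). { rewrite <- (pow1 p). apply pow_incr. lra. }
    assert (0 <= Rabs h ^ p) by (apply pow_le; lra). nra. }
  unfold Rdiv. rewrite Rabs_mult, Rabs_inv. assert (Hp0 : 0 < Rabs h) by (apply Rabs_pos_lt; auto).
  apply Rmult_lt_reg_r with (Rabs h); auto. rewrite Rmult_assoc, Rinv_l, Rmult_1_r by lra.
  assert (Hlt : Rabs h < e / (C + 1)) by lra. apply Rlt_div_r in Hlt; [|lra]. nra.
Qed.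

(** Each derivative loses one order of vanishing; starting from [r + 1], the last one still vanishes
    on [Sg] to order 1 and is continuous there. *)
Lemma Fl_CC n Sg U r p u : openset n U -> closed_in_Rn n Sg -> Sg zerov ->
  Fl n Sg U r p u -> (r + 1 <= p)%nat -> CC n r U u.
Proof.
  intros HU Hcl H0. revert p u; induction r as [|r IH]; intros p u Hf Hp.
  - split; auto. apply (Fl_contf n Sg U 0 p); auto; lia.
  - assert (Hcont : contf n U u) by (apply (Fl_contf n Sg U (S r) p); auto; lia).
    assert (Hf1 := Hf). destruct Hf as [_ [_ [D HD]]].
    split; auto. exists D. intros i Hi. destruct (HD i Hi) as [H1 H2].
    split; [|apply IH with (p - 1)%nat; auto; lia].
    apply Fl_derivable with n Sg r p (p - 1)%nat; auto; [apply Fl_pred_r; auto|lia|lia].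
Qed.

Lemma Fl_le_p n Sg U r p p' u : Sg zerov -> (forall x, U x -> distS n Sg x <= 1) -> (p' <= p)%nat ->
  Fl n Sg U r p u -> Fl n Sg U r p' u.
Proof.
  intros H0 H1. revert p p' u; induction r as [|r IH]; intros p p' u Hp [[C [HC Hb]] [Hc Hd]];
    (split; [exists C; split; auto; intros x Hx; eapply Rle_trans; [apply Hb; auto|];
      apply Rmult_le_compat_l; auto; replace p with (p' + (p - p'))%nat by lia; rewrite pow_add;
      rewrite <- (Rmult_1_r (distS n Sg x ^ p')) at 2; apply Rmult_le_compat_l;
      [apply pow_le, distS_nonneg; auto | rewrite <- (pow1 (p - p')); apply pow_incr; split; auto using distS_nonneg]
    | split; auto]).
  destruct Hd as [D HD]. exists D. intros i Hi. destruct (HD i Hi). split; auto. apply IH with (p - 1)%nat; auto; lia.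
Qed.

Lemma Fl_sub n Sg U U' r p u : (forall x, U' x -> U x) -> Fl n Sg U r p u -> Fl n Sg U' r p u.
Proof.
  intros H. revert p u; induction r as [|r IH]; intros p u [[C [HC Hb]] [Hc Hd]];
    (split; [exists C; split; auto | split; [eapply contf_sub; [|apply Hc]; intros x [Hx Hn]; auto | auto]]).
  destruct Hd as [D HD]. exists D. intros i Hi. destruct (HD i Hi). split; auto.
Qed.

Lemma Fl_plus n Sg U r p u v : Fl n Sg U r p u -> Fl n Sg U r p v -> Fl n Sg U r p (fun x => u x + v x).
Proof.
  revert p u v; induction r as [|r IH]; intros p u v [[C [HC Hb]] [Hc Hd]] [[C' [HC' Hb']] [Hc' Hd']];
    (split; [exists (C + C'); split; [lra|]; intros x Hx; eapply Rle_trans; [apply Rabs_triang|];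
      rewrite Rmult_plus_distr_r; apply Rplus_le_compat; auto | split; [apply contf_plus; auto | auto]]).
  destruct Hd as [D HD], Hd' as [D' HD']. exists (fun i x => D i x + D' i x). intros i Hi.
  destruct (HD i Hi), (HD' i Hi). split; auto. intros x Hx Hn.
  apply (derivable_pt_lim_plus (fun t => u (shift x i t)) (fun t => v (shift x i t))); auto.
Qed.

Lemma Fl_mult n Sg U r p q u v : Sg zerov -> (forall x, U x -> distS n Sg x <= 1) ->
  Fl n Sg U r p u -> Fl n Sg U r q v -> Fl n Sg U r (p + q) (fun x => u x * v x).
Proof.
  intros H0 H1. revert p q u v; induction r as [|r IH]; intros p q u v Hu Hv.
  - destruct Hu as [[C [HC Hb]] [Hc _]], Hv as [[C' [HC' Hb']] [Hc' _]].
    split; [|split; [apply contf_mult; auto | auto]]. exists (C * C'). split; [apply Rmult_le_pos; auto|].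
    intros x Hx. rewrite Rabs_mult, pow_add.
    replace (C * C' * (distS n Sg x ^ p * distS n Sg x ^ q)) with ((C * distS n Sg x ^ p) * (C' * distS n Sg x ^ q)) by ring.
    apply Rmult_le_compat; auto using Rabs_pos.
  - assert (Hu' := Fl_pred_r _ _ _ _ _ _ Hu). assert (Hv' := Fl_pred_r _ _ _ _ _ _ Hv).
    assert (Hb0 := Fl_bound _ _ _ _ _ _ (IH p q u v Hu' Hv')).
    destruct Hu as [_ [Hc [D HD]]], Hv as [_ [Hc' [D' HD']]].
    split; auto. split; [apply contf_mult; auto|].
    exists (fun i x => D i x * v x + u x * D' i x). intros i Hi. destruct (HD i Hi), (HD' i Hi). split.
    + intros x Hx Hn. apply derivable_pt_lim_mult_shift; auto.
    (* Because subtraction is truncated, [p - 1 + q] and [p + (q - 1)] may exceed [p + q - 1]; the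
       order is lowered to the latter. *)
    + apply Fl_plus.
      * apply Fl_le_p with (p - 1 + q)%nat; auto; lia.
      * apply Fl_le_p with (p + (q - 1))%nat; auto; lia.
Qed.

Lemma Fl_const n Sg U r a : Fl n Sg U r 0 (fun _ => a).
Proof.
  revert a; induction r as [|r IH]; intros a;
    (split; [exists (Rabs a); split; [apply Rabs_pos | intros; simpl; lra] | split; [apply contf_const | auto]]).
  exists (fun _ _ => 0). intros i Hi. split; auto. intros x _ _. apply derivable_pt_lim_const.
Qed.

Lemma Fl_sumn n Sg U r m (f : nat -> fn) : (forall j, (j < m)%nat -> Fl n Sg U r 0 (f j)) ->
  Fl n Sg U r 0 (fun x => sumn m (fun j => f j x)).
Proof.
  induction m as [|m IH]; intros H; simpl. apply Fl_const. apply Fl_plus; auto.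
Qed.

(* [(u/Q)' = (u' Q - u Q') / Q^2]: each derivative doubles the order of vanishing of the denominator. *)
Lemma Fl_quot n Sg U r p a c u Q : openset n U -> closed_in_Rn n Sg -> Sg zerov ->
  (forall x, U x -> distS n Sg x <= 1) -> (0 < a)%nat -> 0 < c ->
  (forall x, U x -> c * distS n Sg x ^ a <= Q x) -> Fl n Sg U r 0 Q -> (r <= p)%nat ->
  Fl n Sg U r (p + 2 ^ r * a) u -> Fl n Sg U r p (fun x => u x / Q x).
Proof.
  intros HU Hcl H0 H1. revert p a c u Q; induction r as [|r IH]; intros p a c u Q Ha Hc HQ HQF Hp Hu.
  all: assert (HQ0 : forall x, U x /\ ~ Sg x -> Q x <> 0) by
    (intros x [Hx Hn]; pose proof (distS_pos n Sg x Hcl H0 (proj1 HU x Hx) Hn) as Hd;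
     pose proof (HQ x Hx); pose proof (pow_lt _ a Hd); nra).
  all: assert (Hbd : forall r' P, (p + a <= P)%nat -> Fl n Sg U r' P u -> exists C, 0 <= C /\ forall x, U x -> Rabs (u x / Q x) <= C * distS n Sg x ^ p).
  1,3: intros r' P HP HF; apply Fl_le_p with (p' := (p + a)%nat) in HF; auto;
    destruct (Fl_bound _ _ _ _ _ _ HF) as [C [HC Hb]]; exists (C / c);
    split; [apply Rdiv_le_0_compat; auto|]; intros x Hx;
    destruct (classic (Sg x)) as [Hs|Hs];
    [ rewrite (Fl_zero n Sg U r' (p + a) u x) by (auto; lia); unfold Rdiv at 1; rewrite Rmult_0_l, Rabs_R0;
      apply Rmult_le_pos; [apply Rdiv_le_0_compat; auto | apply pow_le, distS_nonneg; auto]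
    | pose proof (pow_lt _ a (distS_pos n Sg x Hcl H0 (proj1 HU x Hx) Hs)) as Hda; specialize (HQ x Hx);
      assert (HQp : 0 < Q x) by nra;
      unfold Rdiv at 1; rewrite Rabs_mult, Rabs_inv, (Rabs_pos_eq (Q x)) by lra;
      apply Rmult_le_reg_r with (Q x); auto; rewrite Rmult_assoc, Rinv_l, Rmult_1_r by lra;
      eapply Rle_trans; [apply Hb; auto|]; rewrite pow_add;
      replace (C * (distS n Sg x ^ p * distS n Sg x ^ a)) with (C / c * distS n Sg x ^ p * (c * distS n Sg x ^ a)) by (field; lra);
      apply Rmult_le_compat_l; auto; apply Rmult_le_pos; [apply Rdiv_le_0_compat; auto | apply pow_le, distS_nonneg; auto] ].
  - split; [|split; [|auto]].
    + apply Hbd with 0%nat (p + 2 ^ 0 * a)%nat; auto. simpl; lia.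
    + destruct Hu as [_ [Hcu _]], HQF as [_ [HcQ _]]. apply contf_mult; auto. apply contf_inv; auto.
  - assert (H2r : (1 <= 2 ^ r)%nat) by (clear; induction r; simpl; lia).
    assert (Hu' := Fl_pred_r _ _ _ _ _ _ Hu). assert (HQ' := Fl_pred_r _ _ _ _ _ _ HQF).
    split; [|split].
    + apply Hbd with (S r) (p + 2 ^ S r * a)%nat; auto. simpl; nia.
    + destruct Hu as [_ [Hcu _]], HQF as [_ [HcQ _]]. apply contf_mult; auto. apply contf_inv; auto.
    + destruct Hu as [_ [_ [D HD]]], HQF as [_ [_ [DQ HDQ]]].
      exists (fun i x => (D i x * Q x + (-1) * u x * DQ i x) / (Q x * Q x)). intros i Hi.
      destruct (HD i Hi) as [K1 K2], (HDQ i Hi) as [K3 K4]. split.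
      * intros x Hx Hn.
        pose proof (derivable_pt_lim_div (fun t => u (shift x i t)) (fun t => Q (shift x i t)) 0 _ _ (K1 x Hx Hn) (K3 x Hx Hn)) as P.
        cbv beta in P. rewrite shift_zero in P. specialize (P (HQ0 x (conj Hx Hn))).
        replace ((D i x * Q x + -1 * u x * DQ i x) / (Q x * Q x)) with ((D i x * Q x - DQ i x * u x) / Rsqr (Q x)).
        -- apply P.
        -- unfold Rsqr. f_equal. ring.
      * apply IH with (2 * a)%nat (c * c); try lia.
        -- nra.
        -- intros x Hx. specialize (HQ x Hx). replace (2 * a)%nat with (a + a)%nat by lia. rewrite pow_add.
           pose proof (pow_le _ a (distS_nonneg n Sg x H0)).
           replace (c * c * (distS n Sg x ^ a * distS n Sg x ^ a)) with ((c * distS n Sg x ^ a) * (c * distS n Sg x ^ a)) by ring.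
           apply Rmult_le_compat; auto; apply Rmult_le_pos; lra.
        -- apply (Fl_mult n Sg U r 0 0); auto.
        (* The hypothesis [S r <= p] keeps [p - 1] from being truncated; the summand 0 is the order
           of [Q] in [Fl_mult]. *)
        -- replace (p - 1 + 2 ^ r * (2 * a))%nat with (p + 2 ^ S r * a - 1 + 0)%nat by (simpl; nia).
           apply Fl_plus.
           ++ apply Fl_mult; auto.
           ++ apply Fl_mult; auto. apply Fl_le_p with (p + 2 ^ S r * a)%nat; auto; [lia|].
              apply (Fl_mult n Sg U r 0 (p + 2 ^ S r * a)); auto. apply Fl_const.
Qed.

Lemma Fl_ext n Sg U r p u v : openset n U -> closed_in_Rn n Sg -> (forall x, U x -> u x = v x) ->
  Fl n Sg U r p u -> Fl n Sg U r p v.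
Proof.
  intros HU Hcl H Hf. destruct r as [|r]; destruct Hf as [[C [HC Hb]] [Hc Hd]];
    (split; [exists C; split; auto; intros x Hx; rewrite <- H; auto
      | split; [eapply contf_ext; [|apply Hc]; intros x [Hx _]; auto | auto]]).
  destruct Hd as [D HD]. exists D. intros i Hi. destruct (HD i Hi) as [H1 H2]. split; auto.
  intros x Hx Hn. destruct (shift_open n U x i HU Hx Hi) as [d [Hd Hs]].
  apply derivable_pt_lim_local with (2 := fun t Ht => H _ (Hs t Ht)); auto.
Qed.

Lemma Fl_iterD n Sg U r p u l : openset n U -> closed_in_Rn n Sg -> Sg zerov ->
  Fl n Sg U r p u -> (r + 1 <= p)%nat -> idx_ok n l -> (length l <= r)%nat ->
  forall x, U x -> Sg x -> iterD l u x = 0.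
Proof.
  intros HU Hcl H0. revert p u l; induction r as [|r IH]; intros p u l Hf Hp Hl Hlen x Hx Hs.
  - destruct l; [|simpl in Hlen; lia]. simpl. apply (Fl_zero n Sg U 0 p); auto; lia.
  - destruct (list_nil_or_snoc l) as [->|[l' [i ->]]].
    + simpl. apply (Fl_zero n Sg U (S r) p); auto; lia.
    + apply Forall_app in Hl. destruct Hl as [Hl' Hi]. inversion Hi as [|? ? Hi' _]; subst.
      rewrite length_app in Hlen; simpl in Hlen. rewrite iterD_snoc.
      assert (Hf1 := Hf). destruct Hf as [_ [_ [D HD]]]. destruct (HD i Hi') as [H1 H2].
      apply (IH (p - 1)%nat); auto; try lia. apply Fl_ext with (D i); auto.
      intros y Hy. symmetry. apply pd_spec. revert y Hy.
      apply Fl_derivable with n Sg r p (p - 1)%nat; auto; [apply Fl_pred_r; auto|lia|lia].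
Qed.

Lemma Fl_scal n Sg U r p a u : Sg zerov -> (forall x, U x -> distS n Sg x <= 1) ->
  Fl n Sg U r p u -> Fl n Sg U r p (fun x => a * u x).
Proof. intros H0 H1 Hu. apply (Fl_mult n Sg U r 0 p); auto. apply Fl_const. Qed.

(** * Compactness by ultralimits, mean values and Taylor estimates *)

(** The limit is the supremum of the numbers [a] for which [a <= u m] holds on a set of [U]; the
    ultrafilter decides each such comparison. *)
Lemma ultra_lim U (u : nat -> R) B : ultra U -> (forall m, Rabs (u m) <= B) ->
  exists L, Rabs L <= B /\ forall e, 0 < e -> U (fun m => Rabs (u m - L) < e).
Proof.
  intros HU HB.
  assert (Hall : forall P : nat -> Prop, (forall m, P m) -> U P).
  { intros P HP. apply (ultra_mono _ HU (fun m => (0 <= m)%nat)); auto. apply (ultra_tail _ HU). }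
  destruct (completeness (fun a => U (fun m => a <= u m))) as [L [HL1 HL2]].
  - exists B. intros a Ha. destruct (ultra_ex _ HU _ Ha) as [m Hm].
    specialize (HB m). apply Rabs_le_between in HB. lra.
  - exists (- B). apply Hall. intros m. specialize (HB m). apply Rabs_le_between in HB. lra.
  - exists L. split.
    + apply Rabs_le. split.
      * apply HL1. apply Hall. intros m. specialize (HB m). apply Rabs_le_between in HB. lra.
      * apply HL2. intros a Ha. destruct (ultra_ex _ HU _ Ha) as [m Hm].
        specialize (HB m). apply Rabs_le_between in HB. lra.
    + intros e He.
      assert (H1 : U (fun m => L - e / 2 <= u m)).
      { apply NNPP; intros Hn. assert (L <= L - e / 2); [|lra]. apply HL2. intros a Ha.
        apply Rnot_lt_le; intros Hlt. apply Hn. eapply (ultra_mono _ HU); [|apply Ha]. intros m Hm; simpl in *; lra. }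
      assert (H2 : U (fun m => u m < L + e / 2)).
      { destruct (ultra_or _ HU (fun m => L + e / 2 <= u m)) as [Ha|Ha].
        - assert (L + e / 2 <= L) by (apply HL1; auto). lra.
        - eapply (ultra_mono _ HU); [|apply Ha]. intros m Hm; simpl in *; lra. }
      eapply (ultra_mono _ HU); [|apply (ultra_and _ HU _ _ H1 H2)].
      intros m [K1 K2]. apply Rabs_def1; lra.
Qed.

Lemma ultra_lim_vec U n (x : nat -> Rvec) B : ultra U -> 0 <= B -> (forall m, inRn n (x m) /\ normv n (x m) <= B) ->
  exists y, inRn n y /\ normv n y <= B /\ forall e, 0 < e -> U (fun m => distv n (x m) y < e).
Proof.
  intros HU HB Hx.
  assert (H : forall i, exists L, (i < n)%nat -> Rabs L <= B /\ forall e, 0 < e -> U (fun m => Rabs (x m i - L) < e)).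
  { intros i. destruct (Nat.lt_ge_cases i n) as [Hi|Hi]; [|exists 0; intros; lia].
    destruct (ultra_lim U (fun m => x m i) B HU) as [L HL].
    - intros m. eapply Rle_trans; [apply (normv_ge n (x m) i Hi) | apply Hx].
    - exists L; auto. }
  set (y0 := fun i => proj1_sig (constructive_indefinite_description _ (H i))).
  assert (Hy0 : forall i, (i < n)%nat -> Rabs (y0 i) <= B /\ forall e, 0 < e -> U (fun m => Rabs (x m i - y0 i) < e)).
  { intros i Hi; unfold y0; destruct constructive_indefinite_description; auto. }
  set (y := fun i => if Nat.ltb i n then y0 i else 0).
  assert (Hyi : forall i, (i < n)%nat -> y i = y0 i).
  { intros i Hi; unfold y. rewrite (proj2 (Nat.ltb_lt i n) Hi); auto. }
  exists y. split; [|split].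
  - intros i Hi. unfold y. rewrite (proj2 (Nat.ltb_ge i n) Hi); auto.
  - apply normv_le; auto. intros i Hi. rewrite Hyi by auto. apply Hy0; auto.
  - intros e He.
    assert (Hk : forall k, (k <= n)%nat -> U (fun m => forall i, (i < k)%nat -> Rabs (x m i - y i) < e)).
    { induction k as [|k IH]; intros Hk.
      - eapply (ultra_mono _ HU); [|apply (ultra_tail _ HU 0)]. intros m _ i Hi; lia.
      - eapply (ultra_mono _ HU); [|apply (ultra_and _ HU _ _ (IH ltac:(lia)) (proj2 (Hy0 k ltac:(lia)) e He))].
        intros m [H1 H2] i Hi. destruct (Nat.eq_dec i k) as [->|]; [rewrite Hyi; auto; lia | apply H1; lia]. }
    eapply (ultra_mono _ HU); [|apply (Hk n); auto]. intros m Hm. apply distv_lt; auto.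
Qed.

(** Otherwise points with [|g| > m] would have a limit along an ultrafilter in the closed ball of
    radius [e'], where [g] is continuous and hence locally bounded. *)
Lemma cont_bounded n e e' g : 0 < e' < e -> contf n (ball n e) g ->
  exists B, 0 <= B /\ forall x, ball n e' x -> Rabs (g x) <= B.
Proof.
  intros He Hg. apply NNPP; intros Hn.
  assert (H : forall m, exists x, ball n e' x /\ INR m < Rabs (g x)).
  { intros m. apply NNPP; intros Hm. apply Hn. exists (INR m). split; [apply pos_INR|].
    intros x Hx. apply Rnot_lt_le; intros Hlt. apply Hm; eauto. }
  set (x := fun m => proj1_sig (constructive_indefinite_description _ (H m))).
  assert (Hx : forall m, ball n e' (x m) /\ INR m < Rabs (g (x m))).
  { intros m; unfold x; destruct constructive_indefinite_description; auto. }
  destruct FilterLemmas.ultra_exists as [U HU].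
  destruct (ultra_lim_vec U n x e' HU ltac:(lra)) as [y [Hy1 [Hy2 Hy3]]].
  { intros m. destruct (Hx m) as [[H1 H2] _]. split; auto. rewrite <- distv_zero. lra. }
  assert (Hyb : ball n e y) by (split; auto; rewrite distv_zero; lra).
  destruct (Hg y Hyb 1 ltac:(lra)) as [d [Hd Hd']].
  destruct (INR_unbounded (Rabs (g y) + 1)) as [N HN].
  destruct (ultra_ex _ HU _ (ultra_and _ HU _ _ (Hy3 d Hd) (ultra_tail _ HU N))) as [m [H1 H2]].
  destruct (Hx m) as [K1 K2].
  assert (K3 : ball n e (x m)) by (apply ball_mono with e'; auto; lra).
  specialize (Hd' (x m) K3 H1). apply le_INR in H2.
  assert (Rabs (g (x m)) <= Rabs (g y) + Rabs (g (x m) - g y)).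
  { replace (g (x m)) with (g y + (g (x m) - g y)) at 1 by ring. apply Rabs_triang. }
  lra.
Qed.

Lemma family_bound n (P : nat -> R -> Prop) : (forall i C C', C <= C' -> P i C -> P i C') ->
  (forall i, (i < n)%nat -> exists C, 0 <= C /\ P i C) -> exists C, 0 <= C /\ forall i, (i < n)%nat -> P i C.
Proof.
  intros HP. induction n as [|n IH]; intros H.
  - exists 0; split; [lra|]. intros; lia.
  - destruct IH as [C [HC IH]]; auto. destruct (H n ltac:(lia)) as [C' [HC' H']].
    exists (Rmax C C'). split; [eapply Rle_trans; [apply HC | apply Rmax_l]|].
    intros i Hi. destruct (Nat.eq_dec i n) as [->|].
    + apply HP with C'; auto. apply Rmax_r.
    + apply HP with C; [apply Rmax_l|]. apply IH; lia.
Qed.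

Lemma derivable_along_shift (f : fn) z j t l :
  derivable_pt_lim (fun s => f (shift (shift z j t) j s)) 0 l -> derivable_pt_lim (fun s => f (shift z j s)) t l.
Proof.
  intros H e He. destruct (H e He) as [d Hd]. exists d. intros h Hh Hhd. specialize (Hd h Hh Hhd).
  rewrite !shift_shift, Rplus_0_l, Rplus_0_r in Hd. auto.
Qed.

(* The box spanned by [x] and [y] stays in the ball, so one can walk from [y] to [x] along the axes. *)
Lemma box_mean_value n e f (D : nat -> fn) x y K : 0 <= K ->
  (forall i z, (i < n)%nat -> ball n e z -> derivable_pt_lim (fun t => f (shift z i t)) 0 (D i z)) ->
  ball n e x -> ball n e y ->
  (forall i z, (i < n)%nat -> ball n e z -> distv n z y <= distv n x y -> Rabs (D i z) <= K) ->
  Rabs (f x - f y) <= INR n * K * distv n x y.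
Proof.
  intros HK Hder [Hx Hxe] [Hy Hye] HD. rewrite distv_zero in Hxe, Hye.
  set (z := fun j i => if Nat.ltb i j then x i else y i).
  assert (Hzlt : forall j i, (i < j)%nat -> z j i = x i).
  { intros j i Hi; unfold z. rewrite (proj2 (Nat.ltb_lt i j) Hi); auto. }
  assert (Hzge : forall j i, (j <= i)%nat -> z j i = y i).
  { intros j i Hi; unfold z. rewrite (proj2 (Nat.ltb_ge i j) Hi); auto. }
  assert (Hz0 : z 0%nat = y) by (apply functional_extensionality; intros i; apply Hzge; lia).
  assert (Hzn : z n = x).
  { apply functional_extensionality; intros i. destruct (Nat.lt_ge_cases i n).
    apply Hzlt; auto. rewrite Hzge, Hx, Hy; auto. }
  assert (HzS : forall j, z (S j) = shift (z j) j (x j - y j)).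
  { intros j. apply functional_extensionality; intros i. destruct (Nat.eq_dec i j) as [->|].
    - rewrite shift_same, Hzlt, Hzge by lia. ring.
    - rewrite shift_other by auto. destruct (Nat.lt_ge_cases i j).
      rewrite !Hzlt by lia; auto. rewrite !Hzge by lia; auto. }
  assert (Hstep : forall j, (j < n)%nat -> Rabs (f (z (S j)) - f (z j)) <= K * distv n x y).
  { intros j Hj. rewrite HzS.
    assert (Hin : forall c, Rmin 0 (x j - y j) <= c <= Rmax 0 (x j - y j) ->
       ball n e (shift (z j) j c) /\ distv n (shift (z j) j c) y <= distv n x y).
    { intros c Hc.
      assert (Hxj := normv_ge n x j Hj). assert (Hyj := normv_ge n y j Hj).
      assert (Hc2 : Rabs (y j + c) < e /\ Rabs c <= Rabs (x j - y j)).
      { apply Rabs_le_between in Hxj. apply Rabs_le_between in Hyj. unfold Rmin, Rmax in Hc. destruct (Rle_dec 0 (x j - y j)).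
        - split; [apply Rabs_def1; lra|]. rewrite !Rabs_pos_eq; lra.
        - split; [apply Rabs_def1; lra|]. rewrite !Rabs_left1; lra. }
      destruct Hc2 as [Hc2 Hc3]. split; [split|].
      - intros i Hi. rewrite shift_other by lia. rewrite Hzge by lia. auto.
      - apply distv_lt. { pose proof (normv_nonneg n x). lra. }
        intros i Hi. unfold zerov. rewrite Rminus_0_r. destruct (Nat.eq_dec i j) as [->|].
        + rewrite shift_same, Hzge by lia. auto.
        + rewrite shift_other by auto. unfold z. destruct (Nat.ltb i j).
          * eapply Rle_lt_trans; [apply (normv_ge n x i Hi) | auto].
          * eapply Rle_lt_trans; [apply (normv_ge n y i Hi) | auto].
      - apply distv_le; [apply distv_nonneg|]. intros i Hi. destruct (Nat.eq_dec i j) as [->|].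
        + rewrite shift_same, Hzge by lia. replace (y j + c - y j) with c by ring.
          eapply Rle_trans; [apply Hc3 | apply distv_ge; auto].
        + rewrite shift_other by auto. unfold z. destruct (Nat.ltb i j).
          * apply distv_ge; auto.
          * rewrite Rminus_diag_eq, Rabs_R0 by auto. apply distv_nonneg. }
    destruct (MVT_abs (fun t => f (shift (z j) j t)) (fun t => D j (shift (z j) j t)) 0 (x j - y j)) as [c [Hc1 Hc2]].
    - intros c Hc. apply derivable_along_shift. apply Hder; auto. apply Hin; auto.
    - cbv beta in Hc1. rewrite shift_zero, Rminus_0_r in Hc1. rewrite Hc1.
      destruct (Hin c Hc2). apply Rmult_le_compat; auto using Rabs_pos. apply distv_ge; auto. }
  assert (Hsum : forall j, (j <= n)%nat -> Rabs (f (z j) - f y) <= INR j * K * distv n x y).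
  { induction j as [|j IH]; intros Hj.
    - rewrite Hz0. rewrite Rminus_diag_eq, Rabs_R0 by auto. simpl. lra.
    - replace (f (z (S j)) - f y) with ((f (z (S j)) - f (z j)) + (f (z j) - f y)) by ring.
      eapply Rle_trans; [apply Rabs_triang|]. rewrite S_INR.
      specialize (Hstep j ltac:(lia)). specialize (IH ltac:(lia)). lra. }
  rewrite <- Hzn at 1. apply Hsum; auto.
Qed.

(** The mean value estimate on the box between [y] and [x] turns order [j] of the first derivatives
    of [iterD l u] into order [j + 1] of [iterD l u] itself. The constant does not depend on the
    point [y] of [S]. *)
Lemma taylor_bound n (S : Rvec -> Prop) e e' k u : 0 < e' < e -> Cr_on n (k + 1) (ball n e) u ->
  (forall l x, idx_ok n l -> (length l <= k)%nat -> S x -> ball n e x -> iterD l u x = 0) ->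
  forall j l, idx_ok n l -> (length l + j <= k + 1)%nat ->
  exists C, 0 <= C /\ forall x y, ball n e' x -> ball n e' y -> S y -> Rabs (iterD l u x) <= C * distv n x y ^ j.
Proof.
  intros He Hu Hz. induction j as [|j IH]; intros l Hl Hlen.
  - destruct (cont_bounded n e e' (iterD l u) He) as [B [HB0 HB]]. { apply Hu; auto; lia. }
    exists B; split; auto. intros x y Hx _ _. simpl. rewrite Rmult_1_r; auto.
  - destruct (family_bound n (fun i C => forall x y, ball n e' x -> ball n e' y -> S y ->
       Rabs (iterD (i :: l) u x) <= C * distv n x y ^ j)) as [C [HC HCb]].
    { intros i C C' HCC H x y Hx Hy Hs. eapply Rle_trans; [apply (H x y); auto|].
      apply Rmult_le_compat_r; auto. apply pow_le, distv_nonneg. }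
    { intros i Hi. apply IH. constructor; auto. simpl; lia. }
    exists (INR n * C). split; [apply Rmult_le_pos; auto using pos_INR|]. intros x y Hx Hy Hs.
    replace (iterD l u x) with (iterD l u x - iterD l u y).
    2:{ rewrite (Hz l y); auto; [ring|lia|]. apply ball_mono with e'; auto; lra. }
    replace (INR n * C * distv n x y ^ Datatypes.S j) with (INR n * (C * distv n x y ^ j) * distv n x y) by (simpl; ring).
    apply box_mean_value with e' (fun i => iterD (i :: l) u); auto.
    + apply Rmult_le_pos; auto. apply pow_le, distv_nonneg.
    + intros i z Hi Hbz. assert (Hbz' : ball n e z) by (apply ball_mono with e'; auto; lra).
      destruct (Hu l Hl ltac:(lia)) as [_ Hd]. destruct (Hd ltac:(lia) i z Hi Hbz') as [d Hd'].
      simpl. rewrite (pd_spec i (iterD l u) z d Hd'). auto.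
    + intros i z Hi Hbz Hdz. eapply Rle_trans; [apply (HCb i Hi z y); auto|].
      apply Rmult_le_compat_l; auto. apply pow_incr. split; auto using distv_nonneg.
Qed.

(** The Taylor estimate is applied at a point [y] of [Sg] whose distance from [x] is at most twice
    [distS n Sg x]. Since 0 lies in [Sg], the norm of [y] is at most three times that of [x], whence
    the radius [e' / 3]. *)
Lemma taylor_Fl n Sg e e' k u : closed_in_Rn n Sg -> Sg zerov -> 0 < e' < e -> Cr_on n (k + 1) (ball n e) u ->
  (forall l x, idx_ok n l -> (length l <= k)%nat -> Sg x -> ball n e x -> iterD l u x = 0) ->
  forall r p l, idx_ok n l -> (length l + r + p <= k + 1)%nat -> Fl n Sg (ball n (e' / 3)) r p (iterD l u).
Proof.
  intros Hcl H0 He Hu Hz.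
  assert (Hsub : forall x, ball n (e' / 3) x -> ball n e x) by (intros x Hx; apply ball_mono with (e' / 3); auto; lra).
  induction r as [|r IH]; intros p l Hl Hlen.
  all: destruct (taylor_bound n Sg e e' k u He Hu Hz p l Hl ltac:(lia)) as [C [HC HCb]].
  all: assert (Hb : exists C, 0 <= C /\ forall x, ball n (e' / 3) x -> Rabs (iterD l u x) <= C * distS n Sg x ^ p).
  1,3: exists (C * 2 ^ p); split; [apply Rmult_le_pos; auto; apply pow_le; lra|]; intros x Hx;
    assert (Hx' : ball n e' x) by (apply ball_mono with (e' / 3); auto; lra);
    assert (Hd := distS_nonneg n Sg x H0);
    assert (Hy : exists y, Sg y /\ distv n x y <= 2 * distS n Sg x);
    [ destruct Hd as [Hd|Hd];
      [ destruct (distS_approx n Sg x (distS n Sg x) H0 Hd) as [y [Hy Hyd]]; exists y; split; auto; lra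
      | exists x; rewrite distv_refl; split; [|lra]; apply NNPP; intros Hn;
        pose proof (distS_pos n Sg x Hcl H0 (proj1 Hx) Hn); lra ]
    | destruct Hy as [y [Hy Hyd]]; rewrite Rmult_assoc, <- Rpow_mult_distr;
      eapply Rle_trans; [apply (HCb x y); auto|apply Rmult_le_compat_l; auto; apply pow_incr; split; auto using distv_nonneg];
      split; [apply Hcl; auto|]; pose proof (distv_triang n y x zerov); rewrite (distv_sym n y x) in H;
      pose proof (proj2 (distS_ball n Sg _ x H0 Hx)); destruct Hx as [_ Hx2]; lra ].
  - split; auto. split; auto. apply contf_sub with (ball n e); [intros x [Hx _]; auto|]. apply Hu; auto; lia.
  - split; auto. split.
    { apply contf_sub with (ball n e); [intros x [Hx _]; auto|]. apply Hu; auto; lia. }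
    exists (fun i => iterD (i :: l) u). intros i Hi. split.
    + intros x Hx _. destruct (Hu l Hl ltac:(lia)) as [_ Hd]. destruct (Hd ltac:(lia) i x Hi (Hsub x Hx)) as [d Hd'].
      simpl. rewrite (pd_spec i (iterD l u) x d Hd'). auto.
    + apply IH; [constructor; auto | simpl; lia].
Qed.

Lemma smooth_Fl0 n Sg e e' r u : 0 < e' < e -> smoothC n (ball n e) u -> Fl n Sg (ball n e') r 0 u.
Proof.
  intros He. revert u; induction r as [|r IH]; intros u Hu.
  all: assert (Hb : exists C, 0 <= C /\ forall x, ball n e' x -> Rabs (u x) <= C * distS n Sg x ^ 0)
    by (destruct (cont_bounded n e e' u He (CC_cont _ _ _ _ (Hu 0%nat))) as [B [HB0 HB]];
        exists B; split; auto; intros x Hx; simpl; rewrite Rmult_1_r; auto).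
  all: assert (Hc : contf n (fun x => ball n e' x /\ ~ Sg x) u)
    by (apply contf_sub with (ball n e); [intros x [Hx _]; apply ball_mono with e'; auto; lra | apply (CC_cont _ _ _ _ (Hu 0%nat))]).
  - split; auto.
  - split; auto. split; auto. exists (fun i => pd i u). intros i Hi. split.
    + intros x Hx _. apply pd_deriv with n (ball n e); auto. apply ball_mono with e'; auto; lra.
    + apply IH. apply smooth_pd; auto. apply ball_open.
Qed.

(** * Analytic functions are smooth *)

(** Germs in [Og] are functions on all sequences that look at the first coordinates only, while the
    maps of the theorem are controlled on [inRn n]; precomposition with [trunc] passes from the
    second kind to the first. *)
Definition trunc (n : nat) (x : Rvec) : Rvec := fun i => if Nat.ltb i n then x i else 0.

Lemma trunc_lt n x i : (i < n)%nat -> trunc n x i = x i.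
Proof. intros H; unfold trunc. rewrite (proj2 (Nat.ltb_lt i n) H); auto. Qed.

Lemma trunc_inRn n x : inRn n (trunc n x).
Proof. intros i H; unfold trunc. rewrite (proj2 (Nat.ltb_ge i n) H); auto. Qed.

Lemma trunc_id n x : inRn n x -> trunc n x = x.
Proof. intros H. apply inRn_ext with n; auto. apply trunc_inRn. intros i Hi; apply trunc_lt; auto. Qed.

Lemma trunc_zero n : trunc n zerov = zerov.
Proof. apply trunc_id. intros i _; auto. Qed.

Lemma sumlists_ext n k F G : (forall l, idx_ok n l -> F l = G l) -> sumlists n k F = sumlists n k G.
Proof.
  revert F G; induction k as [|k IH]; intros F G H; simpl. { apply H; constructor. }
  apply sumn_ext; intros i Hi. apply IH. intros l Hl. apply H. constructor; auto.
Qed.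

Lemma PS_sumlists n rho k (m : list nat -> R) (f : list nat -> fn) : posr n rho ->
  (forall l, idx_ok n l -> PS n rho (m l) (f l)) -> PS n rho (sumlists n k m) (fun x => sumlists n k (fun l => f l x)).
Proof.
  intros Hr. revert m f; induction k as [|k IH]; intros m f H; simpl. { apply H; constructor. }
  apply (PS_sumn n rho n (fun i => sumlists n k (fun l => m (i :: l))) (fun i x => sumlists n k (fun l => f (i :: l) x))); auto.
  intros i Hi. apply (IH (fun l => m (i :: l)) (fun l => f (i :: l))). intros l Hl. apply H. constructor; auto.
Qed.

Lemma sumlists_nonneg n k F : (forall l, 0 <= F l) -> 0 <= sumlists n k F.
Proof.
  revert F; induction k as [|k IH]; intros F H; simpl; auto. apply sumn_nonneg; intros; apply IH; auto.
Qed.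

(** Absolute convergence at the corner [(r, ..., r)] of the polydisc is the bound that [PS]
    requires. *)
Lemma analytic_PS n f : analytic_at n f zerov -> exists r M, 0 < r /\ PS n (cst r) M (fun x => f (trunc n x)).
Proof.
  intros [d [c [Hd H]]]. set (r := d / 2). assert (Hr : 0 < r) by (unfold r; lra).
  assert (Hball : forall x, polyd n (cst r) x -> ball n d (trunc n x)).
  { intros x Hx. split; [apply trunc_inRn|]. apply distv_lt; auto. intros i Hi.
    rewrite trunc_lt by auto. unfold zerov. rewrite Rminus_0_r. specialize (Hx i Hi). unfold cst, r in *. lra. }
  assert (Hp : posr n (cst r)) by (apply posr_cst; auto).
  destruct (H _ (Hball _ (polyd_self _ _ Hp))) as [[s Hs] _].
  exists r, s. split; auto.
  apply (PS_series n (cst r) (fun k => sumlists n k (fun l => Rabs (c l) * mono (cst r) l))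
     (fun k x => sumlists n k (fun l => c l * mono x l))); auto.
  - intros k. apply PS_sumlists; auto. intros l Hl. apply PS_monomial; auto.
  - intros N. apply is_series_Reals in Hs.
    rewrite (sumn_ext N _ (fun k => sumlists n k (fun l => Rabs (c l) * Rabs (mono (trunc n (cst r)) l)))).
    + apply nonneg_series_ge; auto. intros k. apply sumlists_nonneg. intros l. apply Rmult_le_pos; apply Rabs_pos.
    + intros k _. apply sumlists_ext. intros l Hl. f_equal.
      rewrite (mono_ext n (trunc n (cst r)) (cst r)) by (auto; intros; apply trunc_lt; auto).
      rewrite Rabs_pos_eq; auto. eapply mono_nonneg; eauto.
  - intros x Hx. destruct (H _ (Hball x Hx)) as [_ E]. apply is_series_Reals in E.
    replace (vadd zerov (trunc n x)) with (trunc n x) in E by (apply functional_extensionality; intros; unfold vadd, zerov; ring).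
    eapply is_series_ext; [|apply E]. intros k; simpl. apply sumlists_ext. intros l Hl. f_equal.
    apply mono_ext with n; auto. intros; apply trunc_lt; auto.
Qed.

Definition AnAt (n : nat) (g : fn) (y : Rvec) : Prop := Og n (fun h => g (vadd y (trunc n h))).

(** Recentring is the substitution of [y i + h i], whose bound [|y i| + s] is at most [r]. *)
Lemma PS_AnAt n f r M y : 0 < r -> PS n (cst r) M (fun x => f (trunc n x)) -> ball n r y -> AnAt n f y.
Proof.
  intros Hr Hf [Hy Hyr]. rewrite distv_zero in Hyr. set (s := r - normv n y). assert (Hs : 0 < s) by (unfold s; lra).
  exists s, M. split; auto.
  pose proof (PS_subst n n (cst r) (cst s) M (fun x => f (trunc n x)) (fun i h => y i + h i) (posr_cst n s Hs) (posr_cst n r Hr)) as P.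
  cbv beta in P. eapply PS_ext; [|apply P; auto].
  - intros h Hh. cbv beta. f_equal. apply inRn_ext with n.
    + apply trunc_inRn.
    + intros i Hi. unfold vadd. rewrite (trunc_inRn n h i Hi), (Hy i Hi). ring.
    + intros i Hi. unfold vadd. rewrite !trunc_lt by auto. auto.
  - intros i Hi. eapply PS_le; [|apply PS_plus; [apply posr_cst; auto|apply PS_const, posr_cst; auto|apply PS_coord; auto; apply posr_cst; auto]].
    pose proof (normv_ge n y i Hi). unfold cst, s. lra.
Qed.

Lemma shift_vadd n y h i t : (i < n)%nat -> inRn n h -> shift (vadd y h) i t = vadd y (trunc n (vadd h (scalv t (unitv i)))).
Proof.
  intros Hi Hh. apply functional_extensionality; intros j. destruct (Nat.eq_dec j i) as [->|].
  - rewrite shift_same. unfold vadd. rewrite trunc_lt by auto. unfold scalv, unitv. rewrite Nat.eqb_refl. ring.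
  - rewrite shift_other by auto. unfold vadd. destruct (Nat.lt_ge_cases j n).
    + rewrite trunc_lt by auto. unfold scalv, unitv. rewrite (proj2 (Nat.eqb_neq j i)) by auto. ring.
    + rewrite (trunc_inRn n _ j), (Hh j) by auto. ring.
Qed.

Lemma AnAt_Tot_pd n g y gs : (forall j, Og n (gs j)) -> Tot n (fun h => g (vadd y (trunc n h))) gs ->
  forall i, (i < n)%nat -> near n (fun h =>
    derivable_pt_lim (fun t => g (shift (vadd y (trunc n h)) i t)) 0 (gs i h)).
Proof.
  intros Hgs HT i Hi. destruct (Tot_ddir n _ gs HT) as [e [He Hd]].
  destruct (Og_dep n (gs i) (Hgs i)) as [e' [He' Hdep]].
  exists (Rmin e e'). split; [apply Rmin_pos; auto|]. intros h Hh.
  pose proof (Rmin_l e e'); pose proof (Rmin_r e e').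
  rewrite <- (Hdep h) with (y := trunc n h).
  - specialize (Hd (trunc n h)). unfold ddir in Hd.
    assert (Hp : forall j, (j < n)%nat -> Rabs (trunc n h j) < e).
    { intros j Hj. rewrite trunc_lt by auto. specialize (Hh j Hj). lra. }
    specialize (Hd Hp (unitv i)).
    rewrite (sumn_ext n (fun j => gs j (trunc n h) * unitv i j) (fun j => unitv j i * gs j (trunc n h))) in Hd
      by (intros j _; unfold unitv; rewrite (Nat.eqb_sym i j); ring).
    rewrite sumn_delta in Hd by auto.
    replace (fun t => g (shift (vadd y (trunc n h)) i t)) with
      (fun t => g (vadd y (trunc n (vadd (trunc n h) (scalv t (unitv i)))))); auto.
    apply functional_extensionality; intros t. rewrite (shift_vadd n); auto. apply trunc_inRn.
  - intros j Hj. specialize (Hh j Hj). lra.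
  - intros j Hj. apply trunc_lt; auto.
Qed.

Lemma vadd_zero y : vadd y zerov = y.
Proof. apply functional_extensionality; intros; unfold vadd, zerov; ring. Qed.

Lemma AnAt_pd n g y i : (i < n)%nat -> AnAt n g y ->
  AnAt n (pd i g) y /\ derivable_pt_lim (fun t => g (shift y i t)) 0 (pd i g y).
Proof.
  intros Hi Hg. destruct (Og_Tot n _ Hg) as [gs [Hgs HT]].
  destruct (AnAt_Tot_pd n g y gs Hgs HT i Hi) as [e [He Hd]]. split.
  - apply Og_ext with (gs i); auto. exists e; split; auto. intros h Hh. symmetry. apply pd_spec. auto.
  - specialize (Hd zerov). rewrite trunc_zero, vadd_zero in Hd.
    rewrite (pd_spec i g y (gs i zerov)); apply Hd; intros; unfold zerov; rewrite Rabs_R0; auto.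
Qed.

(** By [AnAt_pd] the partial derivatives are analytic at the same points; continuity at each order
    is the Lipschitz bound there. *)
Lemma AnAt_smooth n U g : (forall y, U y -> inRn n y) -> (forall y, U y -> AnAt n g y) -> smoothC n U g.
Proof.
  intros HU Hg r. revert g Hg; induction r as [|r IH]; intros g Hg.
  all: assert (Hc : contf n U g).
  1,3: intros y Hy e He; destruct (Og_lip n _ (Hg y Hy)) as [L [eL [HL [HeL Hlip]]]];
    set (d := Rmin eL (e / (L + 1)));
    assert (Hd : 0 < d) by (apply Rmin_pos; auto; apply Rdiv_lt_0_compat; lra);
    exists d; split; auto; intros z Hz Hzd;
    assert (K1 : d <= eL) by apply Rmin_l; assert (K2 : d <= e / (L + 1)) by apply Rmin_r;
    specialize (Hlip zerov (fun i => z i - y i) (distv n z y)); rewrite trunc_zero, vadd_zero in Hlip;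
    replace (vadd y (trunc n (fun i => z i - y i))) with z in Hlip;
    [ assert (Hlt : distv n z y < e / (L + 1)) by lra; apply Rlt_div_r in Hlt; [|lra];
      pose proof (distv_nonneg n z y);
      eapply Rle_lt_trans; [apply Hlip; [intros; unfold zerov; rewrite Rabs_R0; auto
        | intros i Hi; unfold zerov; rewrite Rminus_0_r; apply distv_ge; auto | split; lra] | nra]
    | apply inRn_ext with n; auto;
      [intros i Hi; unfold vadd; rewrite (trunc_inRn n _ i Hi), (HU y Hy i Hi); ring
      | intros i Hi; unfold vadd; rewrite trunc_lt by auto; ring] ].
  - split; auto.
  - split; auto. exists (fun i => pd i g). intros i Hi. split.
    + intros x Hx. apply AnAt_pd with n; auto.
    + apply IH. intros y Hy. apply AnAt_pd; auto.
Qed.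

Lemma analytic_smooth n f : analytic_at n f zerov -> exists e, 0 < e /\ smoothC n (ball n e) f.
Proof.
  intros H. destruct (analytic_PS n f H) as [r [M [Hr Hf]]]. exists r; split; auto.
  apply AnAt_smooth; [intros y Hy; apply Hy|]. intros y Hy. apply PS_AnAt with r M; auto.
Qed.

(** Identifies the derivatives that occur in [tangent_field] with rows of the Jacobian matrix
    applied to the field. *)
Lemma analytic_ddir n f : analytic_at n f zerov ->
  near n (fun x => inRn n x -> forall V, ddir (fun y => f (trunc n y)) x V (sumn n (fun j => pd j f x * V j))).
Proof.
  intros H. destruct (analytic_PS n f H) as [r [M [Hr Hf]]].
  assert (HO : AnAt n f zerov).
  { apply PS_AnAt with r M; auto. apply ball_zero; auto. }
  assert (E : (fun h => f (vadd zerov (trunc n h))) = (fun h => f (trunc n h))).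
  { apply functional_extensionality; intros h. f_equal. apply functional_extensionality; intros; unfold vadd, zerov; ring. }
  destruct (Og_Tot n _ HO) as [gs [Hgs HT]].
  assert (Hall : forall k, (k <= n)%nat -> near n (fun h => inRn n h -> forall i, (i < k)%nat -> pd i f h = gs i h)).
  { induction k as [|k IH]; intros Hk.
    - exists 1; split; [lra|]. intros; lia.
    - eapply near_mono; [|apply (near_and _ _ _ (IH ltac:(lia)) (AnAt_Tot_pd n f zerov gs Hgs HT k ltac:(lia)))].
      intros h [H1 H2] Hh i Hi. destruct (Nat.eq_dec i k) as [->|]; [|apply H1; auto; lia].
      apply pd_spec. rewrite trunc_id in H2 by auto.
      replace (vadd zerov h) with h in H2; auto. apply functional_extensionality; intros; unfold vadd, zerov; ring. }
  eapply near_mono; [|apply (near_and _ _ _ (Hall n ltac:(lia)) (Tot_ddir n _ gs HT))].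
  intros x [H1 H2] Hx V. rewrite E in H2. specialize (H2 V).
  rewrite (sumn_ext n _ (fun j => gs j x * V j)); auto. intros j Hj. rewrite H1; auto.
Qed.

(** * Sums of bump functions accumulating on the closed set *)

(** The power of [/ t] makes the family closed under differentiation: the derivative of one member
    combines the next two. *)
Definition Ebump (j : nat) (t : R) : R := if Rle_dec t 0 then 0 else (/ t) ^ j * exp (- / t).

Lemma Ebump_nonpos j t : t <= 0 -> Ebump j t = 0.
Proof. intros H; unfold Ebump. destruct (Rle_dec t 0); auto; lra. Qed.

Lemma Ebump_pos j t : 0 < t -> Ebump j t = (/ t) ^ j * exp (- / t).
Proof. intros H; unfold Ebump. destruct (Rle_dec t 0); auto; lra. Qed.

Lemma exp_INR n x : exp (INR n * x) = exp x ^ n.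
Proof.
  induction n as [|n IH]. simpl; rewrite Rmult_0_l, exp_0; auto.
  rewrite S_INR, Rmult_plus_distr_r, Rmult_1_l, exp_plus, IH. simpl; ring.
Qed.

(** The inequality [x <= exp x] at [x = s / j], raised to the power [j]. *)
Lemma pow_le_exp j s : 0 <= s -> s ^ j <= INR j ^ j * exp s.
Proof.
  intros Hs. destruct j as [|j].
  - simpl. pose proof (exp_ineq1_le s). lra.
  - assert (Hj : 0 < INR (S j)) by (apply lt_0_INR; lia).
    replace s with (INR (S j) * (s / INR (S j))) at 1 2 by (field; lra).
    rewrite exp_INR, Rpow_mult_distr. apply Rmult_le_compat_l; [apply pow_le; lra|].
    apply pow_incr. assert (0 <= s / INR (S j)) by (apply Rdiv_le_0_compat; auto).
    pose proof (exp_ineq1_le (s / INR (S j))). lra.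
Qed.

Lemma Ebump_bound j t : 0 <= Ebump j t <= INR j ^ j.
Proof.
  destruct (Rle_lt_dec t 0) as [Ht|Ht].
  - rewrite Ebump_nonpos by auto. split; [lra|]. apply pow_le, pos_INR.
  - rewrite Ebump_pos by auto. assert (Hi : 0 < / t) by (apply Rinv_0_lt_compat; auto).
    pose proof (exp_pos (- / t)) as He. assert (0 <= (/ t) ^ j) by (apply pow_le; lra).
    split; [nra|]. pose proof (pow_le_exp j (/ t) ltac:(lra)) as Hp.
    replace (INR j ^ j) with (INR j ^ j * exp (/ t) * exp (- / t)).
    + apply Rmult_le_compat_r; lra.
    + rewrite Rmult_assoc, <- exp_plus, Rplus_opp_r, exp_0. ring.
Qed.

Lemma Ebump_derive j t : is_derive (Ebump j) t (- INR j * Ebump (S j) t + Ebump (S (S j)) t).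
Proof.
  destruct (total_order_T t 0) as [[Ht|Ht]|Ht].
  - rewrite !Ebump_nonpos by lra. replace (- INR j * 0 + 0) with 0 by ring.
    apply is_derive_ext_loc with (fun _ => 0); [|apply (is_derive_const 0)].
    exists (mkposreal (- t) ltac:(lra)). intros y Hy. symmetry; apply Ebump_nonpos.
    apply Rabs_def2 in Hy. unfold minus, plus, opp in Hy; simpl in Hy. lra.
  (* For [h > 0] the difference quotient at 0 is [h * Ebump (S (S j)) h], with a bounded second
     factor. *)
  - subst t. rewrite !Ebump_nonpos by lra. replace (- INR j * 0 + 0) with 0 by ring.
    apply is_derive_Reals. intros e He. set (K := INR (S (S j)) ^ (S (S j))).
    assert (HK : 0 <= K) by (apply pow_le, pos_INR).
    assert (Hd : 0 < e / (K + 1)) by (apply Rdiv_lt_0_compat; lra).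
    exists (mkposreal _ Hd). simpl. intros h Hh Hhd. rewrite Rplus_0_l, (Ebump_nonpos j 0), !Rminus_0_r by lra.
    destruct (Rle_lt_dec h 0) as [H|H].
    + rewrite Ebump_nonpos by auto. unfold Rdiv. rewrite Rmult_0_l, Rabs_R0; auto.
    + replace (Ebump j h / h) with (h * Ebump (S (S j)) h).
      * pose proof (Ebump_bound (S (S j)) h) as [B1 B2]. fold K in B2.
        rewrite Rabs_pos_eq in Hhd by lra. apply Rlt_div_r in Hhd; [|lra]. rewrite Rabs_pos_eq by nra. nra.
      * rewrite !Ebump_pos by auto. simpl. field. lra.
  - rewrite !Ebump_pos by auto.
    apply is_derive_ext_loc with (fun s => (/ s) ^ j * exp (- / s)).
    { exists (mkposreal t Ht). intros y Hy. symmetry; apply Ebump_pos.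
      apply Rabs_def2 in Hy. unfold minus, plus, opp in Hy; simpl in Hy. lra. }
    destruct j as [|j].
    + auto_derive; [lra|]. simpl. field. lra.
    + auto_derive; [lra|]. replace (match j with O => 1 | S _ => INR j + 1 end) with (INR (S j)) by reflexivity.
      simpl pow. field. lra.
Qed.

(** For [a = b = 0] a standard bump on the interval from -1 to 1; the two indices record the powers
    that differentiation produces. *)
Definition bfac (a b : nat) (t : R) : R := Ebump a (1 + t) * Ebump b (1 - t).

Lemma bfac_derive a b t : is_derive (bfac a b) t
  (- INR a * bfac (S a) b t + bfac (S (S a)) b t + INR b * bfac a (S b) t - bfac a (S (S b)) t).
Proof.
  unfold bfac.
  assert (H1 : is_derive (fun s => Ebump a (1 + s)) t (1 * (- INR a * Ebump (S a) (1 + t) + Ebump (S (S a)) (1 + t)))).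
  { apply (is_derive_comp (Ebump a) (fun s => 1 + s)). apply Ebump_derive. auto_derive; auto. }
  assert (H2 : is_derive (fun s => Ebump b (1 - s)) t (-1 * (- INR b * Ebump (S b) (1 - t) + Ebump (S (S b)) (1 - t)))).
  { apply (is_derive_comp (Ebump b) (fun s => 1 - s)). apply Ebump_derive. auto_derive; auto. }
  pose proof (is_derive_mult _ _ _ _ _ H1 H2 Rmult_comm) as P.
  eapply is_derive_ext; [|eapply eq_rect; [apply P|]]; [reflexivity|].
  unfold plus, mult; simpl. ring.
Qed.

Fixpoint prodn (n : nat) (f : nat -> R) : R := match n with O => 1 | S m => prodn m f * f m end.

Lemma prodn_ext n f g : (forall i, (i < n)%nat -> f i = g i) -> prodn n f = prodn n g.
Proof. induction n as [|n IH]; simpl; intros H; auto. rewrite IH, H; auto. Qed.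

Lemma prodn_split n f i : (i < n)%nat -> prodn n f = prodn n (fun j => if Nat.eqb j i then 1 else f j) * f i.
Proof.
  induction n as [|n IH]; intros Hi; [lia|]. simpl. destruct (Nat.eq_dec i n) as [->|].
  - rewrite Nat.eqb_refl, Rmult_1_r. f_equal. apply prodn_ext. intros j Hj.
    rewrite (proj2 (Nat.eqb_neq j n)) by lia. auto.
  - rewrite (proj2 (Nat.eqb_neq n i)) by lia. rewrite IH by lia. ring.
Qed.

Lemma prodn_zero n f i : (i < n)%nat -> f i = 0 -> prodn n f = 0.
Proof. intros Hi H. rewrite (prodn_split n f i Hi), H. ring. Qed.

Lemma prodn_bound n f K : (forall i, (i < n)%nat -> 0 <= f i <= K i) -> 0 <= prodn n f <= prodn n K.
Proof.
  induction n as [|n IH]; intros H; simpl; [lra|].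
  specialize (IH (fun i Hi => H i (Nat.lt_lt_succ_r _ _ Hi))). specialize (H n (Nat.lt_succ_diag_r n)).
  split; [nra|]. apply Rmult_le_compat; lra.
Qed.

Definition incr (a : nat -> nat) (i k : nat) : nat -> nat := fun j => if Nat.eqb j i then (a j + k)%nat else a j.

Definition bumpW (n : nat) (a b : nat -> nat) (x : Rvec) : R := prodn n (fun i => bfac (a i) (b i) (x i)).

Lemma bfac_out a b t : 1 <= Rabs t -> bfac a b t = 0.
Proof.
  intros H. unfold bfac. destruct (Rle_lt_dec 0 t).
  - rewrite Rabs_pos_eq in H by auto. rewrite (Ebump_nonpos b) by lra. ring.
  - rewrite Rabs_left in H by auto. rewrite (Ebump_nonpos a) by lra. ring.
Qed.

Lemma bumpW_out n a b x i : (i < n)%nat -> 1 <= Rabs (x i) -> bumpW n a b x = 0.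
Proof. intros Hi H. apply prodn_zero with i; auto. apply bfac_out; auto. Qed.

Lemma bumpW_bound n a b : exists K, 0 <= K /\ forall x, Rabs (bumpW n a b x) <= K.
Proof.
  assert (H : forall x, 0 <= bumpW n a b x <= prodn n (fun i => INR (a i) ^ (a i) * INR (b i) ^ (b i))).
  { intros x. apply prodn_bound. intros i _. unfold bfac.
    pose proof (Ebump_bound (a i) (1 + x i)). pose proof (Ebump_bound (b i) (1 - x i)).
    split; [nra|]. apply Rmult_le_compat; lra. }
  eexists; split; [|intros x; rewrite Rabs_pos_eq; apply H]. pose proof (H zerov). lra.
Qed.

Lemma bumpW_incr n a b i p q x : (i < n)%nat ->
  bumpW n (incr a i p) (incr b i q) x =
  prodn n (fun j => if Nat.eqb j i then 1 else bfac (a j) (b j) (x j)) * bfac (a i + p) (b i + q) (x i).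
Proof.
  intros Hi. unfold bumpW. rewrite (prodn_split n _ i Hi). unfold incr. rewrite !Nat.eqb_refl.
  f_equal. apply prodn_ext. intros j _. destruct (Nat.eqb j i); auto.
Qed.

Lemma incr_zero a i : incr a i 0 = a.
Proof. apply functional_extensionality; intros j; unfold incr. destruct (Nat.eqb j i); rewrite ?Nat.add_0_r; auto. Qed.

(* [z] is the centre and [s] the inverse radius of the support. *)
Definition bumpS (n : nat) (a b : nat -> nat) (z : Rvec) (s : R) : fn := fun x => bumpW n a b (fun i => (x i - z i) * s).

Lemma bumpS_derive n a b z s x i : (i < n)%nat ->
  derivable_pt_lim (fun t => bumpS n a b z s (shift x i t)) 0
   (s * (- INR (a i) * bumpS n (incr a i 1) b z s x + bumpS n (incr a i 2) b z s x
      + INR (b i) * bumpS n a (incr b i 1) z s x - bumpS n a (incr b i 2) z s x)).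
Proof.
  intros Hi. apply is_derive_Reals.
  set (R0 := prodn n (fun j => if Nat.eqb j i then 1 else bfac (a j) (b j) ((x j - z j) * s))).
  apply is_derive_ext with (fun t => R0 * bfac (a i) (b i) ((x i + t - z i) * s)).
  { intros t. unfold bumpS. rewrite <- (incr_zero a i) at 2. rewrite <- (incr_zero b i) at 2.
    rewrite bumpW_incr, shift_same, !Nat.add_0_r by auto. f_equal.
    apply prodn_ext. intros j _. destruct (Nat.eqb_spec j i); auto. rewrite shift_other; auto. }
  assert (Hb : forall p q, bumpS n (incr a i p) (incr b i q) z s x = R0 * bfac (a i + p) (b i + q) ((x i - z i) * s)).
  { intros p q. unfold bumpS. rewrite bumpW_incr by auto. auto. }
  pose proof (Hb 1%nat 0%nat) as E1. pose proof (Hb 2%nat 0%nat) as E2.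
  pose proof (Hb 0%nat 1%nat) as E3. pose proof (Hb 0%nat 2%nat) as E4.
  rewrite incr_zero in E1, E2, E3, E4. rewrite E1, E2, E3, E4, !Nat.add_0_r.
  rewrite !(Nat.add_comm _ 1), !(Nat.add_comm _ 2). simpl plus.
  set (u := (x i - z i) * s).
  assert (H1 : is_derive (fun t => (x i + t - z i) * s) 0 s) by (auto_derive; auto; ring).
  assert (Hu : (x i + 0 - z i) * s = u) by (unfold u; ring).
  pose proof (bfac_derive (a i) (b i) ((x i + 0 - z i) * s)) as H2.
  pose proof (is_derive_comp (bfac (a i) (b i)) (fun t => (x i + t - z i) * s) 0 _ _ H2 H1) as P.
  rewrite Hu in P. pose proof (is_derive_scal _ _ R0 _ P) as Q.
  eapply eq_rect; [apply Q|]. unfold scal; simpl; unfold mult; simpl. ring.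
Qed.

Lemma bumpS_lip n a b z s : exists L, 0 <= L /\ forall x y, inRn n x -> inRn n y ->
  Rabs (bumpS n a b z s x - bumpS n a b z s y) <= L * distv n x y.
Proof.
  destruct (family_bound n (fun i C => forall x, Rabs (s * (- INR (a i) * bumpS n (incr a i 1) b z s x + bumpS n (incr a i 2) b z s x
      + INR (b i) * bumpS n a (incr b i 1) z s x - bumpS n a (incr b i 2) z s x)) <= C)) as [K [HK HKb]].
  { intros i C C' HC H x. eapply Rle_trans; [apply H | auto]. }
  { intros i Hi. destruct (bumpW_bound n (incr a i 1) b) as [K1 [P1 B1]].
    destruct (bumpW_bound n (incr a i 2) b) as [K2 [P2 B2]].
    destruct (bumpW_bound n a (incr b i 1)) as [K3 [P3 B3]].
    destruct (bumpW_bound n a (incr b i 2)) as [K4 [P4 B4]].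
    pose proof (pos_INR (a i)). pose proof (pos_INR (b i)).
    exists (Rabs s * (INR (a i) * K1 + K2 + INR (b i) * K3 + K4)). split.
    { apply Rmult_le_pos; [apply Rabs_pos|]. assert (0 <= INR (a i) * K1) by (apply Rmult_le_pos; auto).
      assert (0 <= INR (b i) * K3) by (apply Rmult_le_pos; auto). lra. }
    intros x. rewrite Rabs_mult. apply Rmult_le_compat_l; [apply Rabs_pos|]. unfold bumpS.
    set (y := fun i => (x i - z i) * s). specialize (B1 y). specialize (B2 y). specialize (B3 y). specialize (B4 y).
    apply Rabs_le_between in B1. apply Rabs_le_between in B2. apply Rabs_le_between in B3. apply Rabs_le_between in B4.
    apply Rabs_le. split; nra. }
  exists (INR n * K). split; [apply Rmult_le_pos; auto using pos_INR|]. intros x y Hx Hy.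
  set (e := normv n x + normv n y + 1).
  pose proof (normv_nonneg n x). pose proof (normv_nonneg n y).
  apply box_mean_value with e (fun i x => s * (- INR (a i) * bumpS n (incr a i 1) b z s x + bumpS n (incr a i 2) b z s x
      + INR (b i) * bumpS n a (incr b i 1) z s x - bumpS n a (incr b i 2) z s x)); auto.
  - intros i w Hi _. apply bumpS_derive; auto.
  - split; auto. rewrite distv_zero. unfold e; lra.
  - split; auto. rewrite distv_zero. unfold e; lra.
Qed.

(** Halving the norms separates the supports: [distS] is at most the norm because 0 lies in [Sg], so
    on the box of radius [distS / 4] about [z m] the norm stays between 3/4 and 5/4 of that of
    [z m]. *)
Record bump_centres (n : nat) (Sg : Rvec -> Prop) (z : nat -> Rvec) : Prop := {
  bc_in : forall m, inRn n (z m);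
  bc_pos : forall m, 0 < distS n Sg (z m);
  bc_half : forall m, normv n (z (S m)) <= normv n (z m) / 2 }.

Definition inb (n : nat) (Sg : Rvec -> Prop) (z : nat -> Rvec) (m : nat) (x : Rvec) : Prop :=
  distv n x (z m) < distS n Sg (z m) / 4.

Definition bterm (n : nat) (Sg : Rvec -> Prop) (z : nat -> Rvec) (a b : nat -> nat) (m : nat) : fn :=
  bumpS n a b (z m) (4 / distS n Sg (z m)).

(** The boxes are disjoint, so the infinite sum has at most one nonzero term at each point and is
    written as the choice of that term. *)
Definition bsum (n : nat) (Sg : Rvec -> Prop) (z : nat -> Rvec) (w : nat -> R) (a b : nat -> nat) : fn := fun x =>
  match excluded_middle_informative (exists m, inb n Sg z m x) with
  | left H => let m := proj1_sig (constructive_indefinite_description _ H) in w m * bterm n Sg z a b m x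
  | right _ => 0
  end.

Lemma bc_norm n Sg z m : Sg zerov -> bump_centres n Sg z -> 0 < distS n Sg (z m) <= normv n (z m).
Proof.
  intros H0 Hz. split; [apply (bc_pos _ _ _ Hz)|]. rewrite <- distv_zero. apply distS_le; auto.
Qed.

Lemma bc_halves n Sg z m m' : Sg zerov -> bump_centres n Sg z -> (m < m')%nat -> normv n (z m') <= normv n (z m) / 2.
Proof.
  intros H0 Hz. induction 1 as [|m' Hm IH]; [apply (bc_half _ _ _ Hz)|].
  pose proof (bc_half _ _ _ Hz m'). pose proof (bc_norm n Sg z m' H0 Hz). lra.
Qed.

Lemma normv_distv n x y : Rabs (normv n x - normv n y) <= distv n x y.
Proof.
  rewrite <- !distv_zero. pose proof (distv_triang n x y zerov). pose proof (distv_triang n y x zerov).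
  rewrite (distv_sym n y x) in H0. apply Rabs_le; lra.
Qed.

Lemma inb_norm n Sg z m x : Sg zerov -> bump_centres n Sg z -> inb n Sg z m x ->
  3 / 4 * normv n (z m) < normv n x < 5 / 4 * normv n (z m).
Proof.
  intros H0 Hz H. unfold inb in H. pose proof (bc_norm n Sg z m H0 Hz). pose proof (normv_distv n x (z m)) as Hn.
  apply Rabs_le_between in Hn. lra.
Qed.

Lemma bterm_out n Sg z a b m x : Sg zerov -> bump_centres n Sg z -> ~ inb n Sg z m x -> bterm n Sg z a b m x = 0.
Proof.
  intros H0 Hz Hn. pose proof (bc_norm n Sg z m H0 Hz) as Hd.
  assert (H : exists i, (i < n)%nat /\ distS n Sg (z m) / 4 <= Rabs (x i - z m i)).
  { apply NNPP; intros H. apply Hn. apply distv_lt; [lra|]. intros i Hi. apply Rnot_le_lt; intros Hle. apply H; eauto. }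
  destruct H as [i [Hi Hle]]. apply bumpW_out with i; auto. rewrite Rabs_mult.
  rewrite (Rabs_pos_eq (4 / _)) by (apply Rdiv_le_0_compat; lra).
  apply Rmult_le_reg_r with (distS n Sg (z m) / 4); [lra|].
  replace (Rabs (x i - z m i) * (4 / distS n Sg (z m)) * (distS n Sg (z m) / 4)) with (Rabs (x i - z m i)) by (field; lra). lra.
Qed.

Lemma inb_unique n Sg z m m' x : Sg zerov -> bump_centres n Sg z -> inb n Sg z m x -> inb n Sg z m' x -> m = m'.
Proof.
  intros H0 Hz H H'. pose proof (inb_norm n Sg z m x H0 Hz H). pose proof (inb_norm n Sg z m' x H0 Hz H').
  pose proof (bc_norm n Sg z m H0 Hz). pose proof (bc_norm n Sg z m' H0 Hz).
  destruct (Nat.lt_total m m') as [Hl|[Hl|Hl]]; auto; exfalso;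
    pose proof (bc_halves n Sg z _ _ H0 Hz Hl); lra.
Qed.

Lemma bsum_in n Sg z w a b m x : Sg zerov -> bump_centres n Sg z -> inb n Sg z m x ->
  bsum n Sg z w a b x = w m * bterm n Sg z a b m x.
Proof.
  intros H0 Hz H. unfold bsum. destruct excluded_middle_informative as [He|He]; [|exfalso; eauto].
  destruct constructive_indefinite_description as [m' Hm']; simpl.
  rewrite (inb_unique n Sg z m' m x); auto.
Qed.

Lemma bsum_out n Sg z w a b x : ~ (exists m, inb n Sg z m x) -> bsum n Sg z w a b x = 0.
Proof. intros H. unfold bsum. destruct excluded_middle_informative; tauto. Qed.

(** Away from 0 a single centre matters locally. Its index is chosen before the weights and the
    exponents, so that the sum and the candidates for its derivatives are compared with the same
    term. *)
Lemma bsum_local n Sg z x : Sg zerov -> bump_centres n Sg z -> 0 < normv n x ->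
  exists m, forall w a b y, distv n y x < normv n x / 20 -> bsum n Sg z w a b y = w m * bterm n Sg z a b m y.
Proof.
  intros H0 Hz Hx. set (s := normv n x) in *.
  (* Within [s / 20] of [x] norms lie between 19/20 and 21/20 of [s], and a box through such a point
     has a centre whose norm is between 4/5 and 4/3 of that of the point. The extremes 19/25 and 7/5
     have a quotient below 2, so two centres cannot both qualify. *)
  assert (Hcand : forall y m, distv n y x < s / 20 -> inb n Sg z m y -> 19 / 25 * s < normv n (z m) < 7 / 5 * s).
  { intros y m Hy Hm. pose proof (inb_norm n Sg z m y H0 Hz Hm). pose proof (normv_distv n y x) as Hn.
    apply Rabs_le_between in Hn. fold s in Hn. lra. }
  assert (Hone : exists m, forall m', 19 / 25 * s < normv n (z m') < 7 / 5 * s -> m' = m).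
  { destruct (classic (exists m, 19 / 25 * s < normv n (z m) < 7 / 5 * s)) as [[m Hm]|Hn].
    - exists m. intros m' Hm'. destruct (Nat.lt_total m m') as [Hl|[Hl|Hl]]; auto; exfalso;
        pose proof (bc_halves n Sg z _ _ H0 Hz Hl); lra.
    - exists 0%nat. intros m' Hm'. exfalso; eauto. }
  destruct Hone as [m Hm]. exists m. intros w a b y Hy.
  destruct (classic (exists m', inb n Sg z m' y)) as [[m' Hm']|Hn].
  - rewrite <- (Hm m' (Hcand y m' Hy Hm')). apply bsum_in; auto.
  - rewrite bsum_out by auto. rewrite bterm_out; auto; [ring|]. intros H; apply Hn; eauto.
Qed.

Definition rapid (n : nat) (Sg : Rvec -> Prop) (z : nat -> Rvec) (w : nat -> R) : Prop :=
  forall N : nat, exists C, 0 <= C /\ forall m, Rabs (w m) <= C * distS n Sg (z m) ^ N.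

(** The factor [4 / distS] is what the chain rule produces at each derivative of a bump. *)
Lemma rapid_div n Sg z w : bump_centres n Sg z -> rapid n Sg z w -> rapid n Sg z (fun m => w m * (4 / distS n Sg (z m))).
Proof.
  intros Hz H N. destruct (H (S N)) as [C [HC HCb]]. exists (C * 4). split; [lra|]. intros m.
  pose proof (bc_pos _ _ _ Hz m) as Hd. rewrite Rabs_mult, (Rabs_pos_eq (4 / _)) by (apply Rdiv_le_0_compat; lra).
  apply Rle_trans with (C * distS n Sg (z m) ^ S N * (4 / distS n Sg (z m))).
  - apply Rmult_le_compat_r; auto. apply Rdiv_le_0_compat; lra.
  - right. simpl. field. lra.
Qed.

(** A derivative of the sum is a combination of sums of the same kind with weights multiplied by
    [4 / distS]. On the box about [z m] the distance of [z m] to [Sg] is at most 4/3 of that of [x],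
    which turns decay of the weights into vanishing along [Sg]. *)
Lemma bsum_Fl n Sg z e r p w a b : closed_in_Rn n Sg -> Sg zerov -> bump_centres n Sg z -> 0 < e <= 1 ->
  rapid n Sg z w -> Fl n Sg (ball n e) r p (bsum n Sg z w a b).
Proof.
  intros Hcl H0 Hz He. assert (H1 : forall x, ball n e x -> distS n Sg x <= 1).
  { intros x Hx. pose proof (distS_ball n Sg e x H0 Hx). lra. }
  assert (Hnz : forall x, inRn n x -> ~ Sg x -> 0 < normv n x).
  { intros x Hx Hn. rewrite <- distv_zero.
    eapply Rlt_le_trans; [apply (distS_pos n Sg x Hcl H0 Hx Hn) | apply distS_le; auto]. }
  revert p w a b; induction r as [|r IH]; intros p w a b Hw.
  all: assert (Hb : exists C, 0 <= C /\ forall x, ball n e x -> Rabs (bsum n Sg z w a b x) <= C * distS n Sg x ^ p).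
  1,3: destruct (bumpW_bound n a b) as [K [HK HKb]]; destruct (Hw p) as [C [HC HCb]];
    exists (C * K * (4 / 3) ^ p); split; [apply Rmult_le_pos; [apply Rmult_le_pos; auto | apply pow_le; lra]|];
    intros x Hx; destruct (classic (exists m, inb n Sg z m x)) as [[m Hm]|Hn];
    [ rewrite (bsum_in n Sg z w a b m x) by auto; rewrite Rabs_mult, Rmult_assoc, <- Rpow_mult_distr;
      apply Rle_trans with (C * distS n Sg (z m) ^ p * K);
      [ apply Rmult_le_compat; auto using Rabs_pos; apply HKb
      | replace (C * distS n Sg (z m) ^ p * K) with (C * K * distS n Sg (z m) ^ p) by ring;
        apply Rmult_le_compat_l; [apply Rmult_le_pos; auto|]; apply pow_incr;
        pose proof (distS_lip n Sg (z m) x H0); rewrite distv_sym in H; unfold inb in Hm;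
        pose proof (bc_pos _ _ _ Hz m); lra ]
    | rewrite bsum_out by auto; rewrite Rabs_R0; apply Rmult_le_pos;
      [apply Rmult_le_pos; [apply Rmult_le_pos; auto | apply pow_le; lra] | apply pow_le, distS_nonneg; auto] ].
  all: assert (Hc : contf n (fun x => ball n e x /\ ~ Sg x) (bsum n Sg z w a b)).
  1,3: intros x [Hx Hxn] eps Heps; pose proof (Hnz x (proj1 Hx) Hxn) as Hpos;
    destruct (bsum_local n Sg z x H0 Hz Hpos) as [m Hm];
    destruct (bumpS_lip n a b (z m) (4 / distS n Sg (z m))) as [L [HL HLip]];
    set (M := Rabs (w m) * L); assert (HM : 0 <= M) by (apply Rmult_le_pos; auto; apply Rabs_pos);
    exists (Rmin (normv n x / 20) (eps / (M + 1))); split; [apply Rmin_pos; [lra | apply Rdiv_lt_0_compat; lra]|];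
    intros y [Hy _] Hyd; pose proof (Rmin_l (normv n x / 20) (eps / (M + 1))); pose proof (Rmin_r (normv n x / 20) (eps / (M + 1)));
    rewrite !Hm by (try rewrite distv_refl; lra);
    rewrite <- Rmult_minus_distr_l, Rabs_mult;
    assert (Hlt : distv n y x < eps / (M + 1)) by lra; apply Rlt_div_r in Hlt; [|lra];
    pose proof (distv_nonneg n y x);
    apply Rle_lt_trans with (M * distv n y x);
    [ unfold M; rewrite Rmult_assoc; apply Rmult_le_compat_l; [apply Rabs_pos | apply HLip; [apply Hy | apply Hx]] | nra ].
  - split; auto.
  - split; auto. split; auto.
    set (w' := fun m => w m * (4 / distS n Sg (z m))).
    assert (Hw' : rapid n Sg z w') by (apply rapid_div; auto).
    exists (fun i x => - INR (a i) * bsum n Sg z w' (incr a i 1) b x + bsum n Sg z w' (incr a i 2) b x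
       + INR (b i) * bsum n Sg z w' a (incr b i 1) x + - 1 * bsum n Sg z w' a (incr b i 2) x).
    intros i Hi. split.
    + intros x Hx Hxn. pose proof (Hnz x (proj1 Hx) Hxn) as Hpos.
      destruct (bsum_local n Sg z x H0 Hz Hpos) as [m Hm].
      rewrite !Hm by (rewrite distv_refl; lra).
      apply derivable_pt_lim_local with (fun t => w m * bterm n Sg z a b m (shift x i t)) (normv n x / 20).
      * lra.
      * intros t Ht. rewrite Hm; auto. eapply Rle_lt_trans; [apply distv_shift | auto].
      * pose proof (derivable_pt_lim_scal _ (w m) _ _ (bumpS_derive n a b (z m) (4 / distS n Sg (z m)) x i Hi)) as P.
        eapply eq_rect; [apply P|]. unfold w', bterm. ring.
    + apply Fl_plus; [apply Fl_plus; [apply Fl_plus|]|].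
      * apply Fl_scal; auto.
      * apply IH; auto.
      * apply Fl_scal; auto.
      * apply Fl_scal; auto.
Qed.

Lemma bsum_centre n Sg z w m : Sg zerov -> bump_centres n Sg z ->
  bsum n Sg z w (fun _ => O) (fun _ => O) (z m) = w m * (exp (-1) * exp (-1)) ^ n.
Proof.
  intros H0 Hz. rewrite (bsum_in n Sg z _ _ _ m); auto.
  - f_equal. unfold bterm, bumpS, bumpW.
    rewrite (prodn_ext n _ (fun _ => exp (-1) * exp (-1))).
    + clear. generalize (exp (-1) * exp (-1)). intros c. induction n as [|n IH]; simpl; auto. rewrite IH; ring.
    + intros i _. rewrite Rminus_diag_eq, Rmult_0_l by auto. unfold bfac.
      rewrite Rplus_0_r, Rminus_0_r. rewrite !Ebump_pos by lra. rewrite Rinv_1. simpl.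
      replace (- (1)) with (-1) by ring. ring.
  - unfold inb. rewrite distv_refl. pose proof (bc_pos _ _ _ Hz m). lra.
Qed.

(** * Maps vanishing only on the closed set *)

Definition sqnorm (n : nat) (F : Rvec -> Rvec) (x : Rvec) : R := sumn n (fun i => F x i * F x i).

Definition Ell (n : nat) (Sg : Rvec -> Prop) (F : Rvec -> Rvec) : Prop :=
  exists C (a : nat) e, 0 < C /\ 0 < e /\ forall x, ball n e x -> C * distS n Sg x ^ a <= sqnorm n F x.

(** The order [r + 1 + 2 ^ r * a] leaves [r + 1] after the division by [sqnorm n F], and that is
    what a C^r coefficient requires. On [Sg], where [sqnorm n F] may vanish, both sides are 0
    because [u] is. *)
Lemma ideal_quotient n Sg e (F : Rvec -> Rvec) u r C a : closed_in_Rn n Sg -> Sg zerov -> 0 < e <= 1 ->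
  (forall i, (i < n)%nat -> Fl n Sg (ball n e) r 0 (coord i F)) -> (0 < a)%nat -> 0 < C ->
  (forall x, ball n e x -> C * distS n Sg x ^ a <= sqnorm n F x) ->
  Fl n Sg (ball n e) r (r + 1 + 2 ^ r * a) u ->
  (forall j, (j < n)%nat -> CC n r (ball n e) (fun x => u x * F x j / sqnorm n F x)) /\
  forall x, ball n e x -> u x = sumn n (fun j => u x * F x j / sqnorm n F x * F x j).
Proof.
  intros Hcl H0 He HF Ha HC HE Hu.
  assert (H1 : forall x, ball n e x -> distS n Sg x <= 1).
  { intros x Hx. pose proof (distS_ball n Sg e x H0 Hx). lra. }
  assert (HQ : Fl n Sg (ball n e) r 0 (sqnorm n F)).
  { apply (Fl_sumn n Sg (ball n e) r n (fun i x => F x i * F x i)). intros i Hi.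
    apply (Fl_mult n Sg (ball n e) r 0 0); auto; apply HF; auto. }
  split.
  - intros j Hj. apply Fl_CC with Sg (r + 1)%nat; auto; [apply ball_open|].
    apply (Fl_quot n Sg (ball n e) r (r + 1) a C (fun x => u x * F x j)); auto; [apply ball_open|lia|].
    rewrite <- (Nat.add_0_r (r + 1 + 2 ^ r * a)). apply Fl_mult; auto. apply HF; auto.
  - intros x Hx. destruct (classic (Sg x)) as [Hs|Hs].
    + assert (Hux : u x = 0) by (apply (Fl_zero n Sg (ball n e) r (r + 1 + 2 ^ r * a)); auto; lia).
      rewrite Hux. rewrite sumn_zero; auto. intros; unfold Rdiv; ring.
    + assert (Hp : 0 < sqnorm n F x).
      { eapply Rlt_le_trans; [|apply HE; auto]. apply Rmult_lt_0_compat; auto. apply pow_lt.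
        apply distS_pos; auto. apply Hx. }
      rewrite (sumn_ext n _ (fun j => (u x / sqnorm n F x) * (F x j * F x j))) by (intros; unfold Rdiv; ring).
      rewrite sumn_scal. fold (sqnorm n F x). field. lra.
Qed.

Lemma common_smooth n (F : Rvec -> Rvec) : (forall i, (i < n)%nat -> exists e, 0 < e /\ smoothC n (ball n e) (coord i F)) ->
  exists e, 0 < e /\ forall i, (i < n)%nat -> smoothC n (ball n e) (coord i F).
Proof.
  intros H.
  assert (Hk : forall k, (k <= n)%nat -> exists e, 0 < e /\ forall i, (i < k)%nat -> smoothC n (ball n e) (coord i F)).
  { induction k as [|k IH]; intros Hk.
    - exists 1; split; [lra|]. intros; lia.
    - destruct (IH ltac:(lia)) as [e [He IHe]]. destruct (H k ltac:(lia)) as [e' [He' H']].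
      exists (Rmin e e'). split; [apply Rmin_pos; auto|]. intros i Hi r.
      destruct (Nat.eq_dec i k) as [->|].
      + apply CC_sub with (ball n e'); [|apply H']. intros x; apply ball_mono, Rmin_r.
      + apply CC_sub with (ball n e); [|apply IHe; lia]. intros x; apply ball_mono, Rmin_l. }
  apply Hk; auto.
Qed.

Lemma analytic_mapgerm_smooth n F : analytic_mapgerm n F ->
  exists e, 0 < e /\ forall i, (i < n)%nat -> smoothC n (ball n e) (coord i F).
Proof. intros [_ H]. apply common_smooth. intros i Hi. apply analytic_smooth; auto. Qed.

Lemma Ell_pos n Sg F : Sg zerov -> Ell n Sg F -> exists C (a : nat) e, (0 < a)%nat /\ 0 < C /\ 0 < e <= 1 /\
  forall x, ball n e x -> C * distS n Sg x ^ a <= sqnorm n F x.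
Proof.
  intros H0 [C [a [e [HC [He H]]]]]. exists C, (S a), (Rmin e 1).
  split; [lia|]. split; auto. split; [split; [apply Rmin_pos; lra | apply Rmin_r]|].
  intros x Hx. eapply Rle_trans; [|apply H; apply ball_mono with (Rmin e 1); auto; apply Rmin_l].
  apply Rmult_le_compat_l; [lra|]. pose proof (distS_ball n Sg _ x H0 Hx). pose proof (Rmin_r e 1).
  pose proof (pow_le (distS n Sg x) a ltac:(lra)). simpl. nra.
Qed.

Lemma Ell_flat_ideal n Sg F f : closed_in_Rn n Sg -> Sg zerov ->
  (exists e, 0 < e /\ forall i, (i < n)%nat -> smoothC n (ball n e) (coord i F)) -> Ell n Sg F ->
  flat_on n Sg f -> inIdeal n n (IT_gen n F) f.
Proof.
  intros Hcl H0 [e1 [He1 HF]] HE [e0 [He0 [Hf Hflat]]].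
  destruct (Ell_pos n Sg F H0 HE) as [C [a [e2 [Ha [HC [He2 HEb]]]]]].
  set (e := Rmin (e0 / 6) (Rmin (e1 / 2) e2)).
  assert (He : 0 < e) by (repeat apply Rmin_pos; lra).
  assert (K0 : e <= e0 / 6) by apply Rmin_l.
  assert (K1 : e <= e1 / 2) by (eapply Rle_trans; [apply Rmin_r | apply Rmin_l]).
  assert (K2 : e <= e2) by (eapply Rle_trans; [apply Rmin_r | apply Rmin_r]).
  (* The coefficients and the ball do not depend on [r], so being C^r for every [r] makes the
     coefficients smooth. *)
  assert (Hq : forall r, (forall j, (j < n)%nat -> CC n r (ball n e) (fun x => f x * F x j / sqnorm n F x)) /\
     forall x, ball n e x -> f x = sumn n (fun j => f x * F x j / sqnorm n F x * F x j)).
  { intros r. apply (ideal_quotient n Sg e F f r C a); auto; try lra.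
    - intros i Hi. apply smooth_Fl0 with e1; auto; lra.
    - intros x Hx. apply HEb. apply ball_mono with e; auto; lra.
    - set (p := (r + 1 + 2 ^ r * a)%nat).
      apply Fl_sub with (ball n (e0 / 2 / 3)); [intros x; apply ball_mono; lra|].
      apply (taylor_Fl n Sg e0 (e0 / 2) (r + p) f Hcl H0 ltac:(lra) (Hf (r + p + 1)%nat)) with (l := nil).
      + intros l x Hl _ Hs Hx. apply Hflat; auto.
      + constructor.
      + simpl; lia. }
  exists e, (fun j x => f x * F x j / sqnorm n F x). split; auto. split.
  - intros j Hj. apply smooth_on_iff; [apply ball_open|]. intros r. apply Hq; auto.
  - intros x Hx. unfold IT_gen, coord. apply (Hq 0%nat); auto.
Qed.

Lemma CrIdeal_transfer n r e (F G : Rvec -> Rvec) (B : nat -> nat -> fn) h : 0 < e ->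
  (forall i j, (i < n)%nat -> (j < n)%nat -> CC n r (ball n e) (B i j)) ->
  (forall i x, (i < n)%nat -> ball n e x -> F x i = G x i + sumn n (fun j => B i j x * G x j)) ->
  inCrIdeal n r (fun i x => F x i) h -> inCrIdeal n r (fun i x => G x i) h.
Proof.
  intros He HB HFG [e' [a [He' [Ha Hh]]]].
  exists (Rmin e e'), (fun j x => a j x + sumn n (fun i => a i x * B i j x)).
  assert (Hm : 0 < Rmin e e') by (apply Rmin_pos; auto).
  assert (S1 : forall x, ball n (Rmin e e') x -> ball n e x) by (intros x; apply ball_mono, Rmin_l).
  assert (S2 : forall x, ball n (Rmin e e') x -> ball n e' x) by (intros x; apply ball_mono, Rmin_r).
  assert (Ha' : forall i, (i < n)%nat -> CC n r (ball n (Rmin e e')) (a i)).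
  { intros i Hi. apply CC_sub with (ball n e'); auto. apply Cr_on_CC; auto. }
  split; auto. split.
  - intros j Hj. apply CC_Cr_on; [apply ball_open|]. apply CC_plus; auto.
    apply (CC_sumn n r _ n (fun i x => a i x * B i j x)). intros i Hi. apply CC_mult; auto.
    apply CC_sub with (ball n e); auto.
  - intros x Hx. rewrite Hh by auto.
    rewrite (sumn_ext n _ (fun i => a i x * G x i + sumn n (fun j => a i x * B i j x * G x j))).
    + rewrite sumn_plus. rewrite <- (sumn_swap n n (fun i j => a i x * B i j x * G x j)).
      rewrite <- sumn_plus. apply sumn_ext. intros j Hj. rewrite sumn_scal_r. ring.
    + intros i Hi. rewrite HFG by auto. rewrite Rmult_plus_distr_l, <- sumn_scal. f_equal.
      apply sumn_ext; intros; ring.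
Qed.

Lemma homeo_id n Sg : homeo_fix_on n Sg 1 (fun x => x).
Proof.
  split; [lra|]. split; [intros x Hx; apply Hx|]. split; [intros i _; auto|]. split; [intros x _ _ i _; auto|].
  split; [intros x Hx e He; exists e; split; auto|]. split.
  - intros x Hx. destruct (ball_open n 1) as [_ Ho]. destruct (Ho x Hx) as [r [Hr H]]. exists r; split; auto.
    intros y Hy. split; [apply Hy|]. exists y. split; auto. intros i _; auto.
  - exists (fun y => y). split; [|split].
    + intros y [Hy [x [Hx E]]]. rewrite <- (inRn_ext n x y (proj1 Hx) Hy E). split; auto. intros i _; auto.
    + intros x _ i _; auto.
    + intros x Hx e He; exists e; split; auto.
Qed.

(* With [h = psi - phi] flat enough on the closed set, [h_i = sum_j (h_i phi_j / |phi|^2) phi_j]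
   and likewise for [psi], so that no homeomorphism is needed. *)
Lemma Ell_rigid n Sg phi r : closed_in_Rn n Sg -> Sg zerov ->
  (exists e, 0 < e /\ forall i, (i < n)%nat -> smoothC n (ball n e) (coord i phi)) -> Ell n Sg phi ->
  rigid n Sg r phi.
Proof.
  intros Hcl H0 [e1 [He1 HF]] HE.
  destruct (Ell_pos n Sg phi H0 HE) as [C [a [e2 [Ha [HC [He2 HEb]]]]]].
  (* Agreement of the jets of order [r + p] lets [taylor_Fl] give [h] the order [p] together with
     [r] derivatives. *)
  set (p := (r + 1 + 2 ^ r * a)%nat). exists (r + p)%nat. intros psi [_ [e3 [He3 Hpsi]]] [e4 [He4 Hjet]].
  assert (Hpsi' : forall i, (i < n)%nat -> smoothC n (ball n e3) (coord i psi)).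
  { intros i Hi. apply smooth_on_iff; auto. apply ball_open. }
  assert (H2r : (1 <= 2 ^ r)%nat) by (clear; induction r; simpl; lia).
  set (h := fun x i => psi x i - phi x i).
  set (e5 := Rmin e1 (Rmin e3 e4)). assert (He5 : 0 < e5) by (repeat apply Rmin_pos; auto).
  assert (S1 : e5 <= e1) by apply Rmin_l.
  assert (S3 : e5 <= e3) by (eapply Rle_trans; [apply Rmin_r | apply Rmin_l]).
  assert (S4 : e5 <= e4) by (eapply Rle_trans; [apply Rmin_r | apply Rmin_r]).
  assert (Hphi5 : forall i, (i < n)%nat -> smoothC n (ball n e5) (coord i phi)).
  { intros i Hi s. apply CC_sub with (ball n e1); [intros x; apply ball_mono; auto | apply HF; auto]. }
  assert (Hpsi5 : forall i, (i < n)%nat -> smoothC n (ball n e5) (coord i psi)).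
  { intros i Hi s. apply CC_sub with (ball n e3); [intros x; apply ball_mono; auto | apply Hpsi'; auto]. }
  assert (Hh5 : forall i, (i < n)%nat -> smoothC n (ball n e5) (coord i h)).
  { intros i Hi s. apply (CC_minus n s (ball n e5) (coord i psi) (coord i phi)); [apply Hpsi5 | apply Hphi5]; auto. }
  assert (HhF : forall i, (i < n)%nat -> Fl n Sg (ball n (e5 / 6)) r p (coord i h)).
  { intros i Hi. apply Fl_sub with (ball n (e5 / 2 / 3)); [intros x; apply ball_mono; lra|].
    apply (taylor_Fl n Sg e5 (e5 / 2) (r + p) (coord i h) Hcl H0 ltac:(lra)) with (l := nil).
    - apply CC_Cr_on; [apply ball_open | apply Hh5; auto].
    - intros l x Hl Hlen Hs Hx.
      assert (E : iterD l (coord i psi) x = iterD l (coord i phi) x + iterD l (coord i h) x).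
      { rewrite <- (iterD_plus n (ball n e5) l (coord i phi) (coord i h)); auto.
        - apply iterD_ext with n (ball n e5); auto; [apply ball_open| |apply Hpsi5; auto].
          intros y _. unfold coord, h; ring.
        - apply ball_open.
        - apply Hphi5; auto.
        - apply Hh5; auto. }
      rewrite (Hjet x l i) in E; auto; [lra|]. apply ball_mono with e5; auto.
    - constructor.
    - simpl; lia. }
  assert (Hbd : exists K, 0 <= K /\ forall i, (i < n)%nat -> forall x, ball n (e5 / 6) x -> Rabs (h x i) <= K * distS n Sg x ^ p).
  { apply (family_bound n (fun i K => forall x, ball n (e5 / 6) x -> Rabs (h x i) <= K * distS n Sg x ^ p)).
    - intros i K K' HK H x Hx. eapply Rle_trans; [apply H; auto|]. apply Rmult_le_compat_r; auto.
      apply pow_le, distS_nonneg; auto.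
    - intros i Hi. apply (Fl_bound _ _ _ _ _ _ (HhF i Hi)). }
  destruct Hbd as [K [HK HKb]].
  set (T := INR n * (K * K)). assert (HT : 0 <= T) by (apply Rmult_le_pos; [apply pos_INR | nra]).
  (* The last bound makes [|h|^2] at most [C / 4 * d ^ a], so that [psi] inherits the lower estimate
     of [phi] with [C / 4] in place of [C]. *)
  set (e := Rmin (Rmin (e5 / 6) e2) (C / (4 * (T + 1)))).
  assert (He : 0 < e) by (repeat apply Rmin_pos; try lra; apply Rdiv_lt_0_compat; lra).
  assert (L1 : e <= e5 / 6) by (eapply Rle_trans; [apply Rmin_l | apply Rmin_l]).
  assert (L2 : e <= e2) by (eapply Rle_trans; [apply Rmin_l | apply Rmin_r]).
  assert (L3 : e <= C / (4 * (T + 1))) by apply Rmin_r. apply Rle_div_r in L3; [|lra].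
  assert (B5 : forall x, ball n e x -> ball n (e5 / 6) x) by (intros x; apply ball_mono; auto).
  assert (HEphi : forall x, ball n e x -> C * distS n Sg x ^ a <= sqnorm n phi x).
  { intros x Hx. apply HEb. apply ball_mono with e; auto. }
  assert (HEpsi : forall x, ball n e x -> C / 4 * distS n Sg x ^ a <= sqnorm n psi x).
  { intros x Hx. specialize (HEphi x Hx). pose proof (distS_ball n Sg e x H0 Hx) as Hd.
    set (d := distS n Sg x) in *. pose proof (pow_le d a (proj1 Hd)) as Hda.
    assert (Hh2 : sqnorm n h x <= T * (d * d ^ a)).
    { unfold sqnorm, T. rewrite Rmult_assoc, <- sumn_const. apply sumn_le. intros i Hi.
      specialize (HKb i Hi x (B5 x Hx)). fold d in HKb.
      assert (Hp1 : d ^ p <= d ^ (S a)).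
      { replace p with (S a + (p - S a))%nat by (unfold p; nia). rewrite pow_add.
        rewrite <- (Rmult_1_r (d ^ S a)) at 2. apply Rmult_le_compat_l; [apply pow_le; lra|].
        rewrite <- (pow1 (p - S a)). apply pow_incr. lra. }
      assert (Hp2 : d ^ p <= 1). { rewrite <- (pow1 p). apply pow_incr. lra. }
      pose proof (pow_le d p (proj1 Hd)) as Hp0. simpl in Hp1.
      rewrite <- (Rabs_pos_eq (h x i * h x i)) by apply Rle_0_sqr. rewrite Rabs_mult.
      apply Rle_trans with ((K * d ^ p) * (K * d ^ p)). { apply Rmult_le_compat; auto using Rabs_pos. }
      replace (K * d ^ p * (K * d ^ p)) with (K * K * (d ^ p * d ^ p)) by ring.
      apply Rmult_le_compat_l; [nra|]. nra. }
    assert (Hsq : sqnorm n phi x <= 2 * sqnorm n psi x + 2 * sqnorm n h x).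
    { unfold sqnorm. rewrite <- !sumn_scal, <- sumn_plus. apply sumn_le. intros i _. unfold h.
      pose proof (Rle_0_sqr (2 * psi x i - phi x i)) as Hs. unfold Rsqr in Hs. lra. }
    assert (T * d <= C / 4) by nra.
    assert (T * (d * d ^ a) <= C / 4 * d ^ a) by nra. lra. }
  assert (Q1 : forall i, (i < n)%nat -> (forall j, (j < n)%nat -> CC n r (ball n e) (fun x => h x i * phi x j / sqnorm n phi x)) /\
     forall x, ball n e x -> h x i = sumn n (fun j => h x i * phi x j / sqnorm n phi x * phi x j)).
  { intros i Hi. apply (ideal_quotient n Sg e phi (coord i h) r C a); auto; try lra.
    - intros j Hj. apply smooth_Fl0 with e5; [lra | auto].
    - apply Fl_sub with (ball n (e5 / 6)); [auto | apply HhF; auto]. }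
  assert (Q2 : forall i, (i < n)%nat -> (forall j, (j < n)%nat -> CC n r (ball n e) (fun x => h x i * psi x j / sqnorm n psi x)) /\
     forall x, ball n e x -> h x i = sumn n (fun j => h x i * psi x j / sqnorm n psi x * psi x j)).
  { intros i Hi. apply (ideal_quotient n Sg e psi (coord i h) r (C / 4) a); auto; try lra.
    - intros j Hj. apply smooth_Fl0 with e5; [lra | auto].
    - apply Fl_sub with (ball n (e5 / 6)); [auto | apply HhF; auto]. }
  exists (fun x => x), 1. split; [apply homeo_id|]. intros g. split.
  - apply (CrIdeal_transfer n r e phi psi (fun i j x => -1 * (h x i * psi x j / sqnorm n psi x))); auto.
    + intros i j Hi Hj. apply CC_scal. apply Q2; auto.
    + intros i x Hi Hx. rewrite (sumn_ext n _ (fun j => -1 * (h x i * psi x j / sqnorm n psi x * psi x j))) by (intros; ring).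
      rewrite sumn_scal, <- (proj2 (Q2 i Hi) x Hx). unfold h; ring.
  - apply (CrIdeal_transfer n r e psi phi (fun i j x => h x i * phi x j / sqnorm n phi x)); auto.
    + intros i j Hi Hj. apply Q1; auto.
    + intros i x Hi Hx. rewrite <- (proj2 (Q1 i Hi) x Hx). unfold h; ring.
Qed.

(** * From rigidity to the equivalence of zero sets *)

(** Each [F i] lies in the ideal of [F], hence is a combination of the [G j] and vanishes with
    them. *)
Lemma zero_of_ideal n r (F G : nat -> fn) :
  (forall h, inCrIdeal n r F h -> inCrIdeal n r G h) ->
  exists e, 0 < e /\ forall x, ball n e x -> (forall i, (i < n)%nat -> G i x = 0) -> forall i, (i < n)%nat -> F i x = 0.
Proof.
  intros H.
  assert (Hi : forall i, (i < n)%nat -> exists e, 0 < e /\ forall x, ball n e x -> (forall i, (i < n)%nat -> G i x = 0) -> F i x = 0).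
  { intros i Hi. destruct (H (F i)) as [e [a [He [_ E]]]].
    - exists 1, (fun j _ => unitv i j). split; [lra|]. split.
      + intros j Hj. apply CC_Cr_on; [apply ball_open|]. apply CC_const.
      + intros x _. symmetry. rewrite (sumn_ext n _ (fun j => unitv j i * F j x)).
        * apply (sumn_delta n i (fun j => F j x)); auto.
        * intros j Hj. unfold unitv. rewrite Nat.eqb_sym. auto.
    - exists e; split; auto. intros x Hx HG. rewrite E by auto. apply sumn_zero. intros j Hj. rewrite HG; auto; ring. }
  assert (Hk : forall k, (k <= n)%nat -> exists e, 0 < e /\ forall x, ball n e x ->
     (forall i, (i < n)%nat -> G i x = 0) -> forall i, (i < k)%nat -> F i x = 0).
  { induction k as [|k IH]; intros Hk. { exists 1; split; [lra|]. intros; lia. }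
    destruct (IH ltac:(lia)) as [e [He IHe]]. destruct (Hi k ltac:(lia)) as [e' [He' He'']].
    exists (Rmin e e'). split; [apply Rmin_pos; auto|]. intros x Hx HG i Hik.
    destruct (Nat.eq_dec i k) as [->|].
    - apply He''; auto. apply ball_mono with (Rmin e e'); auto. apply Rmin_r.
    - apply IHe; auto; [|lia]. apply ball_mono with (Rmin e e'); auto. apply Rmin_l. }
  apply Hk; auto.
Qed.

(** The image of the smaller ball is open because the inverse [sigma] is continuous on the open
    image of the larger one. *)
Lemma homeo_restrict n Sg e e' tau : 0 < e' <= e -> homeo_fix_on n Sg e tau -> homeo_fix_on n Sg e' tau.
Proof.
  intros He [_ [H1 [H2 [H3 [H4 [H5 [sigma [H6 [H7 H8]]]]]]]]].
  assert (Hb : forall x, ball n e' x -> ball n e x) by (intros x; apply ball_mono; lra).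
  assert (Himg : forall x, ball n e' x -> inRn n (tau x) /\ exists x0, ball n e x0 /\ eqn n (tau x0) (tau x)).
  { intros x Hx. split; auto. exists x; split; auto. intros i _; auto. }
  assert (Hsig : forall x, ball n e' x -> sigma (tau x) = x).
  { intros x Hx. apply inRn_ext with n; [|apply Hx|apply H7; auto]. apply (H6 (tau x)). apply Himg; auto. }
  split; [lra|]. split; auto. split; auto. split; auto. split.
  { intros x Hx eps Heps. destruct (H4 x (Hb x Hx) eps Heps) as [d [Hd Hd']]. exists d; split; auto. }
  split.
  - intros x Hx. destruct (H5 x (Hb x Hx)) as [r [Hr Hri]].
    destruct (ball_open n e') as [_ Ho]. destruct (Ho x Hx) as [q [Hq Hqb]].
    destruct (H8 (tau x) (Himg x Hx) q Hq) as [d [Hd Hd']].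
    exists (Rmin r d). split; [apply Rmin_pos; auto|]. intros y [Hy Hyd].
    pose proof (Rmin_l r d); pose proof (Rmin_r r d).
    assert (Hyr : ballc n (tau x) r y) by (split; auto; lra).
    assert (Hiy := Hri y Hyr). split; auto.
    destruct (H6 y Hiy) as [K1 K2]. exists (sigma y). split; auto.
    apply Hqb. split; [apply K1|]. rewrite <- (Hsig x Hx). apply Hd'; auto; lra.
  - exists sigma. split; [|split; auto].
    + intros y [Hy [x [Hx E]]].
      assert (Exy : tau x = y) by (apply inRn_ext with n; auto). rewrite <- Exy, (Hsig x Hx). split; auto.
      intros i _; auto.
    + intros y [Hy [x [Hx E]]] eps Heps.
      destruct (H8 y ltac:(split; eauto) eps Heps) as [d [Hd Hd']]. exists d; split; auto.
      intros y' [Hy' [x' [Hx' E']]] Hyd. apply Hd'; auto. split; eauto.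
Qed.

Lemma rigid_SV n Sg phi : (0 < n)%nat -> rigid n Sg 0 phi -> finSV n Sg phi.
Proof.
  intros Hn [k H]. exists k. intros g Hg Hj. destruct (H g Hg Hj) as [tau [e [Hh Hid]]].
  destruct (zero_of_ideal n 0 (fun i x => phi (tau x) i) (fun i x => g x i) (fun h => proj1 (Hid h))) as [e1 [He1 Z1]].
  destruct (zero_of_ideal n 0 (fun i x => g x i) (fun i x => phi (tau x) i) (fun h => proj2 (Hid h))) as [e2 [He2 Z2]].
  set (e' := Rmin e (Rmin e1 e2)). assert (He : 0 < e) by apply Hh.
  assert (He' : 0 < e') by (repeat apply Rmin_pos; auto).
  assert (S0 : e' <= e) by apply Rmin_l.
  assert (S1 : e' <= e1) by (eapply Rle_trans; [apply Rmin_r | apply Rmin_l]).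
  assert (S2 : e' <= e2) by (eapply Rle_trans; [apply Rmin_r | apply Rmin_r]).
  assert (Hh' := homeo_restrict n Sg e e' tau (conj He' S0) Hh).
  exists tau, e'. split; auto. destruct Hh' as [_ [K1 [K2 [_ [_ [K5 _]]]]]].
  destruct (K5 zerov (ball_zero n e' He')) as [r [Hr Hri]].
  assert (E0 : tau zerov = zerov).
  { apply inRn_ext with n; auto. apply K1, ball_zero; auto. intros i _; auto. }
  rewrite E0 in Hri. exists r; split; auto. intros y Hy. split.
  - intros Hz. destruct (Hri y Hy) as [_ [x [Hx E]]]. exists x; split; auto. split; auto.
    intros i Hi. apply (Z2 x); auto; [apply ball_mono with e'; auto|].
    intros j Hj'. rewrite (inRn_ext n (tau x) y); auto. apply Hy.
  - intros [x [Hx [Hz E]]] i Hi. rewrite <- (inRn_ext n (tau x) y); auto; [|apply Hy].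
    apply (Z1 x); auto. apply ball_mono with e'; auto.
Qed.

Lemma SV_V n Sg f g : SVeq n Sg f g -> Veq n Sg f g.
Proof.
  intros [tau [e [Hh [d [Hd Hz]]]]]. assert (Hh' := Hh).
  destruct Hh' as [He [K1 [K2 [K3 [K4 [K5 [sigma [K6 [K7 K8]]]]]]]]].
  assert (B0 := ball_zero n e He).
  assert (E0 : tau zerov = zerov).
  { apply inRn_ext with n; auto. intros i _; auto. }
  destruct (K5 zerov B0) as [r [Hr Hri]]. rewrite E0 in Hri.
  set (d' := Rmin d r). assert (Hd' : 0 < d') by (apply Rmin_pos; auto).
  assert (Sd : d' <= d) by apply Rmin_l. assert (Sr : d' <= r) by apply Rmin_r.
  assert (Hvimg : forall y, ball n d' y -> inRn n y /\ exists x, ball n e x /\ eqn n (tau x) y).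
  { intros y Hy. apply Hri. apply ball_mono with d'; auto. }
  (* The radius [d'] keeps the target inside the image of [tau] and inside the ball where the zero
     sets are known to correspond; the source is its preimage. *)
  exists (fun x => ball n e x /\ ball n d' (tau x)), (ball n d'), tau, sigma.
  split; [|split; [apply ball_open|]].
  { split; [intros x [Hx _]; apply Hx|]. intros x [Hx Hxd].
    destruct (ball_open n e) as [_ Ho]. destruct (Ho x Hx) as [r1 [Hr1 Hb1]].
    destruct (ball_open n d') as [_ Ho']. destruct (Ho' (tau x) Hxd) as [r2 [Hr2 Hb2]].
    destruct (K4 x Hx r2 Hr2) as [r3 [Hr3 Hb3]].
    exists (Rmin r1 r3). split; [apply Rmin_pos; auto|]. pose proof (Rmin_l r1 r3); pose proof (Rmin_r r1 r3).
    intros y [Hy Hyd]. assert (Hye : ball n e y) by (apply Hb1; split; auto; lra). split; auto.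
    apply Hb2. split; auto. apply Hb3; auto; lra. }
  split; [split; auto; rewrite E0; apply ball_zero; auto|]. split; [apply ball_zero; auto|].
  split.
  { intros x [Hx Hxd] Hfx. split; auto. apply Hz; [apply ball_mono with d'; auto|]. exists x. split; auto. split; auto.
    intros i _; auto. }
  split.
  { intros y Hy Hgy. destruct (K6 y (Hvimg y Hy)) as [L1 L2].
    assert (Ey : tau (sigma y) = y) by (apply inRn_ext with n; auto; apply Hy).
    split; [split; auto; rewrite Ey; auto|].
    apply Hz in Hgy; [|apply ball_mono with d'; auto]. destruct Hgy as [x [Hx [Hfx E]]].
    assert (Ex : sigma y = x).
    { apply inRn_ext with n; [apply L1 | apply Hx|]. rewrite <- (inRn_ext n (tau x) y); auto. apply Hy. }
    rewrite Ex; auto. }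
  split; [intros x [Hx _] _; apply K7; auto|].
  split; [intros y Hy _; apply K6; auto|].
  split.
  { intros x [[Hx _] _] eps Heps. destruct (K4 x Hx eps Heps) as [dd [Hdd H]]. exists dd; split; auto.
    intros y [[Hy _] _]; auto. }
  split.
  { intros y [Hy _] eps Heps. destruct (K8 y (Hvimg y Hy) eps Heps) as [dd [Hdd H]]. exists dd; split; auto.
    intros y' [Hy' _]; auto. }
  intros x [Hx _] _ Hs. apply K3; auto.
Qed.

Lemma finSV_finV n Sg phi : finSV n Sg phi -> finV n Sg phi.
Proof. intros [k H]. exists k. intros g Hg Hj. apply SV_V; auto. Qed.

(** * Sequences along which ellipticity fails *)

(** Dependent choice: the recursion carries the radius [normv n (z m) / 2], which is positive
    because the distance of [z m] to [Sg] is positive and 0 lies in [Sg]. *)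
Lemma pick_centres n Sg (P : nat -> Rvec -> Prop) : Sg zerov ->
  (forall m e, 0 < e -> exists x, ball n e x /\ 0 < distS n Sg x /\ P m x) ->
  exists z, bump_centres n Sg z /\ (forall m, ball n (/ (INR m + 1)) (z m)) /\ forall m, P m (z m).
Proof.
  intros H0 H.
  assert (Hinv : forall m, 0 < / (INR m + 1)) by (intros m; apply Rinv_0_lt_compat; pose proof (pos_INR m); lra).
  assert (H' : forall m (r : {r : R | 0 < r}), exists x, ball n (Rmin (/ (INR m + 1)) (proj1_sig r)) x /\ 0 < distS n Sg x /\ P m x).
  { intros m [r Hr]; simpl. apply H. apply Rmin_pos; auto. }
  set (c := fun m r => constructive_indefinite_description _ (H' m r)).
  assert (Hpos : forall m r, 0 < normv n (proj1_sig (c m r)) / 2).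
  { intros m r. destruct (c m r) as [x [Hx [Hd HP]]]; simpl. rewrite <- distv_zero.
    pose proof (distS_le n Sg x zerov H0 H0). lra. }
  set (rad := fix rad m : {r : R | 0 < r} :=
    match m with O => exist _ 1 Rlt_0_1 | S m' => exist _ (normv n (proj1_sig (c m' (rad m'))) / 2) (Hpos m' (rad m')) end).
  set (z := fun m => proj1_sig (c m (rad m))).
  assert (Hz : forall m, ball n (Rmin (/ (INR m + 1)) (proj1_sig (rad m))) (z m) /\ 0 < distS n Sg (z m) /\ P m (z m)).
  { intros m. apply (proj2_sig (c m (rad m))). }
  exists z. split; [split|split].
  - intros m. apply (Hz m).
  - intros m. apply (Hz m).
  - intros m. destruct (Hz (S m)) as [[_ Hb] _]. rewrite distv_zero in Hb.
    pose proof (Rmin_r (/ (INR (S m) + 1)) (proj1_sig (rad (S m)))) as Hr.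
    change (proj1_sig (rad (S m))) with (normv n (z m) / 2) in *. lra.
  - intros m. destruct (Hz m) as [Hb _]. apply ball_mono with (2 := Hb). apply Rmin_l.
  - intros m. apply (Hz m).
Qed.

Lemma inv_small e : 0 < e -> exists N, forall m, (N <= m)%nat -> / (INR m + 1) < e.
Proof.
  intros He. destruct (INR_unbounded (/ e)) as [N HN]. exists N. intros m Hm. apply le_INR in Hm.
  assert (0 < / e) by (apply Rinv_0_lt_compat; auto).
  rewrite <- (Rinv_inv e). apply Rinv_lt_contravar; [|lra]. apply Rmult_lt_0_compat; auto. lra.
Qed.

Lemma centres_tend0 n z : (forall m, ball n (/ (INR m + 1)) (z m)) -> tend0 n z.
Proof.
  intros Hz i Hi e He. destruct (inv_small e He) as [N HN]. exists N. intros m Hm.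
  destruct (Hz m) as [_ Hb]. rewrite distv_zero in Hb. pose proof (normv_ge n (z m) i Hi). specialize (HN m Hm). lra.
Qed.

Lemma centres_dist_small n Sg z e : Sg zerov -> (forall m, ball n (/ (INR m + 1)) (z m)) -> 0 < e ->
  exists N, forall m, (N <= m)%nat -> distS n Sg (z m) < e.
Proof.
  intros H0 Hz He. destruct (inv_small e He) as [N HN]. exists N. intros m Hm.
  pose proof (distS_ball n Sg _ (z m) H0 (Hz m)). specialize (HN m Hm). lra.
Qed.

Lemma centres_dist_le1 n Sg z m : Sg zerov -> (forall m, ball n (/ (INR m + 1)) (z m)) -> distS n Sg (z m) <= 1.
Proof.
  intros H0 Hz. pose proof (distS_ball n Sg _ (z m) H0 (Hz m)). pose proof (pos_INR m).
  assert (/ (INR m + 1) <= 1) by (rewrite <- Rinv_1; apply Rinv_le_contravar; lra). lra.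
Qed.

Lemma pow_le_pow d a b : 0 <= d <= 1 -> (a <= b)%nat -> d ^ b <= d ^ a.
Proof.
  intros Hd Hab. replace b with (a + (b - a))%nat by lia. rewrite pow_add.
  rewrite <- (Rmult_1_r (d ^ a)) at 2. apply Rmult_le_compat_l; [apply pow_le; lra|].
  rewrite <- (pow1 (b - a)). apply pow_incr. auto.
Qed.

(** Against the power [N] of the distance only the finitely many indices with [m + 1 < N] are
    critical, and the constant [S0] pays for them. *)
Lemma rapid_pow n Sg z w B : bump_centres n Sg z -> (forall m, distS n Sg (z m) <= 1) -> 0 <= B ->
  (forall m, Rabs (w m) <= B * distS n Sg (z m) ^ (m + 1)) -> rapid n Sg z w.
Proof.
  intros Hz Hd1 HB H N.
  assert (Hd : forall m, 0 < distS n Sg (z m)) by apply (bc_pos _ _ _ Hz).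
  set (S0 := sumn N (fun m => / distS n Sg (z m) ^ N)).
  assert (Hpw : forall m, 0 < / distS n Sg (z m) ^ N) by (intros m; apply Rinv_0_lt_compat, pow_lt; auto).
  assert (HS0 : 0 <= S0) by (apply sumn_nonneg; intros; apply Rlt_le; auto).
  exists (B * (1 + S0)). split; [nra|]. intros m. eapply Rle_trans; [apply H|].
  rewrite Rmult_assoc. apply Rmult_le_compat_l; auto.
  assert (Hdm : 0 <= distS n Sg (z m) <= 1) by (specialize (Hd m); specialize (Hd1 m); lra).
  pose proof (pow_lt (distS n Sg (z m)) N (Hd m)) as HN.
  destruct (Nat.le_gt_cases N (m + 1)) as [Hm|Hm].
  - pose proof (pow_le_pow _ N (m + 1) Hdm Hm). nra.
  - assert (Hs : / distS n Sg (z m) ^ N <= S0).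
    { apply (sumn_term_le N (fun m => / distS n Sg (z m) ^ N)); [intros; apply Rlt_le; auto | lia]. }
    assert (K1 : distS n Sg (z m) ^ (m + 1) <= 1) by (rewrite <- (pow1 (m + 1)); apply pow_incr; auto).
    assert (K2 : 1 = / distS n Sg (z m) ^ N * distS n Sg (z m) ^ N) by (field; lra).
    nra.
Qed.

Lemma bsum_flat n Sg z w : closed_in_Rn n Sg -> Sg zerov -> bump_centres n Sg z -> rapid n Sg z w ->
  flat_on n Sg (bsum n Sg z w (fun _ => O) (fun _ => O)).
Proof.
  intros Hcl H0 Hz Hw. exists 1. split; [lra|]. split.
  - apply smooth_on_iff; [apply ball_open|]. intros r. apply Fl_CC with Sg (r + 1)%nat; auto; [apply ball_open|].
    apply bsum_Fl; auto; lra.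
  - intros l x Hl Hs Hx.
    apply (Fl_iterD n Sg (ball n 1) (length l) (length l + 1)); auto; [apply ball_open|].
    apply bsum_Fl; auto; lra.
Qed.

Lemma IK_smooth n phi : (exists e, 0 < e /\ forall i, (i < n)%nat -> smoothC n (ball n e) (coord i phi)) ->
  exists e, 0 < e /\ forall j, (j < S n)%nat -> smoothC n (ball n e) (IK_gen n phi j).
Proof.
  intros [e [He H]]. exists e; split; auto. intros j Hj r. unfold IK_gen.
  destruct (Nat.ltb_spec j n) as [Hl|Hl]; [apply H; auto|].
  apply (CC_detm n r (ball n e) n (fun x i j => pd j (coord i phi) x)).
  intros i k Hi Hk. apply smooth_pd; auto. apply ball_open.
Qed.

(** If ellipticity fails, it fails for the sum of squares [Q] of the generators. Where
    [Q < d ^ (4 (m + 1))], the generators are at most [d ^ (2 (m + 1))], too small to represent with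
    bounded coefficients a bump whose height is a constant times [d ^ (m + 1)]. *)
Lemma flat_ideal_elliptic n Sg phi : closed_in_Rn n Sg -> Sg zerov ->
  (exists e, 0 < e /\ forall i, (i < n)%nat -> smoothC n (ball n e) (coord i phi)) ->
  (forall f, flat_on n Sg f -> inIdeal n (S n) (IK_gen n phi) f) -> elliptic n (S n) (IK_gen n phi) Sg.
Proof.
  intros Hcl H0 Hs H5. destruct (IK_smooth n phi Hs) as [e0 [He0 HG]].
  set (G := IK_gen n phi) in *. set (Q := fun x => sumn (S n) (fun j => G j x * G j x)).
  apply NNPP; intros Hne.
  assert (HQ : inIdeal n (S n) G Q).
  { exists e0, G. split; auto. split; auto. intros j Hj. apply smooth_on_iff; auto. apply ball_open. }
  destruct (pick_centres n Sg (fun m x => Q x < distS n Sg x ^ (4 * (m + 1)))) as [z [Hz [Hzb HzP]]]; auto.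
  { intros m e He. apply NNPP; intros Hn. apply Hne. exists Q. split; auto.
    exists 1, (INR (4 * (m + 1))), e. split; [lra|]. split; [apply lt_0_INR; lia|]. split; auto.
    intros x Hx d Hd. rewrite (is_inf_dist_uniq n Sg x d (distS n Sg x) Hd (distS_spec n Sg x H0)).
    rewrite Rmult_1_l. unfold rpow. destruct (Rle_dec (distS n Sg x) 0) as [Hle|Hgt]; [apply Rabs_pos|].
    rewrite Rpower_pow by lra. eapply Rle_trans; [|apply Rle_abs]. apply Rnot_lt_le; intros Hlt. apply Hn.
    exists x. split; auto. split; auto. lra. }
  assert (Hd1 : forall m, distS n Sg (z m) <= 1) by (intros m; apply centres_dist_le1; auto).
  set (w := fun m => distS n Sg (z m) ^ (m + 1)).
  assert (Hw : rapid n Sg z w).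
  { apply rapid_pow with 1; auto; [lra|]. intros m. rewrite Rmult_1_l. unfold w. rewrite Rabs_pos_eq; [lra|].
    apply pow_le, distS_nonneg; auto. }
  destruct (H5 _ (bsum_flat n Sg z w Hcl H0 Hz Hw)) as [e1 [a [He1 [Ha E]]]].
  destruct (family_bound (S n) (fun j C => forall x, ball n (e1 / 2) x -> Rabs (a j x) <= C)) as [A [HA HAb]].
  { intros i C C' HC H x Hx. eapply Rle_trans; [apply H; auto | auto]. }
  { intros j Hj. apply cont_bounded with e1; [lra|]. apply (proj1 (Ha j Hj 0%nat nil ltac:(constructor) ltac:(simpl; lia))). }
  set (kap := (exp (-1) * exp (-1)) ^ n).
  assert (Hkap : 0 < kap) by (apply pow_lt; pose proof (exp_pos (-1)); nra).
  set (T := INR (S n) * A). assert (HT : 0 <= T) by (apply Rmult_le_pos; auto using pos_INR).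
  destruct (inv_small (e1 / 2) ltac:(lra)) as [N1 HN1].
  destruct (centres_dist_small n Sg z (kap / (T + 1)) H0 Hzb) as [N2 HN2]. { apply Rdiv_lt_0_compat; lra. }
  set (m := Nat.max N1 N2). specialize (HN1 m ltac:(lia)). specialize (HN2 m ltac:(lia)). apply Rlt_div_r in HN2; [|lra].
  assert (Hbm : ball n (e1 / 2) (z m)) by (apply ball_mono with (2 := Hzb m); lra).
  assert (Hbm1 : ball n e1 (z m)) by (apply ball_mono with (2 := Hbm); lra).
  specialize (E (z m) Hbm1). rewrite bsum_centre in E by auto. fold kap in E. specialize (HzP m). unfold w in E.
  specialize (Hd1 m). pose proof (bc_pos _ _ _ Hz m) as Hdp. set (d := distS n Sg (z m)) in *.
  assert (HGj : forall j, (j < S n)%nat -> Rabs (G j (z m)) <= d ^ (m + 1) * d ^ (m + 1)).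
  { intros j Hj. apply Rnot_lt_le; intros Hlt.
    assert (Hjj : G j (z m) * G j (z m) <= Q (z m)).
    { apply (sumn_term_le (S n) (fun j => G j (z m) * G j (z m)) j); auto. intros; apply Rle_0_sqr. }
    replace (4 * (m + 1))%nat with ((m + 1) + (m + 1) + ((m + 1) + (m + 1)))%nat in HzP by lia. rewrite !pow_add in HzP.
    rewrite <- (Rabs_pos_eq (G j (z m) * G j (z m))), Rabs_mult in Hjj by apply Rle_0_sqr.
    rewrite !pow_add in Hlt.
    set (q := d ^ m * d ^ 1 * (d ^ m * d ^ 1)) in *.
    assert (Hq : 0 <= q). { unfold q. pose proof (pow_le d m ltac:(lra)). simpl.
      apply Rmult_le_pos; apply Rmult_le_pos; lra. }
    nra. }
  assert (Hle : d ^ (m + 1) * kap <= T * (d ^ (m + 1) * d ^ (m + 1))).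
  { rewrite E. eapply Rle_trans; [apply Rle_abs|]. eapply Rle_trans; [apply sumn_Rabs|].
    unfold T. rewrite Rmult_assoc, <- sumn_const. apply sumn_le. intros j Hj. rewrite Rabs_mult.
    apply Rmult_le_compat; auto using Rabs_pos. }
  pose proof (pow_lt d (m + 1) Hdp) as Hdm.
  assert (Hd1' : d ^ (m + 1) <= d).
  { pose proof (pow_le_pow d 1 (m + 1) ltac:(lra) ltac:(lia)). simpl in H. lra. }
  assert (kap <= T * d ^ (m + 1)).
  { apply Rmult_le_reg_l with (d ^ (m + 1)); auto. lra. }
  nra.
Qed.

(** On [Sg] the power of the distance is 0, so points at which the estimate of [Ell] fails lie off
    [Sg]. The exponent [2 (m + 1)] bounds each component of [F] by the power [m + 1]. *)
Lemma not_Ell_centres n Sg F : Sg zerov -> ~ Ell n Sg F ->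
  exists z, bump_centres n Sg z /\ (forall m, ball n (/ (INR m + 1)) (z m)) /\
    forall m, sqnorm n F (z m) < distS n Sg (z m) ^ (2 * (m + 1)).
Proof.
  intros H0 Hn. apply (pick_centres n Sg (fun m x => sqnorm n F x < distS n Sg x ^ (2 * (m + 1)))); auto.
  intros m e He. apply NNPP; intros Hno. apply Hn. exists 1, (2 * (m + 1))%nat, e. split; [lra|]. split; auto.
  intros x Hx. rewrite Rmult_1_l. apply Rnot_lt_le; intros Hlt. apply Hno. exists x. split; auto. split; auto.
  destruct (distS_nonneg n Sg x H0) as [|E]; auto. exfalso.
  rewrite <- E, pow_i in Hlt by lia.
  assert (0 <= sqnorm n F x) by (apply sumn_nonneg; intros; apply Rle_0_sqr). lra.
Qed.

Lemma component_small n Sg F z m i : (forall m, distS n Sg (z m) <= 1) -> (forall m, 0 < distS n Sg (z m)) ->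
  sqnorm n F (z m) < distS n Sg (z m) ^ (2 * (m + 1)) -> (i < n)%nat -> Rabs (F (z m) i) <= distS n Sg (z m) ^ (m + 1).
Proof.
  intros Hd1 Hd H Hi. apply Rnot_lt_le; intros Hlt.
  assert (Hii : F (z m) i * F (z m) i <= sqnorm n F (z m)).
  { apply (sumn_term_le n (fun j => F (z m) j * F (z m) j) i); auto. intros; apply Rle_0_sqr. }
  rewrite <- (Rabs_pos_eq (F (z m) i * F (z m) i)), Rabs_mult in Hii by apply Rle_0_sqr.
  replace (2 * (m + 1))%nat with ((m + 1) + (m + 1))%nat in H by lia.
  rewrite (pow_add _ (m + 1) (m + 1)) in H. pose proof (pow_lt _ (m + 1) (Hd m)). nra.
Qed.

Definition flat_small (U : (nat -> Prop) -> Prop) (d : nat -> R) (u : nat -> R) : Prop :=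
  forall N : nat, U (fun m => Rabs (u m) <= d m ^ N).

Lemma flat_small_dom U d u v B : ultra U -> (forall m, 0 < d m) ->
  (forall e, 0 < e -> exists N, forall m, (N <= m)%nat -> d m < e) ->
  (exists N, forall m, (N <= m)%nat -> Rabs (u m) <= B * Rabs (v m)) -> flat_small U d v -> flat_small U d u.
Proof.
  intros HU Hd Hd0 [N1 H1] Hv N. destruct (Hd0 (/ (Rabs B + 1))) as [N2 H2].
  { apply Rinv_0_lt_compat. pose proof (Rabs_pos B); lra. }
  eapply (ultra_mono _ HU); [|apply (ultra_and _ HU _ _ (Hv (S N)) (ultra_tail _ HU (Nat.max N1 N2)))].
  intros m [K1 K2]. specialize (H1 m ltac:(lia)). specialize (H2 m ltac:(lia)).
  eapply Rle_trans; [apply H1|]. pose proof (Rle_abs B). pose proof (Rabs_pos B). pose proof (Rabs_pos (v m)).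
  apply Rle_trans with (Rabs B * d m ^ S N). { apply Rle_trans with (Rabs B * Rabs (v m)); [apply Rmult_le_compat_r | apply Rmult_le_compat_l]; auto. }
  simpl. pose proof (pow_lt _ N (Hd m)). pose proof (Hd m).
  assert (Hc : Rabs B * d m <= 1).
  { apply Rle_trans with (Rabs B * / (Rabs B + 1)).
    - apply Rmult_le_compat_l; lra.
    - apply Rmult_le_reg_r with (Rabs B + 1); [lra|]. rewrite Rmult_assoc, Rinv_l by lra. lra. }
  rewrite <- Rmult_assoc. rewrite <- (Rmult_1_l (d m ^ N)) at 2. apply Rmult_le_compat_r; lra.
Qed.

(** If [u] is not small, the ultrafilter provides an [N0] with [|u| > d ^ N0] on a set of [U]; there
    [|u v| <= d ^ (N0 + N)] forces [|v| <= d ^ N]. *)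
Lemma flat_small_prime U d : ultra U -> (forall m, 0 < d m) ->
  (forall e, 0 < e -> exists N, forall m, (N <= m)%nat -> d m < e) -> prime_ideal (flat_small U d).
Proof.
  intros HU Hd Hd0. split.
  - intros u v [N1 H1] Hu N. eapply (ultra_mono _ HU); [|apply (ultra_and _ HU _ _ (Hu N) (ultra_tail _ HU N1))].
    intros m [K1 K2]. rewrite <- H1; auto.
  - intros N. eapply (ultra_mono _ HU); [|apply (ultra_tail _ HU 0)]. intros m _. rewrite Rabs_R0. apply pow_le, Rlt_le; auto.
  - intros u v Hu Hv N. destruct (Hd0 (/ 2) ltac:(lra)) as [N1 H1].
    eapply (ultra_mono _ HU); [|apply (ultra_and _ HU _ _ (ultra_and _ HU _ _ (Hu (S N)) (Hv (S N))) (ultra_tail _ HU N1))].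
    intros m [[K1 K2] K3]. specialize (H1 m K3). eapply Rle_trans; [apply Rabs_triang|]. simpl in K1, K2.
    pose proof (pow_lt _ N (Hd m)). nra.
  - intros u v [B [N1 HB]] Hu. apply flat_small_dom with u B; auto. exists N1. intros m Hm.
    rewrite Rabs_mult. apply Rmult_le_compat_r; auto. apply Rabs_pos.
  - intros u v Hu Hv Huv. destruct (classic (flat_small U d u)) as [|Hn]; auto. right.
    apply not_all_ex_not in Hn. destruct Hn as [N0 Hn0]. destruct (ultra_or _ HU (fun m => Rabs (u m) <= d m ^ N0)) as [|Hc]; [contradiction|].
    intros N. eapply (ultra_mono _ HU); [|apply (ultra_and _ HU _ _ (Huv (N0 + N)%nat) Hc)].
    intros m [K1 K2]. apply Rnot_le_lt in K2. rewrite Rabs_mult, pow_add in K1.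
    pose proof (pow_lt _ N0 (Hd m)). pose proof (pow_lt _ N (Hd m)).
    apply Rnot_lt_le; intros Hlt. nra.
  - intros H. destruct (Hd0 1 ltac:(lra)) as [N1 H1].
    destruct (ultra_ex _ HU _ (ultra_and _ HU _ _ (H 1%nat) (ultra_tail _ HU N1))) as [m [K1 K2]].
    specialize (H1 m K2). rewrite Rabs_R1 in K1. simpl in K1. lra.
Qed.

(** Differentiating the components along the tangent field shows that the Jacobian matrix maps the
    field to small sequences. By [cramer_bound] its determinant times a component of the field that
    is not small is small, and primality removes that component. *)
Lemma sm_component_germ n phi U d z : (0 < n)%nat -> analytic_mapgerm n phi -> ultra U -> prime_ideal (flat_small U d) ->
  (forall m, inRn n (z m)) -> tend0 n z -> (forall m, 0 < d m) ->
  (forall e, 0 < e -> exists N, forall m, (N <= m)%nat -> d m < e) ->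
  (exists i, (i < n)%nat /\ ~ flat_small U d (fun m => z m i)) ->
  (forall i, (i < n)%nat -> flat_small U d (fun m => phi (z m) i)) ->
  flat_small U d (fun m => jacdet n phi (z m)).
Proof.
  intros Hn0 Hphi HU HS Hzin Hz0 Hd Hd0 Hns Hsm.
  destruct (structure_theorem n z _ HS Hz0 Hns) as [[V [HVb [[j0 [Hj0 Hj0n]] HV]]] _].
  assert (Hu : forall i, exists u, (i < n)%nat -> flat_small U d u /\ exists N, forall m, (N <= m)%nat ->
     u m = sumn n (fun j => pd j (coord i phi) (z m) * V m j)).
  { intros i. destruct (Nat.lt_ge_cases i n) as [Hi|Hi]; [|exists (fun _ => 0); intros; lia].
    destruct (analytic_PS n (coord i phi) (proj2 Hphi i Hi)) as [r [M [Hr HP]]].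
    destruct (HV (fun x => coord i phi (trunc n x))) as [u [Hu Hud]].
    - exists r, M; auto.
    - eapply sm_eq; [auto| |apply (Hsm i Hi)]. intros m; simpl. rewrite trunc_id; auto.
    - exists u. intros _. split; auto.
      destruct (ev_and _ _ Hud (near_ev n z _ (analytic_ddir n (coord i phi) (proj2 Hphi i Hi)) Hz0)) as [N HN].
      exists N. intros m Hm. destruct (HN m Hm) as [K1 K2]. apply (ddir_uniq _ _ _ _ _ K1 (K2 (Hzin m) (V m))). }
  set (u := fun i => proj1_sig (constructive_indefinite_description _ (Hu i))).
  assert (Huu : forall i, (i < n)%nat -> flat_small U d (u i) /\ exists N, forall m, (N <= m)%nat ->
     u i m = sumn n (fun j => pd j (coord i phi) (z m) * V m j)).
  { intros i; unfold u; destruct constructive_indefinite_description; auto. }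
  destruct (analytic_mapgerm_smooth n phi Hphi) as [e [He Hs]].
  destruct (family_bound n (fun i C => forall j, (j < n)%nat -> forall x, ball n (e / 2) x -> Rabs (pd j (coord i phi) x) <= C)) as [K [HK HKb]].
  { intros i C C' HC H j Hj x Hx. eapply Rle_trans; [apply H; auto | auto]. }
  { intros i Hi. apply (family_bound n (fun j C => forall x, ball n (e / 2) x -> Rabs (pd j (coord i phi) x) <= C)).
    - intros j C C' HC H x Hx. eapply Rle_trans; [apply H; auto | auto].
    - intros j Hj. apply cont_bounded with e; [lra|]. apply CC_cont with 0%nat. apply smooth_pd; auto. apply ball_open. }
  destruct (cramer_bound n K HK) as [K' [HK' Hcr]].
  assert (Hin : exists N, forall m, (N <= m)%nat -> ball n (e / 2) (z m)).
  { destruct (near_ev n z (fun x => forall i, (i < n)%nat -> Rabs (x i) < e / 2)) as [N HN]; auto.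
    - exists (e / 2); split; [lra|]; auto.
    - exists N. intros m Hm. split; auto. rewrite distv_zero. apply normv_lt; [lra|]. apply HN; auto. }
  assert (Hsum : flat_small U d (fun m => sumn n (fun i => Rabs (u i m)))).
  { apply (sm_sumn _ n (fun i m => Rabs (u i m)) HS). intros i Hi N.
    eapply (ultra_mono _ HU); [|apply (proj1 (Huu i Hi) N)]. intros m Hm. rewrite Rabs_Rabsolu. auto. }
  assert (Hall : exists N, forall m, (N <= m)%nat -> forall i, (i < n)%nat ->
      u i m = sumn n (fun j => pd j (coord i phi) (z m) * V m j)).
  { assert (Hk : forall k, (k <= n)%nat -> exists N, forall m, (N <= m)%nat -> forall i, (i < k)%nat ->
      u i m = sumn n (fun j => pd j (coord i phi) (z m) * V m j)).
    { induction k as [|k IH]; intros Hk. { exists 0%nat; intros; lia. }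
      destruct (ev_and _ _ (IH ltac:(lia)) (proj2 (Huu k ltac:(lia)))) as [N HN]. exists N. intros m Hm i Hi.
      destruct (HN m Hm) as [K1 K2]. destruct (Nat.eq_dec i k) as [->|]; auto. apply K1; lia. }
    apply Hk; auto. }
  assert (Hprod : flat_small U d (fun m => jacdet n phi (z m) * V m j0)).
  { apply flat_small_dom with (fun m => sumn n (fun i => Rabs (u i m))) K'; auto.
    destruct (ev_and _ _ Hin Hall) as [N HN]. exists N. intros m Hm. destruct (HN m Hm) as [K1 K2].
    rewrite Rabs_mult. eapply Rle_trans.
    - apply (Hcr (fun i j => pd j (coord i phi) (z m)) (V m) j0); auto.
    - apply Rmult_le_compat_l; auto. rewrite Rabs_pos_eq.
      + apply sumn_le. intros i Hi. rewrite K2; auto; lra.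
      + apply sumn_nonneg; intros; apply Rabs_pos. }
  destruct (sm_prime _ HS (fun m => jacdet n phi (z m)) (fun m => V m j0)) as [|]; auto; [|contradiction].
  destruct (detm_bounded n K HK) as [B [HB HBb]]. destruct Hin as [N HN]. exists B, N. intros m Hm.
  apply HBb. intros i j Hi Hj. apply HKb; auto.
Qed.

(* If [phi] is not elliptic, [phi] vanishes to infinite order along a sequence tending to 0, and then
   so does its Jacobian determinant, by the tangent field of the structure theorem. *)
Lemma elliptic_Ell n Sg phi : (0 < n)%nat -> closed_in_Rn n Sg -> Sg zerov -> analytic_mapgerm n phi ->
  elliptic n (S n) (IK_gen n phi) Sg -> Ell n Sg phi.
Proof.
  intros Hn0 Hcl H0 Hphi [f [[e1 [a [He1 [Ha E]]]] [C [al [e2 [HC [Hal [He2 Hell]]]]]]]].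
  apply NNPP; intros Hne. destruct (not_Ell_centres n Sg phi H0 Hne) as [z [Hz [Hzb HzP]]].
  set (d := fun m => distS n Sg (z m)).
  assert (Hd : forall m, 0 < d m) by apply (bc_pos _ _ _ Hz).
  assert (Hd1 : forall m, d m <= 1) by (intros m; apply centres_dist_le1; auto).
  assert (Hd0 : forall e, 0 < e -> exists N, forall m, (N <= m)%nat -> d m < e).
  { intros e He. apply centres_dist_small; auto. }
  assert (Hz0 := centres_tend0 n z Hzb).
  destruct FilterLemmas.ultra_exists as [U HU].
  assert (HS := flat_small_prime U d HU Hd Hd0).
  assert (Hsm : forall i, (i < n)%nat -> flat_small U d (fun m => phi (z m) i)).
  { intros i Hi N. eapply (ultra_mono _ HU); [|apply (ultra_tail _ HU N)]. intros m Hm; cbv beta in Hm.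
    eapply Rle_trans; [apply component_small with (n := n) (Sg := Sg); auto|].
    apply (pow_le_pow (d m) N (m + 1)); [|lia]. specialize (Hd m); specialize (Hd1 m); lra. }
  (* If all coordinates were small, the norm of [z m] would be at most [d ^ 2] for some [m] with
     [d < 1]; yet it is at least [d], because 0 lies in [Sg]. *)
  assert (Hns : exists i, (i < n)%nat /\ ~ flat_small U d (fun m => z m i)).
  { apply NNPP; intros Hno.
    assert (Hk : forall k, (k <= n)%nat -> U (fun m => forall i, (i < k)%nat -> Rabs (z m i) <= d m ^ 2)).
    { induction k as [|k IH]; intros Hk.
      - eapply (ultra_mono _ HU); [|apply (ultra_tail _ HU 0)]. intros m _ i Hi; lia.
      - assert (Hsk : flat_small U d (fun m => z m k)).
        { apply NNPP; intros H; apply Hno. exists k; split; auto. }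
        eapply (ultra_mono _ HU); [|apply (ultra_and _ HU _ _ (IH ltac:(lia)) (Hsk 2%nat))].
        intros m [K1 K2] i Hi. destruct (Nat.eq_dec i k) as [->|]; auto. apply K1; lia. }
    destruct (Hd0 1 ltac:(lra)) as [N1 H1].
    destruct (ultra_ex _ HU _ (ultra_and _ HU _ _ (Hk n ltac:(lia)) (ultra_tail _ HU N1))) as [m [K1 K2]].
    specialize (H1 m K2). assert (Hnorm : normv n (z m) <= d m ^ 2).
    { apply normv_le; auto. apply pow_le, Rlt_le; auto. }
    pose proof (proj2 (bc_norm n Sg z m H0 Hz)) as Hle. fold (d m) in Hle. specialize (Hd m). simpl in Hnorm. nra. }
  assert (Hjac := sm_component_germ n phi U d z Hn0 Hphi HU HS (bc_in _ _ _ Hz) Hz0 Hd Hd0 Hns Hsm).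
  assert (Hf : flat_small U d (fun m => f (z m))).
  { destruct (inv_small e1 He1) as [N1 HN1].
    apply (sm_ev _ HS) with (fun m => sumn (S n) (fun j => a j (z m) * IK_gen n phi j (z m))).
    - exists N1. intros m Hm. symmetry. apply E. apply ball_mono with (2 := Hzb m). specialize (HN1 m Hm). lra.
    - apply (sm_sumn _ (S n) (fun j m => a j (z m) * IK_gen n phi j (z m)) HS). intros j Hj.
      apply (sm_mul _ HS).
      + destruct (cont_bounded n e1 (e1 / 2) (a j)) as [B [HB HBb]]; [lra| |].
        { apply (proj1 (Ha j Hj 0%nat nil ltac:(constructor) ltac:(simpl; lia))). }
        destruct (inv_small (e1 / 2) ltac:(lra)) as [N2 HN2]. exists B, N2. intros m Hm. apply HBb.
        apply ball_mono with (2 := Hzb m). specialize (HN2 m Hm). lra.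
      + unfold IK_gen. destruct (Nat.ltb_spec j n); auto. apply Hsm; auto. }
  (* Smallness of [f] with exponent [N0 + 1], where [N0 > al], contradicts the lower bound
     [C * d ^ al] once [d < C] and [d < 1]. *)
  destruct (INR_unbounded al) as [N0 HN0].
  destruct (inv_small e2 He2) as [N1 HN1]. destruct (Hd0 (Rmin C 1)) as [N2 HN2]. { apply Rmin_pos; lra. }
  destruct (ultra_ex _ HU _ (ultra_and _ HU _ _ (Hf (S N0)) (ultra_tail _ HU (Nat.max N1 N2)))) as [m [K1 K2]].
  specialize (HN1 m ltac:(lia)). specialize (HN2 m ltac:(lia)). pose proof (Rmin_l C 1); pose proof (Rmin_r C 1).
  assert (Hb : ball n e2 (z m)) by (apply ball_mono with (2 := Hzb m); lra).
  specialize (Hell (z m) Hb (d m) (distS_spec n Sg (z m) H0)).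
  unfold rpow in Hell. destruct (Rle_dec (d m) 0) as [Hle|_]; [specialize (Hd m); lra|].
  assert (Hpw : d m ^ N0 <= Rpower (d m) al).
  { rewrite <- Rpower_pow by auto. unfold Rpower. destruct (Rle_lt_or_eq_dec (INR N0 * ln (d m)) (al * ln (d m))) as [Hlt|Heq].
    - assert (ln (d m) <= 0). { rewrite <- ln_1. apply ln_le; auto. } nra.
    - apply Rlt_le, exp_increasing; auto.
    - rewrite Heq; lra. }
  pose proof (pow_lt _ N0 (Hd m)) as Hp. simpl in K1. nra.
Qed.

(** * Isolated zeros *)

Lemma family_radius n (P : nat -> R -> Prop) : (forall i d d', d' <= d -> P i d -> P i d') ->
  (forall i, (i < n)%nat -> exists d, 0 < d /\ P i d) -> exists d, 0 < d /\ forall i, (i < n)%nat -> P i d.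
Proof.
  intros HP. induction n as [|n IH]; intros H.
  - exists 1; split; [lra|]. intros; lia.
  - destruct IH as [d [Hd IH]]; auto. destruct (H n ltac:(lia)) as [d' [Hd' H']].
    exists (Rmin d d'). split; [apply Rmin_pos; auto|]. intros i Hi. destruct (Nat.eq_dec i n) as [->|].
    + apply HP with d'; auto. apply Rmin_r.
    + apply HP with d; [apply Rmin_l|]. apply IH; lia.
Qed.

Lemma sumn_shift n (J : nat -> R) x j t : (j < n)%nat ->
  sumn n (fun l => J l * shift x j t l) = sumn n (fun l => J l * x l) + t * J j.
Proof.
  intros Hj. rewrite (sumn_ext n _ (fun l => J l * x l + unitv l j * (t * J l))).
  - rewrite sumn_plus, (sumn_delta n j (fun l => t * J l)); auto.
  - intros l Hl. unfold unitv. destruct (Nat.eqb_spec j l) as [->|].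
    + rewrite shift_same. ring.
    + rewrite shift_other by auto. ring.
Qed.

(** Near [y] the map [g] minus its linear part [J] has small partial derivatives, so for a zero [x]
    the vector [J (x - y)] is at most a small multiple of [|x - y|]. Cramer's rule then bounds
    [|det J| |x - y|] by less than itself unless [x = y]. *)
Lemma nondegenerate_isolated n e (g : Rvec -> Rvec) y :
  (forall i, (i < n)%nat -> CC n 1 (ball n e) (coord i g)) -> ball n e y -> zero n g y ->
  detm n (fun i j => pd j (coord i g) y) <> 0 ->
  exists d, 0 < d /\ forall x, ball n e x -> distv n x y < d -> zero n g x -> x = y.
Proof.
  intros Hg Hy Hzy Hdet. set (J := fun i j => pd j (coord i g) y) in *.
  destruct (family_bound n (fun i C => forall j, (j < n)%nat -> Rabs (J i j) <= C)) as [K [HK HKb]].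
  { intros i C C' HC H j Hj. eapply Rle_trans; [apply H; auto | auto]. }
  { intros i Hi. apply (family_bound n (fun j C => Rabs (J i j) <= C)).
    - intros; lra.
    - intros j Hj. exists (Rabs (J i j)); split; [apply Rabs_pos | lra]. }
  destruct (cramer_bound n K HK) as [K' [HK' Hcr]].
  assert (Hdp : 0 < Rabs (detm n J)) by (apply Rabs_pos_lt; auto).
  (* One factor [n] comes from the mean value estimate, the other from the sum over the rows in
     [cramer_bound]; [eta] is chosen so that [T * eta < |det J|]. *)
  set (T := K' * (INR n * INR n)).
  assert (HT : 0 <= T) by (apply Rmult_le_pos; auto; apply Rmult_le_pos; apply pos_INR).
  set (eta := Rabs (detm n J) / (2 * (T + 1))). assert (Heta : 0 < eta) by (apply Rdiv_lt_0_compat; lra).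
  assert (Hte : T * eta < Rabs (detm n J)).
  { apply Rlt_le_trans with ((2 * (T + 1)) * eta); [nra|]. right. unfold eta. field. lra. }
  destruct (family_radius n (fun i d => forall j, (j < n)%nat -> forall x, ball n e x -> distv n x y < d ->
     Rabs (pd j (coord i g) x - J i j) <= eta)) as [d [Hd Hdb]].
  { intros i d d' Hdd H j Hj x Hx Hxd. apply H; auto. lra. }
  { intros i Hi. apply (family_radius n (fun j d => forall x, ball n e x -> distv n x y < d ->
     Rabs (pd j (coord i g) x - J i j) <= eta)).
    - intros j d d' Hdd H x Hx Hxd. apply H; auto. lra.
    - intros j Hj. destruct (Hg i Hi) as [_ [D HD]]. destruct (HD j Hj) as [H1 [H2 _]].
      destruct (H2 y Hy eta Heta) as [d [Hd Hd']]. exists d; split; auto. intros x Hx Hxd. unfold J.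
      rewrite !(pd_spec j (coord i g) _ (D j _)) by (apply H1; auto). apply Rlt_le, Hd'; auto. }
  exists d. split; auto. intros x Hx Hxd Hzx.
  assert (Hrow : forall i, (i < n)%nat -> Rabs (sumn n (fun l => J i l * (x l - y l))) <= INR n * eta * distv n x y).
  { intros i Hi. set (G := fun x => coord i g x + - sumn n (fun l => J i l * x l)).
    replace (sumn n (fun l => J i l * (x l - y l))) with (- (G x - G y)).
    - rewrite Rabs_Ropp. apply box_mean_value with e (fun j x => pd j (coord i g) x - J i j); auto; [lra| |].
      + intros j z Hj Hz.
        apply (derivable_pt_lim_plus (fun t => coord i g (shift z j t)) (fun t => - sumn n (fun l => J i l * shift z j t l))).
        * apply pd_deriv with n (ball n e); auto.
        * apply is_derive_Reals. apply is_derive_ext with (fun t => - (sumn n (fun l => J i l * z l) + t * J i j)).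
          { intros t. rewrite sumn_shift by auto. reflexivity. }
          auto_derive; auto. ring.
      + intros j z Hj Hz Hzd. apply (Hdb i Hi j Hj); auto. lra.
    - unfold G, coord. rewrite (Hzx i Hi), (Hzy i Hi).
      rewrite (sumn_ext n (fun l => J i l * (x l - y l)) (fun l => J i l * x l + - 1 * (J i l * y l))) by (intros; ring).
      rewrite sumn_plus, sumn_scal. ring. }
  assert (Hv : distv n x y * Rabs (detm n J) <= T * eta * distv n x y).
  { rewrite Rmult_comm. apply Rmult_le_reg_l with (/ Rabs (detm n J)); [apply Rinv_0_lt_compat; auto|].
    rewrite <- Rmult_assoc, Rinv_l, Rmult_1_l by lra.
    assert (Hnn : 0 <= T * eta * distv n x y) by (apply Rmult_le_pos; [nra | apply distv_nonneg]).
    apply distv_le. { apply Rmult_le_pos; auto. apply Rlt_le, Rinv_0_lt_compat; auto. }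
    intros j Hj. apply Rmult_le_reg_l with (Rabs (detm n J)); auto.
    rewrite <- Rmult_assoc, Rinv_r, Rmult_1_l by lra.
    eapply Rle_trans; [apply (Hcr J (fun l => x l - y l) j); auto|].
    unfold T. replace (K' * (INR n * INR n) * eta * distv n x y) with (K' * (INR n * (INR n * eta * distv n x y))) by ring.
    apply Rmult_le_compat_l; auto. rewrite <- sumn_const. apply sumn_le; auto. }
  apply distv_eq0 with n; [apply Hx | apply Hy|].
  apply Rnot_lt_le; intros Hlt. nra.
Qed.

Lemma CC_coord n r U i : (i < n)%nat -> CC n r U (fun x => x i).
Proof.
  intros Hi. assert (Hc : contf n U (fun x => x i)).
  { intros x Hx e He. exists e; split; auto. intros y Hy Hyd. eapply Rle_lt_trans; [apply (distv_ge n y x i Hi) | auto]. }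
  destruct r as [|r]; split; auto. exists (fun j _ => unitv j i). intros j Hj. split; [|apply CC_const].
  intros x _. unfold unitv. destruct (Nat.eqb_spec i j) as [->|Hn].
  - apply is_derive_Reals. apply is_derive_ext with (fun t => x j + t). { intros t; rewrite shift_same; auto. }
    auto_derive; auto.
  - apply is_derive_Reals. apply is_derive_ext with (fun t => x i). { intros t; rewrite shift_other; auto. }
    apply (is_derive_const (x i)).
Qed.

(* The perturbation cancels the value of [F] at each centre and adds a small multiple of the
   identity to its derivative there, which makes the derivative invertible. *)
Lemma isolating_perturbation n Sg F : (0 < n)%nat -> closed_in_Rn n Sg -> Sg zerov ->
  (forall i, (i < n)%nat -> F zerov i = 0) ->
  (exists e, 0 < e /\ forall i, (i < n)%nat -> smoothC n (ball n e) (coord i F)) -> ~ Ell n Sg F ->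
  exists g z, smooth_mapgerm n g /\ (forall k, jet_eq n Sg k g F) /\ (forall m, ball n (/ (INR m + 1)) (z m)) /\
    (forall m, 0 < normv n (z m)) /\
    exists e, 0 < e /\ forall m, ball n e (z m) -> zero n g (z m) /\
      exists d, 0 < d /\ forall x, ball n e x -> distv n x (z m) < d -> zero n g x -> x = z m.
Proof.
  intros Hn0 Hcl H0 HF0 [e1 [He1 HF]] Hne. destruct (not_Ell_centres n Sg F H0 Hne) as [z [Hz [Hzb HzP]]].
  set (d := fun m => distS n Sg (z m)).
  assert (Hd : forall m, 0 < d m) by apply (bc_pos _ _ _ Hz).
  assert (Hd1 : forall m, d m <= 1) by (intros m; apply centres_dist_le1; auto).
  set (kap := (exp (-1) * exp (-1)) ^ n).
  assert (Hkap : 0 < kap) by (apply pow_lt; pose proof (exp_pos (-1)); nra).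
  set (W0 := fun _ : nat => O). set (bt := fun m => bterm n Sg z W0 W0 m).
  assert (Hbt : forall m, bt m (z m) = kap).
  { intros m. pose proof (bsum_centre n Sg z (fun _ => 1) m H0 Hz) as E. fold kap in E.
    rewrite (bsum_in n Sg z _ _ _ m) in E; auto; [unfold bt, W0; lra|].
    unfold inb. rewrite distv_refl. specialize (Hd m). unfold d in Hd. lra. }
  assert (Hbtd : forall m j, (j < n)%nat -> derivable_pt_lim (fun t => bt m (shift (z m) j t)) 0 (pd j (bt m) (z m))).
  { intros m j Hj. unfold bt, bterm. erewrite pd_spec; apply bumpS_derive; auto. }
  (* Derivative at [z m] of [F] minus the multiple of the bump that cancels its value there. *)
  set (M := fun m i j => pd j (coord i F) (z m) - F (z m) i / kap * pd j (bt m) (z m)).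
  assert (Heps : forall m, exists e', 0 < e' < kap * d m ^ (m + 1) /\
     detm n (fun i j => M m i j + (if Nat.eqb i j then e' else 0)) <> 0).
  { intros m. apply detm_perturb_neq0. apply Rmult_lt_0_compat; auto. apply pow_lt; auto. }
  set (ee := fun m => proj1_sig (constructive_indefinite_description _ (Heps m))).
  assert (Hee : forall m, 0 < ee m < kap * d m ^ (m + 1) /\ detm n (fun i j => M m i j + (if Nat.eqb i j then ee m else 0)) <> 0).
  { intros m; unfold ee; destruct constructive_indefinite_description; auto. }
  set (eps := fun m => ee m / kap).
  assert (Hepsb : forall m, 0 < eps m <= d m ^ (m + 1)).
  { intros m. destruct (Hee m) as [[K1 K2] _]. unfold eps. split; [apply Rdiv_lt_0_compat; auto|].
    apply Rle_div_l; auto. lra. }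
  (* On the box about [z m] the intended perturbation is [- F_i(z m) / kap + eps (x_i - z_i)] times
     the bump. Its constant part goes into the weights [w i], its linear part into [x i * Bs eps];
     the latter adds [eps * kap = ee] on the diagonal of the derivative. *)
  set (w := fun i m => - F (z m) i / kap - eps m * z m i).
  set (Bs := fun w => bsum n Sg z w W0 W0).
  assert (Hzn : forall m i, (i < n)%nat -> Rabs (z m i) <= 1).
  { intros m i Hi. destruct (Hzb m) as [_ Hb]. rewrite distv_zero in Hb. pose proof (normv_ge n (z m) i Hi).
    pose proof (pos_INR m). assert (/ (INR m + 1) <= 1) by (rewrite <- Rinv_1; apply Rinv_le_contravar; lra). lra. }
  assert (Hrw : forall i, (i < n)%nat -> rapid n Sg z (w i)).
  { intros i Hi. assert (Hik : 0 < / kap) by (apply Rinv_0_lt_compat; auto).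
    apply rapid_pow with (/ kap + 1); auto; [lra|]. intros m. unfold w.
    assert (Hc : Rabs (F (z m) i) <= d m ^ (m + 1)) by (apply component_small with (n := n); auto).
    specialize (Hepsb m). specialize (Hzn m i Hi). fold (d m).
    replace (- F (z m) i / kap - eps m * z m i) with (- (/ kap * F (z m) i + eps m * z m i)) by (unfold Rdiv; ring).
    rewrite Rabs_Ropp. eapply Rle_trans; [apply Rabs_triang|]. rewrite !Rabs_mult.
    rewrite (Rabs_pos_eq (/ kap)), (Rabs_pos_eq (eps m)) by lra. pose proof (Rabs_pos (z m i)). nra. }
  assert (Hre : rapid n Sg z eps).
  { apply rapid_pow with 1; auto; [lra|]. intros m. specialize (Hepsb m). fold (d m). rewrite Rabs_pos_eq; lra. }
  set (u := fun i x => Bs (w i) x + x i * Bs eps x).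
  set (g := fun x i => F x i + u i x).
  assert (H1 : forall x, ball n (/ 2) x -> distS n Sg x <= 1).
  { intros x Hx. pose proof (distS_ball n Sg _ x H0 Hx). lra. }
  assert (HuF : forall i r p, (i < n)%nat -> Fl n Sg (ball n (/ 2)) r p (u i)).
  { intros i r p Hi. apply Fl_plus.
    - apply bsum_Fl; auto; lra.
    - apply (Fl_mult n Sg (ball n (/ 2)) r 0 p (fun x => x i) (Bs eps)); auto.
      + apply smooth_Fl0 with 1; [lra|]. intros s. apply CC_coord; auto.
      + apply bsum_Fl; auto; lra. }
  set (e := Rmin e1 (/ 2)). assert (He : 0 < e) by (apply Rmin_pos; lra).
  assert (S1 : e <= e1) by apply Rmin_l. assert (S2 : e <= / 2) by apply Rmin_r.
  assert (HuS : forall i, (i < n)%nat -> smoothC n (ball n e) (u i)).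
  { intros i Hi r. apply CC_sub with (ball n (/ 2)); [intros x; apply ball_mono; auto|].
    apply Fl_CC with Sg (r + 1)%nat; auto. apply ball_open. }
  assert (HFS : forall i, (i < n)%nat -> smoothC n (ball n e) (coord i F)).
  { intros i Hi r. apply CC_sub with (ball n e1); [intros x; apply ball_mono; auto | apply HF; auto]. }
  assert (HgS : forall i, (i < n)%nat -> smoothC n (ball n e) (coord i g)).
  { intros i Hi r. apply (CC_plus n r (ball n e) (coord i F) (u i)); [apply HFS | apply HuS]; auto. }
  exists g, z. split; [|split; [|split; [auto|split]]].
  - split.
    + intros i Hi. unfold g. rewrite HF0 by auto.
      rewrite (Fl_zero n Sg (ball n (/ 2)) 0 1 (u i) zerov); auto; [ring|]. apply ball_zero; lra.
    + exists e; split; auto. intros i Hi. apply smooth_on_iff; auto. apply ball_open.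
  - intros k. exists e; split; auto. intros x l i Hs Hx Hl Hlen Hi.
    replace (coord i g) with (fun y => coord i F y + u i y) by auto.
    rewrite (iterD_plus n (ball n e) l (coord i F) (u i)); auto; [|apply ball_open|apply HFS; auto|apply HuS; auto].
    rewrite (Fl_iterD n Sg (ball n (/ 2)) (length l) (length l + 1) (u i) l); auto; [ring|apply ball_open|].
    apply ball_mono with e; auto.
  - intros m. pose proof (bc_norm n Sg z m H0 Hz). lra.
  - exists e. split; auto. intros m Hm.
    assert (Hin : inb n Sg z m (z m)).
    { unfold inb. rewrite distv_refl. specialize (Hd m). unfold d in Hd. lra. }
    assert (HBs : forall w', Bs w' (z m) = w' m * kap).
    { intros w'. unfold Bs. rewrite (bsum_in n Sg z w' W0 W0 m) by auto. fold (bt m). rewrite Hbt; auto. }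
    assert (Hzero : zero n g (z m)).
    { intros i Hi. unfold g, u. rewrite !HBs. unfold w. field. lra. }
    split; auto. apply nondegenerate_isolated; auto; [intros i Hi; apply HgS; auto|].
    destruct (Hee m) as [_ Hdet]. intros Hdz. apply Hdet. eapply eq_trans; [|apply Hdz]. apply detm_ext. intros i j Hi Hj.
    symmetry. apply pd_spec.
    assert (Hloc : forall w', derivable_pt_lim (fun t => Bs w' (shift (z m) j t)) 0 (w' m * pd j (bt m) (z m))).
    { intros w'. apply derivable_pt_lim_local with (fun t => w' m * bt m (shift (z m) j t)) (d m / 4).
      - specialize (Hd m); lra.
      - intros t Ht. symmetry. apply bsum_in; auto. unfold inb. eapply Rle_lt_trans; [apply distv_shift | auto].
      - apply (derivable_pt_lim_scal (fun t => bt m (shift (z m) j t))). apply Hbtd; auto. }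
    assert (Hcx : derivable_pt_lim (fun t => shift (z m) j t i) 0 (unitv j i)).
    { apply is_derive_Reals. unfold unitv. destruct (Nat.eqb_spec i j) as [->|Hn].
      - apply is_derive_ext with (fun t => z m j + t). { intros t; rewrite shift_same; auto. } auto_derive; auto.
      - apply is_derive_ext with (fun t => z m i). { intros t; rewrite shift_other; auto. } apply (is_derive_const (z m i)). }
    assert (HdF := pd_deriv n (ball n e) (coord i F) j (z m) Hj Hm (HFS i Hi 1%nat)).
    pose proof (derivable_pt_lim_mult_shift (fun x => x i) (Bs eps) (z m) j _ _ Hcx (Hloc eps)) as Hprod. cbv beta in Hprod.
    pose proof (derivable_pt_lim_plus _ _ _ _ _ HdF (derivable_pt_lim_plus _ _ _ _ _ (Hloc (w i)) Hprod)) as Hall.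
    eapply eq_rect; [apply Hall|]. rewrite HBs. unfold M, w, eps, unitv.
    destruct (Nat.eqb i j); field; lra.
Qed.

(** For primality: the ultrafilter contains the zero set of [u] or its complement, and in the second
    case also the zero set of [v]. *)
Lemma eventually_zero_prime U : ultra U -> prime_ideal (fun u => U (fun m => u m = 0)).
Proof.
  intros HU. split.
  - intros u v [N H] Hu. eapply (ultra_mono _ HU); [|apply (ultra_and _ HU _ _ Hu (ultra_tail _ HU N))].
    intros m [K1 K2]. rewrite <- H; auto.
  - eapply (ultra_mono _ HU); [|apply (ultra_tail _ HU 0)]. auto.
  - intros u v Hu Hv. eapply (ultra_mono _ HU); [|apply (ultra_and _ HU _ _ Hu Hv)].
    intros m [K1 K2]. rewrite K1, K2. ring.
  - intros u v _ Hu. eapply (ultra_mono _ HU); [|apply Hu]. intros m Hm. cbv beta in Hm. rewrite Hm. ring.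
  - intros u v _ _ Huv. destruct (ultra_or _ HU (fun m => u m = 0)) as [|Hn]; auto. right.
    eapply (ultra_mono _ HU); [|apply (ultra_and _ HU _ _ Huv Hn)]. intros m [K1 K2].
    destruct (Rmult_integral _ _ K1); tauto.
  - intros H. destruct (ultra_ex _ HU _ H) as [m Hm]. lra.
Qed.

Lemma ultra_list (U : (nat -> Prop) -> Prop) {A} (l : list A) (P : A -> nat -> Prop) : ultra U ->
  (forall a, In a l -> U (P a)) -> U (fun m => forall a, In a l -> P a m).
Proof.
  intros HU. induction l as [|a l IH]; intros H.
  - eapply (ultra_mono _ HU); [|apply (ultra_tail _ HU 0)]. intros m _ b [].
  - eapply (ultra_mono _ HU); [|apply (ultra_and _ HU _ _ (H a (or_introl eq_refl)) (IH (fun b Hb => H b (or_intror Hb))))].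
    intros m [K1 K2] b [<-|Hb]; auto.
Qed.

(** The components of [phi] vanish along the sequence and so belong to [P], and [P] is not maximal
    because the points are not 0. Both genericity conditions then hold on a set of the ultrafilter,
    where [structure_theorem] contradicts isolation. *)
Lemma isolated_zeros_locally_finite n phi (y : nat -> Rvec) (N : nat) : analytic_mapgerm n phi ->
  (forall m, inRn n (y m)) -> tend0 n y ->
  (forall m, (N <= m)%nat -> y m <> zerov /\ zero n phi (y m) /\
     exists d, 0 < d /\ forall x, inRn n x -> distv n x (y m) < d -> zero n phi x -> x = y m) -> False.
Proof.
  intros Hphi Hy Hy0 H. destruct FilterLemmas.ultra_exists as [U HU].
  assert (HS := eventually_zero_prime U HU).
  destruct (structure_theorem n y _ HS Hy0) as [_ HA].
  { apply NNPP; intros Hno.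
    assert (Hk : U (fun m => forall i, In i (seq 0 n) -> y m i = 0)).
    { apply (ultra_list U (seq 0 n) (fun i m => y m i = 0) HU). intros i Hi. apply in_seq in Hi.
      apply NNPP; intros Hn. apply Hno. exists i. split; [lia | auto]. }
    destruct (ultra_ex _ HU _ (ultra_and _ HU _ _ Hk (ultra_tail _ HU N))) as [m [K1 K2]].
    destruct (H m K2) as [Hne _]. apply Hne. apply inRn_ext with n; auto. { intros i _; auto. }
    intros i Hi. apply K1. apply in_seq; lia. }
  destruct (HA (map (fun i x => coord i phi (trunc n x)) (seq 0 n))) as [c [qs [Hc [Hcn [Hqs [N' HN]]]]]].
  { intros p Hp. apply in_map_iff in Hp. destruct Hp as [i [<- Hi]]. apply in_seq in Hi. split.
    - destruct (analytic_PS n (coord i phi) (proj2 Hphi i ltac:(lia))) as [r [M [Hr HP]]]. exists r, M; auto.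
    - eapply (ultra_mono _ HU); [|apply (ultra_tail _ HU N)]. intros m Hm. rewrite trunc_id by auto.
      apply (H m Hm). lia. }
  destruct (ultra_or _ HU (fun m => c (y m) = 0)) as [|Hcc]; [contradiction|].
  assert (Hqq : U (fun m => forall q, In q qs -> q (y m) = 0)).
  { apply (ultra_list U qs (fun q m => q (y m) = 0) HU). intros q Hq. apply Hqs; auto. }
  destruct (ultra_ex _ HU _ (ultra_and _ HU _ _ (ultra_and _ HU _ _ Hcc Hqq) (ultra_tail _ HU (Nat.max N N')))) as [m [[K1 K2] K3]].
  destruct (H m ltac:(lia)) as [_ [_ [d [Hd Hiso]]]].
  destruct (HN m ltac:(lia) K1 K2 d Hd) as [x [Hx [[i [Hi Hxi]] Hpx]]].
  apply Hxi. rewrite <- (trunc_lt n x i Hi). rewrite (Hiso (trunc n x)); auto.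
  - apply trunc_inRn.
  - apply distv_lt; auto. intros j Hj. rewrite trunc_lt by auto. auto.
  - intros j Hj. apply (Hpx (fun x => coord j phi (trunc n x))). apply in_map_iff. exists j; split; auto. apply in_seq; lia.
Qed.

(** The homeomorphism of the zero sets fixes 0 because 0 lies in [Sg], so the zeros [z m] of the
    perturbation go to zeros of [phi] that tend to 0; continuity of the inverse keeps them
    isolated. *)
Lemma finV_Ell n Sg phi : (0 < n)%nat -> closed_in_Rn n Sg -> Sg zerov -> analytic_mapgerm n phi ->
  finV n Sg phi -> Ell n Sg phi.
Proof.
  intros Hn0 Hcl H0 Hphi [k HV]. apply NNPP; intros Hne.
  destruct (isolating_perturbation n Sg phi Hn0 Hcl H0 (proj1 Hphi) (analytic_mapgerm_smooth n phi Hphi) Hne)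
    as [g [z [Hg [Hj [Hzb [Hzn [e [He Hiso]]]]]]]].
  destruct (HV g Hg (Hj k)) as [U [V [h [h' [HU [HVo [HU0 [HV0 [A1 [A2 [A3 [A4 [A5 [A6 A7]]]]]]]]]]]]]].
  assert (Hg0 : zero n g zerov) by (intros i Hi; apply Hg; auto).
  assert (Hh0 : h zerov = zerov).
  { apply inRn_ext with n; [apply HVo, A1; auto | intros i _; auto | apply A7; auto]. }
  assert (Hk0 : h' zerov = zerov).
  { apply inRn_ext with n.
    - rewrite <- Hh0. apply HU, A2; apply A1; auto.
    - intros i _; auto.
    - rewrite <- Hh0 at 1. apply A3; auto. }
  destruct HU as [HUin HUo]. destruct HVo as [HVin HVo].
  destruct (HUo zerov HU0) as [rU [HrU HUb]].
  destruct (inv_small (Rmin rU e)) as [N1 HN1]. { apply Rmin_pos; auto. }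
  pose proof (Rmin_l rU e) as L1. pose proof (Rmin_r rU e) as L2.
  assert (HzU : forall m, (N1 <= m)%nat -> U (z m) /\ ball n e (z m)).
  { intros m Hm. specialize (HN1 m Hm). split; [apply HUb|]; apply ball_mono with (2 := Hzb m); lra. }
  (* Truncation puts [y m] into R^n also for small [m], at which [h] is not controlled. *)
  set (y := fun m => trunc n (h (z m))).
  assert (Hyh : forall m, (N1 <= m)%nat -> y m = h (z m)).
  { intros m Hm. destruct (HzU m Hm) as [K1 K2]. apply trunc_id. apply HVin, A1; auto. apply Hiso; auto. }
  apply (isolated_zeros_locally_finite n phi y N1 Hphi).
  - intros m. apply trunc_inRn.
  - intros i Hi eps Heps. destruct (A5 zerov (conj HU0 Hg0) eps Heps) as [d [Hd Hd']].
    destruct (inv_small d Hd) as [N2 HN2]. exists (Nat.max N1 N2). intros m Hm.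
    rewrite Hyh by lia. destruct (HzU m ltac:(lia)) as [K1 K2]. destruct (Hiso m K2) as [K3 _].
    specialize (HN2 m ltac:(lia)). destruct (Hzb m) as [_ Hb].
    specialize (Hd' (z m) (conj K1 K3) ltac:(lra)). rewrite Hh0, distv_zero in Hd'.
    eapply Rle_lt_trans; [apply (normv_ge n (h (z m)) i Hi) | auto].
  - intros m Hm. rewrite Hyh by auto. destruct (HzU m Hm) as [K1 K2]. destruct (Hiso m K2) as [K3 [d [Hd Hd']]].
    destruct (A1 (z m) K1 K3) as [Hv Hz0].
    assert (Hkh : h' (h (z m)) = z m).
    { apply inRn_ext with n; [apply HUin, A2; auto | apply HUin; auto | apply A3; auto]. }
    split; [|split; auto].
    + intros E. rewrite E, Hk0 in Hkh. specialize (Hzn m). rewrite <- Hkh, <- distv_zero, distv_refl in Hzn. lra.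
    + destruct (ball_open n e) as [_ Ho]. destruct (Ho (z m) K2) as [r1 [Hr1 Hb1]].
      destruct (HVo (h (z m)) Hv) as [r2 [Hr2 Hb2]].
      destruct (A6 (h (z m)) (conj Hv Hz0) (Rmin d r1)) as [r3 [Hr3 Hb3]]. { apply Rmin_pos; auto. }
      pose proof (Rmin_l d r1). pose proof (Rmin_r d r1).
      exists (Rmin r2 r3). split; [apply Rmin_pos; auto|]. pose proof (Rmin_l r2 r3). pose proof (Rmin_r r2 r3).
      (* A zero [x] of [phi] near [h (z m)] is sent by the inverse to a zero of [g] near [z m],
         which can only be [z m]. *)
      intros x Hx Hxd Hxz.
      assert (HVx : V x) by (apply Hb2; split; auto; lra).
      specialize (Hb3 x (conj HVx Hxz) ltac:(lra)). rewrite Hkh in Hb3.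
      destruct (A2 x HVx Hxz) as [M1 M2].
      assert (Ek : h' x = z m).
      { apply Hd'; auto; [|lra]. apply Hb1. split; [apply HUin; auto | lra]. }
      rewrite <- Ek. symmetry. apply inRn_ext with n; auto. apply HVin, A1; auto.
Qed.

Theorem theorem6p8 (n : nat) (Sig : Rvec -> Prop) (phi : Rvec -> Rvec) :
  (0 < n)%nat ->
  closed_in_Rn n Sig -> Sig zerov -> subanalytic_germ0 n Sig -> coherent n Sig ->
  analytic_mapgerm n phi ->
  let c1 := forall r : nat, rigid n Sig r phi in
  let c2 := finSV n Sig phi in
  let c3 := finV n Sig phi in
  let c4 := elliptic n (S n) (IK_gen n phi) Sig in
  let c5 := forall f, flat_on n Sig f -> inIdeal n (S n) (IK_gen n phi) f in
  let c6 := forall f, flat_on n Sig f -> inIdeal n n (IT_gen n phi) f in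
  (c1 <-> c2) /\ (c1 <-> c3) /\ (c1 <-> c4) /\ (c1 <-> c5) /\ (c1 <-> c6).
Proof.
  intros Hn Hcl H0 _ _ Hphi c1 c2 c3 c4 c5 c6.
  assert (Hs := analytic_mapgerm_smooth n phi Hphi).
  assert (E1 : Ell n Sig phi -> c1) by (intros HE r; apply Ell_rigid; auto).
  assert (E12 : c1 -> c2) by (intros H; apply rigid_SV; auto).
  assert (E23 : c2 -> c3) by apply finSV_finV.
  assert (E3 : c3 -> Ell n Sig phi) by (apply finV_Ell; auto).
  assert (E6 : Ell n Sig phi -> c6) by (intros HE f Hf; apply Ell_flat_ideal with Sig; auto).
  (* The generators of [I_T] are the first [n] generators of [I_K]; the Jacobian determinant gets
     the coefficient 0. *)
  assert (E65 : c6 -> c5).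
  { intros H f Hf. destruct (H f Hf) as [e [a [He [Ha E]]]].
    exists e, (fun j => if Nat.ltb j n then a j else (fun _ => 0)). split; auto. split.
    - intros j Hj. destruct (Nat.ltb_spec j n); auto.
      apply smooth_on_iff; [apply ball_open|]. intros r; apply CC_const.
    - intros x Hx. rewrite (E x Hx). simpl. rewrite Nat.ltb_irrefl.
      rewrite (sumn_ext n (fun j => (if Nat.ltb j n then a j else fun _ => 0) x * IK_gen n phi j x)
         (fun j => a j x * IT_gen n phi j x)); [ring|].
      intros j Hj. unfold IK_gen, IT_gen. rewrite (proj2 (Nat.ltb_lt j n) Hj). auto. }
  assert (E54 : c5 -> c4) by (apply flat_ideal_elliptic; auto).
  assert (E4 : c4 -> Ell n Sig phi) by (apply elliptic_Ell; auto).
  tauto.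
Qed.
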